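(* Let $b,r,f$ be fixed analytic data on $[0,1]$ and $\gamma>0$ a fixed constant as in the context. There exist constants $c_0\in(0,1)$, $\kappa>0$, $\sigma>0$ and $C>0$, all independent of $\varepsilon_1,\varepsilon_2$ and $p$, such that the following holds for all $p\in\mathbb{N}$, $p\ge 1$, and all $0<\varepsilon_1,\varepsilon_2\le 1$ satisfying $r-\tfrac{\varepsilon_2}{2}b'\ge\gamma$ on $[0,1]$ and $\varepsilon_1\le c_0\,\varepsilon_2^2$, $\varepsilon_2^2\le c_0$ (that is, $\varepsilon_1\ll\varepsilon_2^2\ll 1$), for which the Spectral Boundary Layer mesh $\omega=\omega_{BL}(\kappa,p)$ described in the context is defined. Let $u$ be the solution of $$-\varepsilon_1u''(x)+\varepsilon_2b(x)u'(x)+r(x)u(x)=f(x),\quad x\in I=(0,1),\qquad u(0)=u(1)=0,$$ and let $u_p\in V^{\omega}_{p,0}$ be the weak Galerkin solution on the mesh $\omega$, i.e. $\mathcal{A}_p(u_p,v)=(f,v_0)_I$ for all $v=(v_0,v_b)\in V^{\omega}_{p,0}$. Then $$|||u-u_p|||_p\le C\,e^{-\sigma p}.$$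
   Context: Data. $I=(0,1)$, $0<\varepsilon_1,\varepsilon_2\le1$ are parameters. The functions $b,r,f$ do not depend on $\varepsilon_1,\varepsilon_2$ and are analytic on $[0,1]$: there are positive constants $C_0,\gamma_b,\gamma_r,\gamma_f$, independent of $\varepsilon_1,\varepsilon_2$, with $\|b^{(n)}\|_{L^\infty(I)}\le C_0\,n!\,\gamma_b^n$, $\|r^{(n)}\|_{L^\infty(I)}\le C_0\,n!\,\gamma_r^n$, $\|f^{(n)}\|_{L^\infty(I)}\le C_0\,n!\,\gamma_f^n$ for all $n\in\mathbb{N}_0$. Moreover $b>0$ and $r\ge0$ on $[0,1]$, and $r-\tfrac{\varepsilon_2}{2}b'\ge\gamma>0$ on $[0,1]$, with $\gamma$ independent of $\varepsilon_1,\varepsilon_2$. Mesh. Put $$\mu_{0}=\min_{x\in[0,1]}\frac{-\varepsilon_2b(x)+\sqrt{\varepsilon_2^2b(x)^2+4\varepsilon_1r(x)}}{2\varepsilon_1},\qquad \mu_{1}=\min_{x\in[0,1]}\frac{\varepsilon_2b(x)+\sqrt{\varepsilon_2^2b(x)^2+4\varepsilon_1r(x)}}{2\varepsilon_1}.$$ The Spectral Boundary Layer mesh $\omega_{BL}(\kappa,p)$ has nodes $\{0,1\}$ if $\kappa p\varepsilon_1\ge 1/2$, and nodes $\{0,\kappa p\mu_0^{-1},1-\kappa p\mu_1^{-1},1\}$ if $\kappa p\varepsilon_2<1/2$. It is defined when one of these two conditions holds and, in the second case, the listed nodes are strictly increasing. Spaces. For a mesh $\omega:0=x_0<x_1<\dots<x_N=1$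 put $I_j=(x_{j-1},x_j)$, $h_j=x_j-x_{j-1}$. Let $\mathcal{M}^\omega$ be the set of pairs $v=(v_0,v_b)\in L^2(I)\times\mathbb{R}^{N+1}$ with $v_0|_{I_j}\in H^1(I_j)$ for all $j$ and $v_b=(v_{b,0},\dots,v_{b,N})$. A function $v\in H^1(I)$ is identified with the element $(v,(v(x_0),\dots,v(x_N)))$ of $\mathcal{M}^\omega$. With $\mathbb{P}_p$ the polynomials of degree at most $p$, let $V^\omega_p=\{v\in\mathcal{M}^\omega: v_0|_{I_j}\in\mathbb{P}_p\ \forall j\}$, $V^\omega_{p,0}=\{v\in V^\omega_p: v_{b,0}=v_{b,N}=0\}$, and $W^\omega_p=\{w\in L^2(I): w|_{I_j}\in\mathbb{P}_p\ \forall j\}$. Weak derivatives. For $v\in\mathcal{M}^\omega$ and $p\in\mathbb{N}_0$, the weak derivative $D_pv\in W^\omega_p$ and weak convection derivative $D^c_pv\in W^\omega_p$ are the unique elements such that, for all $q\in\mathbb{P}_p$ and $j=1,\dots,N$, $$\int_{I_j}D_pv\,q=-\int_{I_j}v_0q'+v_{b,j}q(x_j)-v_{b,j-1}q(x_{j-1}),$$ $$\int_{I_j}D^c_pv\,q=-\int_{I_j}v_0(bq)'+v_{b,j}(bq)(x_j)-v_{b,j-1}(bq)(x_{j-1}).$$ Bilinear form. For $p\ge1$, with $(\cdot,\cdot)_I$ the $L^2(I)$ inner product, $$\mathcal{A}_p(w,v)=\varepsilon_1(D_{p-1}w,D_{p-1}v)_I+\varepsilon_2(D^c_pw,v_0)_I+(rw_0,v_0)_I+S(w,v)+S_c(w,v),$$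 $$S(w,v)=\sum_{j=1}^N\sigma_j\Big[(w_0(x_j^-)-w_{b,j})(v_0(x_j^-)-v_{b,j})+(w_0(x_{j-1}^+)-w_{b,j-1})(v_0(x_{j-1}^+)-v_{b,j-1})\Big],$$ $$S_c(w,v)=\sum_{j=1}^N\varepsilon_2b(x_j)(w_0(x_j^-)-w_{b,j})(v_0(x_j^-)-v_{b,j}),$$ where the penalty parameters are $\sigma_j=\varepsilon_1p^2/h_j$ and $x_j^\mp$ denote one-sided limits from the left/right. Norm. For $v\in\mathcal{M}^\omega$, $$|||v|||_p^2=\varepsilon_1\|D_{p-1}v\|_{L^2(I)}^2+\|v_0\|_{L^2(I)}^2+S(v,v)+S_c(v,v)+|v|_J^2,\qquad |v|_J^2=\sum_{j=1}^Nw_j\,\varepsilon_2b(x_j)\,(v_0(x_j^-)-v_{b,j})^2,$$ with $w_j=1$ for $j=1,\dots,N-1$ and $w_N=1/2$. *)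

(* Defs.v *)
From HB Require Import structures.
From mathcomp Require Import all_boot all_order all_algebra.
From mathcomp Require Import all_classical all_reals all_analysis.

Set Implicit Arguments.
Unset Strict Implicit.
Unset Printing Implicit Defensive.

Import Order.TTheory GRing.Theory Num.Theory.
Import numFieldNormedType.Exports.

Local Open Scope classical_set_scope.
Local Open Scope ring_scope.

(* Functions on [0, 1] or (0, 1) are total functions R -> R whose values
   elsewhere are never used, except that a function analytic on the closed
   interval [0, 1] is represented by an extension that is smooth at the end
   points too, so that its derivatives there are the two-sided [derive1n]. *)

(* [C0] and [g] are the constants of the bound
   |h^(n)|_{L^oo(0,1)} <= C0 n! g^n; since h^(n) is continuous, the L^oo norm
   is the supremum over (0, 1). *)
Definition analytic_data (R : realType) (C0 g : R) (h : R -> R) : Prop :=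
  forall n : nat,
    (forall x : R, x \in `[0, 1] -> derivable (derive1n n h) x 1) /\
    (forall x : R, x \in `]0, 1[ -> `|derive1n n h x| <= C0 * n`!%:R * g ^+ n).

Definition inner (R : realType) (a c : R) (f g : R -> R) : R :=
  \int[lebesgue_measure]_(t in `]a, c[) (f t * g t).

Definition in_L2 (R : realType) (a c : R) (f : R -> R) : Prop :=
  f \_ `]a, c[ \in Lfun (@lebesgue_measure R) 2%:E.

Definition test_function (R : realType) (a c : R) (phi : R -> R) : Prop :=
  (forall (n : nat) (x : R), derivable (derive1n n phi) x 1) /\
  (exists a' c' : R, [/\ a < a', c' < c &
    forall x : R, x \notin `[a', c'] -> phi x = 0]).

(* Elements of H^1(a, c) are represented by their continuous representative,
   so that one-sided limits at a and c make sense. *)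
Definition in_H1 (R : realType) (a c : R) (v : R -> R) : Prop :=
  [/\ in_L2 a c v,
      {in `]a, c[, continuous v} &
      exists2 g : R -> R, in_L2 a c g &
        forall phi : R -> R, test_function a c phi ->
          inner a c v (derive1 phi) = - inner a c g phi].

(* A mesh 0 = x_0 < ... < x_N = 1. Its elements are indexed by j : 'I_N, from
   0, so that the element j is (x_j, x_{j+1}). *)
Definition mesh (R : realType) (N : nat) (x : N.+1.-tuple R) : Prop :=
  [/\ tnth x ord0 = 0, tnth x ord_max = 1 & sorted <%R x].

Definition lnode (N : nat) (j : 'I_N) : 'I_N.+1 := widen_ord (leqnSn N) j.
Definition rnode (N : nat) (j : 'I_N) : 'I_N.+1 := lift ord0 j.

Definition xl (R : realType) (N : nat) (x : N.+1.-tuple R) (j : 'I_N) : R :=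
  tnth x (lnode j).
Definition xr (R : realType) (N : nat) (x : N.+1.-tuple R) (j : 'I_N) : R :=
  tnth x (rnode j).

Definition is_min01 (R : realType) (g : R -> R) (m : R) : Prop :=
  (exists2 y : R, y \in `[0, 1] & g y = m) /\
  (forall y : R, y \in `[0, 1] -> m <= g y).

Definition layer_rate0 (R : realType) (e1 e2 : R) (b r : R -> R) (y : R) : R :=
  (- (e2 * b y) + Num.sqrt (e2 ^+ 2 * b y ^+ 2 + 4 * e1 * r y)) / (2 * e1).
Definition layer_rate1 (R : realType) (e1 e2 : R) (b r : R -> R) (y : R) : R :=
  (e2 * b y + Num.sqrt (e2 ^+ 2 * b y ^+ 2 + 4 * e1 * r y)) / (2 * e1).

(* If mu0 = 0 then mu0^-1 = 0, so the listed nodes are not strictly increasing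
   and the mesh is undefined, as it should be. *)
Definition BL_mesh (R : realType) (b r : R -> R) (kappa e1 e2 : R) (p N : nat)
    (x : N.+1.-tuple R) : Prop :=
  mesh x /\
  ((kappa * p%:R * e1 >= 1 / 2 /\ x = [:: 0; 1] :> seq R) \/
   (kappa * p%:R * e2 < 1 / 2 /\
    exists mu0 mu1 : R,
      [/\ is_min01 (layer_rate0 e1 e2 b r) mu0,
          is_min01 (layer_rate1 e1 e2 b r) mu1 &
          x = [:: 0; kappa * p%:R * mu0^-1; 1 - kappa * p%:R * mu1^-1; 1]
            :> seq R])).

Definition broken (R : realType) (N : nat) : Type :=
  ((R -> R) * 'rV[R]_N.+1)%type.

Definition in_M (R : realType) (N : nat) (x : N.+1.-tuple R)
    (v : broken R N) : Prop :=
  in_L2 0 1 v.1 /\ (forall j : 'I_N, in_H1 (xl x j) (xr x j) v.1).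

Definition embed (R : realType) (N : nat) (x : N.+1.-tuple R) (u : R -> R) :
    broken R N :=
  (u, \row_(i < N.+1) u (tnth x i)).

Definition piecewise_poly (R : realType) (N : nat) (x : N.+1.-tuple R)
    (p : nat) (w : R -> R) : Prop :=
  forall j : 'I_N, exists2 q : {poly R}, (size q <= p.+1)%N &
    forall t : R, t \in `]xl x j, xr x j[ -> w t = q.[t].

Definition in_W (R : realType) (N : nat) (x : N.+1.-tuple R) (p : nat)
    (w : R -> R) : Prop :=
  in_L2 0 1 w /\ piecewise_poly x p w.

Definition in_V (R : realType) (N : nat) (x : N.+1.-tuple R) (p : nat)
    (v : broken R N) : Prop :=
  in_M x v /\ piecewise_poly x p v.1.

Definition in_V0 (R : realType) (N : nat) (x : N.+1.-tuple R) (p : nat)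
    (v : broken R N) : Prop :=
  [/\ in_V x p v, v.2 0 ord0 = 0 & v.2 0 ord_max = 0].

Definition is_wderiv (R : realType) (N : nat) (x : N.+1.-tuple R) (p : nat)
    (v : broken R N) (d : R -> R) : Prop :=
  in_W x p d /\
  (forall (j : 'I_N) (q : {poly R}), (size q <= p.+1)%N ->
    inner (xl x j) (xr x j) d (horner q) =
      - inner (xl x j) (xr x j) v.1 (horner (deriv q))
      + v.2 0 (rnode j) * q.[xr x j] - v.2 0 (lnode j) * q.[xl x j]).

Definition is_wderivc (R : realType) (N : nat) (x : N.+1.-tuple R)
    (b : R -> R) (p : nat) (v : broken R N) (d : R -> R) : Prop :=
  in_W x p d /\
  (forall (j : 'I_N) (q : {poly R}), (size q <= p.+1)%N ->
    let bq := fun t : R => b t * q.[t] in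
    inner (xl x j) (xr x j) d (horner q) =
      - inner (xl x j) (xr x j) v.1 (derive1 bq)
      + v.2 0 (rnode j) * bq (xr x j) - v.2 0 (lnode j) * bq (xl x j)).

(* The weak derivatives are unique as elements of L^2, i.e. up to their values
   at the nodes; [xget] selects a representative. *)
Definition wderiv (R : realType) (N : nat) (x : N.+1.-tuple R) (p : nat)
    (v : broken R N) : R -> R :=
  xget (fun=> 0) [set d : R -> R | is_wderiv x p v d].

Definition wderivc (R : realType) (N : nat) (x : N.+1.-tuple R)
    (b : R -> R) (p : nat) (v : broken R N) : R -> R :=
  xget (fun=> 0) [set d : R -> R | is_wderivc x b p v d].

(* The jumps v_0(x_{j+1}^-) - v_{b,j+1} and v_0(x_j^+) - v_{b,j} on the
   element j. *)
Definition jumpr (R : realType) (N : nat) (x : N.+1.-tuple R)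
    (v : broken R N) (j : 'I_N) : R :=
  lim (v.1 t @[t --> (xr x j)^'-]) - v.2 0 (rnode j).
Definition jumpl (R : realType) (N : nat) (x : N.+1.-tuple R)
    (v : broken R N) (j : 'I_N) : R :=
  lim (v.1 t @[t --> (xl x j)^'+]) - v.2 0 (lnode j).

Definition penalty (R : realType) (e1 : R) (p N : nat) (x : N.+1.-tuple R)
    (j : 'I_N) : R :=
  e1 * p%:R ^+ 2 / (xr x j - xl x j).

Definition stab (R : realType) (e1 : R) (p N : nat) (x : N.+1.-tuple R)
    (w v : broken R N) : R :=
  \sum_(j < N) penalty e1 p x j *
    (jumpr x w j * jumpr x v j + jumpl x w j * jumpl x v j).

Definition stabc (R : realType) (e2 : R) (b : R -> R) (N : nat)
    (x : N.+1.-tuple R) (w v : broken R N) : R :=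
  \sum_(j < N) e2 * b (xr x j) * jumpr x w j * jumpr x v j.

Definition bilinear_form (R : realType) (e1 e2 : R) (b r : R -> R) (p N : nat)
    (x : N.+1.-tuple R) (w v : broken R N) : R :=
  e1 * inner 0 1 (wderiv x p.-1 w) (wderiv x p.-1 v)
  + e2 * inner 0 1 (wderivc x b p w) v.1
  + inner 0 1 (fun t => r t * w.1 t) v.1
  + stab e1 p x w v + stabc e2 b x w v.

Definition jump_sqnorm (R : realType) (e2 : R) (b : R -> R) (N : nat)
    (x : N.+1.-tuple R) (v : broken R N) : R :=
  \sum_(j < N) (if j.+1 == N then 1 / 2 else 1) *
    (e2 * b (xr x j) * jumpr x v j ^+ 2).

Definition energy_norm (R : realType) (e1 e2 : R) (b : R -> R) (p N : nat)
    (x : N.+1.-tuple R) (v : broken R N) : R :=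
  Num.sqrt (e1 * inner 0 1 (wderiv x p.-1 v) (wderiv x p.-1 v)
            + inner 0 1 v.1 v.1
            + stab e1 p x v v + stabc e2 b x v v
            + jump_sqnorm e2 b x v).

Definition is_solution (R : realType) (e1 e2 : R) (b r f u : R -> R) : Prop :=
  [/\ {within `[0, 1], continuous u},
      forall y : R, y \in `]0, 1[ ->
        [/\ derivable u y 1, derivable (derive1 u) y 1 &
            - e1 * derive1n 2 u y + e2 * b y * derive1 u y + r y * u y = f y],
      u 0 = 0 & u 1 = 0].

Definition is_galerkin_solution (R : realType) (e1 e2 : R) (b r f : R -> R)
    (p N : nat) (x : N.+1.-tuple R) (up : broken R N) : Prop :=
  in_V0 x p up /\
  (forall v : broken R N, in_V0 x p v ->
    bilinear_form e1 e2 b r p x up v = inner 0 1 f v.1).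

(* Main.v *)
(* The error u_p - u is compared with a continuous piecewise polynomial W. The
   bilinear form is coercive on V = u_p - W, and tested with V it leaves the
   residual of W, which after integration by parts involves only L (u - W),
   L being the differential operator, and the derivatives of W at the nodes.
   It thus suffices to find W for which these are exponentially small in p.

   On the last element, or on all of (0, 1) if the mesh is {0, 1}, the size of
   the element is of order kappa p e1 / e2. Taylor coefficients of u grow at most
   like (e2 / e1)^n there, which costs a factor exp(C kappa p); for small kappa it
   is absorbed by the exponential rate of polynomial approximation.

   On the other elements W is made from two approximate solutions:
   - a truncated expansion U of the solution in powers of e2, for L U = f;
   - E = exp(int_0^x m / e2), where m is a Picard iterate of the Riccati equation
     that makes L E = 0.
   The number of terms and of iterations is proportional to p; since
   kappa p e2 < 1/2, the residuals f - L U and L E are exponentially small. The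
   maximum principle with the barrier exp(- beta e2 (1 - x) / e1) shows that
   u - U + U(0) E is exponentially small to the left of the last element, and an
   energy identity gives the same for its derivative.

   Analytic functions are approximated by blending their Taylor polynomials at
   equidistant points with Bernstein weights. *)
Require Import Defs.
From HB Require Import structures.
From mathcomp Require Import all_boot all_order all_algebra.
From mathcomp Require Import all_classical all_reals all_analysis.
From mathcomp Require Import measurable_realfun ring lra.
Import Order.TTheory GRing.Theory Num.Theory.
Import numFieldNormedType.Exports.
Local Open Scope classical_set_scope.
Local Open Scope ring_scope.
Set Implicit Arguments.
Unset Strict Implicit.
Unset Printing Implicit Defensive.

(** * Integration of bounded continuous functions on open intervals *)

Section Integration.
Context {R : realType}.
Implicit Types (a b c k : R) (f g h : R -> R).

(** The obstacle is the loss of derivatives: the expansion and the Riccati iteration both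
    differentiate, and about [p] steps are needed for an error exponential in [p]. Analyticity is
    measured by a weighted norm of Taylor coefficients with radius [t0]. Spreading [t0] over the
    steps leaves [d], of order [t0 / p], for each of them, so a step costs a multiple of [e2 / d],
    of order [p e2]. This stays bounded exactly because [kap p e2 < 1/2]. No expansion is made of
    the layer at 1. The last element approximates [u] itself, with its left end value prescribed to
    be that of the neighbouring piece; the mismatch is exponentially small because the remainder is
    small up to that node. The order of choices matters. The growth constants of the layer function
    and of [u] come before [kap], which is then taken small in terms of them; [c0] comes after
    [kap]. Energy estimates on the short elements lose one factor [p], which half of the exponential
    rate absorbs in the end. *)

Definition itg a c g : R := \int[lebesgue_measure]_(t in `]a, c[) g t.

(** The class in which integrals are computed. It asks nothing at the end points because [u'] is
    only known, continuous and bounded, in the open interval, and the outer elements touch 0 and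
    1. *)
Definition bc a c g : Prop :=
  {in `]a, c[, continuous g} /\
  exists B, forall t, t \in `]a, c[ -> `|g t| <= B.

Lemma bc_measurable a c g : {in `]a, c[, continuous g} ->
  measurable_fun `]a, c[ g.
Proof.
move=> cg; apply: open_continuous_measurable_fun; first exact: interval_open.
by move=> x; rewrite inE /= => xac; apply: cg.
Qed.

Lemma lebesgue_itvoo_fin a c : (lebesgue_measure `]a, c[%classic < +oo :> \bar R)%E.
Proof. by rewrite lebesgue_measure_itv /=; case: ifP => //; rewrite ltry. Qed.

Lemma lebesgue_itvoc_fin a c : (lebesgue_measure `]a, c]%classic < +oo :> \bar R)%E.
Proof. by rewrite lebesgue_measure_itv /=; case: ifP => //; rewrite ltry. Qed.

Lemma bc_integrable a c g : bc a c g ->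
  lebesgue_measure.-integrable `]a, c[ (EFin \o g).
Proof.
move=> [cg [B gB]]; apply: measurable_bounded_integrable => //.
- exact: lebesgue_itvoo_fin.
- exact: bc_measurable.
- exists B; split; first by rewrite num_real.
  move=> M BM t /= tac; apply: le_trans (gB _ tac) (ltW BM).
Qed.

Lemma bcD a c f g : bc a c f -> bc a c g -> bc a c (fun t => f t + g t).
Proof.
move=> [cf [B fB]] [cg [C gC]]; split.
  by move=> t tac; apply: continuousD; [exact: cf|exact: cg].
exists (B + C) => t tac; apply: le_trans (ler_normD _ _) _.
by rewrite lerD// ?fB ?gC.
Qed.

Lemma bcM a c f g : bc a c f -> bc a c g -> bc a c (fun t => f t * g t).
Proof.
move=> [cf [B fB]] [cg [C gC]]; split.
  by move=> t tac; apply: continuousM; [exact: cf|exact: cg].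
exists (B * C) => t tac; rewrite normrM.
by rewrite ler_pM// ?fB ?gC.
Qed.

Lemma bc_cst a c k : bc a c (fun=> k).
Proof. by split; [move=> t _; apply: cst_continuous|exists `|k|]. Qed.

Lemma bcN a c f : bc a c f -> bc a c (fun t => - f t).
Proof.
move=> [cf [B fB]]; split.
  by move=> t tac; apply: continuousN; exact: cf.
by exists B => t tac; rewrite normrN fB.
Qed.

Lemma bcB a c f g : bc a c f -> bc a c g -> bc a c (fun t => f t - g t).
Proof. by move=> bf bg; apply: bcD => //; apply: bcN. Qed.

Lemma bcZ a c k f : bc a c f -> bc a c (fun t => k * f t).
Proof. by move=> bf; apply: bcM => //; apply: bc_cst. Qed.

Lemma horner_continuous (q : {poly R}) : continuous (horner q).
Proof. exact: continuous_horner. Qed.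

Lemma bc_within a c f : {within `[a, c], continuous f} -> bc a c f.
Proof.
have [ac|ca] := ltP a c; last first.
  move=> _; split.
    by move=> t; rewrite in_itv /= => /andP[/lt_trans h /h]; rewrite ltNge ca.
  by exists 0 => t; rewrite in_itv /= => /andP[/lt_trans h /h]; rewrite ltNge ca.
move=> cf; split.
  by have /(continuous_within_itvP _ ac)[] := cf.
have [c1 _ h1] := EVT_max (ltW ac) cf.
have [c2 _ h2] := EVT_min (ltW ac) cf.
exists (`|f c1| + `|f c2|) => t tac.
have tac' : t \in `[a, c] by apply: subset_itv_oo_cc tac.
have := h1 t tac'; have := h2 t tac'.
have := ler_norm (f c1); have := ler_norm (- f c2); rewrite normrN => ? ? ? ?.
have := normr_ge0 (f c1); have := normr_ge0 (f c2) => ? ?.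
by rewrite ler_norml; apply/andP; split; lra.
Qed.

Lemma bc_cont a c f : continuous f -> bc a c f.
Proof. by move=> cf; apply: bc_within; apply: continuous_subspaceT. Qed.

Lemma bc_horner a c (q : {poly R}) : bc a c (horner q).
Proof. exact/bc_cont/horner_continuous. Qed.

Lemma bc_sub a c a' c' f : a <= a' -> c' <= c -> bc a c f -> bc a' c' f.
Proof.
move=> aa cc [cf [B fB]].
have sub t : t \in `]a', c'[ -> t \in `]a, c[.
  by rewrite !in_itv /= => /andP[h1 h2]; rewrite (le_lt_trans aa h1) (lt_le_trans h2 cc).
split; first by move=> t /sub; apply: cf.
by exists B => t /sub; apply: fB.
Qed.

Lemma eq_itg a c f g : (forall t, t \in `]a, c[ -> f t = g t) ->
  itg a c f = itg a c g.
Proof. by move=> fg; apply: eq_Rintegral => t; rewrite inE => /fg. Qed.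

Lemma itgD a c f g : bc a c f -> bc a c g ->
  itg a c (fun t => f t + g t) = itg a c f + itg a c g.
Proof. by move=> bf bg; apply: RintegralD => //; apply: bc_integrable. Qed.

Lemma itgB a c f g : bc a c f -> bc a c g ->
  itg a c (fun t => f t - g t) = itg a c f - itg a c g.
Proof. by move=> bf bg; apply: RintegralB => //; apply: bc_integrable. Qed.

Lemma itgZ a c k f : bc a c f -> itg a c (fun t => k * f t) = k * itg a c f.
Proof. by move=> bf; apply: RintegralZl => //; apply: bc_integrable. Qed.

Lemma itg_ge0 a c f : (forall t, t \in `]a, c[ -> 0 <= f t) -> 0 <= itg a c f.
Proof. by move=> f0; apply: Rintegral_ge0. Qed.

Lemma itg_le a c f g : bc a c f -> bc a c g ->
  (forall t, t \in `]a, c[ -> f t <= g t) -> itg a c f <= itg a c g.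
Proof. by move=> bf bg fg; apply: le_Rintegral => //; apply: bc_integrable. Qed.

Lemma itg_cst a c k : a <= c -> itg a c (fun=> k) = k * (c - a).
Proof.
move=> ac; rewrite /itg Rintegral_cst// /= lebesgue_measure_itv /= lte_fin.
case: ltP => [//|ca]; have -> : c = a by apply/eqP; rewrite eq_le ca ac.
by rewrite subrr.
Qed.

Lemma itg_norm_le a c k f : a <= c -> bc a c f ->
  (forall t, t \in `]a, c[ -> `|f t| <= k) -> `|itg a c f| <= k * (c - a).
Proof.
move=> ac bf fk; rewrite ler_norml -mulNr -!itg_cst//; apply/andP; split.
  apply: itg_le => //; first exact: bc_cst.
  by move=> t /fk; rewrite ler_norml => /andP[].
apply: itg_le => //; first exact: bc_cst.
by move=> t /fk; rewrite ler_norml => /andP[].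
Qed.

Lemma itg_cc a c f : bc a c f -> a <= c ->
  itg a c f = \int[lebesgue_measure]_(t in `[a, c]) f t.
Proof.
move=> bf ac; have mf := bc_measurable bf.1.
have [a_c|ca] := ltP a c; last first.
  have -> : c = a by apply/eqP; rewrite eq_le ca ac.
  by rewrite set_itv1 Rintegral_set1 /itg set_itvoo0// Rintegral_set0.
have i1 : lebesgue_measure.-integrable `]a, c] (EFin \o f).
  apply: measurable_bounded_integrable => //.
  - exact: lebesgue_itvoc_fin.
  - exact/measurable_fun_itv_bndo_bndcP.
  - by case: bf => _ [B fB]; exists (Num.max B `|f c|); split;
      [rewrite num_real|move=> M; rewrite gt_max => /andP[BM fM] t /=;
       rewrite in_itv /= => /andP[at_]; rewrite le_eqVlt => /predU1P[->|tc];
       [exact: ltW|apply: le_trans (ltW BM); apply: fB; rewrite in_itv /= at_ tc]].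
rewrite /itg Rintegral_itv_bndo_bndc; last exact: bc_integrable.
by rewrite Rintegral_itv_obnd_cbnd.
Qed.

Lemma itg_split a b c f : a <= b -> b <= c -> bc a c f ->
  itg a c f = itg a b f + itg b c f.
Proof.
move=> ab bc' bf.
have b1 := bc_sub (lexx a) bc' bf; have b2 := bc_sub ab (lexx c) bf.
have [ab'|] := ltP a b; last first.
  move=> ba; have -> : b = a by apply/eqP; rewrite eq_le ba ab.
  by rewrite [X in X + _]/itg set_itvoo0// Rintegral_set0 add0r.
have [bc''|] := ltP b c; last first.
  move=> cb; have -> : b = c by apply/eqP; rewrite eq_le bc' cb.
  by rewrite [X in _ + X]/itg set_itvoo0// Rintegral_set0 addr0.
have mf := bc_measurable bf.1.
have -> : itg a b f = \int[lebesgue_measure]_(t in `]a, b]) f t.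
  by rewrite /itg Rintegral_itv_bndo_bndc//; exact: bc_integrable.
rewrite /itg.
have -> : `]a, c[%classic = `]a, b]%classic `|` `]b, c[%classic :> set R.
  by rewrite -itv_bndbnd_setU// ?bnd_simp.
rewrite Rintegral_setU//.
  have -> : `]a, b]%classic `|` `]b, c[%classic = `]a, c[%classic :> set R.
    by rewrite -itv_bndbnd_setU// ?bnd_simp.
  exact: bc_integrable.
rewrite disj_set2E; apply/eqP; rewrite -subset0 => x [] /=.
by rewrite !in_itv /= => /andP[_ xb] /andP[bx _]; have := le_lt_trans xb bx; rewrite ltxx.
Qed.

Lemma itg_deriv_cc (G g : R -> R) a c s t : a < s -> s < t -> t < c ->
  (forall x, x \in `]a, c[ -> is_derive x 1 G (g x)) ->
  {in `]a, c[, continuous g} -> itg s t g = G t - G s.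
Proof.
move=> as_ st tc dG cg.
have sub x : x \in `[s, t] -> x \in `]a, c[.
  rewrite !in_itv /= => /andP[sx xt].
  by rewrite (lt_le_trans as_ sx) (le_lt_trans xt tc).
have cG x : x \in `]a, c[ -> {for x, continuous G}.
  move=> /dG dx; apply: differentiable_continuous; apply/derivable1_diffP.
  exact: ex_derive.
have wc h : {in `]a, c[, continuous h} -> {within `[s, t], continuous h}.
  move=> ch; apply: continuous_in_subspaceT => x; rewrite inE /= => /sub.
  exact: ch.
rewrite itg_cc ?ltW//; last by apply: bc_within; exact: wc.
rewrite /Rintegral (@continuous_FTC2 _ g G)//; first exact: wc.
- have : {within `[s, t], continuous G} by apply: wc => x /cG.
  move=> /(continuous_within_itvP _ st)[_ cs ct]; split => //.
  move=> x xst; have /sub /dG dx : x \in `[s, t] by apply: subset_itv_oo_cc xst.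
  exact: ex_derive.
- move=> x xst; have /sub /dG dx : x \in `[s, t] by apply: subset_itv_oo_cc xst.
  by rewrite derive1E; apply: derive_val.
Qed.

Lemma itg_deriv_near (G g : R -> R) a c B s t : a < s -> s < t -> t < c ->
  (forall x, x \in `]a, c[ -> is_derive x 1 G (g x)) ->
  {in `]a, c[, continuous g} ->
  (forall x, x \in `]a, c[ -> `|g x| <= B) ->
  `|itg a c g - (G t - G s)| <= B * ((s - a) + (c - t)).
Proof.
move=> as_ st tc dG cg gB.
have bg : bc a c g by split => //; exists B.
have ac := lt_trans as_ (lt_trans st tc).
rewrite (itg_split (ltW as_) (ltW (lt_trans st tc)) bg).
have bsc : bc s c g by apply: bc_sub bg => //; exact: ltW.
rewrite (itg_split (ltW st) (ltW tc) bsc) (itg_deriv_cc as_ st tc dG cg).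
rewrite [X in `|X|](_ : _ = itg a s g + itg t c g); last by ring.
rewrite mulrDr; apply: le_trans (ler_normD _ _) _; apply: lerD.
  apply: itg_norm_le; [exact: ltW|apply: bc_sub bg => //; exact: ltW (lt_trans st tc)|].
  move=> x xs; apply: gB; move: xs; rewrite !in_itv /= => /andP[-> xs].
  exact: lt_trans (lt_trans xs st) tc.
apply: itg_norm_le; [exact: ltW|apply: bc_sub bg => //; exact: ltW (lt_trans as_ st)|].
move=> x xs; apply: gB; move: xs; rewrite !in_itv /= => /andP[xs ->].
by rewrite (lt_trans (lt_trans as_ st) xs).
Qed.

(** Nothing is assumed on [G] at [a] and [c]: cutting off two pieces of length [k] changes the
    integral by at most [2 B k]. The two forms of the fundamental theorem below identify or bound
    the limit. *)
Lemma itg_deriv_cvg (G g : R -> R) a c : a < c ->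
  (forall x, x \in `]a, c[ -> is_derive x 1 G (g x)) -> bc a c g ->
  (G (c - k) - G (a + k)) @[k --> 0^'+] --> itg a c g.
Proof.
move=> ac dG [cg [B gB]].
have B0 : 0 <= B.
  apply: le_trans (gB ((a + c) / 2) _); first exact: normr_ge0.
  by rewrite in_itv /=; apply/andP; split; lra.
apply/cvgrPdist_le => e e0; near=> k.
have k0 : 0 < k by near: k; exact: nbhs_right_gt.
have kac : k < (c - a) / 2.
  by near: k; apply: nbhs_right_lt; rewrite divr_gt0// subr_gt0.
have ke : k < e / (2 * B + 1).
  by near: k; apply: nbhs_right_lt; rewrite divr_gt0//; lra.
have := @itg_deriv_near G g a c B (a + k) (c - k) _ _ _ dG cg gB.
move=> /(_ ltac:(lra) ltac:(lra) ltac:(lra)) h; apply: le_trans h _.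
move: ke; rewrite ltr_pdivlMr; last by lra.
have -> : B * (a + k - a + (c - (c - k))) = k * (2 * B) by ring.
by move=> ke; nra.
Unshelve. all: by end_near. Qed.

Lemma near0_shift (G : R -> R) a : G k @[k --> a^'+] --> G a ->
  G (a + k) @[k --> 0^'+] --> G a.
Proof.
move=> Ga; rewrite -[X in X @ _]/(G \o (fun k => a + k)).
apply: cvg_trans Ga => /=.
apply: cvg_comp; last exact: cvg_id.
move=> A [e /= e0 eA]; exists e => //= x /=; rewrite sub0r normrN => xe x0.
apply: eA => /=; last by lra.
by rewrite opprD addNKr normrN.
Qed.

Lemma near0_shiftN (G : R -> R) c : G k @[k --> c^'-] --> G c ->
  G (c - k) @[k --> 0^'+] --> G c.
Proof.
move=> Gc; rewrite -[X in X @ _]/(G \o (fun k => c - k)).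
apply: cvg_trans Gc => /=.
apply: cvg_comp; last exact: cvg_id.
move=> A [e /= e0 eA]; exists e => //= x /=; rewrite sub0r normrN => xe x0.
apply: eA => /=; last by lra.
by rewrite opprB addrC subrK.
Qed.

Lemma itg_deriv (G g : R -> R) a c : a < c ->
  (forall x, x \in `]a, c[ -> is_derive x 1 G (g x)) -> bc a c g ->
  {within `[a, c], continuous G} -> itg a c g = G c - G a.
Proof.
move=> ac dG bg /(continuous_within_itvP _ ac)[_ Ga Gc].
have h1 := itg_deriv_cvg ac dG bg.
have h2 : (G (c - k) - G (a + k)) @[k --> 0^'+] --> G c - G a.
  by apply: cvgB; [exact: near0_shiftN|exact: near0_shift].
exact: (cvg_unique _ h1 h2).
Qed.

(** For primitives such as [u' V], without known values at the end points: a continuous majorant [H]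
    bounds the boundary terms. *)
Lemma itg_deriv_le (G g H : R -> R) a c : a < c ->
  (forall x, x \in `]a, c[ -> is_derive x 1 G (g x)) -> bc a c g ->
  (forall x, x \in `]a, c[ -> `|G x| <= H x) -> continuous H ->
  `|itg a c g| <= H a + H c.
Proof.
move=> ac dG bg GH cH.
have h1 : `|G (c - k) - G (a + k)| @[k --> 0^'+] --> `|itg a c g|.
  by apply: cvg_norm; apply: itg_deriv_cvg ac dG bg.
have h2 : (H (c - k) + H (a + k)) @[k --> 0^'+] --> H c + H a.
  apply: cvgD; [apply: near0_shiftN|apply: near0_shift].
    exact/cvg_at_left_filter/cH.
  exact/cvg_at_right_filter/cH.
rewrite addrC; apply: ler_cvg_to h1 h2 _; near=> k.
have k0 : 0 < k by near: k; exact: nbhs_right_gt.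
have kac : k < (c - a) / 2.
  by near: k; apply: nbhs_right_lt; rewrite divr_gt0// subr_gt0.
apply: le_trans (ler_normB _ _) _; apply: lerD; apply: GH; rewrite in_itv /=;
  by apply/andP; split; lra.
Unshelve. all: by end_near. Qed.

End Integration.

(** Follows the syntax of the integrand by second-order patterns. Each factor that is neither a
    constant nor a polynomial must have its [bc] fact in the context. *)
Ltac bcs := idtac; solve [lazymatch goal with
  | |- bc _ _ (fun=> ?k) => exact: bc_cst
  | |- bc _ _ (fun t => @?f t + @?g t) => apply: (@bcD _ _ _ f g); bcs
  | |- bc _ _ (fun t => - @?f t) => apply: (@bcN _ _ _ f); bcs
  | |- bc _ _ (fun t => @?f t * @?g t) => apply: (@bcM _ _ _ f g); bcs
  | |- bc _ _ (fun t => horner _ t) => exact: bc_horner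
  | |- bc _ _ (horner _) => exact: bc_horner
  | |- _ => assumption
  end].

(** * Cauchy-Schwarz inequality *)

Section CauchySchwarz.
Context {R : realType}.
Implicit Types (a c : R) (f g : R -> R).

(** The integral of [(f + s g)^2] is nonnegative at [s = - X / B]. If [B = 0] it is affine in [s],
    and [s = - (A + 1) / (2 X)] would give it the value -1. *)
Lemma itg_cauchy a c f g : bc a c f -> bc a c g ->
  itg a c (fun t => f t * g t) ^+ 2 <=
  itg a c (fun t => f t * f t) * itg a c (fun t => g t * g t).
Proof.
move=> bf bg; set A := itg _ _ (fun t => f t * f t).
set B := itg _ _ (fun t => g t * g t); set X := itg _ _ _.
have A0 : 0 <= A by apply: itg_ge0 => t _; rewrite -expr2 sqr_ge0.
have B0 : 0 <= B by apply: itg_ge0 => t _; rewrite -expr2 sqr_ge0.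
have key s : 0 <= A + 2 * s * X + s ^+ 2 * B.
  have -> : A + 2 * s * X + s ^+ 2 * B =
      itg a c (fun t => (f t + s * g t) * (f t + s * g t)).
    rewrite /A /B /X -!itgZ; try by apply: bcM.
    rewrite -!itgD; try by bcs.
    by apply: eq_itg => t _; ring.
  by apply: itg_ge0 => t _; rewrite -expr2 sqr_ge0.
have [B00|B00] := eqVneq B 0.
  rewrite B00 mulr0; have [->|X0] := eqVneq X 0; first by rewrite expr0n.
  have := key (- (A + 1) / (2 * X)); rewrite B00 mulr0 addr0.
  rewrite [_ * _ * X](_ : _ = - (A + 1)); last by field.
  by move=> h; exfalso; move: h; lra.
have {}B0 : 0 < B by rewrite lt_def B00 B0.
have := key (- X / B).
have -> : A + 2 * (- X / B) * X + (- X / B) ^+ 2 * B = (A * B - X ^+ 2) / B.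
  by field.
by rewrite pmulr_lge0 ?invr_gt0// subr_ge0.
Qed.

Lemma itg_cauchy_le a c f g m n : 0 <= m -> 0 <= n -> bc a c f -> bc a c g ->
  itg a c (fun t => f t * f t) <= m ^+ 2 ->
  itg a c (fun t => g t * g t) <= n ^+ 2 ->
  `|itg a c (fun t => f t * g t)| <= m * n.
Proof.
move=> m0 n0 bf bg fm gn; rewrite -(@ler_pXn2r _ 2)// ?nnegrE ?mulr_ge0//.
rewrite real_normK ?num_real// exprMn; apply: le_trans (itg_cauchy bf bg) _.
by apply: ler_pM => //; apply: itg_ge0 => t _; rewrite -expr2 sqr_ge0.
Qed.

End CauchySchwarz.

(** * Trace inequality and Riesz representation for polynomials *)

Section Poly.
Context {R : realType}.
Implicit Types (a c : R) (p q : {poly R}).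

Lemma is_derive_horner q (x : R) : is_derive x 1 (horner q) q^`().[x].
Proof. exact: is_derive_poly. Qed.

Lemma itg_poly_parts a c p q : a < c ->
  itg a c (fun t => p.[t] * q^`().[t]) =
  p.[c] * q.[c] - p.[a] * q.[a] - itg a c (fun t => p^`().[t] * q.[t]).
Proof.
move=> ac; have := @itg_deriv _ (horner (p * q)) (horner (p * q)^`()) a c ac.
move=> /(_ (fun x _ => is_derive_horner _ x) (bc_horner _ _ _)).
move=> /(_ (continuous_subspaceT (@continuous_horner _ _))).
rewrite (_ : itg a c _ = itg a c (fun t => p^`().[t] * q.[t] + p.[t] * q^`().[t])).
  by rewrite itgD; [rewrite !hornerM => <-; ring|bcs|bcs].
by apply: eq_itg => t _; rewrite derivM !hornerE.
Qed.

(** Leibniz' rule at a root of order [m]. The derivative of [(X - s)^(m+1) Q] has again the form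
    [(X - s)^m Q1], so the induction runs over all [Q]. *)
Lemma derivn_root_mul m : forall (s : R) (Q : {poly R}),
  [/\ forall j, (j < m)%N -> ((('X - s%:P) ^+ m * Q)^`(j)).[s] = 0,
      ((('X - s%:P) ^+ m * Q)^`(m)).[s] = m`!%:R * Q.[s] &
      ((('X - s%:P) ^+ m * Q)^`(m.+1)).[s] = m.+1`!%:R * Q^`().[s]].
Proof.
elim: m => [|m IH] s Q; first by split=> //; rewrite expr0 mul1r ?derivn0 ?derivn1 mul1r.
have [h1 h2 h3] := IH s (m.+1%:R *: Q + ('X - s%:P) * Q^`()).
have dE : (('X - s%:P) ^+ m.+1 * Q)^`() =
    ('X - s%:P) ^+ m * (m.+1%:R *: Q + ('X - s%:P) * Q^`()).
  rewrite derivM deriv_exp derivXsubC mul1r /= mulrDr.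
  rewrite -scaler_nat -scalerAl -scalerAr; congr (_ + _).
  by rewrite exprSr mulrA.
split.
- case=> [|j] jm; first by rewrite derivn0 !hornerE subrr expr0n /= mul0r.
  by rewrite derivSn dE h1.
- by rewrite derivSn dE h2 !hornerE subrr mul0r addr0 factS natrM; ring.
- rewrite derivSn dE h3 derivD derivZ derivM derivXsubC mul1r !hornerE subrr mul0r.
  by rewrite [in RHS]factS natrM -[m.+2%:R]natr1 /= addr0; ring.
Qed.

Lemma size_derivn_leq p n : (size p^`(n) <= size p - n)%N.
Proof.
elim: n => [|n IH]; first by rewrite derivn0 subn0.
rewrite derivnS subnS; apply: leq_trans (size_poly _ _) _.
by rewrite -!subn1 leq_sub2r.
Qed.

(** All boundary terms of [n] integrations by parts vanish, and [n] derivatives annihilate [q]. *)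
Lemma itg_derivn_eq0 a c (G : {poly R}) n : a < c ->
  (forall j, (j < n)%N -> G^`(j).[a] = 0 /\ G^`(j).[c] = 0) ->
  forall q, (size q <= n)%N -> itg a c (fun t => q.[t] * G^`(n).[t]) = 0.
Proof.
move=> ac; elim: n => [|n IH] Gn q qn.
  move: qn; rewrite leqn0 size_poly_eq0 => /eqP ->.
  rewrite (@eq_itg _ _ _ _ (fun=> 0)); last by move=> t _; rewrite horner0 mul0r.
  by rewrite itg_cst ?ltW// mul0r.
rewrite derivnS itg_poly_parts//.
have [-> ->] := Gn n (ltnSn n); rewrite !mulr0 subrr sub0r IH ?oppr0//.
  by move=> j jn; apply: Gn; exact: ltnW.
apply: leq_trans (size_poly _ _) _.
by rewrite -subn1 leq_subLR add1n.
Qed.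

(* [k] is the reproducing kernel at [t] of the polynomials of degree at most
   [n]: by Rodrigues' formula it is a multiple of
   [D^(n+1) ((X - s)^(n+1) (X - t)^n)], where [s] is the other end point. *)
Lemma end_kernel a c n : a < c -> forall t, t \in [:: a; c] ->
  exists k : {poly R}, [/\ (size k <= n.+1)%N,
    forall q, (size q <= n.+1)%N -> itg a c (fun x => q.[x] * k.[x]) = q.[t] &
    k.[t] = n.+1%:R ^+ 2 / (c - a)].
Proof.
move=> ac t tac.
pose s := if t == a then c else a.
have ca0 : c - a != 0 by rewrite subr_eq0 gt_eqF.
have ts : t - s != 0.
  rewrite subr_eq0 /s; case: ifP => [/eqP ->|/negbT //]; by rewrite lt_eqF.
pose G : {poly R} := ('X - t%:P) ^+ n * ('X - s%:P) ^+ n.+1.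
have [Gt0 Gt1 Gt2] := derivn_root_mul n t (('X - s%:P) ^+ n.+1).
have [Gs _ _] := derivn_root_mul n.+1 s (('X - t%:P) ^+ n).
rewrite -/G in Gt0 Gt1 Gt2.
have {}Gs j : (j < n.+1)%N -> G^`(j).[s] = 0.
  by move=> jn; rewrite /G [_ ^+ n * _]mulrC Gs.
rewrite !hornerE in Gt1.
have {}Gt2 : (G^`(n.+1)).[t] = n.+1`!%:R * (n.+1%:R * (t - s) ^+ n).
  by rewrite Gt2 deriv_exp derivXsubC mul1r /= hornerMn horner_exp hornerXsubC; congr (_ * _); rewrite -[LHS]mulr_natl.
have Ft0 : (G^`(n)).[t] != 0.
  by rewrite Gt1 mulf_neq0// ?pnatr_eq0 -?lt0n ?fact_gt0// expf_neq0.
(* The sign of the boundary term at [t]: -1 at the left end, 1 at the right end. *)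
pose e : R := if t == a then -1 else 1.
have ets : e / (t - s) = (c - a)^-1.
  rewrite /e /s; move: tac ts; rewrite /s !inE; case: eqP => [->|_] /=.
    by move=> _ _; rewrite -[a - c]opprB invrN mulrNN mul1r.
  by move=> /eqP -> _; rewrite mul1r.
exists ((e / G^`(n).[t]) *: G^`(n.+1)); split.
- apply: leq_trans (size_scale_leq _ _) _.
  apply: leq_trans (size_derivn_leq _ _) _; rewrite leq_subLR.
  apply: leq_trans (size_polyMleq _ _) _.
  by rewrite !size_exp_XsubC addSn addnS.
- move=> q qn.
  (* One integration by parts. As [G^(n)] vanishes at [s], the boundary term is [q(t)] after the
     scaling; the remaining integral is 0 because [q'] has degree less than [n]. *)
  rewrite (@eq_itg _ _ _ _ (fun x => (e / G^`(n).[t]) * (q.[x] * (G^`(n)^`()).[x]))); last first.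
    by move=> x _; rewrite derivnS hornerZ; ring.
  rewrite itgZ; last by bcs.
  rewrite itg_poly_parts// (@itg_derivn_eq0 a c G n)// ?subr0; last 2 first.
  + move=> j jn; move: tac ts; rewrite !inE /s; case: eqP => [ta|_] /=.
      move=> _ _; split; first by rewrite -ta Gt0.
      by have := Gs j (ltnW jn); rewrite /s ta eqxx.
    move=> /eqP tc _; split; last by rewrite -tc Gt0.
    by have := Gs j (ltnW jn); rewrite /s tc gt_eqF.
  + apply: leq_trans (size_poly _ _) _.
    by rewrite -subn1 leq_subLR add1n.
  have := Gs n (ltnSn n); rewrite /s /e; move: tac; rewrite !inE.
  case: eqP => [ta|_] /= => [_ ->|/eqP tc ->]; rewrite mulr0 ?sub0r ?subr0.
    by rewrite -ta; field.
  by rewrite -tc; field.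
- rewrite hornerZ Gt1 Gt2 -ets factS natrM exprS.
  by field; rewrite ts /= expf_neq0//= pnatr_eq0 -lt0n fact_gt0.
Qed.

(** Cauchy-Schwarz against the end point kernel [k], whose squared norm is its own value [k(t)]. The
    factor [n^2 / (c - a)] matches the penalty [e1 p^2 / h] when [q] is the derivative of a
    polynomial of degree [p]. *)
Lemma trace_ineq a c n q t : a < c -> t \in [:: a; c] -> (size q <= n)%N ->
  q.[t] ^+ 2 * (c - a) <= n%:R ^+ 2 * itg a c (fun x => q.[x] * q.[x]).
Proof.
move=> ac tac; case: n => [|n] qn.
  move: qn; rewrite leqn0 size_poly_eq0 => /eqP ->.
  by rewrite horner0 !expr0n /= !mul0r.
have [k [kn kq kt]] := end_kernel n ac tac.
have := itg_cauchy (bc_horner a c q) (bc_horner a c k).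
rewrite kq// (kq k kn) kt => h.
have ca : 0 < c - a by rewrite subr_gt0.
by move: h; rewrite mulrA ler_pdivlMr// [X in _ <= X]mulrC.
Qed.

(** The integral over each [(a, t)] vanishes too, so the trace inequality at its right end forces
    [q(t) = 0]. The points [a + (c - a) / (i + 1)] are then more roots than the degree allows. *)
Lemma itg_sqr_eq0 a c q : a < c -> itg a c (fun x => q.[x] * q.[x]) = 0 -> q = 0.
Proof.
move=> ac q0.
have rt t : a < t <= c -> root q t.
  move=> /andP[at_ tc].
  have h : itg a t (fun x => q.[x] * q.[x]) <= 0.
    rewrite -q0 (@itg_split _ a t c) ?(ltW at_)//; last by bcs.
    by rewrite lerDl itg_ge0// => x _; rewrite -expr2 sqr_ge0.
  have := @trace_ineq a t (size q) q t at_ _ (leqnn _).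
  rewrite !inE eqxx orbT => /(_ isT) h2.
  have : q.[t] ^+ 2 * (t - a) <= 0.
    by apply: le_trans h2 _; rewrite mulr_ge0_le0// sqr_ge0.
  rewrite pmulr_lle0 ?subr_gt0// => h3; apply/eqP/eqP.
  by rewrite -sqrf_eq0 eq_le h3 sqr_ge0.
apply: (@roots_geq_poly_eq0 _ q [seq a + (c - a) / i.+1%:R | i <- iota 0 (size q)]).
- apply/allP => _ /mapP[i _ ->]; apply: rt.
  rewrite ltrDl divr_gt0 ?subr_gt0//= -lerBrDl ler_pdivrMr ?ltr0Sn//.
  by rewrite ler_peMr ?ler1n// subr_ge0 ltW.
- rewrite map_inj_uniq ?iota_uniq// => i j /addrI /(mulfI _).
  rewrite subr_eq0 gt_eqF// => /(_ isT) /invr_inj /eqP.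
  by rewrite eqr_nat => /eqP [].
- by rewrite size_map size_iota.
Qed.

(** The Gram matrix of the monomials is invertible, because a vector of its kernel is a polynomial
    of norm zero. The existence of weak derivatives rests on this. *)
Lemma poly_riesz a c n (l : {poly R} -> R) : a < c ->
  (forall p q, l (p + q) = l p + l q) -> (forall k p, l (k *: p) = k * l p) ->
  exists2 d : {poly R}, (size d <= n)%N &
    forall q, (size q <= n)%N -> itg a c (fun x => d.[x] * q.[x]) = l q.
Proof.
move=> ac lD lZ.
have l0 : l 0 = 0 by rewrite -[0 in LHS](scale0r 0) lZ mul0r.
have sumE (L : {poly R} -> R) : (forall p q, L (p + q) = L p + L q) ->
    (forall k p, L (k *: p) = k * L p) -> forall v : 'rV[R]_n,
    L (rVpoly v) = \sum_j v 0 j * L 'X^j.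
  move=> LD LZ v.
  have L0 : L 0 = 0 by rewrite -[0 in LHS](scale0r 0) LZ mul0r.
  rewrite /rVpoly poly_def (big_morph L LD L0); apply: eq_bigr => i _.
  by rewrite LZ valK.
pose B p q := itg a c (fun x => p.[x] * q.[x]).
have BD p : forall q r, B p (q + r) = B p q + B p r.
  move=> q r; rewrite /B -itgD; [|bcs|bcs].
  by apply: eq_itg => t _; rewrite hornerD mulrDr.
have BZ p : forall k q, B p (k *: q) = k * B p q.
  move=> k q; rewrite /B -itgZ; last by bcs.
  by apply: eq_itg => t _; rewrite hornerZ mulrCA.
have BC p q : B p q = B q p by apply: eq_itg => t _; rewrite mulrC.
pose G : 'M[R]_n := \matrix_(i, j) B 'X^i 'X^j.
have BG (u : 'rV[R]_n) (j : 'I_n) : B (rVpoly u) 'X^j = (u *m G) 0 j.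
  rewrite BC sumE; [|exact: BD|exact: BZ].
  by rewrite mxE; apply: eq_bigr => i _; rewrite mxE BC.
have Gu : G \in unitmx.
  rewrite -row_free_unit; apply: inj_row_free => v vG.
  have : B (rVpoly v) (rVpoly v) = 0.
    rewrite sumE; [|exact: BD|exact: BZ].
    by rewrite big1// => j _; rewrite BG vG mxE mulr0.
  by move=> /(itg_sqr_eq0 ac) v0; rewrite -[v]rVpolyK v0 linear0.
exists (rVpoly ((\row_j l 'X^j) *m invmx G)); first exact: size_poly.
move=> q qn; rewrite -(poly_rV_K qn) -/(B _ _).
rewrite sumE; [|exact: BD|exact: BZ].
rewrite [RHS]sumE//; apply: eq_bigr => j _; congr (_ * _).
by rewrite BG mulmxKV// mxE.
Qed.

End Poly.

(** * Sequences of Taylor coefficients *)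

Section Sequences.
Context {R : realType}.
Implicit Types (F G H : nat -> R) (t C : R).

Definition smul F G n : R := \sum_(i < n.+1) F i * G (n - i)%N.
Definition sder F n : R := n.+1%:R * F n.+1.

(** Course-of-values recursion: [step F n] sees the earlier values as a function that is 0 from [n]
    on. The unfolding [srecE] holds if [step] reads only indices below [n]. *)
Fixpoint srl (step : (nat -> R) -> nat -> R) n : seq R :=
  if n is m.+1 then rcons (srl step m) (step (nth 0 (srl step m)) m) else [::].
Definition srec step n : R := nth 0 (srl step n.+1) n.

Lemma size_srl step n : size (srl step n) = n.
Proof. by elim: n => //= n IH; rewrite size_rcons IH. Qed.

Lemma nth_srl step n i : (i < n)%N -> nth 0 (srl step n) i = srec step i.
Proof.
elim: n => // n IH; rewrite ltnS leq_eqVlt => /predU1P[->//|in_].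
by rewrite /= nth_rcons size_srl in_ IH.
Qed.

Lemma srecE step n :
  (forall F G, (forall i, (i < n)%N -> F i = G i) -> step F n = step G n) ->
  srec step n = step (srec step) n.
Proof.
move=> ext; rewrite {1}/srec /= nth_rcons size_srl ltnn eqxx.
by apply: ext => i; apply: nth_srl.
Qed.

(** Leibniz' rule, by writing the factor [n + 1] as [i + (n + 1 - i)] in each term of the
    product. *)
Lemma sder_smul F G n : sder (smul F G) n =
  \sum_(i < n.+1) (sder F i * G (n - i)%N + F i * sder G (n - i)%N).
Proof.
rewrite /sder /smul mulr_sumr.
transitivity (\sum_(i < n.+2) i%:R * (F i * G (n.+1 - i)%N) +
              \sum_(i < n.+2) (n.+1 - i)%N%:R * (F i * G (n.+1 - i)%N)).
  rewrite -big_split; apply: eq_bigr => i _ /=.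
  by rewrite -mulrDl -natrD subnKC// -ltnS.
rewrite big_ord_recl mul0r add0r [X in _ + X]big_ord_recr /= subnn mul0r addr0.
rewrite -big_split; apply: eq_bigr => i _ /=.
rewrite /bump /= add1n subSS subSn; last by rewrite -ltnS.
by ring.
Qed.

(** A bound on the l^1 norm with weights [t^n] of a sequence of Taylor coefficients; this norm is
    submultiplicative. Partial sums avoid any question of convergence. *)
Definition nb t C F : Prop := forall N, \sum_(n < N) t ^+ n * `|F n| <= C.

Lemma nb_ge0 t C F : nb t C F -> 0 <= C.
Proof. by move/(_ 0%N); rewrite big_ord0. Qed.

Lemma nb_le t C C' F : C <= C' -> nb t C F -> nb t C' F.
Proof. by move=> CC h N; apply: le_trans (h N) CC. Qed.

Lemma nb_mono t t' C F : 0 <= t' -> t' <= t -> nb t C F -> nb t' C F.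
Proof.
move=> t0 tt h N; apply: le_trans (h N); apply: ler_sum => i _.
by rewrite ler_wpM2r// lerXn2r// nnegrE (le_trans t0).
Qed.

Lemma nb_add t C C' F G : 0 <= t -> nb t C F -> nb t C' G ->
  nb t (C + C') (fun n => F n + G n).
Proof.
move=> t0 hF hG N; apply: le_trans (lerD (hF N) (hG N)).
rewrite -big_split; apply: ler_sum => i _ /=; rewrite -mulrDr.
by rewrite ler_wpM2l ?exprn_ge0// ler_normD.
Qed.

Lemma nb_scale t C k F : 0 <= t -> nb t C F -> nb t (`|k| * C) (fun n => k * F n).
Proof.
move=> t0 hF N; apply: le_trans (ler_wpM2l (normr_ge0 k) (hF N)).
rewrite mulr_sumr; apply: ler_sum => i _ /=.
by rewrite normrM mulrCA.
Qed.

Lemma nb_opp t C F : nb t C F -> nb t C (fun n => - F n).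
Proof. by move=> h N; apply: le_trans (h N); apply: ler_sum => i _; rewrite normrN. Qed.

Lemma nb_sub t C C' F G : 0 <= t -> nb t C F -> nb t C' G ->
  nb t (C + C') (fun n => F n - G n).
Proof. by move=> t0 hF /nb_opp hG; apply: nb_add. Qed.

Lemma sum_shift_ge (b : nat -> R) N i :
  \sum_(n < N | (i < n.+1)%N) b (n - i)%N = \sum_(j < N - i) b j.
Proof.
elim: N => [|N IH]; first by rewrite big_ord0 sub0n big_ord0.
rewrite big_mkcond big_ord_recr -big_mkcond /= IH ltnS.
case: leqP => iN; first by rewrite subSn// big_ord_recr.
by rewrite addr0; have /eqP -> : (N - i)%N == 0%N; rewrite ?subn_eq0 1?ltnW//;
   have /eqP -> : (N.+1 - i)%N == 0%N; rewrite ?subn_eq0.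
Qed.

Lemma nb_mul t C C' F G : 0 <= t -> nb t C F -> nb t C' G ->
  nb t (C * C') (smul F G).
Proof.
move=> t0 hF hG N.
pose a i := t ^+ i * `|F i|; pose b i := t ^+ i * `|G i|.
have a0 i : 0 <= a i by rewrite mulr_ge0 ?exprn_ge0.
have b0 i : 0 <= b i by rewrite mulr_ge0 ?exprn_ge0.
apply: (@le_trans _ _ (\sum_(n < N) \sum_(i < N | (i < n.+1)%N) a i * b (n - i)%N)).
  apply: ler_sum => n _; rewrite -(big_ord_widen N (fun i => a i * b (n - i)%N))//.
  apply: (@le_trans _ _ (t ^+ n * \sum_(i < n.+1) `|F i * G (n - i)%N|)).
    by rewrite ler_wpM2l ?exprn_ge0// ler_norm_sum.
  rewrite mulr_sumr; apply: ler_sum => i _; rewrite normrM /a /b.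
  rewrite -[in t ^+ n](@subnKC i n) -1?ltnS// exprD.
  by rewrite mulrACA.
rewrite (exchange_big_dep xpredT)//=.
apply: (@le_trans _ _ (\sum_(i < N) a i * \sum_(j < N) b j)).
  apply: ler_sum => i _; rewrite -mulr_sumr ler_wpM2l//.
  rewrite sum_shift_ge (big_ord_widen N b) ?leq_subr//.
  rewrite big_mkcond; apply: ler_sum => j _.
  by case: ifP.
rewrite -mulr_suml; apply: ler_pM; try exact: sumr_ge0.
- exact: hF.
- exact: hG.
Qed.

Lemma der_weight (t t' : R) n : 0 <= t' -> t' <= t ->
  n.+1%:R * t' ^+ n * (t - t') <= t ^+ n.+1 - t' ^+ n.+1.
Proof.
move=> t0 tt; elim: n => [|n IH]; first by rewrite !expr1 expr0 !mul1r.
have h : t' * (n.+1%:R * t' ^+ n * (t - t')) <= t * (t ^+ n.+1 - t' ^+ n.+1).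
  apply: ler_pM => //; first by rewrite !mulr_ge0 ?exprn_ge0// subr_ge0.
rewrite (exprS t n.+1) (exprS t' n.+1) -[n.+2%:R]natr1.
rewrite (exprS t' n) in h *.
have -> : t * t ^+ n.+1 - t' * (t' * t' ^+ n) =
  t * (t ^+ n.+1 - t' * t' ^+ n) + t' * t' ^+ n * (t - t') by ring.
by rewrite !mulrDl mul1r lerD2r; apply: le_trans h; rewrite le_eqVlt; apply/orP; left; apply/eqP; ring.
Qed.

(** Cauchy's estimate in this norm: a derivative costs the piece [t - t'] of the radius and the
    factor [1 / (t - t')]. *)
Lemma nb_der t t' C F : 0 <= t' -> t' < t -> nb t C F ->
  nb t' (C / (t - t')) (sder F).
Proof.
move=> t0 tt hF N; rewrite ler_pdivlMr ?subr_gt0//.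
have := hF N.+1; rewrite big_ord_recl => h.
apply: le_trans h.
apply: (@le_trans _ _ (\sum_(i < N) t ^+ lift ord0 i * `|F (lift ord0 i)|)); last first.
  by rewrite lerDr mulr_ge0// exprn_ge0// (le_trans t0)// ltW.
rewrite mulr_suml; apply: ler_sum => i _ /=.
rewrite /sder normrM ger0_norm// /bump /= add1n.
have := der_weight i t0 (ltW tt) => hw.
rewrite -[X in X <= _](_ : (i.+1%:R * t' ^+ i * (t - t')) * `|F i.+1| = _); last by ring.
rewrite ler_wpM2r//; apply: le_trans hw _; rewrite gerBl exprn_ge0//.
Qed.

Lemma nb_coef t C F n : 0 < t -> nb t C F -> `|F n| <= C * t^-1 ^+ n.
Proof.
move=> t0 hF; have := hF n.+1; rewrite big_ord_recr /= => h.
rewrite exprVn ler_pdivlMr ?exprn_gt0// mulrC; apply: le_trans h.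
by rewrite lerDr sumr_ge0// => i _; rewrite mulr_ge0// exprn_ge0// ltW.
Qed.

Lemma sum_half N : \sum_(n < N) (2^-1 : R) ^+ n <= 2.
Proof.
suff -> : \sum_(n < N) (2^-1 : R) ^+ n = 2 - 2 * 2^-1 ^+ N.
  by rewrite gerBl mulr_ge0// exprn_ge0// invr_ge0.
elim: N => [|N IH]; first by rewrite big_ord0 expr0 mulr1 subrr.
by rewrite big_ord_recr /= IH exprS; field.
Qed.

Lemma sum_geo_le t K C F N : 0 <= t -> 0 <= K -> t * K <= 2^-1 -> 0 <= C ->
  (forall n, `|F n| <= C * K ^+ n) -> \sum_(n < N) t ^+ n * `|F n| <= 2 * C.
Proof.
move=> t0 K0 tK C0 FK.
apply: (@le_trans _ _ (\sum_(n < N) C * 2^-1 ^+ n)).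
  apply: ler_sum => n _.
  apply: (@le_trans _ _ (t ^+ n * (C * K ^+ n))).
    by rewrite ler_wpM2l// exprn_ge0.
  rewrite mulrCA -exprMn ler_wpM2l// lerXn2r// nnegrE ?mulr_ge0// invr_ge0//.
by rewrite -mulr_sumr mulrC ler_wpM2r// sum_half.
Qed.

Lemma nb_geo t K C F : 0 <= t -> 0 <= K -> t * K <= 2^-1 -> 0 <= C ->
  (forall n, `|F n| <= C * K ^+ n) -> nb t (2 * C) F.
Proof. by move=> *; move=> N; apply: (sum_geo_le (K := K)). Qed.

(** Coefficients of [1 / F], from the equations saying that its product with [F] is 1. *)
Definition sinv F : nat -> R := srec (fun h n =>
  if n is m.+1 then - ((F 0%N)^-1 * \sum_(i < m.+1) F i.+1 * h (m - i)%N)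
  else (F 0%N)^-1).

Lemma sinv0 F : sinv F 0 = (F 0%N)^-1.
Proof. by rewrite /sinv srecE. Qed.

Lemma sinvS F n : sinv F n.+1 =
  - ((F 0%N)^-1 * \sum_(i < n.+1) F i.+1 * sinv F (n - i)%N).
Proof.
rewrite {1}/sinv srecE// => G H GH; do 2 congr (_ _).
by apply: eq_bigr => i _; rewrite GH// ltnS leq_subr.
Qed.

(* [beta] is a lower bound of the constant term, and the remaining terms have
   weighted sum at most [beta / 2]. *)
Lemma nb_inv t K C beta F : 0 <= t -> 0 <= K -> t * K <= 2^-1 -> 0 <= C ->
  (forall n, `|F n| <= C * K ^+ n) -> 0 < beta -> beta <= F 0%N ->
  2 * C * (t * K) <= beta / 2 ->
  nb t (2 / beta) (sinv F).
Proof.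
move=> t0 K0 tK C0 FK b0 bF tKb.
have F00 : 0 < F 0%N by apply: lt_le_trans bF.
have tail N : \sum_(n < N) t ^+ n.+1 * `|F n.+1| <= beta / 2.
  apply: le_trans tKb.
  have -> : \sum_(n < N) t ^+ n.+1 * `|F n.+1| =
      t * \sum_(n < N) t ^+ n * `|F n.+1|.
    by rewrite mulr_sumr; apply: eq_bigr => i _; rewrite exprS mulrA.
  have -> : 2 * C * (t * K) = t * (2 * (C * K)) by ring.
  rewrite ler_wpM2l//; apply: (@sum_geo_le t K (C * K) (fun n => F n.+1)) => //; first exact: mulr_ge0.
    move=> n.
  by apply: le_trans (FK _) _; rewrite exprS mulrA.
elim=> [|N IH]; first by rewrite big_ord0 divr_ge0// ltW.
rewrite big_ord_recl expr0 mul1r sinv0.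
have Fb : `|(F 0%N)^-1| <= beta^-1.
  by rewrite normfV gtr0_norm// lef_pV2// ?posrE.
(* The bound [2 / beta] reproduces itself: [1 / beta] comes from the constant term and [1 / beta]
   from the tail. *)
apply: (@le_trans _ _ (beta^-1 + beta^-1 * (beta / 2 * (2 / beta)))); last first.
  by rewrite le_eqVlt; apply/orP; left; apply/eqP; field; rewrite gt_eqF.
apply: lerD => //.
apply: (@le_trans _ _ (beta^-1 * \sum_(n < N) t ^+ n *
   `|smul (fun i => t * `|F i.+1|) (fun i => `|sinv F i|) n|)); last first.
  rewrite ler_wpM2l ?invr_ge0 ?(ltW b0)//.
  suff h : nb t (beta / 2) (fun i => t * `|F i.+1|).
    (* The induction hypothesis bounds the first [N] terms only, so the sequence is cut off at [N]
       before [nb_mul] applies. *)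
    pose H i := if (i < N)%N then `|sinv F i| else 0.
    have hH : nb t (2 / beta) H.
      move=> M; apply: le_trans IH.
      have [MN|NM] := leqP M N.
        rewrite (big_ord_widen N (fun n => t ^+ n * `|H n|))// big_mkcond.
        apply: ler_sum => i _; rewrite /H ltn_ord; case: ifP => _.
          by rewrite normr_id.
        by rewrite mulr_ge0// exprn_ge0.
      rewrite -(subnKC (ltnW NM)) big_split_ord /= [X in _ + X]big1 ?addr0.
        by apply: ler_sum => i _; rewrite /H ltn_ord normr_id.
      by move=> i _; rewrite /H ltnNge leq_addr /= normr0 mulr0.
    have := nb_mul t0 h hH N; apply: le_trans.
    apply: ler_sum => n _; rewrite ler_wpM2l ?exprn_ge0//.
    rewrite le_eqVlt; apply/orP; left; apply/eqP; congr `|_|.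
    apply: eq_bigr => i _; congr (_ * _); rewrite /H ifT//.
    by apply: leq_ltn_trans (leq_subr _ _) (ltn_ord n).
  move=> M; apply: le_trans (tail M); apply: ler_sum => i _.
  by rewrite ger0_norm ?mulr_ge0// exprS mulrCA mulrA.
rewrite mulr_sumr; apply: ler_sum => n _; rewrite lift0 sinvS normrN normrM.
have -> : t ^+ n.+1 * (`|(F 0%N)^-1| * `|\sum_(i < n.+1) F i.+1 * sinv F (n - i)%N|)
  = `|(F 0%N)^-1| * (t ^+ n * (t * `|\sum_(i < n.+1) F i.+1 * sinv F (n - i)%N|)).
  by rewrite exprS; ring.
apply: ler_pM => //; first by rewrite !mulr_ge0// exprn_ge0.
rewrite ler_wpM2l ?exprn_ge0// [X in _ <= X]ger0_norm; last first.
  by apply: sumr_ge0 => i _; rewrite !mulr_ge0.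
apply: (@le_trans _ _ (t * \sum_(i < n.+1) `|F i.+1 * sinv F (n - i)%N|)).
  by rewrite ler_wpM2l// ler_norm_sum.
by rewrite mulr_sumr; apply: ler_sum => i _; rewrite normrM mulrA.
Qed.

End Sequences.

(** * Families of Taylor coefficients depending on the base point *)

Section Jets.
Context {R : realType}.
Implicit Types (D : R -> Prop) (F G : R -> nat -> R) (x k : R).

(* [F x n] stands for the n-th Taylor coefficient at [x] of [fun y => F y 0]. *)
Definition jet D F : Prop := forall x, D x -> forall n,
  is_derive x 1 (fun y => F y n) (sder (F x) n).

Lemma is_derive_bigsum x n (f : 'I_n -> R -> R) (df : 'I_n -> R) :
  (forall i, is_derive x 1 (f i) (df i)) ->
  is_derive x 1 (fun y => \sum_i f i y) (\sum_i df i).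
Proof.
move=> h; rewrite (_ : (fun y => _) = \sum_i f i); last by rewrite fct_sumE.
by apply: is_derive_eq.
Qed.

Lemma is_deriveM' x (f g : R -> R) df dg :
  is_derive x 1 f df -> is_derive x 1 g dg ->
  is_derive x 1 (fun y => f y * g y) (df * g x + f x * dg).
Proof.
move=> hf hg; have := is_deriveM hf hg => h.
by apply: is_derive_eq; rewrite /GRing.scale /=; ring.
Qed.

Lemma is_deriveZ' x k (f : R -> R) df :
  is_derive x 1 f df -> is_derive x 1 (fun y => k * f y) (k * df).
Proof. by move=> hf; have := is_deriveZ k hf. Qed.

Lemma is_deriveD' x (f g : R -> R) df dg :
  is_derive x 1 f df -> is_derive x 1 g dg ->
  is_derive x 1 (fun y => f y + g y) (df + dg).
Proof. by move=> hf hg; have := is_deriveD hf hg. Qed.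

Lemma is_deriveB' x (f g : R -> R) df dg :
  is_derive x 1 f df -> is_derive x 1 g dg ->
  is_derive x 1 (fun y => f y - g y) (df - dg).
Proof. by move=> hf hg; have := is_deriveB hf hg. Qed.

Lemma is_deriveN' x (f : R -> R) df :
  is_derive x 1 f df -> is_derive x 1 (fun y => - f y) (- df).
Proof. by move=> hf; have := is_deriveN hf. Qed.

Lemma is_derive_smul x F G n :
  (forall i, (i <= n)%N -> is_derive x 1 (fun y => F y i) (sder (F x) i)) ->
  (forall i, (i <= n)%N -> is_derive x 1 (fun y => G y i) (sder (G x) i)) ->
  is_derive x 1 (fun y => smul (F y) (G y) n) (sder (smul (F x) (G x)) n).
Proof.
move=> hF hG; rewrite sder_smul /smul; apply: is_derive_bigsum => i.
apply: is_deriveM'; first by apply: hF; rewrite -ltnS.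
by apply: hG; apply: leq_subr.
Qed.

Lemma jet_mul D F G : jet D F -> jet D G -> jet D (fun x => smul (F x) (G x)).
Proof.
move=> hF hG x Dx n; apply: (@is_derive_smul x F G n) => i _.
  exact: (hF x Dx i).
exact: (hG x Dx i).
Qed.

Lemma jet_add D F G : jet D F -> jet D G -> jet D (fun x n => F x n + G x n).
Proof.
move=> hF hG x Dx n; rewrite /sder mulrDr.
by apply: is_deriveD'; [exact: hF|exact: hG].
Qed.

Lemma jet_scale D F k : jet D F -> jet D (fun x n => k * F x n).
Proof.
move=> hF x Dx n; rewrite /sder mulrCA.
by apply: is_deriveZ'; exact: hF.
Qed.

Lemma jet_opp D F : jet D F -> jet D (fun x n => - F x n).
Proof.
move=> hF x Dx n; rewrite /sder mulrN.
by apply: is_deriveN'; exact: hF.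
Qed.

Lemma jet_sub D F G : jet D F -> jet D G -> jet D (fun x n => F x n - G x n).
Proof. by move=> hF /jet_opp hG; apply: jet_add. Qed.

Lemma jet_der D F : jet D F -> jet D (fun x => sder (F x)).
Proof.
move=> hF x Dx n; rewrite /sder.
by apply: is_deriveZ'; exact: hF.
Qed.

Lemma jet0 D : jet D (fun _ _ => 0).
Proof.
by move=> x Dx n; rewrite /sder mulr0; apply: is_derive_cst.
Qed.

(** Each coefficient is a formula in lower ones. Differentiating the formula and comparing with the
    recursion for the next coefficient closes the induction; [jet_exp] and [jet_ode] follow the same
    scheme. *)
Lemma jet_inv D F : jet D F -> (forall x, D x -> F x 0%N != 0) ->
  jet D (fun x => sinv (F x)).
Proof.
move=> hF F0 x Dx.
have d0 : is_derive x 1 (fun y => sinv (F y) 0) (sder (sinv (F x)) 0).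
  rewrite (_ : (fun y => _) = (fun y => (F y 0%N)^-1)); last first.
    by apply/funext => y; rewrite sinv0.
  have h := is_deriveV (F0 _ Dx) (hF _ Dx 0%N).
  rewrite /sder sinvS big_ord1 sinv0 /=.
  apply: is_derive_eq; rewrite /GRing.scale /= /sder; field.
  exact: F0.
suff h n : forall m, (m <= n)%N ->
    is_derive x 1 (fun y => sinv (F y) m) (sder (sinv (F x)) m).
  by move=> n; apply: (h n).
elim: n => [|n IH] m; first by rewrite leqn0 => /eqP ->.
rewrite leq_eqVlt ltnS => /predU1P[->|]; last exact: IH.
pose c := \sum_(i < n.+1) F x i.+1 * sinv (F x) (n - i)%N.
have dsum : is_derive x 1 (fun y => \sum_(i < n.+1) F y i.+1 * sinv (F y) (n - i)%N)
   (\sum_(i < n.+1) (sder (F x) i.+1 * sinv (F x) (n - i)%N +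
                    F x i.+1 * sder (sinv (F x)) (n - i)%N)).
  apply: is_derive_bigsum => i; apply: is_deriveM'; first exact: hF.
  by apply: IH; apply: leq_subr.
rewrite (_ : (fun y => _) = (fun y => - (sinv (F y) 0 *
    \sum_(i < n.+1) F y i.+1 * sinv (F y) (n - i)%N))); last first.
  by apply/funext => y; rewrite sinvS sinv0.
have := is_deriveN' (is_deriveM' d0 dsum).
set d := (X in is_derive _ _ _ X); move=> h.
suff -> : sder (sinv (F x)) n.+1 = d by [].
rewrite /d -/c.
have -> : sder (sinv (F x)) 0 = - ((F x 0%N)^-1 * (F x 1%N * (F x 0%N)^-1)).
  by rewrite /sder sinvS big_ord1 sinv0 mul1r.
have -> : sder (sinv (F x)) n.+1 = - ((F x 0%N)^-1 *
   (\sum_(i < n.+2) i.+1%:R * (F x i.+1 * sinv (F x) (n.+1 - i)%N) +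
    \sum_(i < n.+2) (n.+1 - i)%:R * (F x i.+1 * sinv (F x) (n.+1 - i)%N))).
  rewrite /sder sinvS mulrN mulrCA; do 2 congr (_ _).
  rewrite -big_split mulr_sumr; apply: eq_bigr => i _ /=.
  by rewrite -mulrDl -natrD addSn subnKC// -ltnS.
rewrite big_ord_recl [X in _ + X]big_ord_recr /= subnn mul0r addr0 subn0 mul1r.
rewrite -addrA -big_split /= [sinv (F x) n.+1]sinvS -/c sinv0.
rewrite [X in _ + X](_ : _ = \sum_(i < n.+1) (sder (F x) i.+1 * sinv (F x) (n - i)%N +
   F x i.+1 * sder (sinv (F x)) (n - i)%N)); first by ring.
apply: eq_bigr => i _; rewrite /sder /bump /= add1n subSS subSn; last by rewrite -ltnS.
by ring.
Qed.

(* The Taylor coefficients of a solution of [g' = l m g]. *)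
Definition expjet (l : R) (m : nat -> R) (g0 : R) : nat -> R :=
  srec (fun h n => if n is n'.+1 then
    l / n'.+1%:R * \sum_(i < n'.+1) m i * h (n' - i)%N else g0).

Lemma expjet0 l m g0 : expjet l m g0 0 = g0.
Proof. by rewrite /expjet srecE. Qed.

Lemma expjetS l m g0 n :
  expjet l m g0 n.+1 = l / n.+1%:R * smul m (expjet l m g0) n.
Proof.
rewrite {1}/expjet srecE// => F G FG; congr (_ * _).
by apply: eq_bigr => i _; rewrite FG// ltnS leq_subr.
Qed.

Lemma jet_exp D F l (g : R -> R) : jet D F ->
  (forall x, D x -> is_derive x 1 g (l * F x 0%N * g x)) ->
  jet D (fun x => expjet l (F x) (g x)).
Proof.
move=> hF hg x Dx.
suff h n : forall m, (m <= n)%N -> is_derive x 1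
    (fun y => expjet l (F y) (g y) m) (sder (expjet l (F x) (g x)) m).
  by move=> n; apply: (h n).
elim: n => [|n IH] m.
  rewrite leqn0 => /eqP ->.
  rewrite /sder expjetS /smul big_ord1 expjet0 divr1 mul1r.
  rewrite (_ : (fun y => _) = g); last by apply/funext => y; rewrite expjet0.
  by rewrite mulrA; apply: hg.
rewrite leq_eqVlt ltnS => /predU1P[->|]; last exact: IH.
rewrite (_ : (fun y => _) =
  (fun y => l / n.+1%:R * smul (F y) (expjet l (F y) (g y)) n)); last first.
  by apply/funext => y; rewrite expjetS.
rewrite /sder expjetS mulrA.
have -> : n.+2%:R * (l / n.+2%:R) * smul (F x) (expjet l (F x) (g x)) n.+1 =
   l / n.+1%:R * sder (smul (F x) (expjet l (F x) (g x))) n.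
  by rewrite /sder; field; rewrite nat1r -!natrD !pnatr_eq0.
apply: is_deriveZ'.
apply: (@is_derive_smul x F (fun y => expjet l (F y) (g y)) n) => i ni.
exact: (hF x Dx i).
Qed.

(* The Taylor coefficients of a solution of [- e1 g'' + e2 b g' + r g = f]. *)
Definition odejet (e1 e2 : R) (b r f : nat -> R) (g0 g1 : R) : nat -> R :=
  srec (fun h n => match n with
    | n'.+2 => (e1 * (n'.+1%:R * n'.+2%:R))^-1 *
        (e2 * (\sum_(i < n'.+1) b i * ((n' - i).+1%:R * h (n' - i).+1)) +
         \sum_(i < n'.+1) r i * h (n' - i)%N - f n')
    | 1%N => g1
    | 0%N => g0 end).

Lemma odejet0 e1 e2 b r f g0 g1 : odejet e1 e2 b r f g0 g1 0 = g0.
Proof. by rewrite /odejet srecE. Qed.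

Lemma odejet1 e1 e2 b r f g0 g1 : odejet e1 e2 b r f g0 g1 1 = g1.
Proof. by rewrite /odejet srecE. Qed.

Lemma odejetSS e1 e2 b r f g0 g1 n (u := odejet e1 e2 b r f g0 g1) :
  u n.+2 = (e1 * (n.+1%:R * n.+2%:R))^-1 *
    (e2 * smul b (sder u) n + smul r u n - f n).
Proof.
rewrite {1}/u {1}/odejet srecE// => F G FG; congr (_ * (_ * _ + _ - _)).
  by apply: eq_bigr => i _; rewrite FG// !ltnS leq_subr.
by apply: eq_bigr => i _; rewrite FG// ltnS (leq_trans (leq_subr _ _)).
Qed.

(** A solution is smooth although two derivatives are assumed: the equation defines the higher
    coefficients, and differentiating it shows that they are consistent. *)
Lemma jet_ode D e1 e2 (B Rr F : R -> nat -> R) (g dg : R -> R) : e1 != 0 ->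
  jet D B -> jet D Rr -> jet D F ->
  (forall x, D x -> is_derive x 1 g (dg x)) ->
  (forall x, D x -> is_derive x 1 dg
     (e1^-1 * (e2 * (B x 0%N * dg x) + Rr x 0%N * g x - F x 0%N))) ->
  jet D (fun x => odejet e1 e2 (B x) (Rr x) (F x) (g x) (dg x)).
Proof.
move=> e10 hB hR hF hg hdg x Dx.
pose u y := odejet e1 e2 (B y) (Rr y) (F y) (g y) (dg y).
have P0 : is_derive x 1 (fun y => u y 0%N) (sder (u x) 0).
  rewrite /sder /u odejet1 mul1r.
  rewrite (_ : (fun y => _) = g); last by apply/funext => y; rewrite odejet0.
  exact: hg.
have P1 : is_derive x 1 (fun y => u y 1%N) (sder (u x) 1).
  rewrite /sder /u odejetSS.
  rewrite (_ : (fun y => _) = dg); last by apply/funext => y; rewrite odejet1.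
  rewrite /smul !big_ord1 /sder !subnn odejet0 odejet1.
  apply: is_derive_eq; first exact: (hdg _ Dx).
  by field; rewrite e10.
suff h n : forall m, (m <= n.+1)%N ->
    is_derive x 1 (fun y => u y m) (sder (u x) m).
  by move=> n; apply: (h n).
elim: n => [|n IH] m.
  by rewrite leq_eqVlt ltnS leqn0 => /predU1P[->|/eqP ->].
rewrite leq_eqVlt ltnS => /predU1P[->|]; last exact: IH.
rewrite (_ : (fun y => _) = (fun y => (e1 * (n.+1%:R * n.+2%:R))^-1 *
    (e2 * smul (B y) (sder (u y)) n + smul (Rr y) (u y) n - F y n))); last first.
  by apply/funext => y; rewrite /u odejetSS.
have -> : sder (u x) n.+2 = (e1 * (n.+1%:R * n.+2%:R))^-1 *
    (e2 * sder (smul (B x) (sder (u x))) n + sder (smul (Rr x) (u x)) n -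
      sder (F x) n).
  rewrite /sder {1}/u odejetSS -/(u x); field.
  by rewrite nat1r -!natrD !pnatr_eq0 e10.
apply: is_deriveZ'; apply: is_deriveB'; last exact: hF.
apply: is_deriveD'.
  apply: is_deriveZ'; apply: (@is_derive_smul x B (fun y => sder (u y)) n) => i ni.
    exact: (hB x Dx i).
  by apply: is_deriveZ'; apply: IH.
apply: (@is_derive_smul x Rr u n) => i ni; first exact: (hR x Dx i).
by apply: IH; apply: leq_trans ni _.
Qed.

End Jets.

(** * Polynomial approximation of analytic functions *)

Section Approx.
Context {R : realType}.
Implicit Types (F G : R -> nat -> R) (a c x y : R) (p q : {poly R}).

Definition oo a c x : Prop := a < x < c.

Lemma is_derive_continuous x (f : R -> R) df : is_derive x 1 f df ->
  {for x, continuous f}.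
Proof.
move=> h; apply: differentiable_continuous; apply/derivable1_diffP.
exact: ex_derive.
Qed.

(** The bound [|x - z| <= |x - y|] on the intermediate point serves the Taylor remainder. *)
Lemma mvt_oo (f df : R -> R) a c x y : oo a c x -> oo a c y ->
  (forall z, oo a c z -> is_derive z 1 f (df z)) ->
  exists2 z, `|x - z| <= `|x - y| & oo a c z /\ f x - f y = df z * (x - y).
Proof.
move=> /andP[ax xc] /andP[ay yc] dfz.
have key s t : a < s -> s < t -> t < c ->
    exists2 z, z \in `]s, t[%R & f t - f s = df z * (t - s).
  move=> as_ st tc; apply: MVT => //.
    move=> z; rewrite in_itv /= => /andP[sz zt]; apply: dfz.
    by rewrite /oo (lt_trans as_ sz) (lt_trans zt tc).
  apply: continuous_in_subspaceT => z; rewrite inE /= in_itv /= => /andP[sz zt].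
  apply: is_derive_continuous (dfz z _).
  by rewrite /oo (lt_le_trans as_ sz) (le_lt_trans zt tc).
have [xy|yx|<-] := ltgtP x y; last first.
- exists x; first by rewrite !subrr.
  by split; [rewrite /oo ax xc|rewrite !subrr mulr0].
- have [z] := key _ _ ay yx xc; rewrite in_itv /= => /andP[yz zx] e.
  exists z; last by split; [rewrite /oo (lt_trans ay yz) (lt_trans zx xc)|].
  by rewrite !ger0_norm; lra.
- have [z] := key _ _ ax xy yc; rewrite in_itv /= => /andP[xz zy] e.
  exists z; last by split; [rewrite /oo (lt_trans ax xz) (lt_trans zy yc)|lra].
  by rewrite !ler0_norm; lra.
Qed.

Lemma mvt_le (f df : R -> R) a c x y (k : R) : oo a c x -> oo a c y ->
  (forall z, oo a c z -> is_derive z 1 f (df z)) ->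
  (forall z, oo a c z -> `|df z| <= k) -> `|f x - f y| <= k * `|x - y|.
Proof.
move=> hx hy hd hk; have [z _ [hz ->]] := mvt_oo hx hy hd.
by rewrite normrM ler_wpM2r// hk.
Qed.

(** The Taylor sum at [x] is differentiated with respect to its centre [z]. All terms cancel but
    [(m+1) F z (m+1) (x - z)^m], and the mean value theorem gives Cauchy's form of the remainder;
    its factor [m + 1] is harmless. *)
Lemma taylor_remainder F a c Q K m x y : 0 <= Q -> 0 <= K ->
  jet (oo a c) F -> (forall z n, oo a c z -> `|F z n| <= Q * K ^+ n) ->
  oo a c x -> oo a c y ->
  `|F x 0%N - \sum_(i < m.+1) F y i * (x - y) ^+ i| <=
  m.+1%:R * Q * (K * `|x - y|) ^+ m.+1.
Proof.
move=> Q0 K0 jF FK hx hy.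
pose Phi n z := \sum_(i < n.+1) F z i * (x - z) ^+ i.
have dPhi n z : oo a c z -> is_derive z 1 (Phi n) (n.+1%:R * F z n.+1 * (x - z) ^+ n).
  move=> hz; elim: n => [|n IH].
    rewrite (_ : Phi 0%N = fun w => F w 0%N); last first.
      by apply/funext => w; rewrite /Phi big_ord1 expr0 mulr1.
    by rewrite expr0 mulr1; exact: jF.
  rewrite (_ : Phi n.+1 = fun w => Phi n w + F w n.+1 * (x - w) ^+ n.+1); last first.
    by apply/funext => w; rewrite /Phi big_ord_recr.
  have h1 : is_derive z 1 (fun w => x - w) (0 - 1).
    exact: is_deriveB'.
  have h2 : is_derive z 1 (fun w => (x - w) ^+ n.+1) (- (n.+1%:R * (x - z) ^+ n)).
    rewrite (_ : (fun w => _) = (fun w => x - w) ^+ n.+1); last by rewrite exprfctE.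
    have := is_deriveX n.+1 h1 => h; apply: is_derive_eq.
    by rewrite /GRing.scale /=; ring.
  have := is_deriveD' IH (is_deriveM' (jF z hz n.+1) h2).
  by move=> h; apply: is_derive_eq; rewrite /sder; ring.
have -> : F x 0%N = Phi m x.
  rewrite /Phi big_ord_recl expr0 mulr1 big1 ?addr0// => i _.
  by rewrite subrr expr0n /= mulr0.
have [z zx [hz ->]] := mvt_oo hx hy (dPhi m).
rewrite !normrM normrX [X in _ <= X](_ : _ =
  m.+1%:R * (Q * K ^+ m.+1) * `|x - y| ^+ m * `|x - y|); last first.
  by rewrite exprMn (exprSr `|_|); ring.
rewrite ler_wpM2r// ler_pM ?mulr_ge0 ?exprn_ge0//.
  by rewrite ger0_norm// ler_wpM2l// FK.
by rewrite lerXn2r// nnegrE.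
Qed.

Lemma expR_le_quad (k : R) : `|k| <= 1 / 2 -> expR k <= 1 + k + 2 * k ^+ 2.
Proof.
rewrite ler_norml => /andP[k1 k2].
have := expR_ge1Dx (- k); rewrite expRN => h.
have k0 : 0 < 1 - k by lra.
have : expR k <= (1 - k)^-1.
  by rewrite -[expR k]invrK lef_pV2// ?posrE ?invr_gt0 ?expR_gt0.
move/le_trans; apply; rewrite -[leLHS]mul1r ler_pdivrMr//.
have : 0 <= k ^+ 2 * (1 - 2 * k) by rewrite mulr_ge0 ?sqr_ge0//; lra.
rewrite (_ : (1 + k + 2 * k ^+ 2) * (1 - k) = 1 + k ^+ 2 * (1 - 2 * k)); last by ring.
by lra.
Qed.

Definition bern (n k : nat) x : R := 'C(n, k)%:R * (x ^+ k * (1 - x) ^+ (n - k)).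

Lemma bern_ge0 n k x : 0 <= x <= 1 -> 0 <= bern n k x.
Proof.
move=> /andP[x0 x1]; rewrite mulr_ge0// mulr_ge0// exprn_ge0//; lra.
Qed.

Lemma bern_gen n x z : \sum_(k < n.+1) bern n k x * z ^+ k = (1 - x + x * z) ^+ n.
Proof.
rewrite exprDn; apply: eq_bigr => k _.
by rewrite /bern exprMn -mulr_natl; ring.
Qed.

(** The [bern n i x] are binomial probabilities. This is the sub-Gaussian bound of the centred
    moment generating function, the source of the tail estimate in [poly_approx]. *)
Lemma bern_mgf n x (k : R) : 0 <= x <= 1 -> `|k| <= 1 / 2 ->
  \sum_(i < n.+1) bern n i x * expR (k * (i%:R - n%:R * x)) <=
  expR (2 * k ^+ 2 * n%:R).
Proof.
move=> /andP[x0 x1] k2.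
have -> : \sum_(i < n.+1) bern n i x * expR (k * (i%:R - n%:R * x)) =
   ((1 - x + x * expR k) * expR (- (k * x))) ^+ n.
  rewrite exprMn -bern_gen mulr_suml; apply: eq_bigr => i _.
  rewrite -[RHS]mulrA; congr (bern n i x * _).
  rewrite -!expRM_natl -expRD; congr expR; ring.
rewrite [X in _ <= X](_ : _ = (expR (2 * k ^+ 2)) ^+ n); last first.
  by rewrite -expRM_natl; congr expR; ring.
have h0 : 0 <= (1 - x + x * expR k).
  by rewrite addr_ge0 ?mulr_ge0 ?expR_ge0//; lra.
apply: lerXn2r; rewrite ?nnegrE ?expR_ge0// ?mulr_ge0 ?expR_ge0//.
apply: (@le_trans _ _ (expR (k * x + 2 * k ^+ 2) * expR (- (k * x)))).
  rewrite ler_wpM2r ?expR_ge0//.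
  apply: (@le_trans _ _ (1 + (k * x + 2 * k ^+ 2))); last exact: expR_ge1Dx.
  have := expR_le_quad k2 => h.
  have : x * expR k <= x * (1 + k + 2 * k ^+ 2) by rewrite ler_wpM2l.
  have : x * (2 * k ^+ 2) <= 1 * (2 * k ^+ 2).
    by rewrite ler_wpM2r// mulr_ge0// sqr_ge0.
  by lra.
by rewrite -expRD le_eqVlt; apply/orP; left; apply/eqP; congr expR; ring.
Qed.

Lemma natr_le_expn2 m : m.+1%:R <= 2 ^+ m :> R.
Proof. by rewrite -natrX ler_nat ltn_expl. Qed.

(* Near its node, the Taylor polynomial of degree [m] is exponentially close;
   away from it, it grows at most like [(2 K)^m], which the Bernstein weights of
   degree [L m] compensate. *)
Theorem poly_approx K : 0 <= K -> exists2 sigma : R, 0 < sigma &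
  forall (Q : R) F, 0 <= Q -> jet (oo 0 1) F ->
    (forall x n, oo 0 1 x -> `|F x n| <= Q * K ^+ n) ->
  forall p : nat, exists2 q : {poly R}, (size q <= p)%N &
    forall x, oo 0 1 x -> `|F x 0%N - q.[x]| <= 10 * Q * expR (- sigma * p%:R).
Proof.
move=> K0; pose K' := K + 1; have K'1 : 1 <= K' by rewrite /K'; lra.
have K'0 : 0 < K' by lra.
(* Up to distance [tau] the Taylor polynomials are accurate; [s] is the rate of the Chernoff tail
   beyond [tau], and [L] makes [exp(- L s)] beat the growth [2 K']. *)
pose tau := (8 * K')^-1.
have tau0 : 0 < tau by rewrite invr_gt0 mulr_gt0.
have tauK : K' * tau = 1 / 8 by rewrite /tau; field; lra.
have tau18 : tau <= 1 / 8 by rewrite -tauK ler_peMl// ltW.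
pose s := tau ^+ 2 / 8.
have s0 : 0 < s by rewrite divr_gt0// exprn_gt0.
have [L hL] : exists L : nat, 2 * K' * expR (- (L%:R * s)) <= 1 / 2.
  have := @archi_boundP R ((4 * K') / s) _; set L := Num.bound _.
  move=> /(_ ltac:(by rewrite divr_ge0 ?mulr_ge0// ltW)); rewrite ltr_pdivrMr// => h.
  exists L; rewrite expRN ler_pdivrMr ?expR_gt0//.
  by have := expR_ge1Dx (L%:R * s); lra.
have ln2_gt0 : 0 < ln 2 :> R by rewrite ln_gt0// ltr1n.
pose sigma := ln 2 / L.+1%:R : R.
exists sigma; first by rewrite divr_gt0// ln2_gt0.
(* Weights of degree [L m] times Taylor polynomials of degree [m] have degree [(L + 1) m], which is
   at most [p - 1] by this choice. *)
move=> Q F Q0 jF FK p; pose m := (p.-1 %/ L.+1)%N.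
have hm : (2^-1 : R) ^+ m <= 2 * expR (- sigma * p%:R).
  have pm : p%:R <= (m.+1 * L.+1)%:R :> R.
    rewrite ler_nat; case: (p) @m => // p' /=; by rewrite ltn_ceil.
  have : 2^-1 ^+ m.+1 <= expR (- sigma * p%:R).
    rewrite -[2^-1]lnK ?posrE ?invr_gt0// -expRM_natl ler_expR lnV ?posrE//.
    rewrite mulrN mulNr lerN2 /sigma mulrAC ler_pdivrMr// mulrC mulrAC.
    by rewrite -natrM ler_wpM2r// ltW// ln2_gt0.
  by rewrite exprS => h; rewrite mulrC -ler_pdivrMr// mulrC.
suff [q qp hq] : exists2 q : {poly R}, (size q <= p)%N &
    forall x, oo 0 1 x -> `|F x 0%N - q.[x]| <= 5 * Q * 2^-1 ^+ m.
  exists q => // x hx; apply: le_trans (hq x hx) _.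
  have -> : 10 * Q * expR (- sigma * p%:R) = 5 * Q * (2 * expR (- sigma * p%:R)) by ring.
  by rewrite ler_wpM2l// mulr_ge0.
have [m0|m0] := posnP m.
  exists 0; first by rewrite size_poly0.
  move=> x hx; rewrite horner0 subr0 m0 expr0 mulr1.
  have := FK x 0%N hx; rewrite expr0 mulr1 => h.
  by apply: le_trans h _; rewrite ler_peMl//; lra.
have p0 : (m * L.+1 < p)%N.
  have p0 : (0 < p)%N by move: m0; rewrite /m; case: (p) => //; rewrite div0n.
  by rewrite -[X in (_ < X)%N](prednK p0) ltnS leq_trunc_div.
pose n := (L * m)%N.
have L0 : (0 < L)%N.
  case: (L) hL => // /=; rewrite mul0r oppr0 expR0; lra.
have n0 : (0 < n)%N by rewrite muln_gt0 L0.
have n0R : 0 < n%:R :> R by rewrite ltr0n.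
(* The equidistant points [k / n] are moved by at most [tau / 2] into the open interval, where [F]
   is controlled. *)
pose y (k : nat) : R := (1 - tau) * (k%:R / n%:R) + tau / 2.
have ykn k : (k <= n)%N -> 0 <= (k%:R / n%:R : R) <= 1.
  by move=> kn; rewrite divr_ge0//= ler_pdivrMr// mul1r ler_nat.
have yoo k : (k <= n)%N -> oo 0 1 (y k).
  move=> /ykn; set z := _ / _; rewrite /y -/z => /andP[z0 z1].
  have : 0 <= (1 - tau) * z by rewrite mulr_ge0//; lra.
  have : (1 - tau) * z <= (1 - tau) * 1 by rewrite ler_wpM2l//; lra.
  by move=> *; apply/andP; split; lra.
have ynear k : (k <= n)%N -> `|y k - k%:R / n%:R| <= tau / 2.
  move=> /ykn; set z := _ / _; rewrite /y -/z => /andP[z0 z1].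
  rewrite (_ : _ - z = tau * (1 / 2 - z)); last by ring.
  rewrite normrM gtr0_norm// ler_wpM2l ?(ltW tau0)// ler_norml.
  by apply/andP; split; lra.
pose T (k : nat) := \sum_(i < m.+1) F (y k) i *: ('X - (y k)%:P) ^+ i.
pose q := \sum_(k < n.+1) ('C(n, k)%:R *: ('X ^+ k * (1 - 'X) ^+ (n - k))) * T k.
exists q.
  apply: leq_trans p0; apply: (leq_trans (size_sum _ _ _)); apply/bigmax_leqP => k _.
  apply: leq_trans (size_polyMleq _ _) _.
  have h1 : (size ('C(n, k)%:R *: ('X ^+ k * (1 - 'X : {poly R}) ^+ (n - k))) <= n.+1)%N.
    apply: leq_trans (size_scale_leq _ _) _.
    apply: leq_trans (size_polyMleq _ _) _.
    have h : (size ((1 - 'X : {poly R}) ^+ (n - k)) <= (n - k).+1)%N.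
      apply: leq_trans (size_poly_exp_leq _ _) _.
      by rewrite -opprB size_polyN -polyC1 size_XsubC mul1n.
    rewrite size_polyXn addSn /=; apply: leq_trans (leq_add (leqnn k) h) _.
    by rewrite addnS subnKC// -ltnS.
  have h2 : (size (T k) <= m.+1)%N.
    apply: (leq_trans (size_sum _ _ _)); apply/bigmax_leqP => i _.
    by apply: leq_trans (size_scale_leq _ _) _; rewrite size_exp_XsubC.
  rewrite -subn1 leq_subLR add1n; apply: leq_trans (leq_add h1 h2) _.
  by rewrite addSn addnS mulnS mulnC -/n addnC.
move=> x hx; have [x0 x1] := andP hx.
have x01 : 0 <= x <= 1 by rewrite !ltW.
(* [lam] minimizes [2 lam^2 - lam tau], with minimum [- tau^2 / 8 = - s]. The weight [wt k] is at
   least 1 if [k / n] is farther than [tau] from [x], so it replaces the indicator of the far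
   points. *)
pose lam := tau / 4.
pose wt (k : nat) := expR (- lam * n%:R * tau) *
   (expR (lam * (k%:R - n%:R * x)) + expR (- lam * (k%:R - n%:R * x))).
have TE k : (T k).[x] = \sum_(i < m.+1) F (y k) i * (x - y k) ^+ i.
  by rewrite /T horner_sum; apply: eq_bigr => i _; rewrite hornerZ horner_exp !hornerE.
have qE : F x 0%N - q.[x] = \sum_(k < n.+1) bern n k x * (F x 0%N - (T k).[x]).
  have h1 : \sum_(k < n.+1) bern n k x = 1.
    have := bern_gen n x 1; rewrite mulr1 subrK expr1n => <-.
    by apply: eq_bigr => k _; rewrite expr1n mulr1.
  rewrite -[F x 0%N in LHS]mul1r -h1 mulr_suml /q horner_sum -sumrB.
  apply: eq_bigr => k _; rewrite mulrBr; congr (_ - _).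
  by rewrite hornerM hornerZ hornerM hornerXn horner_exp hornerD hornerN hornerX hornerC.
have errk (k : 'I_n.+1) : `|F x 0%N - (T k).[x]| <=
    Q * 2^-1 ^+ m + 2 * Q * (2 * K') ^+ m * wt k.
  have kn : (k <= n)%N by rewrite -ltnS.
  have wt0 : 0 <= wt k by rewrite mulr_ge0 ?addr_ge0 ?expR_ge0.
  have KK0 : 0 <= 2 * Q * (2 * K') ^+ m by rewrite !mulr_ge0 ?exprn_ge0// mulr_ge0// ltW.
  have [near|far] := leP `|k%:R - n%:R * x| (n%:R * tau).
    rewrite TE; apply: le_trans (taylor_remainder m Q0 K0 jF FK hx (yoo k kn)) _.
    apply: (@le_trans _ _ (Q * 2^-1 ^+ m)); last by rewrite lerDl mulr_ge0.
    have dxy : `|x - y k| <= 3 / 2 * tau.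
      have h1 := ynear k kn.
      have h2 : `|k%:R / n%:R - x| <= tau.
        rewrite (_ : k%:R / n%:R - x = (k%:R - n%:R * x) / n%:R); last first.
          by field; rewrite gt_eqF.
        by rewrite normrM normfV (gtr0_norm n0R) ler_pdivrMr// [tau * _]mulrC.
      move: h1 h2; rewrite !ler_norml => /andP[? ?] /andP[? ?].
      by apply/andP; split; lra.
    have KK' : K <= K' by rewrite /K'; lra.
    have Kd : K * `|x - y k| <= 4^-1.
      apply: (@le_trans _ _ (K' * (3 / 2 * tau))); first exact: ler_pM.
      by have := tauK; lra.
    apply: (@le_trans _ _ (m.+1%:R * Q * 4^-1 ^+ m.+1)).
      by rewrite ler_wpM2l ?mulr_ge0// lerXn2r// nnegrE ?mulr_ge0.
    rewrite -mulrA mulrCA ler_wpM2l//.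
    rewrite (_ : 4^-1 = 2^-1 * 2^-1 :> R); last by field.
    rewrite exprMn exprS mulrA -[leRHS]mul1r.
    rewrite [leLHS](_ : _ = (m.+1%:R * 2^-1 ^+ m) * 2^-1 * 2^-1 * 2^-1 ^+ m); last by ring.
    rewrite ler_wpM2r ?exprn_ge0 ?invr_ge0//.
    have : m.+1%:R * 2^-1 ^+ m <= 1 :> R.
      by rewrite exprVn ler_pdivrMr ?exprn_gt0// mul1r natr_le_expn2.
    by lra.
  have wt1 : 1 <= wt k.
    have e1 : wt k = expR (lam * (k%:R - n%:R * x - n%:R * tau)) +
                     expR (lam * (- (k%:R - n%:R * x) - n%:R * tau)).
      by rewrite /wt mulrDr -!expRD; congr (expR _ + expR _); ring.
    have lam0 : 0 < lam by rewrite divr_gt0.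
    have ge1 z : 0 <= z -> 1 <= expR z.
      by move=> z0; have := expR_ge1Dx z; lra.
    rewrite e1; move: far; rewrite ltr_normr => /orP[] h.
      rewrite ler_wpDr ?expR_ge0//; apply: ge1.
      by rewrite mulr_ge0 ?(ltW lam0)// subr_ge0 ltW.
    rewrite ler_wpDl ?expR_ge0//; apply: ge1.
    by rewrite mulr_ge0 ?(ltW lam0)// subr_ge0 ltW.
  apply: (@le_trans _ _ (2 * Q * (2 * K') ^+ m)); last first.
    apply: (@le_trans _ _ (2 * Q * (2 * K') ^+ m * wt k)).
      by rewrite ler_peMr.
    by rewrite lerDr mulr_ge0// exprn_ge0// invr_ge0.
  apply: le_trans (ler_normB _ _) _.
  have F0 := FK x 0%N hx; rewrite expr0 mulr1 in F0.
  have KK' : K <= K' by rewrite /K'; lra.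
  have hT : `|(T k).[x]| <= m.+1%:R * (Q * K' ^+ m).
    rewrite TE; apply: le_trans (ler_norm_sum _ _ _) _.
    apply: (@le_trans _ _ (\sum_(i < m.+1) Q * K' ^+ m)); last first.
      by rewrite sumr_const card_ord [leRHS]mulr_natl.
    apply: ler_sum => i _; rewrite normrM normrX.
    have dxy : `|x - y k| <= 1.
      have /andP[? ?] := yoo k kn.
      by rewrite ler_norml; apply/andP; split; lra.
    rewrite -[leRHS]mulr1 ler_pM ?exprn_ge0//; last first.
      by rewrite exprn_ile1.
    apply: le_trans (FK _ _ (yoo k kn)) _; rewrite ler_wpM2l//.
    apply: (@le_trans _ _ (K' ^+ i)); first by rewrite lerXn2r// nnegrE// ltW.
    by rewrite ler_weXn2l// -ltnS.
  apply: le_trans (lerD F0 hT) _.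
  have K'm : 1 <= K' ^+ m by rewrite exprn_ege1.
  rewrite [2 * K' in leRHS]mulrC exprMn.
  have h2 : 2 * 2 ^+ m >= m.+1%:R + 1 :> R.
    by rewrite -exprS natr1; apply: (natr_le_expn2 m.+1).
  have h3 : Q <= Q * K' ^+ m by rewrite ler_peMr.
  apply: (@le_trans _ _ ((m.+1%:R + 1) * (Q * K' ^+ m))); first by rewrite mulrDl mul1r addrC lerD2l.
  rewrite [leRHS](_ : _ = 2 * 2 ^+ m * (Q * K' ^+ m)); last by ring.
  by rewrite ler_wpM2r// mulr_ge0// exprn_ge0// ltW.
rewrite qE; apply: le_trans (ler_norm_sum _ _ _) _.
apply: (@le_trans _ _ (\sum_(k < n.+1) bern n k x *
   (Q * 2^-1 ^+ m + 2 * Q * (2 * K') ^+ m * wt k))).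
  apply: ler_sum => k _; rewrite normrM ger0_norm ?bern_ge0//.
  by rewrite ler_wpM2l ?bern_ge0.
have bern1 : \sum_(k < n.+1) bern n k x = 1.
  have := bern_gen n x 1; rewrite mulr1 subrK expr1n => <-.
  by apply: eq_bigr => k _; rewrite expr1n mulr1.
have swt : \sum_(k < n.+1) bern n k x * wt k <= 2 * expR (- (L%:R * s)) ^+ m.
  have lam2 : `|lam| <= 1 / 2 by rewrite ger0_norm /lam; lra.
  have lam2' : `|- lam| <= 1 / 2 by rewrite normrN.
  have m1 := bern_mgf n x01 lam2; have m2 := bern_mgf n x01 lam2'.
  rewrite sqrrN in m2.
  rewrite (_ : \sum_(k < n.+1) _ = expR (- lam * n%:R * tau) *
     (\sum_(i < n.+1) bern n i x * expR (lam * (i%:R - n%:R * x)) +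
      \sum_(i < n.+1) bern n i x * expR (- lam * (i%:R - n%:R * x)))); last first.
    rewrite -big_split mulr_sumr; apply: eq_bigr => k _ /=.
    by rewrite /wt; ring.
  apply: (@le_trans _ _ (expR (- lam * n%:R * tau) *
     (expR (2 * lam ^+ 2 * n%:R) + expR (2 * lam ^+ 2 * n%:R)))).
    by rewrite ler_wpM2l ?expR_ge0// lerD.
  rewrite -mulr2n -[_ *+ 2]mulr_natl mulrCA ler_wpM2l// -expRD -expRM_natl.
  rewrite le_eqVlt; apply/orP; left; apply/eqP; congr expR.
  by rewrite /lam /s /n natrM; field.
rewrite (_ : \sum_(k < n.+1) _ = Q * 2^-1 ^+ m * (\sum_(k < n.+1) bern n k x) +
   2 * Q * (2 * K') ^+ m * \sum_(k < n.+1) bern n k x * wt k); last first.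
  rewrite !mulr_sumr -big_split; apply: eq_bigr => k _ /=; ring.
rewrite bern1 mulr1.
have KK0 : 0 <= 2 * Q * (2 * K') ^+ m by rewrite !mulr_ge0 ?exprn_ge0// mulr_ge0// ltW.
have h1 := ler_wpM2l KK0 swt.
have h2 : (2 * K' * expR (- (L%:R * s))) ^+ m <= 2^-1 ^+ m.
  rewrite lerXn2r ?nnegrE ?mulr_ge0 ?expR_ge0 ?invr_ge0 ?(ltW K'0)//.
  by apply: le_trans hL _; rewrite div1r.
rewrite exprMn in h2.
have h3 := ler_wpM2l (mulr_ge0 (ler0n R 4) Q0) h2.
by lra.
Qed.

End Approx.

(** * Approximation together with two derivatives, on any interval *)

Section C2Approx.
Context {R : realType}.
Implicit Types (F G : R -> nat -> R) (a c x y : R) (q : {poly R}).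

(** By an affine change of variable only the products [|F x n| (c - a)^n] matter. The rate does not
    depend on the interval, so it holds on elements of layer size. *)
Lemma poly_approx_itv K : 0 <= K -> exists2 sigma : R, 0 < sigma &
  forall (Q : R) F a c, 0 <= Q -> a < c -> jet (oo a c) F ->
    (forall x n, oo a c x -> `|F x n| * (c - a) ^+ n <= Q * K ^+ n) ->
  forall p : nat, exists2 q : {poly R}, (size q <= p)%N &
    forall x, oo a c x -> `|F x 0%N - q.[x]| <= 10 * Q * expR (- sigma * p%:R).
Proof.
move=> K0; have [sigma s0 H] := poly_approx K0.
exists sigma => // Q F a c Q0 ac jF FK p.
pose h := c - a; have h0 : 0 < h by rewrite subr_gt0.
pose G (s : R) n := h ^+ n * F (a + h * s) n.
have sub s : oo 0 1 s -> oo a c (a + h * s).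
  move=> /andP[s0' s1]; have h1 : 0 < h * s by rewrite mulr_gt0.
  have h2 : 0 < h * (1 - s) by rewrite mulr_gt0// subr_gt0.
  by rewrite /h in h1 h2 *; apply/andP; split; lra.
have jG : jet (oo 0 1) G.
  move=> s hs n; rewrite /sder /G.
  have d1 : is_derive s 1 (fun s => a + h * s) (0 + h * 1).
    by apply: is_deriveD'; apply: is_deriveZ'.
  have := @is_derive1_comp _ (fun y => F y n) (fun s => a + h * s) s _ _ (jF _ (sub _ hs) n) d1.
  move=> /(is_deriveZ' (h ^+ n)) d2.
  by apply: is_derive_eq; rewrite /sder exprS; ring.
have GK s n : oo 0 1 s -> `|G s n| <= Q * K ^+ n.
  move=> hs; rewrite /G normrM ger0_norm ?exprn_ge0 ?(ltW h0)// mulrC.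
  exact: FK (sub _ hs).
have [q qp hq] := H Q G Q0 jG GK p.
exists (q \Po (h^-1 *: ('X - a%:P))).
  have [->|q0] := eqVneq q 0; first by rewrite comp_poly0 size_poly0.
  apply: leq_trans (size_comp_poly_leq _ _) _.
  have -> : (size (h^-1 *: ('X - a%:P))).-1 = 1%N.
    by rewrite size_scale ?size_XsubC// invr_eq0 gt_eqF.
  by rewrite muln1 prednK// size_poly_gt0.
move=> x /andP[ax xc].
rewrite horner_comp hornerZ hornerXsubC.
have hs : oo 0 1 (h^-1 * (x - a)).
  rewrite /oo mulrC divr_gt0 ?subr_gt0//= ltr_pdivrMr// mul1r /h.
  by rewrite ltrD2r.
have := hq _ hs; rewrite /G expr0 mul1r mulVKf ?gt_eqF//.
by rewrite subrKC.
Qed.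

Lemma poly_antideriv q : exists2 p : {poly R}, p^`() = q & (size p <= (size q).+1)%N.
Proof.
exists (\poly_(i < (size q).+1) (q`_i.-1 / i%:R)); last exact: size_poly.
apply/polyP => i; rewrite coef_deriv coef_poly ltnS /=.
case: ltnP => iq; last by rewrite mul0rn nth_default.
by rewrite -[LHS]mulr_natr divfK// pnatr_eq0.
Qed.

Lemma sqr_weight n : n.+1%:R * n.+2%:R <= 2 * 4 ^+ n :> R.
Proof.
rewrite (_ : 2 * 4 ^+ n = 2 ^+ n * 2 ^+ n.+1 :> R); last first.
  by rewrite (_ : 4 = 2 * 2 :> R) ?exprMn ?exprS; ring.
have h1 := @natr_le_expn2 R n; have h2 := @natr_le_expn2 R n.+1.
by rewrite ler_pM.
Qed.

(** The second derivative is approximated and integrated twice; an affine correction then attains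
    the end values [A0] and [A1]. These may differ by [tau] from those of [F], so that neighbouring
    pieces can be matched exactly. Derivatives are measured on the scale [c - a]. *)
Lemma poly_approx_C2 K : 0 <= K -> exists sigma C : R, [/\ 0 < sigma, 0 < C &
  forall (Q tau : R) F a c (A0 A1 : R), 0 <= Q -> 0 <= tau -> a < c ->
    jet (oo a c) F -> {within `[a, c], continuous (fun x => F x 0%N)} ->
    (forall x n, oo a c x -> `|F x n| * (c - a) ^+ n <= Q * K ^+ n) ->
    `|A0 - F a 0%N| <= tau -> `|A1 - F c 0%N| <= tau ->
  forall p : nat, (0 < p)%N -> exists P : {poly R},
    [/\ (size P <= p.+1)%N, P.[a] = A0, P.[c] = A1 &
    forall x, oo a c x -> let e := C * Q * expR (- sigma * p%:R) + 3 * tau in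
      [/\ `|F x 0%N - P.[x]| <= e, `|F x 1%N - P^`().[x]| * (c - a) <= e &
          `|2 * F x 2%N - P^`()^`().[x]| * (c - a) ^+ 2 <= e]]].
Proof.
move=> K0; have [|sigma s0 H] := @poly_approx_itv (4 * K); first by rewrite mulr_ge0.
(* The factor [exp sigma] pays for the size [p - 1] of the polynomial that approximates the second
   derivative. *)
exists sigma, (20 * K ^+ 2 * expR sigma + 1); split => //.
  by rewrite ltr_wpDl// !mulr_ge0 ?expR_ge0// exprn_ge0.
move=> Q tau F a c A0 A1 Q0 tau0 ac jF cF FK hA0 hA1 p p0.
pose h := c - a; have h0 : 0 < h by rewrite subr_gt0.
have jF2 := jet_der (jet_der jF).
(* The coefficients of the second derivative carry the factor [(n+1) (n+2) <= 2 4^n], hence [4 K] in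
   place of [K]. *)
pose Q2 := 2 * Q * K ^+ 2 / h ^+ 2.
have Q20 : 0 <= Q2 by rewrite divr_ge0 ?exprn_ge0 ?mulr_ge0 ?(ltW h0)// exprn_ge0.
have F2K x n : oo a c x -> `|sder (sder (F x)) n| * (c - a) ^+ n <= Q2 * (4 * K) ^+ n.
  move=> hx; rewrite /sder !normrM !normr_nat.
  have := FK x n.+2 hx; rewrite -/h !exprS => hF.
  rewrite -(ler_pM2l (exprn_gt0 2 h0)).
  have -> : h ^+ 2 * (n.+1%:R * (n.+2%:R * `|F x n.+2|) * h ^+ n) =
    (n.+1%:R * n.+2%:R) * (`|F x n.+2| * (h * (h * h ^+ n))) by ring.
  have -> : h ^+ 2 * (Q2 * (4 * K) ^+ n) = (2 * 4 ^+ n) * (Q * (K * (K * K ^+ n))).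
    by rewrite /Q2 exprMn; field; rewrite gt_eqF.
  apply: ler_pM => //; first by rewrite !mulr_ge0// ?exprn_ge0 ?(ltW h0).
  exact: sqr_weight.
have [q2 q2p hq2] := H Q2 _ a c Q20 ac jF2 F2K p.-1.
have [q1 dq1 q1p] := poly_antideriv q2.
have [q0 dq0 q0p] := poly_antideriv q1.
pose l1 := ((A1 - q0.[c]) - (A0 - q0.[a])) / h.
pose l : {poly R} := (A0 - q0.[a])%:P + l1 *: ('X - a%:P).
pose P := q0 + l.
have dl : l^`() = l1%:P.
  by rewrite /l derivD derivC derivZ derivXsubC add0r alg_polyC.
have dP : P^`() = q1 + l1%:P by rewrite derivD dq0 dl.
have ddP : P^`()^`() = q2 by rewrite dP derivD dq1 derivC addr0.
have Pa : P.[a] = A0.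
  by rewrite /P /l !hornerD hornerC hornerZ hornerXsubC; ring.
have Pc : P.[c] = A1.
  by rewrite /P /l !hornerD hornerC hornerZ hornerXsubC /l1 -/h divfK ?gt_eqF//; ring.
have sizeP : (size P <= p.+1)%N.
  apply: leq_trans (size_polyD _ _) _; rewrite geq_max; apply/andP; split.
    apply: leq_trans q0p _; rewrite ltnS; apply: leq_trans q1p _.
    by rewrite -(prednK p0) ltnS.
  apply: leq_trans (size_polyD _ _) _; rewrite geq_max; apply/andP; split.
    by apply: leq_trans (size_polyC_leq1 _) _.
  by apply: leq_trans (size_scale_leq _ _) _; rewrite size_XsubC ltnS.
pose d := 10 * Q2 * expR (- sigma * p.-1%:R).
have d0 : 0 <= d.
  by rewrite /d; apply: mulr_ge0; [apply: mulr_ge0|exact: expR_ge0].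
pose y x := F x 0%N - P.[x].
pose y1 x := F x 1%N - P^`().[x].
have dy x : oo a c x -> is_derive x 1 y (y1 x).
  move=> hx; have dF := jF x hx 0%N; rewrite /sder mul1r in dF.
  by apply: is_deriveB' => //; exact: is_derive_horner.
have dy1 x : oo a c x -> is_derive x 1 y1 (2 * F x 2%N - q2.[x]).
  move=> hx; have dF := jF x hx 1%N; rewrite /sder in dF.
  by rewrite -ddP; apply: is_deriveB' => //; exact: is_derive_horner.
have y2d x : oo a c x -> `|2 * F x 2%N - q2.[x]| <= d.
  by move=> hx; have := hq2 x hx; rewrite /sder mul1r.
have cy : {within `[a, c], continuous y}.
  move=> x; apply: continuousB; first exact: cF.
  exact/continuous_subspaceT/horner_continuous.
(* Here the derivative of the error [y] is a difference quotient of end values, hence at most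
   [2 tau / h]; the bound on its second derivative carries this to the whole interval. *)
have [z zac ez] : exists2 z, z \in `]a, c[%R & y c - y a = y1 z * (c - a).
  by apply: MVT => // x; rewrite in_itv /=; exact: dy.
have hz : oo a c z by move: zac; rewrite in_itv.
have ya : `|y a| <= tau by rewrite /y Pa distrC.
have yc : `|y c| <= tau by rewrite /y Pc distrC.
have y1z : `|y1 z| * h <= 2 * tau.
  rewrite -(gtr0_norm h0) -normrM -ez; apply: le_trans (ler_normB _ _) _; lra.
have y1x x : oo a c x -> `|y1 x| * h <= 2 * tau + d * h ^+ 2.
  move=> hx.
  have h1 := mvt_le hx hz dy1 y2d.
  have h2 : `|x - z| <= h.
    move: hx hz => /andP[? ?] /andP[? ?]; rewrite ler_norml /h.
    by apply/andP; split; lra.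
  have h3 : `|y1 x| <= `|y1 z| + d * h.
    rewrite -[y1 x](subrK (y1 z)) addrC; apply: le_trans (ler_normD _ _) _.
    by rewrite lerD2l; apply: le_trans h1 _; rewrite ler_wpM2l.
  have := ler_wpM2r (ltW h0) h3; rewrite mulrDl expr2 mulrA; lra.
have yx x : oo a c x -> `|y x| <= 3 * tau + d * h ^+ 2.
  move=> hx; have /andP[ax xc] := hx.
  have [w wax ew] : exists2 w, w \in `]a, x[%R & y x - y a = y1 w * (x - a).
    apply: MVT => //.
      move=> v; rewrite in_itv /= => /andP[av vx]; apply: dy.
      by rewrite /oo av (lt_trans vx).
    apply: continuous_subspaceW cy => v /=; rewrite !in_itv /= => /andP[-> vx] /=.
    exact: le_trans vx (ltW xc).
  have hw : oo a c w by move: wax; rewrite in_itv /= => /andP[aw wx]; rewrite /oo aw (lt_trans wx).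
  have h1 : `|y1 w * (x - a)| <= `|y1 w| * h.
    by rewrite normrM ler_wpM2l// gtr0_norm ?subr_gt0// /h lerD2r ltW.
  have h2 := y1x w hw.
  rewrite -[y x](subrK (y a)) ew; apply: le_trans (ler_normD _ _) _; lra.
have dE : d * h ^+ 2 = 20 * K ^+ 2 * expR sigma * Q * expR (- sigma * p%:R).
  rewrite /d /Q2 -(prednK p0) -[p.-1.+1%:R]natr1 mulrDr expRD mulr1 [expR (- sigma)]expRN.
  by rewrite prednK//; field; rewrite ?expR_eq0 gt_eqF ?expR_gt0//= gt_eqF.
have dle : d * h ^+ 2 <= (20 * K ^+ 2 * expR sigma + 1) * Q * expR (- sigma * p%:R).
  by rewrite dE ler_wpM2r ?expR_ge0// ler_wpM2r// lerDl.
exists P; split => // x hx /=; split.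
- by apply: le_trans (yx x hx) _; lra.
- by apply: le_trans (y1x x hx) _; lra.
- rewrite ddP; apply: (@le_trans _ _ (d * h ^+ 2)); last by lra.
  by rewrite ler_wpM2r ?exprn_ge0 ?(ltW h0)// y2d.
Qed.

End C2Approx.

(** * Maximum principle *)

Section MaxPrinciple.
Context {R : realType}.
Implicit Types (v dv ddv : R -> R) (x : R).

Lemma mvt_cc (f df : R -> R) (a c : R) : a < c ->
  (forall z, a <= z <= c -> is_derive z 1 f (df z)) ->
  exists2 z, a <= z <= c & f c - f a = df z * (c - a).
Proof.
move=> ac hd; have [||z] := @MVT _ f df a c ac.
- by move=> z; rewrite in_itv /= => /andP[? ?]; apply: hd; rewrite !ltW.
- apply: continuous_in_subspaceT => z; rewrite inE /= in_itv /= => hz.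
  exact: is_derive_continuous (hd z hz).
by rewrite in_itv /= => /andP[? ?] e; exists z; rewrite ?ltW.
Qed.

Lemma mvt_le_cc (f df : R -> R) (a c k x y : R) : a <= x <= c -> a <= y <= c ->
  (forall z, a <= z <= c -> is_derive z 1 f (df z)) ->
  (forall z, a <= z <= c -> `|df z| <= k) -> `|f x - f y| <= k * (c - a).
Proof.
move=> hx hy hd hk; have k0 : 0 <= k by apply: le_trans (hk x hx).
have key s t : a <= s -> s < t -> t <= c -> `|f t - f s| <= k * (c - a).
  move=> as_ st tc.
  have sub z : s <= z <= t -> a <= z <= c.
    by move=> /andP[? ?]; apply/andP; split; lra.
  have [z hz ->] := mvt_cc st (fun z hz => hd z (sub z hz)).
  rewrite normrM ler_pM ?hk//; first exact: sub.
  by rewrite gtr0_norm; lra.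
move: hx hy => /andP[? ?] /andP[? ?].
have [xy|yx|->] := ltgtP x y; first by rewrite distrC; apply: key.
  exact: key.
by rewrite subrr normr0 mulr_ge0//; lra.
Qed.

(** With a negative second derivative at the minimum, [v'] would be negative just to the right of it
    and [v] would drop below its minimum. *)
Lemma min_second_derivative v dv (d2 : R) x :
  oo 0 1 x -> (forall y, oo 0 1 y -> is_derive y 1 v (dv y)) ->
  is_derive x 1 dv d2 -> (forall y, oo 0 1 y -> v x <= v y) ->
  dv x = 0 /\ 0 <= d2.
Proof.
move=> hx hv hdv vmin.
have dv0 : dv x = 0.
  have h : is_derive x 1 v 0.
    apply: (@derive1_at_min _ v 0 1) => //.
    - by move=> y; rewrite in_itv /= => hy; have := hv y hy => ?; exact: ex_derive.
  by have h' := hv x hx; rewrite -(@derive_val _ _ _ _ _ _ _ h') (@derive_val _ _ _ _ _ _ _ h).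
split => //; rewrite leNgt; apply/negP => d20.
have h : (fun h => h^-1 *: (dv (h + x) - dv x)) @ 0^' --> d2.
  have := @ex_derive _ _ _ _ _ _ _ hdv; rewrite /derivable => /cvg_ex[l hl].
  have -> : d2 = l.
    rewrite -(@derive_val _ _ _ _ _ _ _ hdv); apply/cvg_lim => //.
  rewrite (_ : (fun h => _) = (fun h => h^-1 *: ((dv \o shift x) (h *: 1) - dv x))) //.
  by apply/funext => h /=; rewrite [h *: 1]mulr1.
have near0 : \forall h \near 0^', h^-1 *: (dv (h + x) - dv x) < 0.
  apply: (cvgr_lt _ h) => //.
move: near0 => -[e /= e0 he].
have /andP[x0 x1] := hx.
pose k := Num.min (e / 2) ((1 - x) / 2).
have k0 : 0 < k by rewrite lt_min !divr_gt0// subr_gt0.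
have ke : k < e by rewrite /k; apply: (@le_lt_trans _ _ (e / 2)); [rewrite ge_min lexx|lra].
have kx : k < 1 - x by rewrite /k; apply: (@le_lt_trans _ _ ((1 - x) / 2)); [rewrite ge_min lexx orbT|lra].
have hk : oo 0 1 (x + k) by apply/andP; split; lra.
have [z zx ez] : exists2 z, z \in `]x, x + k[%R & v (x + k) - v x = dv z * (x + k - x).
  apply: MVT; first lra.
    move=> y; rewrite in_itv /= => /andP[? ?]; apply: hv; apply/andP; split; lra.
  apply: continuous_in_subspaceT => y; rewrite inE /= in_itv /= => /andP[? ?].
  apply: is_derive_continuous (hv y _); apply/andP; split; lra.
move: zx; rewrite in_itv /= => /andP[xz zk].
have := he (z - x); rewrite /= sub0r normrN gtr0_norm ?subr_gt0//.
move=> /(_ ltac:(lra)); rewrite subr_eq0 gt_eqF// => /(_ isT).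
rewrite subrK dv0 subr0 /GRing.scale /= pmulr_rlt0 ?invr_gt0 ?subr_gt0// => dvz.
have := vmin _ hk; rewrite -subr_ge0 ez => hh.
have : dv z * (x + k - x) < 0 by rewrite nmulr_rlt0//; lra.
by rewrite ltNge hh.
Qed.

Lemma max_principle (e1 e2 : R) (b r v dv ddv : R -> R) : 0 < e1 ->
  {within `[0, 1], continuous v} ->
  (forall x, oo 0 1 x -> is_derive x 1 v (dv x)) ->
  (forall x, oo 0 1 x -> is_derive x 1 dv (ddv x)) ->
  (forall x, oo 0 1 x -> 0 < r x) ->
  (forall x, oo 0 1 x -> 0 <= - e1 * ddv x + e2 * b x * dv x + r x * v x) ->
  0 <= v 0 -> 0 <= v 1 -> forall x, x \in `[0, 1] -> 0 <= v x.
Proof.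
move=> e10 cv hv hdv r0 Lv v0 v1.
have [c c01 hc] := EVT_min (@ler01 R) cv.
suff vc : 0 <= v c by move=> x x01; apply: le_trans vc (hc x x01).
rewrite leNgt; apply/negP => vc.
have hoo : oo 0 1 c.
  move: c01; rewrite in_itv /= => /andP[c0 c1]; apply/andP; split.
    by rewrite lt_def c0 andbT; apply/eqP => c00; move: vc; rewrite c00 ltNge v0.
  by rewrite lt_def c1 andbT; apply/eqP => c00; move: vc; rewrite -c00 ltNge v1.
have [d0 d2] := min_second_derivative hoo hv (hdv c hoo) (fun y hy =>
   hc y (ltac:(by move: hy => /andP[? ?]; rewrite in_itv /= !ltW))).
have := Lv c hoo; rewrite d0 mulr0 addr0 => h.
have h1 : 0 <= e1 * ddv c by rewrite mulr_ge0// ltW.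
have h2 : r c * v c < 0 by rewrite pmulr_rlt0 ?r0.
by move: h; rewrite mulNr; lra.
Qed.

(** On a window of length [e1 / e2] the mean value theorem gives a point with [|e1 u'| <= 2 e2 B].
    From there [H = e1 u' - e2 b u] is transported: by the equation its derivative contains no [u'],
    so it changes by at most a bounded multiple of the length, which is at most [e2]. *)
Lemma derivative_estimate (e1 e2 C0 C1 B rho s : R) (b db r u du ddu g : R -> R) :
  0 < e1 -> 0 < e2 -> e2 <= 1 -> e1 <= e2 ^+ 2 -> 0 < s -> s + e1 / e2 < 1 ->
  (forall x, oo 0 1 x -> is_derive x 1 b (db x)) ->
  (forall x, oo 0 1 x -> is_derive x 1 u (du x)) ->
  (forall x, oo 0 1 x -> is_derive x 1 du (ddu x)) ->
  (forall x, oo 0 1 x -> - e1 * ddu x + e2 * b x * du x + r x * u x = g x) ->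
  (forall x, oo 0 1 x -> [/\ `|b x| <= C0, `|db x| <= C1 & `|r x| <= C0]) ->
  (forall x, s <= x <= s + e1 / e2 -> `|u x| <= B /\ `|g x| <= rho) ->
  forall x, s <= x <= s + e1 / e2 ->
  `|e1 * du x| <= e2 * ((2 + 3 * C0 + C1) * B + rho).
Proof.
move=> e10 e20 e21 e12 s0 s1 hb hu hdu Lu hC hB x hx.
set e := e1 / e2 in s1 hB hx *.
have ep : 0 < e by rewrite divr_gt0.
have ee2 : e <= e2 by rewrite ler_pdivrMr// -expr2.
have sub y : s <= y <= s + e -> oo 0 1 y.
  by move=> /andP[? ?]; apply/andP; split; lra.
have hs : s <= s <= s + e by apply/andP; split; lra.
have hse : s <= s + e <= s + e by apply/andP; split; lra.
have [y hy ey] := mvt_cc (ltac:(lra) : s < s + e) (fun z hz => hu z (sub z hz)).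
have e1y : `|e1 * du y| <= 2 * e2 * B.
  have [B1 _] := hB _ hs; have [B2 _] := hB _ hse.
  have h : `|du y| * e <= 2 * B.
    rewrite -(gtr0_norm ep) -normrM -[X in du y * X](_ : s + e - s = e); last by ring.
    by rewrite -ey; apply: le_trans (ler_normB _ _) _; lra.
  have -> : e1 * du y = e2 * (du y * e) by rewrite /e; field; rewrite gt_eqF.
  rewrite normrM (gtr0_norm e20) normrM (gtr0_norm ep) [2 * e2]mulrC -mulrA.
  by rewrite ler_wpM2l// ltW.
pose H z := e1 * du z - e2 * (b z * u z).
have dH z : s <= z <= s + e -> is_derive z 1 H (r z * u z - g z - e2 * (db z * u z)).
  move=> /sub hz.
  have := is_deriveB' (is_deriveZ' e1 (hdu z hz)) (is_deriveZ' e2 (is_deriveM' (hb z hz) (hu z hz))).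
  by move=> h; apply: is_derive_eq; rewrite -(Lu z hz); ring.
have B0 : 0 <= B by have [h _] := hB _ hs; apply: le_trans h.
have [C00 C10] : 0 <= C0 /\ 0 <= C1.
  by have [h h' _] := hC _ (sub _ hs); split; [apply: le_trans h|apply: le_trans h'].
have dHle z : s <= z <= s + e -> `|r z * u z - g z - e2 * (db z * u z)| <= (C0 + C1) * B + rho.
  move=> hz; have [uB gr] := hB z hz; have [_ bC rC] := hC z (sub z hz).
  have h1 : `|r z * u z| <= C0 * B by rewrite normrM ler_pM.
  have h2 : `|e2 * (db z * u z)| <= C1 * B.
    rewrite normrM gtr0_norm// -[leRHS]mul1r ler_pM// ?(ltW e20)// normrM ler_pM//.
  apply: le_trans (ler_normB _ _) _; apply: le_trans (lerD (ler_normB _ _) h2) _.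
  by lra.
have Hxy := mvt_le_cc hx hy dH dHle.
have [uBx _] := hB x hx; have [uBy _] := hB y hy.
have bu z : s <= z <= s + e -> `|e2 * (b z * u z)| <= e2 * (C0 * B).
  move=> hz; have [uB _] := hB z hz; have [bC _ _] := hC z (sub z hz).
  by rewrite normrM gtr0_norm// ler_wpM2l ?(ltW e20)// normrM ler_pM.
have bx := bu x hx; have by_ := bu y hy.
rewrite -[e1 * du x](_ : (H x - H y) + e1 * du y - e2 * (b y * u y) + e2 * (b x * u x) = _); last by rewrite /H; ring.
apply: le_trans (ler_normD _ _) _; apply: le_trans (lerD (ler_normB _ _) bx) _.
apply: le_trans (lerD (lerD (ler_normD _ _) by_) (lexx _)) _.
have : `|H x - H y| <= ((C0 + C1) * B + rho) * e2.
  apply: le_trans Hxy _; rewrite [s + e - s](_ : _ = e); last by ring.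
  have rho0 : 0 <= rho by have [_ h] := hB _ hs; apply: le_trans h.
  by rewrite ler_wpM2l// addr_ge0// mulr_ge0// addr_ge0.
by lra.
Qed.

End MaxPrinciple.

(** * Analytic data and solutions of the boundary value problem *)

Section Majorant.
Context {R : realType}.

Lemma bin_le_exp2 n k : ('C(n, k) <= 2 ^ n)%N.
Proof.
elim: n k => [|n IH] [|k]; rewrite ?bin0 ?expn_gt0// binS expnS mul2n -addnn.
exact: leq_add.
Qed.

Lemma hockey_stick a n : (\sum_(i < n.+1) 'C(a + i, i) = 'C((a + n).+1, n))%N.
Proof.
elim: n => [|n IH]; first by rewrite big_ord1 !bin0.
by rewrite big_ord_recr /= IH addnS binS addnC.
Qed.

(* The extremal sequence has the generating function [(1 - K x)^(-a)]. *)
Lemma majorant (a : nat) (K : R) (t : nat -> R) : 0 <= K -> 0 <= t 0%N ->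
  (forall n, n.+1%:R * t n.+1 <= a%:R * K * \sum_(i < n.+1) K ^+ i * t (n - i)%N) ->
  forall n, t n <= t 0%N * 2 ^+ (a + n) * K ^+ n.
Proof.
move=> K0 t0 rec n.
suff h : t n <= t 0%N * 'C(a + n, n)%:R * K ^+ n.
  apply: le_trans h _; rewrite ler_wpM2r ?exprn_ge0// ler_wpM2l//.
  by rewrite -natrX ler_nat bin_le_exp2.
elim/ltn_ind: n => -[|n] IH; first by rewrite bin0 expr0 !mulr1.
have h := rec n.
rewrite -(ler_pM2l (ltr0Sn R n)); apply: le_trans h _.
apply: (@le_trans _ _ (a%:R * K * (t 0%N * K ^+ n * \sum_(i < n.+1) 'C(a + i, i)%:R))).
  rewrite ler_wpM2l ?mulr_ge0// mulr_sumr.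
  rewrite [leRHS](reindex_inj rev_ord_inj) /=; apply: ler_sum => i _.
  rewrite subSS; have ni : (i <= n)%N by rewrite -ltnS.
  apply: (@le_trans _ _ (K ^+ i * (t 0%N * 'C(a + (n - i), n - i)%:R * K ^+ (n - i)))).
    by rewrite ler_wpM2l ?exprn_ge0// IH// ltnS leq_subr.
  rewrite -[in K ^+ n](subnKC ni) exprD le_eqVlt; apply/orP; left; apply/eqP; ring.
rewrite -natr_sum hockey_stick exprS.
have -> : n.+1%:R * (t 0%N * 'C(a + n.+1, n.+1)%:R * (K * K ^+ n)) =
   t 0%N * K * K ^+ n * (n.+1 * 'C(a + n.+1, n.+1))%:R by rewrite natrM; ring.
rewrite mul_bin_left addnS subSn ?leq_addl// addnK natrM.
have -> : a%:R * K * (t 0%N * K ^+ n * 'C((a + n).+1, n)%:R) =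
   t 0%N * K * K ^+ n * (a%:R * 'C((a + n).+1, n)%:R) by ring.
rewrite ler_wpM2l ?mulr_ge0 ?exprn_ge0// ler_wpM2r// ler_nat.
exact: leqnSn.
Qed.

Lemma natr_ceil (y : R) : 0 <= y -> exists2 a : nat, y <= a%:R & a%:R <= y + 1.
Proof.
move=> y0; have /andP[h1 h2] := truncn_itv y0.
by exists (Num.truncn y).+1; [exact: ltW|rewrite -natr1 lerD2r].
Qed.

Lemma exp2_le_expR (a : nat) : 2 ^+ a <= expR (a%:R : R).
Proof.
rewrite -[a%:R]mulr1 expRM_natl lerXn2r// ?nnegrE ?expR_ge0//.
by have := expR_ge1Dx (1 : R); lra.
Qed.

End Majorant.

(** * A priori bounds and regularity of the solution *)

Section Data.
Context {R : realType}.
Implicit Types (b r f : R -> nat -> R) (x : R).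

Definition cc x : Prop := 0 <= x <= 1.

Lemma oo_cc x : oo 0 1 x -> cc x.
Proof. by move=> /andP[? ?]; apply/andP; rewrite !ltW. Qed.

Lemma jet_sub_dom (D D' : R -> Prop) (F : R -> nat -> R) :
  (forall x, D' x -> D x) -> jet D F -> jet D' F.
Proof. by move=> h hF x /h; apply: hF. Qed.

Lemma bound_left_end (a c k : R) (h : R -> R) : a < c -> {for a, continuous h} ->
  (forall x, oo a c x -> `|h x| <= k) -> `|h a| <= k.
Proof.
move=> ac ch hk; have h1 : `|h x| @[x --> a^'+] --> `|h a|.
  by apply: cvg_norm; exact/cvg_at_right_filter.
have h2 : (cst k x : R) @[x --> a^'+] --> k by exact: cvg_cst.
apply: ler_cvg_to h1 h2 _; near=> x; apply: hk; apply/andP; split; near: x.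
  exact: nbhs_right_gt.
exact: nbhs_right_lt.
Unshelve. all: by end_near. Qed.

Lemma bound_right_end (a c k : R) (h : R -> R) : a < c -> {for c, continuous h} ->
  (forall x, oo a c x -> `|h x| <= k) -> `|h c| <= k.
Proof.
move=> ac ch hk; have h1 : `|h x| @[x --> c^'-] --> `|h c|.
  by apply: cvg_norm; exact/cvg_at_left_filter.
have h2 : (cst k x : R) @[x --> c^'-] --> k by exact: cvg_cst.
apply: ler_cvg_to h1 h2 _; near=> x; apply: hk; apply/andP; split; near: x.
  exact: nbhs_left_gt.
exact: nbhs_left_lt.
Unshelve. all: by end_near. Qed.

(** The data are bounded on the open interval; continuity of their extensions carries the bounds to
    0 and 1. *)
Lemma cc_bound (h : R -> R) (C : R) : (forall x, cc x -> {for x, continuous h}) ->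
  (forall x, oo 0 1 x -> `|h x| <= C) -> forall x, cc x -> `|h x| <= C.
Proof.
move=> ch hC x hx; have /andP[] := hx.
rewrite le_eqVlt => /predU1P[<- _|x0].
  by apply: bound_left_end ltr01 (ch _ _) hC; rewrite /cc lexx ler01.
rewrite le_eqVlt => /predU1P[->|x1].
  by apply: bound_right_end ltr01 (ch _ _) hC; rewrite /cc lexx ler01.
by apply: hC; rewrite /oo x0.
Qed.

Definition derjet (h : R -> R) x n : R := derive1n n h x / n`!%:R.

Lemma derjet0 h x : derjet h x 0 = h x.
Proof. by rewrite /derjet divr1. Qed.

Lemma jet_analytic C g h : analytic_data C g h -> jet cc (derjet h).
Proof.
move=> ha x hx n; have [hd _] := ha n.
have dh : derivable (derive1n n h) x 1 by apply: hd; rewrite in_itv.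
have d1 : is_derive x 1 (derive1n n h) (derive1n n.+1 h x).
  by apply: DeriveDef; [exact: dh|rewrite -derive1E].
rewrite (_ : (fun y => _) = (fun y => (n`!%:R)^-1 * derive1n n h y)); last first.
  by apply/funext => y; rewrite /derjet mulrC.
have -> : sder (derjet h x) n = (n`!%:R)^-1 * derive1n n.+1 h x.
  rewrite /sder /derjet factS natrM; field.
  by rewrite nat1r !pnatr_eq0 -lt0n fact_gt0.
exact: is_deriveZ'.
Qed.

Lemma jet_continuous (D : R -> Prop) (F : R -> nat -> R) n x :
  jet D F -> D x -> {for x, continuous (fun y => F y n)}.
Proof. by move=> hF Dx; apply: is_derive_continuous (hF x Dx n). Qed.

Lemma derjet_bound C g h x n : analytic_data C g h -> cc x ->
  `|derjet h x n| <= C * g ^+ n.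
Proof.
move=> ha; move: x; apply: cc_bound.
  by move=> x; apply: jet_continuous; exact: jet_analytic ha.
move=> x hx; have [_ hb] := ha n.
have f0 : (0 : R) < n`!%:R by rewrite ltr0n fact_gt0.
rewrite /derjet normrM normfV (gtr0_norm f0) ler_pdivrMr//.
by rewrite mulrAC; apply: hb; rewrite in_itv.
Qed.

(** [gam] bounds [r] itself from below, for the maximum principle. Coercivity uses the bound of
    [r - e2 b' / 2], which is called [gam0] further on. *)
Record ode_data b r f (C0 g beta gam : R) : Prop := OdeData {
  od_b : jet cc b; od_r : jet cc r; od_f : jet cc f;
  od_bC : forall x n, cc x -> `|b x n| <= C0 * g ^+ n;
  od_rC : forall x n, cc x -> `|r x n| <= C0 * g ^+ n;
  od_fC : forall x n, cc x -> `|f x n| <= C0 * g ^+ n;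
  od_beta : 0 < beta; od_bge : forall x, cc x -> beta <= b x 0%N;
  od_gam : 0 < gam; od_rge : forall x, cc x -> gam <= r x 0%N;
  od_C0 : 1 <= C0; od_g : 1 <= g }.

(* [du] is [u'], only required in the open interval. *)
Record ode_sol b r f (e1 e2 : R) (u du : R -> R) : Prop := OdeSol {
  os_cont : {within `[0, 1], continuous u};
  os_d : forall x, oo 0 1 x -> is_derive x 1 u (du x);
  os_dd : forall x, oo 0 1 x -> is_derive x 1 du
    (e1^-1 * (e2 * (b x 0%N * du x) + r x 0%N * u x - f x 0%N));
  os_0 : u 0 = 0; os_1 : u 1 = 0 }.

(** Comparison of [u] and [- u] with the constant [C0 / gam], a supersolution because [r >= gam]. *)
Lemma ode_sol_bound b r f C0 g beta gam e1 e2 u du :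
  ode_data b r f C0 g beta gam -> ode_sol b r f e1 e2 u du -> 0 < e1 ->
  forall x, cc x -> `|u x| <= C0 / gam.
Proof.
move=> od os e10; set k := C0 / gam.
have gam0 := od_gam od.
have k0 : 0 <= k by rewrite divr_ge0// ?(ltW gam0)// (le_trans ler01 (od_C0 od)).
have key (s : R) : `|s| = 1 -> forall x, cc x -> 0 <= k + s * u x.
  move=> s1 x hx.
  apply: (@max_principle _ e1 e2 (fun x => b x 0%N) (fun x => r x 0%N)
    (fun x => k + s * u x) (fun x => s * du x)
    (fun x => s * (e1^-1 * (e2 * (b x 0%N * du x) + r x 0%N * u x - f x 0%N)))).
  - exact: e10.
  - move=> y; apply: cvgD; first exact: cvg_cst.
    apply: cvgM; first exact: cvg_cst.
    exact: (os_cont os).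
  - move=> y hy; have := is_deriveD' (is_derive_cst k y 1) (is_deriveZ' s (os_d os hy)).
    by rewrite add0r.
  - by move=> y hy; apply: is_deriveZ'; exact: (os_dd os).
  - by move=> y /oo_cc hy; apply: lt_le_trans gam0 (od_rge od hy).
  - move=> y /oo_cc hy.
    have -> : - e1 * (s * (e1^-1 * (e2 * (b y 0%N * du y) + r y 0%N * u y - f y 0%N))) +
       e2 * b y 0%N * (s * du y) + r y 0%N * (k + s * u y) = r y 0%N * k + s * f y 0%N.
      by field; rewrite gt_eqF.
    have h1 : C0 <= r y 0%N * k.
      by rewrite /k mulrCA ler_peMr ?(le_trans ler01 (od_C0 od))// ler_pdivlMr// mul1r (od_rge od).
    have h2 : `|s * f y 0%N| <= C0.
      by rewrite normrM s1 mul1r; have := od_fC od 0 hy; rewrite expr0 mulr1.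
    by move: h2; rewrite ler_norml => /andP[? ?]; lra.
  - by rewrite (os_0 os) mulr0 addr0.
  - by rewrite (os_1 os) mulr0 addr0.
  - exact: hx.
move=> x hx; have h1 := key 1 (normr1 _) x hx.
have h2 := key (-1) (ltac:(by rewrite normrN normr1)) x hx.
by rewrite ler_norml; apply/andP; split; lra.
Qed.

(** The window of [derivative_estimate] is put to the right or to the left of [x], whichever stays
    in (0, 1). *)
Lemma ode_dsol_bound b r f C0 g beta gam e1 e2 u du :
  ode_data b r f C0 g beta gam -> ode_sol b r f e1 e2 u du ->
  0 < e1 -> 0 < e2 -> e2 <= 1 -> 4 * e1 <= e2 ^+ 2 ->
  forall x, oo 0 1 x ->
  `|e1 * du x| <= e2 * ((2 + 3 * C0 + C0 * g) * (C0 / gam) + C0).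
Proof.
move=> od os e10 e20 e21 e12 x hx.
have e12' : e1 <= e2 ^+ 2 by lra.
have ee : e1 / e2 <= 1 / 4.
  rewrite ler_pdivrMr//; have : e2 ^+ 2 <= e2 by rewrite expr2 ler_piMr// ltW.
  by lra.
have ee0 : 0 < e1 / e2 by rewrite divr_gt0.
have /andP[x0 x1] := hx.
have key s : 0 < s -> s + e1 / e2 < 1 -> s <= x <= s + e1 / e2 ->
    `|e1 * du x| <= e2 * ((2 + 3 * C0 + C0 * g) * (C0 / gam) + C0).
  move=> s0 s1; apply: (@derivative_estimate _ e1 e2 C0 (C0 * g) (C0 / gam) C0 s
    (fun x => b x 0%N) (fun x => sder (b x) 0) (fun x => r x 0%N) u du
    (fun x => e1^-1 * (e2 * (b x 0%N * du x) + r x 0%N * u x - f x 0%N))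
    (fun x => f x 0%N)) => //.
  - by move=> y /oo_cc hy; exact: (od_b od).
  - exact: (os_d os).
  - exact: (os_dd os).
  - by move=> y hy; field; rewrite gt_eqF.
  - move=> y /oo_cc hy; split.
    + by have := od_bC od 0 hy; rewrite expr0 mulr1.
    + by have := od_bC od 1 hy; rewrite /sder mul1r expr1.
    + by have := od_rC od 0 hy; rewrite expr0 mulr1.
  - move=> y hy; have hy' : cc y by move: hy => /andP[? ?]; apply/andP; split; lra.
    split; first exact: (ode_sol_bound od os).
    by have := od_fC od 0 hy'; rewrite expr0 mulr1.
have [xl|xr] := ltP x (1 / 2); first by apply: (key x); lra.
by apply: (key (x - e1 / e2)); lra.
Qed.

(** With [e = e1 / e2], the recursion is run on [u] together with [W = e u'], since both are bounded
    independently of [e1] and [e2]. Each step then costs a factor [2 C0 / e]. Multiplied by the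
    length [h], it becomes [2^a] in [majorant], with [a] about [2 C0 h / e]: this is the exponential
    in [Lam]. *)
Lemma ode_sol_regularity b r f C0 g beta gam :
  ode_data b r f C0 g beta gam -> exists2 CQ : R, 0 < CQ &
  forall e1 e2 u du, ode_sol b r f e1 e2 u du ->
  0 < e1 -> 0 < e2 -> e2 <= 1 -> 4 * e1 <= e2 ^+ 2 ->
  let uj x := odejet e1 e2 (b x) (r x) (f x) (u x) (du x) in
  jet (oo 0 1) uj /\
  forall x n h (Lam : R), oo 0 1 x -> 0 <= h -> h <= 1 -> h * (e2 / e1) <= Lam ->
    `|uj x n| * h ^+ n <= CQ * expR (2 * C0 * Lam) * (2 * g) ^+ n.
Proof.
move=> od.
have C01 := od_C0 od; have g1 := od_g od; have gam0 := od_gam od.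
have C00 : 0 < C0 by lra.
have g0 : 0 < g by lra.
pose Q := C0 / gam + ((2 + 3 * C0 + C0 * g) * (C0 / gam) + C0) + 1.
have kk : 0 < C0 / gam by rewrite divr_gt0.
have Q0 : 0 < Q.
  have : 0 < (2 + 3 * C0 + C0 * g) * (C0 / gam).
    by rewrite mulr_gt0// !addr_gt0// ?mulr_gt0.
  by rewrite /Q; lra.
exists (Q * expR 1); first by rewrite mulr_gt0// expR_gt0.
move=> e1 e2 u du os e10 e20 e21 e12 uj.
have ju : jet (oo 0 1) uj.
  apply: jet_ode; first by rewrite gt_eqF.
  - exact: jet_sub_dom oo_cc (od_b od).
  - exact: jet_sub_dom oo_cc (od_r od).
  - exact: jet_sub_dom oo_cc (od_f od).
  - exact: (os_d os).
  - exact: (os_dd os).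
split => // x n h Lam hx h0 h1 hL; have hxc := oo_cc hx.
pose e := e1 / e2; have e0 : 0 < e by rewrite divr_gt0.
have ee2 : e <= e2 by rewrite ler_pdivrMr// -expr2; lra.
pose W n := e * (n.+1%:R * uj x n.+1).
(* The last summand makes [T 0] at least 1, so that the coefficients of [f] are absorbed into the
   convolution with [T]. *)
pose T n := `|uj x n| + `|W n| + (n == 0%N)%:R.
have T0 m : 0 <= T m by rewrite !addr_ge0.
pose t m := T m * h ^+ m.
have hE : h / e = h * (e2 / e1) by rewrite /e invf_div.
have hL0 : 0 <= h / e by rewrite divr_ge0// ltW.
(* [majorant] takes a natural number; rounding up costs the factor [exp 1] in the constant. *)
have [a ha1 ha2] := @natr_ceil R (2 * C0 * (h / e)) (mulr_ge0 (mulr_ge0 (ler0n R 2) (ltW C00)) hL0).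
have t0Q : t 0%N <= Q.
  rewrite /t expr0 mulr1 /T /W /= mul1r /uj odejet0 odejet1 /Q lerD2r lerD//.
    exact: (ode_sol_bound od os).
  have := ode_dsol_bound od os e10 e20 e21 e12 hx.
  rewrite [e * _](_ : _ = (e1 * du x) / e2); last by rewrite /e; field; rewrite gt_eqF.
  by move=> hh; rewrite normrM normfV (gtr0_norm e20) ler_pdivrMr// [leRHS]mulrC.
have rec m : m.+1%:R * t m.+1 <= a%:R * g * \sum_(i < m.+1) g ^+ i * t (m - i)%N.
  pose S := \sum_(i < m.+1) g ^+ i * T (m - i)%N.
  have S0 : 0 <= S by apply: sumr_ge0 => i _; rewrite mulr_ge0// exprn_ge0// ltW.
  have hu : m.+1%:R * `|uj x m.+1| = e^-1 * `|W m|.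
    by rewrite /W normrM (gtr0_norm e0) normrM normr_nat mulKf ?gt_eqF.
  have WE : m.+1%:R * W m.+1 = e^-1 * smul (b x) W m +
      e2^-1 * (smul (r x) (uj x) m - f x m).
    have -> : smul (b x) W m = e * smul (b x) (sder (uj x)) m.
      by rewrite /smul mulr_sumr; apply: eq_bigr => i _; rewrite /W /sder; ring.
    rewrite /W /uj odejetSS -/(uj x) /e; field.
    by rewrite nat1r -!natrD !pnatr_eq0 !gt_eqF.
  have hW : m.+1%:R * `|W m.+1| <= e^-1 * (C0 * S).
    rewrite -[m.+1%:R]normr_nat -normrM WE.
    apply: (@le_trans _ _ (e^-1 * (\sum_(i < m.+1) C0 * g ^+ i * `|W (m - i)%N| +
       (\sum_(i < m.+1) C0 * g ^+ i * `|uj x (m - i)%N| + C0 * g ^+ m)))).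
      rewrite [leRHS]mulrDr; apply: le_trans (ler_normD _ _) _; apply: lerD.
        rewrite normrM ger0_norm ?invr_ge0 ?(ltW e0)// ler_wpM2l ?invr_ge0 ?(ltW e0)//.
        apply: le_trans (ler_norm_sum _ _ _) _; apply: ler_sum => i _.
        by rewrite normrM ler_wpM2r// (od_bC od).
      rewrite normrM ger0_norm ?invr_ge0 ?(ltW e20)//; apply: ler_pM => //.
        by rewrite invr_ge0 ltW.
        by rewrite lef_pV2 ?posrE.
      apply: le_trans (ler_normB _ _) _; apply: lerD; last exact: (od_fC od).
      apply: le_trans (ler_norm_sum _ _ _) _; apply: ler_sum => i _.
      by rewrite normrM ler_wpM2r// (od_rC od).
    rewrite ler_wpM2l ?invr_ge0 ?(ltW e0)//.
    have -> : C0 * g ^+ m = \sum_(i < m.+1) C0 * g ^+ i * ((m - i)%N == 0%N)%:R.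
      rewrite big_ord_recr /= subnn eqxx mulr1 big1 ?add0r// => i _.
      by rewrite subn_eq0 leqNgt ltn_ord mulr0.
    rewrite -!big_split /S mulr_sumr /= le_eqVlt; apply/orP; left; apply/eqP.
    by apply: eq_bigr => i _; rewrite /T; ring.
  have hWS : `|W m| <= C0 * S.
    rewrite /S big_ord_recl /= expr0 mul1r subn0 -[leLHS]mul1r.
    apply: ler_pM => //; apply: (@le_trans _ _ (T m)).
      by rewrite /T addrAC lerDr addr_ge0.
    by rewrite lerDl; apply: sumr_ge0 => i _; rewrite mulr_ge0// exprn_ge0// ltW.
  have h2 : m.+1%:R * T m.+1 <= e^-1 * (2 * C0 * S).
    rewrite /T /= addr0 mulrDr hu.
    have := ler_wpM2l (ltac:(by rewrite invr_ge0 ltW) : 0 <= e^-1) hWS.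
    by move: hW; lra.
  apply: (@le_trans _ _ (h / e * (2 * C0) * (h ^+ m * S))).
    rewrite /t exprS.
    have := ler_wpM2r (mulr_ge0 h0 (exprn_ge0 m h0)) h2.
    have -> : m.+1%:R * T m.+1 * (h * h ^+ m) = m.+1%:R * (T m.+1 * (h * h ^+ m)) by ring.
    move=> /le_trans; apply; rewrite le_eqVlt; apply/orP; left; apply/eqP; ring.
  have hs : h ^+ m * S <= \sum_(i < m.+1) g ^+ i * t (m - i)%N.
    rewrite /S mulr_sumr; apply: ler_sum => i _.
    have im : (i <= m)%N by rewrite -ltnS.
    rewrite /t mulrCA ler_wpM2l ?exprn_ge0 ?(ltW g0)// mulrC ler_wpM2l//.
    rewrite -[in h ^+ m](subnKC im) exprD ler_piMl ?exprn_ge0//.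
    by rewrite exprn_ile1.
  have s0 : 0 <= h ^+ m * S by rewrite mulr_ge0// exprn_ge0.
  apply: ler_pM => //.
    by apply: mulr_ge0 => //; apply: mulr_ge0 => //; exact: ltW.
  apply: (@le_trans _ _ a%:R); first by rewrite mulrC.
  by rewrite ler_peMr.
have tt := majorant (ltW g0) (ltac:(by rewrite /t mulr_ge0// exprn_ge0) : 0 <= t 0%N) rec n.
apply: (@le_trans _ _ (t n)).
  rewrite /t ler_wpM2r ?exprn_ge0// /T -addrA lerDl addr_ge0//.
apply: le_trans tt _; rewrite exprD mulrA -mulrA -exprMn ler_wpM2r ?exprn_ge0 ?mulr_ge0 ?(ltW g0)//.
rewrite -mulrA; apply: ler_pM => //; rewrite ?exprn_ge0//.
  by rewrite /t mulr_ge0// exprn_ge0.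
apply: le_trans (exp2_le_expR a) _; rewrite -expRD ler_expR.
apply: le_trans ha2 _; rewrite addrC lerD2l ler_wpM2l ?mulr_ge0 ?(ltW C00)//.
by rewrite hE.
Qed.

End Data.

(** * Smooth part of the solution *)

Section SlowManifold.
Context {R : realType}.
Implicit Types (b r f m ri bi : nat -> R) (x : R).

(** Increments of the fixed point iteration for [r U = f + e1 U'' - e2 b U']; [ri] stands for the
    coefficients of [1 / r]. *)
Fixpoint smooth_term (e1 e2 : R) ri b f k : nat -> R :=
  if k is k'.+1 then
    let T := smooth_term e1 e2 ri b f k' in
    smul ri (fun n => e1 * sder (sder T) n - e2 * smul b (sder T) n)
  else smul ri f.

(** For [E = exp(int m / e2)] one has [L E = (b m - ep m^2 - eta m' + r) E], where [ep = e1 / e2^2]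
    and [eta = e1 / e2]. The iteration solves for the term [b m], which selects the decaying root
    near [- r / b]; [bi] stands for the coefficients of [1 / b]. *)
Fixpoint riccati (ep eta : R) bi r k : nat -> R :=
  if k is k'.+1 then
    let m := riccati ep eta bi r k' in
    smul bi (fun n => ep * smul m m n + eta * sder m n - r n)
  else fun=> 0.

(** Each term loses the piece [d] of the radius, [d / 2] per derivative, and gains a factor 1/2. As
    [t0 = 2 d M], half of the radius is left after [M] terms. *)
Lemma nb_smooth_term (e1 e2 t0 d CR CB CF : R) ri b f M : 0 < d ->
  t0 = 2 * d * M%:R -> 0 <= e1 -> 0 <= e2 -> 0 <= t0 ->
  nb t0 CR ri -> nb t0 CB b -> nb t0 CF f ->
  CR * (e1 * (4 / d ^+ 2) + e2 * (CB * (2 / d))) <= 1 / 2 ->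
  forall k, (k <= M)%N ->
  nb (t0 - d * k%:R) (CR * CF * 2^-1 ^+ k) (smooth_term e1 e2 ri b f k).
Proof.
move=> d0 dE e10 e20 t00 hri hb hf small; elim=> [|k IH] kM.
  by rewrite mulr0 subr0 expr0 mulr1; apply: nb_mul.
have {}IH := IH (ltnW kM).
have kMR : k.+1%:R <= M%:R :> R by rewrite ler_nat.
set t := t0 - d * k%:R in IH; set t' := t0 - d * k.+1%:R.
have tt' : t' = t - d by rewrite /t /t' -natr1; ring.
have t'0 : 0 <= t'.
  rewrite /t' dE -mulrA mulrCA -mulrBr mulr_ge0 ?(ltW d0)// subr_ge0.
  by apply: le_trans kMR _; rewrite ler_peMl// ler1n.
have t't0 : t' <= t0 by rewrite /t' gerBl mulr_ge0// ltW.
pose C := CR * CF * 2^-1 ^+ k.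
have CR0 := nb_ge0 hri.
have C0 : 0 <= C := nb_ge0 IH.
have tm : t' <= t - d / 2 by rewrite tt'; lra.
have h1 : nb (t - d / 2) (C / (d / 2)) (sder (smooth_term e1 e2 ri b f k)).
  have := @nb_der R t (t - d / 2) C _ _ _ IH.
  have -> : t - (t - d / 2) = d / 2 by ring.
  by apply; [apply: le_trans t'0 tm|lra].
have h2 : nb t' (C / (d / 2) / (d / 2)) (sder (sder (smooth_term e1 e2 ri b f k))).
  have := @nb_der R (t - d / 2) t' _ _ _ _ h1.
  have -> : t - d / 2 - t' = d / 2 by rewrite tt'; field.
  by apply => //; rewrite tt'; lra.
have h1' := nb_mono t'0 tm h1.
have h3 := nb_mul t'0 (nb_mono t'0 t't0 hri) (nb_sub t'0 (nb_scale e1 t'0 h2)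
   (nb_scale e2 t'0 (nb_mul t'0 (nb_mono t'0 t't0 hb) h1'))).
apply: nb_le h3; rewrite !ger0_norm// exprS.
have -> : CR * (e1 * (C / (d / 2) / (d / 2)) + e2 * (CB * (C / (d / 2)))) =
   CR * (e1 * (4 / d ^+ 2) + e2 * (CB * (2 / d))) * C.
  by field; rewrite gt_eqF.
have -> : CR * CF * (2^-1 * 2^-1 ^+ k) = 1 / 2 * C by rewrite /C; field.
by rewrite ler_wpM2r.
Qed.

(** The radius shrinks as for the smooth terms. Differences [D] of successive iterates are halved at
    each step, because [m1^2 - m0^2 = m1 D + D m0] and the iterates stay below [2 CB CR], the sum of
    the bounds on the differences. *)
Lemma nb_riccati (ep eta t0 d CB CR : R) bi r M : 0 < d ->
  t0 = 2 * d * M%:R -> 0 <= ep -> 0 <= eta -> 0 <= t0 ->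
  nb t0 CB bi -> nb t0 CR r ->
  CB * (ep * (4 * (CB * CR)) + eta / d) <= 1 / 2 ->
  forall k, (k <= M)%N -> let m := riccati ep eta bi r in
  nb (t0 - d * k%:R) (2 * (CB * CR) * (1 - 2^-1 ^+ k)) (m k) /\
  nb (t0 - d * k%:R) (CB * CR * 2^-1 ^+ k) (fun n => m k.+1 n - m k n).
Proof.
move=> d0 dE ep0 eta0 t00 hbi hr small; elim=> [|k IH] kM m.
  rewrite mulr0 subr0 expr0 subrr mulr0 mulr1; split.
    by move=> N; rewrite big1// => i _; rewrite normr0 mulr0.
  have -> : (fun n => m 1%N n - m 0%N n) = (fun n => - smul bi r n).
    apply/funext => n; rewrite /= subr0 /smul -sumrN; apply: eq_bigr => i _.
    have -> : smul (fun=> 0) (fun=> 0) (n - i)%N = 0 :> R.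
      by rewrite /smul big1// => j _; rewrite mul0r.
    by rewrite /sder; ring.
  exact/nb_opp/nb_mul.
have {IH}[h1 h2] := IH (ltnW kM); rewrite -/m in h1 h2.
have kMR : k.+1%:R <= M%:R :> R by rewrite ler_nat.
set t := t0 - d * k%:R in h1 h2; set t' := t0 - d * k.+1%:R.
have tt' : t' = t - d by rewrite /t /t' -natr1; ring.
have t'0 : 0 <= t'.
  rewrite /t' dE -mulrA mulrCA -mulrBr mulr_ge0 ?(ltW d0)// subr_ge0.
  by apply: le_trans kMR _; rewrite ler_peMl// ler1n.
have t't0 : t' <= t0 by rewrite /t' gerBl mulr_ge0// ltW.
have t't : t' <= t by rewrite tt'; lra.
have tp : 0 <= t by apply: le_trans t'0 t't.
have CB0 := nb_ge0 hbi; have CR0 := nb_ge0 hr.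
have CC0 : 0 <= CB * CR by rewrite mulr_ge0.
have hk0 : 0 <= 2^-1 ^+ k :> R by rewrite exprn_ge0// invr_ge0.
have hk1 : 2^-1 ^+ k <= 1 :> R by rewrite exprn_ile1 ?invr_ge0// invf_le1// ler1n.
have g1 : nb t (2 * (CB * CR) * (1 - 2^-1 ^+ k.+1)) (m k.+1).
  have := nb_add tp h1 h2.
  rewrite (_ : (fun n => _) = m k.+1); last by apply/funext => n; rewrite addrC subrK.
  by apply: nb_le; rewrite exprS; lra.
have g1' := nb_le (ltac:(rewrite exprS; nra) : 2 * (CB * CR) * (1 - 2^-1 ^+ k.+1) <= 2 * (CB * CR)) g1.
have h1' := nb_le (ltac:(nra) : 2 * (CB * CR) * (1 - 2^-1 ^+ k) <= 2 * (CB * CR)) h1.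
split; first exact: nb_mono t't g1.
pose D n := m k.+1 n - m k n.
have -> : (fun n => m k.+2 n - m k.+1 n) =
   smul bi (fun n => ep * (smul (m k.+1) D n + smul D (m k) n) + eta * sder D n).
  apply/funext => n.
  pose F (h : nat -> R) n := ep * smul h h n + eta * sder h n - r n.
  transitivity (smul bi (F (m k.+1)) n - smul bi (F (m k)) n) => //.
  rewrite /F; move: (m k.+1) @D => mk1 D.
  rewrite /smul -sumrB; apply: eq_bigr => i _; rewrite -mulrBr; congr (_ * _).
  have -> : \sum_(i0 < (n - i).+1) mk1 i0 * D ((n - i) - i0)%N +
      \sum_(i0 < (n - i).+1) D i0 * m k ((n - i) - i0)%N =
      \sum_(i0 < (n - i).+1) mk1 i0 * mk1 ((n - i) - i0)%N -
      \sum_(i0 < (n - i).+1) m k i0 * m k ((n - i) - i0)%N.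
    rewrite -sumrB -big_split; apply: eq_bigr => j _ /=; rewrite /D; ring.
  by rewrite /sder /D; ring.
have d1 : nb t' (CB * CR * 2^-1 ^+ k / d) (sder D).
  have := @nb_der R t t' _ _ t'0 _ h2; rewrite [t - t'](_ : _ = d); last by rewrite tt'; ring.
  by apply; rewrite tt'; lra.
have h2' := nb_mono t'0 t't h2.
have g1'' := nb_mono t'0 t't g1'; have h1'' := nb_mono t'0 t't h1'.
have q1 := nb_scale ep t'0 (nb_add t'0 (nb_mul t'0 g1'' h2') (nb_mul t'0 h2' h1'')).
have q2 := nb_mul t'0 (nb_mono t'0 t't0 hbi) (nb_add t'0 q1 (nb_scale eta t'0 d1)).
apply: nb_le q2; rewrite !ger0_norm// exprS.
have -> : CB * (ep * (2 * (CB * CR) * (CB * CR * 2^-1 ^+ k) +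
    CB * CR * 2^-1 ^+ k * (2 * (CB * CR))) + eta * (CB * CR * 2^-1 ^+ k / d)) =
  CB * (ep * (4 * (CB * CR)) + eta / d) * (CB * CR * 2^-1 ^+ k).
  by field; rewrite gt_eqF.
have -> : CB * CR * (2^-1 * 2^-1 ^+ k) = 1 / 2 * (CB * CR * 2^-1 ^+ k) by field.
by rewrite ler_wpM2r// mulr_ge0.
Qed.

End SlowManifold.

(** * Truncated expansion and its polynomial approximation *)

Section SmoothPart.
Context {R : realType}.
Implicit Types (b r f : R -> nat -> R) (x : R).

Lemma jet_smooth_term e1 e2 (ri b f : R -> nat -> R) (D : R -> Prop) k :
  jet D ri -> jet D b -> jet D f ->
  jet D (fun x => smooth_term e1 e2 (ri x) (b x) (f x) k).
Proof.
move=> hri hb hf; elim: k => [|k IH]; first exact: (jet_mul hri hf).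
exact: (jet_mul hri (jet_sub (jet_scale e1 (jet_der (jet_der IH)))
  (jet_scale e2 (jet_mul hb (jet_der IH))))).
Qed.

Lemma jet_riccati ep eta (bi r : R -> nat -> R) (D : R -> Prop) k :
  jet D bi -> jet D r -> jet D (fun x => riccati ep eta (bi x) (r x) k).
Proof.
move=> hbi hr; elim: k => [|k IH]; first exact: jet0.
exact: (jet_mul hbi (jet_sub (jet_add (jet_scale ep (jet_mul IH IH))
  (jet_scale eta (jet_der IH))) hr)).
Qed.

(** One radius serves the data and the reciprocals of [b] and [r]: the nonconstant coefficients then
    weigh at most half of the lower bounds [beta] and [gam]. *)
Lemma ode_data_radius b r f C0 g beta gam : ode_data b r f C0 g beta gam ->
  exists t0 : R, [/\ 0 < t0, t0 <= 1 & forall x, cc x ->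
    [/\ nb t0 (2 * C0) (b x), nb t0 (2 * C0) (r x), nb t0 (2 * C0) (f x),
        nb t0 (2 / beta) (sinv (b x)) & nb t0 (2 / gam) (sinv (r x))]].
Proof.
move=> od; have C01 := od_C0 od; have g1 := od_g od.
have b0 := od_beta od; have gam0 := od_gam od.
pose mu := Num.min beta gam.
have mu0 : 0 < mu by rewrite lt_min b0 gam0.
have c0 : cc (0 : R) by rewrite /cc lexx ler01.
have bC : beta <= C0.
  have h := od_bC od 0 c0; rewrite expr0 mulr1 in h.
  apply: le_trans (od_bge od c0) _; exact: le_trans (ler_norm _) h.
have muC : mu <= C0 by rewrite ge_min bC.
have C00 : 0 < C0 by lra.
have g0 : 0 < g by lra.
pose t0 := mu / (4 * C0 * g).
have tg : t0 * g = mu / (4 * C0) by rewrite /t0; field; rewrite !gt_eqF.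
have tg2 : t0 * g <= 2^-1 by rewrite tg ler_pdivrMr ?mulr_gt0//; lra.
have t00 : 0 < t0 by rewrite divr_gt0// !mulr_gt0.
have tC : 2 * C0 * (t0 * g) = mu / 2 by rewrite tg; field; rewrite gt_eqF.
exists t0; split => //.
  by apply: (@le_trans _ _ (t0 * g)); [rewrite ler_peMr// ltW|lra].
move=> x hx.
have h1 := nb_geo (ltW t00) (ltW g0) tg2 (ltW C00).
split.
- by apply: h1 => n; exact: (od_bC od).
- by apply: h1 => n; exact: (od_rC od).
- by apply: h1 => n; exact: (od_fC od).
- apply: (nb_inv (ltW t00) (ltW g0) tg2 (ltW C00)) => //.
  + by move=> n; exact: (od_bC od).
  + exact: (od_bge od).
  + by rewrite tC ler_wpM2r ?invr_ge0// ge_min lexx.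
- apply: (nb_inv (ltW t00) (ltW g0) tg2 (ltW C00)) => //.
  + by move=> n; exact: (od_rC od).
  + exact: (od_rge od).
  + by rewrite tC ler_wpM2r ?invr_ge0// ge_min lexx orbT.
Qed.

Lemma nb_sum t C (T : nat -> nat -> R) M : 0 <= t ->
  (forall k, (k < M)%N -> nb t (C * 2^-1 ^+ k) (T k)) ->
  nb t (2 * C * (1 - 2^-1 ^+ M)) (fun n => \sum_(k < M) T k n).
Proof.
move=> t0; elim: M => [|M IH] hT.
  rewrite expr0 subrr mulr0 => N; rewrite big1// => i _.
  by rewrite big_ord0 normr0 mulr0.
rewrite (_ : (fun n => _) = fun n => \sum_(k < M) T k n + T M n); last first.
  by apply/funext => n; rewrite big_ord_recr.
have h := nb_add t0 (IH (fun k kM => hT k (ltnW kM))) (hT M (ltnSn M)).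
by apply: nb_le h; rewrite exprS; lra.
Qed.

Lemma half_pow_decay (J p : nat) : (0 < J)%N ->
  2^-1 ^+ (p %/ J) <= 2 * expR (- (ln 2 / J%:R) * p%:R) :> R.
Proof.
move=> J0; have ln20 : 0 < ln 2 :> R by rewrite ln_gt0// ltr1n.
have JR : 0 < J%:R :> R by rewrite ltr0n.
have pm : p%:R <= ((p %/ J).+1 * J)%:R :> R by rewrite ler_nat ltnW// ltn_ceil.
have : 2^-1 ^+ (p %/ J).+1 <= expR (- (ln 2 / J%:R) * p%:R) :> R.
  rewrite -[2^-1]lnK ?posrE ?invr_gt0// -expRM_natl ler_expR lnV ?posrE//.
  rewrite mulrN mulNr lerN2 mulrAC ler_pdivrMr// mulrC mulrAC.
  by rewrite -natrM ler_wpM2r// ltW.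
by rewrite exprS => h; rewrite mulrC -ler_pdivrMr// mulrC.
Qed.

(** [q] approximates the sum [U] of [M = p / J] terms, whose residual telescopes to [- r T_M]. The
    integer [J], fixed by [kap], keeps [e2 / d] small enough for the terms to be halved. *)
Lemma smooth_part b r f C0 g beta gam : ode_data b r f C0 g beta gam ->
  forall kap : R, 0 < kap -> exists sigma C : R, [/\ 0 < sigma, 0 < C &
  forall (p : nat) e1 e2, (0 < p)%N -> 0 < e1 -> e1 <= e2 ^+ 2 -> 0 < e2 -> e2 <= 1 ->
  kap * p%:R * e2 < 1 / 2 ->
  exists q : {poly R}, [/\ (size q <= p.+1)%N, `|q.[0]| <= C, `|q.[1]| <= C &
    forall x, oo 0 1 x ->
    `|- e1 * q^`()^`().[x] + e2 * b x 0%N * q^`().[x] + r x 0%N * q.[x] - f x 0%N|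
      <= C * expR (- sigma * p%:R)]].
Proof.
move=> od kap kap0; have [t0 [t00 t01 ht]] := ode_data_radius od.
have C01 := od_C0 od; have gam0 := od_gam od.
have C00 : 0 < C0 by lra.
have ti0 : 0 <= 2 / t0 by rewrite divr_ge0// ltW.
have [s1 [C1 [s10 C10 HP]]] := poly_approx_C2 ti0.
pose CT := 2 / gam * (2 * C0).
have CT0 : 0 < CT by rewrite mulr_gt0 ?divr_gt0// mulr_gt0.
(* Threshold for [e2 / d] in [nb_smooth_term]; the bound by 1 lets [(e2 / d)^2] be replaced by
   [e2 / d]. *)
pose y0 := gam / (16 * (C0 * 2 + 1)).
have y00 : 0 < y0 by rewrite divr_gt0// mulr_gt0// addr_gt0// mulr_gt0.
have [J0 hJ0 _] := @natr_ceil R ((kap * t0 * Num.min y0 1)^-1)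
   (ltac:(by rewrite invr_ge0 !mulr_ge0 ?le_min ?ltW)).
pose J := J0.+1.
have JR : (kap * t0 * Num.min y0 1)^-1 <= J%:R.
  by apply: le_trans hJ0 _; rewrite ler_nat.
have ln20 : 0 < ln 2 :> R by rewrite ln_gt0// ltr1n.
pose s2 := ln 2 / J%:R : R.
have s20 : 0 < s2 by rewrite divr_gt0.
pose s := Num.min s1 s2.
have s0 : 0 < s by rewrite lt_min s10 s20.
pose C := C0 * CT * 2 + 3 * C0 * (C1 * (2 * CT)) + C0 * 2 + 2 * CT.
have h01 := mulr_gt0 C00 CT0; have h02 := mulr_gt0 C00 (mulr_gt0 C10 CT0).
have C0p : 0 < C.
  by rewrite /C; lra.
exists s, C; split => // p e1 e2 p0 e10 e12 e20 e21 kpe.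
pose M := (p %/ J)%N.
have es1 : expR (- s1 * p%:R) <= expR (- s * p%:R).
  by rewrite ler_expR !mulNr lerN2 ler_wpM2r// ge_min lexx.
have hM : 2^-1 ^+ M <= 2 * expR (- s * p%:R) :> R.
  apply: le_trans (half_pow_decay p (ltn0Sn J0)) _.
  by rewrite ler_wpM2l// ler_expR !mulNr lerN2 ler_wpM2r// ge_min lexx orbT.
have e0p := expR_ge0 (- s * p%:R).
(* If [p < J] there is no term at all. Then [exp(- s p) >= 1 / 2], and [q = 0] is enough, with the
   bounded residual [- f]. *)
have [M0|M0] := posnP M.
  exists 0; split; rewrite ?size_poly0// ?horner0 ?normr0 ?(ltW C0p)//.
  move=> x /oo_cc hx; rewrite !deriv0 !horner0 !mulr0 !add0r normrN.
  have := od_fC od 0 hx; rewrite expr0 mulr1 => /le_trans; apply.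
  have h1 : 1 <= 2 * expR (- s * p%:R) by move: hM; rewrite M0 expr0.
  apply: (@le_trans _ _ (C0 * (2 * expR (- s * p%:R)))); first by rewrite ler_peMr// ltW.
  rewrite mulrA ler_wpM2r//.
  by rewrite /C; lra.
pose d := t0 / (2 * M%:R).
have M0R : 0 < M%:R :> R by rewrite ltr0n.
have d0 : 0 < d by rewrite divr_gt0// mulr_gt0.
have dE : t0 = 2 * d * M%:R by rewrite /d; field; rewrite gt_eqF.
have y1 : e2 / d <= Num.min y0 1.
  have -> : e2 / d = 2 * (M%:R * e2) / t0 by rewrite /d; field; rewrite !gt_eqF.
  rewrite ler_pdivrMr//.
  have mm : 0 < Num.min y0 1 by rewrite lt_min y00 ltr01.
  have hMp : M%:R * J%:R <= p%:R :> R by rewrite -natrM ler_nat leq_trunc_div.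
  have hj : 1 <= kap * t0 * Num.min y0 1 * J%:R.
    by rewrite -ler_pdivrMl ?mulr1// !mulr_gt0.
  have h2 : kap * (M%:R * J%:R) * e2 <= 1 / 2.
    apply: le_trans (ltW kpe); rewrite ler_wpM2r ?(ltW e20)// ler_wpM2l// ltW//.
  have h3 : (M%:R * e2) * 1 <= (M%:R * e2) * (kap * t0 * Num.min y0 1 * J%:R).
    by rewrite ler_wpM2l// mulr_ge0// ltW.
  have h4 := ler_wpM2l (ltW (mulr_gt0 t00 mm)) h2.
  rewrite [X in _ <= X](_ : _ = t0 * Num.min y0 1 * (kap * (M%:R * J%:R) * e2)) in h3; last by ring.
  by have := le_trans h3 h4; clear; lra.
have [y1a y1b] : e2 / d <= y0 /\ e2 / d <= 1 by move: y1; rewrite le_min => /andP.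
have small : 2 / gam * (e1 * (4 / d ^+ 2) + e2 * (2 * C0 * (2 / d))) <= 1 / 2.
  set y := e2 / d in y1a y1b; have yp : 0 <= y by rewrite divr_ge0// ltW.
  have h1 : e1 * (4 / d ^+ 2) <= 4 * y.
    apply: (@le_trans _ _ (e2 ^+ 2 * (4 / d ^+ 2))).
      by rewrite ler_wpM2r// divr_ge0// exprn_ge0// ltW.
    have -> : e2 ^+ 2 * (4 / d ^+ 2) = 4 * (y * y) by rewrite /y; field; rewrite gt_eqF.
    by rewrite ler_wpM2l// ler_piMr.
  have h2 : e2 * (2 * C0 * (2 / d)) = 4 * C0 * y by rewrite /y; field; rewrite gt_eqF.
  rewrite h2; apply: (@le_trans _ _ (2 / gam * ((4 + 4 * C0) * y0))).
    rewrite ler_wpM2l ?divr_ge0// ?(ltW gam0)//.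
    apply: (@le_trans _ _ ((4 + 4 * C0) * y)); first by rewrite [leRHS]mulrDl lerD2r.
    by rewrite ler_wpM2l//; clear -C00; lra.
  have -> : 2 / gam * ((4 + 4 * C0) * y0) = (C0 + 1) / (2 * (C0 * 2 + 1)).
    by rewrite /y0; field; rewrite !gt_eqF//; clear -C00; lra.
  by rewrite ler_pdivrMr; clear -C00; lra.
pose T x k := smooth_term e1 e2 (sinv (r x)) (b x) (f x) k.
have hT x k : cc x -> (k <= M)%N -> nb (t0 / 2) (CT * 2^-1 ^+ k) (T x k).
  move=> hx kM; have [hb hr hf hbi hri] := ht x hx.
  have h := nb_smooth_term d0 dE (ltW e10) (ltW e20) (ltW t00) hri hb hf small kM.
  apply: nb_mono h; first by rewrite divr_ge0// ltW.
  have : d * k%:R <= d * M%:R by rewrite ler_wpM2l ?(ltW d0)// ler_nat.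
  by move: dE; clear; lra.
have th : 0 <= t0 / 2 by rewrite divr_ge0// ltW.
have th' : 0 < t0 / 2 by rewrite divr_gt0.
pose U x n := \sum_(k < M) T x k n.
have nU x : cc x -> nb (t0 / 2) (2 * CT) (U x).
  move=> hx; have h := nb_sum th (fun k kM => hT x k hx (ltnW kM)).
  apply: nb_le h.
  have hh : 0 <= 2^-1 ^+ M :> R by rewrite exprn_ge0// invr_ge0.
  by have := mulr_ge0 (ltW CT0) hh; clear; lra.
have jri : jet cc (fun x => sinv (r x)).
  apply: jet_inv (od_r od) _ => x hx; rewrite gt_eqF//.
  by apply: lt_le_trans gam0 (od_rge od hx).
have jT k : jet cc (fun x => T x k) := jet_smooth_term e1 e2 k jri (od_b od) (od_f od).
have jU : jet cc U.
  move=> x hx n; rewrite /sder /U mulr_sumr; apply: is_derive_bigsum => k.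
  exact: jT.
have cU : {within `[0, 1], continuous (fun x => U x 0%N)}.
  apply: continuous_in_subspaceT => x; rewrite inE /= in_itv /= => hx.
  exact: jet_continuous jU hx.
have kap_t : (t0 / 2)^-1 = 2 / t0 by rewrite invf_div.
have UK x n : oo 0 1 x -> `|U x n| * (1 - 0) ^+ n <= 2 * CT * (2 / t0) ^+ n.
  move=> /oo_cc hx; rewrite subr0 expr1n mulr1 -kap_t.
  exact: nb_coef th' (nU x hx).
have z0 : `|U 0 0%N - U 0 0%N| <= 0 by rewrite subrr normr0.
have z1 : `|U 1 0%N - U 1 0%N| <= 0 by rewrite subrr normr0.
have [q [qp q0 q1 hq]] := HP (2 * CT) 0 U 0 1 (U 0 0%N) (U 1 0%N)
  (ltac:(by rewrite mulr_ge0// ltW)) (lexx 0) ltr01 (jet_sub_dom oo_cc jU) cU UK z0 z1 p p0.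
have CTC : 2 * CT <= C.
  by rewrite /C; clear -h01 h02 C00 CT0; lra.
have U0C x : cc x -> `|U x 0%N| <= 2 * CT.
  by move=> hx; have := nb_coef 0 th' (nU x hx); rewrite expr0 mulr1.
exists q; split => //.
- by rewrite q0; apply: le_trans (U0C 0 _) CTC; rewrite /cc lexx ler01.
- by rewrite q1; apply: le_trans (U0C 1 _) CTC; rewrite /cc lexx ler01.
move=> x hx; have := hq x hx; rewrite mulr0 addr0 subr0 !mulr1 expr1n mulr1.
set e := C1 * (2 * CT) * _ => -[h0 h1 h2].
have hxc := oo_cc hx.
(* Telescoping: [r T_0 = f] and [r T_(k+1) = e1 T_k'' - e2 b T_k']. *)
have LU : - e1 * (2 * U x 2%N) + e2 * b x 0%N * U x 1%N + r x 0%N * U x 0%N - f x 0%N =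
   - (r x 0%N * T x M 0%N).
  have r0 : r x 0%N != 0 by rewrite gt_eqF// (lt_le_trans gam0)// (od_rge od).
  have T00 : r x 0%N * T x 0%N 0%N = f x 0%N.
    by rewrite /T /= /smul big_ord1 sinv0 mulVKf.
  have TS k : r x 0%N * T x k.+1 0%N = e1 * (2 * T x k 2%N) - e2 * (b x 0%N * T x k 1%N).
    rewrite /T /= {1}/smul big_ord1 sinv0 mulVKf// -/(T x k) /sder /smul big_ord1 !mul1r.
    by [].
  rewrite /U; elim: (M) => [|k IH].
    by rewrite !big_ord0 T00; ring.
  rewrite !big_ord_recr /= TS; move: IH; set A := \sum_(i < k) _; clear; lra.
have TM : `|r x 0%N * T x M 0%N| <= C0 * (CT * (2 * expR (- s * p%:R))).
  rewrite normrM; apply: ler_pM => //.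
    by have := od_rC od 0 hxc; rewrite expr0 mulr1.
  have := nb_coef 0 th' (hT x M hxc (leqnn M)); rewrite expr0 mulr1 => /le_trans; apply.
  by rewrite ler_wpM2l// ltW.
have e0 : 0 <= e by apply: le_trans h0.
have bC : `|b x 0%N| <= C0 by have := od_bC od 0 hxc; rewrite expr0 mulr1.
have rC : `|r x 0%N| <= C0 by have := od_rC od 0 hxc; rewrite expr0 mulr1.
have e11 : e1 <= 1 by apply: le_trans e12 _; rewrite exprn_ile1// ltW.
have k1 : `|e1 * (2 * U x 2%N - q^`()^`().[x])| <= C0 * e.
  rewrite normrM (gtr0_norm e10); apply: ler_pM => //; first exact: ltW.
  by apply: le_trans e11 C01.
have k2 : `|e2 * (b x 0%N * (U x 1%N - q^`().[x]))| <= C0 * e.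
  rewrite normrM (gtr0_norm e20) -[leRHS]mul1r; apply: ler_pM => //; first exact: ltW.
  by rewrite normrM; apply: ler_pM.
have k3 : `|r x 0%N * (U x 0%N - q.[x])| <= C0 * e by rewrite normrM; apply: ler_pM.
have -> : - e1 * q^`()^`().[x] + e2 * b x 0%N * q^`().[x] + r x 0%N * q.[x] - f x 0%N =
  - (r x 0%N * T x M 0%N) + e1 * (2 * U x 2%N - q^`()^`().[x])
  - e2 * (b x 0%N * (U x 1%N - q^`().[x])) - r x 0%N * (U x 0%N - q.[x]).
  by rewrite -LU; ring.
apply: le_trans (ler_normB _ _) _; apply: le_trans (lerD (ler_normB _ _) k3) _.
apply: le_trans (lerD (lerD (ler_normD _ _) k2) (lexx _)) _.
rewrite normrN; apply: le_trans (lerD (lerD (lerD TM k1) (lexx _)) (lexx _)) _.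
have ee : C0 * e <= C0 * (C1 * (2 * CT)) * expR (- s * p%:R).
  by rewrite /e mulrA; apply: ler_wpM2l => //; clear -h02; lra.
have : 0 <= (C0 * 2 + 2 * CT) * expR (- s * p%:R).
  by apply: mulr_ge0 => //; clear -C00 CT0; lra.
rewrite /C; move: ee; set E := expR _; clear; lra.
Qed.

End SmoothPart.

(** * Layer function at the left end point *)

Section Layer.
Context {R : realType}.
Implicit Types (b r f : R -> nat -> R) (x : R).

(** Composition with the projection [clamp] of R onto [0, 1] gives a continuous function on R, so
    its primitive has two-sided derivatives also at 0 and 1. *)
Lemma antiderivative_cc (h : R -> R) : (forall x, cc x -> {for x, continuous h}) ->
  exists A : R -> R, forall x, cc x -> is_derive x 1 A (h x).
Proof.
move=> ch; pose clamp (x : R) := (`|x| - `|x - 1| + 1) / 2.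
have clamp_cc x : cc (clamp x).
  rewrite /clamp; apply/andP.
  by case: (ger0P x) => hx; case: (ger0P (x - 1)) => hx1; split; lra.
have clampE x : cc x -> clamp x = x.
  move=> /andP[x0 x1]; rewrite /clamp (ger0_norm x0) ler0_norm; first by field.
  by rewrite subr_le0.
have cclamp : continuous clamp.
  move=> x; apply: cvgM; last exact: cvg_cst.
  apply: cvgD; last exact: cvg_cst.
  apply: cvgB; first exact: norm_continuous.
  apply: cvg_norm; apply: cvgB; [exact: cvg_id|exact: cvg_cst].
pose hc := h \o clamp.
have chc : continuous hc.
  move=> x; apply: continuous_comp; first exact: cclamp.
  exact: ch.
exists (fun y => \int[lebesgue_measure]_(t in `[-1, y]) hc t) => x hx.
have /andP[x0 x1] := hx.
have i1 : lebesgue_measure.-integrable `[(-1 : R), 2] (EFin \o hc).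
  apply: continuous_compact_integrable; first exact: segment_compact.
  exact: continuous_subspaceT.
have [d1 d2] := @continuous_FTC1_closed R hc (-1) x 2 (ltac:(lra)) i1 (ltac:(lra)) (chc x).
apply: DeriveDef; first exact: d1.
by rewrite -derive1E d2 /hc /= clampE.
Qed.

(** [al], [CE] and [K] precede [kap], because [kap] is later chosen small in terms of [CE]; [c1] may
    depend on [kap]. For small [c1] the iterate [m] is a perturbation of [- r / b], hence at most
    [- al], and [E] decays on the scale [e2]. *)
Lemma layer_function b r f C0 g beta gam : ode_data b r f C0 g beta gam ->
  exists al CE K : R, [/\ 0 < al, 0 < CE, 0 <= K &
  forall kap : R, 0 < kap -> exists2 c1 : R, 0 < c1 &
  forall (p : nat) e1 e2, 0 < e1 -> 0 < e2 -> e2 <= 1 ->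
    e1 <= c1 * e2 ^+ 2 -> kap * p%:R * e2 < 1 / 2 ->
  exists Ej : R -> nat -> R, [/\ jet cc Ej, Ej 0 0%N = 1,
    forall x, cc x -> [/\ `|Ej x 0%N| <= expR (- (al * x / e2)),
      `|Ej x 1%N| <= CE / e2 * expR (- (al * x / e2)) &
      `|- e1 * (2 * Ej x 2%N) + e2 * b x 0%N * Ej x 1%N + r x 0%N * Ej x 0%N| <=
        CE * 2^-1 ^+ p] &
    forall x n h Lam, cc x -> 0 <= h -> h <= 1 -> h / e2 <= Lam ->
      `|Ej x n| * h ^+ n <= CE * expR (CE * Lam) * K ^+ n]].
Proof.
move=> od; have [t0 [t00 t01 ht]] := ode_data_radius od.
have C01 := od_C0 od; have gam0 := od_gam od; have beta0 := od_beta od.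
have C00 : 0 < C0 by lra.
pose CB := 2 / beta; pose CC := CB * (2 * C0).
have CB0 : 0 < CB by rewrite divr_gt0.
have CC0 : 0 < CC by apply: mulr_gt0 => //; exact: mulr_gt0.
pose al := gam / (2 * C0); have al0 : 0 < al by rewrite divr_gt0// mulr_gt0.
pose CE := 2 * CC + C0 * CC + expR 1.
have CE0 : 0 < CE by rewrite /CE; have := mulr_gt0 C00 CC0; have := expR_gt0 (1 : R); lra.
exists al, CE, (2 * (2 / t0)); split => //.
  by rewrite mulr_ge0// divr_ge0// ltW.
move=> kap kap0.
(* [c1 X] bounds [eta / d], [c1 Y] bounds [ep m^2 + eta m'], and [c1 Z] bounds the contraction
   factor of the Riccati iteration. *)
pose X := 2 / t0 * ((2 * kap)^-1 + 1).
have X0 : 0 < X by rewrite mulr_gt0 ?divr_gt0// addr_gt0// invr_gt0 mulr_gt0.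
pose Y := 4 * CC ^+ 2 + 4 * CC / t0.
have Y0 : 0 < Y by apply: addr_gt0; [apply: mulr_gt0 => //; exact: exprn_gt0|apply: divr_gt0 => //; exact: mulr_gt0].
pose Z := CB * (4 * CC + X).
have Z0 : 0 < Z by apply: mulr_gt0 => //; apply: addr_gt0 => //; exact: mulr_gt0.
pose c1 := Num.min (2 * Z)^-1 (gam / (2 * Y)).
have c10 : 0 < c1.
  by rewrite lt_min invr_gt0; apply/andP; split; [exact: mulr_gt0|apply: divr_gt0 => //; exact: mulr_gt0].
have c1Z : c1 * Z <= 1 / 2.
  apply: (@le_trans _ _ ((2 * Z)^-1 * Z)).
    by rewrite ler_wpM2r ?(ltW Z0)// ge_min lexx.
  by rewrite invfM mulrVK ?unitfE ?gt_eqF// div1r.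
have c1Y : c1 * Y <= gam / 2.
  apply: (@le_trans _ _ (gam / (2 * Y) * Y)).
    by rewrite ler_wpM2r ?(ltW Y0)// ge_min lexx orbT.
  by rewrite invfM mulrA mulrVK ?unitfE ?gt_eqF.
exists c1 => // p e1 e2 e10 e20 e21 e1c kpe.
pose ep := e1 / e2 ^+ 2; pose eta := e1 / e2.
have e2sq : 0 < e2 ^+ 2 by rewrite exprn_gt0.
have ep0 : 0 < ep by rewrite divr_gt0.
have eta0 : 0 < eta by rewrite divr_gt0.
have epc : ep <= c1 by rewrite ler_pdivrMr.
have etac : eta <= c1 * e2.
  by rewrite ler_pdivrMr// -mulrA -expr2.
(* At least one iteration, as the zeroth iterate is 0 and gives no decay; [malp] reads the sign off
   the last one. *)
pose M := p.+1; have M0 : 0 < M%:R :> R by rewrite ltr0n.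
pose d := t0 / (2 * M%:R).
have d0 : 0 < d by rewrite divr_gt0// mulr_gt0.
have dE : t0 = 2 * d * M%:R by rewrite /d; field; rewrite gt_eqF.
have etad : eta / d <= c1 * X.
  have -> : eta / d = 2 / t0 * (eta * M%:R) by rewrite /d; field; rewrite !gt_eqF.
  rewrite /X [leRHS]mulrCA ler_wpM2l ?divr_ge0 ?(ltW t00)//.
  apply: (@le_trans _ _ (c1 * e2 * M%:R)); first by rewrite ler_wpM2r// ltW.
  rewrite -[leLHS]mulrA ler_wpM2l ?(ltW c10)// /M -natr1 mulrDr mulr1 lerD//.
  by rewrite -div1r ler_pdivlMr ?mulr_gt0//; move: kpe; lra.
have small : CB * (ep * (4 * CC) + eta / d) <= 1 / 2.
  apply: le_trans c1Z; rewrite /Z [leRHS]mulrCA ler_wpM2l ?(ltW CB0)// [leRHS]mulrDr lerD//.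
  by rewrite ler_wpM2r// mulr_ge0// ltW.
pose m x k := riccati ep eta (sinv (b x)) (r x) k.
have th' : 0 < t0 / 2 by rewrite divr_gt0.
have half k : 0 <= 2^-1 ^+ k :> R by rewrite exprn_ge0// invr_ge0.
have hm x k : cc x -> (k <= M)%N -> nb (t0 / 2) (2 * CC) (m x k) /\
    nb (t0 / 2) (CC * 2^-1 ^+ k) (fun n => m x k.+1 n - m x k n).
  move=> hx kM; have [hb hr hf hbi hri] := ht x hx.
  have [h1 h2] := nb_riccati d0 dE (ltW ep0) (ltW eta0) (ltW t00) hbi hr small kM.
  have tk : t0 / 2 <= t0 - d * k%:R.
    have : d * k%:R <= d * M%:R by rewrite ler_wpM2l ?(ltW d0)// ler_nat.
    by move: dE; clear; lra.
  split; last exact: nb_mono (ltW th') tk h2.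
  apply: nb_le (nb_mono (ltW th') tk h1).
  rewrite -/CB -/CC; have := mulr_ge0 (ltW CC0) (half k); clear; lra.
have jbi : jet cc (fun x => sinv (b x)).
  apply: jet_inv (od_b od) _ => x hx; rewrite gt_eqF//.
  by apply: lt_le_trans beta0 (od_bge od hx).
have jm k : jet cc (fun x => m x k) := jet_riccati ep eta k jbi (od_r od).
have th2 : (t0 / 2)^-1 = 2 / t0 by rewrite invf_div.
have mc x k n : cc x -> (k <= M)%N -> `|m x k n| <= 2 * CC * (2 / t0) ^+ n.
  by move=> hx kM; have [h _] := hm x k hx kM; have := nb_coef n th' h; rewrite th2.
have bpos x : cc x -> 0 < b x 0%N by move=> hx; apply: lt_le_trans beta0 (od_bge od hx).
have mS x k : cc x -> b x 0%N * m x k.+1 0%N =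
    ep * m x k 0%N ^+ 2 + eta * m x k 1%N - r x 0%N.
  move=> hx; rewrite /m /= {1}/smul big_ord1 sinv0 mulVKf ?gt_eqF ?bpos//.
  by rewrite -/(m x k) /smul big_ord1 /sder mul1r.
have bC x : cc x -> b x 0%N <= C0.
  move=> hx; have := od_bC od 0 hx; rewrite expr0 mulr1; apply: le_trans.
  exact: ler_norm.
have malp x : cc x -> m x M 0%N <= - al.
  move=> hx; have h := mS x p hx.
  have h0 := mc x p 0%N hx (leqnSn p); rewrite expr0 mulr1 in h0.
  have h1 := mc x p 1%N hx (leqnSn p); rewrite expr1 in h1.
  have h2 : ep * m x p 0%N ^+ 2 <= c1 * (4 * CC ^+ 2).
    apply: ler_pM; rewrite ?(ltW ep0) ?sqr_ge0//.
    have -> : 4 * CC ^+ 2 = (2 * CC) ^+ 2 by ring.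
    by rewrite -real_normK ?num_real// lerXn2r// nnegrE mulr_ge0// ltW.
  have h3 : eta * m x p 1%N <= c1 * (4 * CC / t0).
    apply: (@le_trans _ _ (eta * `|m x p 1%N|)).
      by rewrite ler_wpM2l ?(ltW eta0)// ler_norm.
    apply: ler_pM; rewrite ?(ltW eta0)//.
      by apply: le_trans etac _; rewrite ler_piMr// ltW.
    by apply: le_trans h1 _; rewrite le_eqVlt; apply/orP; left; apply/eqP; field; rewrite gt_eqF.
  have h4 := od_rge od hx.
  have h5 : b x 0%N * m x M 0%N <= - (gam / 2).
    rewrite /M h; move: c1Y h3 h4; rewrite /Y mulrDr; move: h2; clear; lra.
  have h6 : b x 0%N * al <= gam / 2.
    apply: (@le_trans _ _ (C0 * al)); first by rewrite ler_wpM2r ?(ltW al0) ?bC.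
    by rewrite /al le_eqVlt; apply/orP; left; apply/eqP; field; rewrite gt_eqF.
  rewrite -(ler_pM2l (bpos x hx)) mulrN; clear -h5 h6; lra.
have [A dA] := antiderivative_cc (fun x hx => @jet_continuous R cc (fun x => m x M) 0%N x (jm M) hx).
pose E x := expR (e2^-1 * (A x - A 0)).
have c00 : cc (0 : R) by rewrite /cc lexx ler01.
have dE' x : cc x -> is_derive x 1 E (e2^-1 * m x M 0%N * E x).
  move=> hx.
  have h1 : is_derive x 1 (fun y => e2^-1 * (A y - A 0)) (e2^-1 * (m x M 0%N - 0)).
    by apply: is_deriveZ'; apply: is_deriveB'; exact: dA.
  have h2 := @is_derive1_comp _ expR (fun y => e2^-1 * (A y - A 0)) x _ _ (is_derive_expR _) h1.
  have -> : e2^-1 * m x M 0%N * E x =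
      expR (e2^-1 * (A x - A 0)) * (e2^-1 * (m x M 0%N - 0)).
    by rewrite subr0 mulrC.
  exact: h2.
pose Ej x := expjet e2^-1 (m x M) (E x).
have jE : jet cc Ej := jet_exp (jm M) dE'.
have Ej0 x : Ej x 0%N = E x by rewrite /Ej expjet0.
have Ej1 x : Ej x 1%N = e2^-1 * m x M 0%N * E x.
  by rewrite /Ej expjetS /smul big_ord1 expjet0 divr1 mulrA.
have Ej2 x : 2 * Ej x 2%N = e2^-1 * (m x M 0%N * Ej x 1%N + m x M 1%N * Ej x 0%N).
  rewrite {1}/Ej expjetS /smul -/(Ej x) big_ord_recr big_ord1 /=.
  by rewrite /Ej; field; rewrite gt_eqF.
have Ele x : cc x -> E x <= expR (- (al * x / e2)).
  move=> hx; rewrite /E ler_expR [leRHS](_ : _ = e2^-1 * (- al * x)); last by ring.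
  rewrite ler_wpM2l ?invr_ge0 ?(ltW e20)//.
  have /andP[] := hx; rewrite le_eqVlt => /predU1P[<- _|x0 x1].
    by rewrite subrr mulr0.
  have sub z : 0 <= z <= x -> cc z.
    by move=> /andP[z0 zx]; rewrite /cc z0 (le_trans zx x1).
  have [z hz e] := @mvt_cc R A (fun x => m x M 0%N) 0 x x0
     (fun z hz => dA z (sub z hz)).
  rewrite e subr0 ler_wpM2r ?(ltW x0)//.
  exact: malp (sub z hz).
have E0 x : 0 < E x by rewrite expR_gt0.
have E1 x : cc x -> E x <= 1.
  move=> hx; apply: le_trans (Ele x hx) _; rewrite -[leRHS]expR0 ler_expR oppr_le0.
  by move: hx => /andP[x0 _]; apply: divr_ge0; [apply: mulr_ge0 => //; exact: ltW|exact: ltW].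
exists Ej; split => //.
- by rewrite Ej0 /E subrr mulr0 expR0.
- move=> x hx; have h0 := mc x M 0%N hx (leqnn M); rewrite expr0 mulr1 in h0.
  have CE1 : 2 * CC <= CE.
    by rewrite /CE; have := mulr_gt0 C00 CC0; have := expR_gt0 (1 : R); clear; lra.
  split.
  + by rewrite Ej0 gtr0_norm// Ele.
  + rewrite Ej1 !normrM (gtr0_norm (E0 x)) ger0_norm ?invr_ge0 ?(ltW e20)//.
    apply: ler_pM; rewrite ?(ltW (E0 x)) ?Ele ?mulr_ge0 ?invr_ge0 ?(ltW e20)//.
    by rewrite mulrC ler_wpM2r ?invr_ge0 ?(ltW e20)// (le_trans h0).
  (* Up to sign, the residual of [E] is [E] times the Riccati residual of [m], which is [b] times
     the difference of two successive iterates. *)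
  + have -> : - e1 * (2 * Ej x 2%N) + e2 * b x 0%N * Ej x 1%N + r x 0%N * Ej x 0%N =
        - (b x 0%N * (m x M.+1 0%N - m x M 0%N)) * E x.
      rewrite mulrBr (mS x M hx) Ej2 Ej1 Ej0 /ep /eta; field.
      by rewrite gt_eqF.
    rewrite normrM normrN normrM (gtr0_norm (E0 x)) (gtr0_norm (bpos x hx)).
    have [_ hD] := hm x M hx (leqnn M).
    have h1 := nb_coef 0 th' hD; rewrite expr0 mulr1 in h1.
    apply: (@le_trans _ _ (C0 * (CC * 2^-1 ^+ M) * 1)).
      apply: ler_pM; rewrite ?mulr_ge0 ?(ltW (E0 x)) ?(ltW (bpos x hx)) ?E1//.
      by apply: ler_pM; rewrite ?(ltW (bpos x hx)) ?bC.
    rewrite mulr1 /M exprS.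
    have := half p => hp.
    have : C0 * CC * 2^-1 ^+ p <= CE * 2^-1 ^+ p.
      by rewrite ler_wpM2r// /CE; have := expR_gt0 (1 : R); clear -CC0; lra.
    have : 0 <= C0 * CC * 2^-1 ^+ p by apply: mulr_ge0 => //; exact: ltW (mulr_gt0 C00 CC0).
    by clear; lra.
- move=> x n h Lam hx h0 h1 hL.
  have hL0 : 0 <= h / e2 by rewrite divr_ge0// ltW.
  have [a ha1 ha2] := @natr_ceil R (2 * CC * (h / e2))
    (mulr_ge0 (mulr_ge0 (ler0n R 2) (ltW CC0)) hL0).
  have K1 : 1 <= 2 / t0 by rewrite ler_pdivlMr//; clear -t01; lra.
  have K0 : 0 <= 2 / t0 by exact: le_trans ler01 K1.
  pose t n := `|Ej x n| * h ^+ n.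
  have t0p : 0 <= t 0%N by rewrite mulr_ge0// exprn_ge0.
  have rec k : k.+1%:R * t k.+1 <= a%:R * (2 / t0) * \sum_(i < k.+1) (2 / t0) ^+ i * t (k - i)%N.
    pose S := \sum_(i < k.+1) (2 / t0) ^+ i * `|Ej x (k - i)%N|.
    have S0 : 0 <= S by apply: sumr_ge0 => i _; rewrite mulr_ge0// exprn_ge0.
    have hE : k.+1%:R * `|Ej x k.+1| <= e2^-1 * (2 * CC * S).
      have -> : k.+1%:R * `|Ej x k.+1| = e2^-1 * `|smul (m x M) (Ej x) k|.
        have -> : Ej x k.+1 = k.+1%:R^-1 * (e2^-1 * smul (m x M) (Ej x) k).
          by rewrite /Ej expjetS; field; rewrite nat1r pnatr_eq0 gt_eqF.
        rewrite [`|_ * (_ * _)|]normrM normfV normr_nat mulVKf ?pnatr_eq0//.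
        by rewrite [LHS]normrM ger0_norm// invr_ge0 ltW.
      rewrite ler_wpM2l ?invr_ge0 ?(ltW e20)//.
      apply: le_trans (ler_norm_sum _ _ _) _; rewrite /S mulr_sumr.
      apply: ler_sum => i _; rewrite normrM mulrA ler_wpM2r//.
      exact: mc.
    have hs : h ^+ k * S <= \sum_(i < k.+1) (2 / t0) ^+ i * t (k - i)%N.
      rewrite /S mulr_sumr; apply: ler_sum => i _.
      have ik : (i <= k)%N by rewrite -ltnS.
      rewrite /t mulrCA ler_wpM2l ?exprn_ge0// mulrC ler_wpM2l//.
      by rewrite -[in h ^+ k](subnKC ik) exprD ler_piMl ?exprn_ge0// exprn_ile1.
    have s0 : 0 <= h ^+ k * S by rewrite mulr_ge0// exprn_ge0.
    apply: (@le_trans _ _ (h / e2 * (2 * CC) * (h ^+ k * S))).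
      rewrite /t exprS; have := ler_wpM2r (mulr_ge0 h0 (exprn_ge0 k h0)) hE.
      have -> : k.+1%:R * `|Ej x k.+1| * (h * h ^+ k) = k.+1%:R * (`|Ej x k.+1| * (h * h ^+ k)) by ring.
      by move=> /le_trans; apply; rewrite le_eqVlt; apply/orP; left; apply/eqP; ring.
    apply: ler_pM => //.
      by apply: mulr_ge0 => //; apply: mulr_ge0 => //; exact: ltW.
    apply: (@le_trans _ _ a%:R); first by rewrite mulrC.
    by rewrite ler_peMr.
  have := majorant K0 t0p rec n; rewrite -/(t n) => /le_trans; apply.
  have t01' : t 0%N <= 1 by rewrite /t expr0 mulr1 Ej0 gtr0_norm// E1.
  rewrite exprD [X in _ <= _ * X]exprMn.
  have h2 : 2 ^+ a <= expR 1 * expR (CE * Lam).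
    apply: le_trans (exp2_le_expR a) _; rewrite -expRD ler_expR.
    apply: le_trans ha2 _; rewrite addrC lerD2l; apply: ler_pM => //.
      by rewrite mulr_ge0// ltW.
    by rewrite /CE; have := mulr_gt0 C00 CC0; have := expR_gt0 (1 : R); clear -CC0; lra.
  have h3 : expR 1 * expR (CE * Lam) <= CE * expR (CE * Lam).
    by rewrite ler_wpM2r ?expR_ge0// /CE; have := mulr_gt0 C00 CC0; clear -CC0; lra.
  have h4 : t 0%N * 2 ^+ a <= CE * expR (CE * Lam).
    apply: le_trans (le_trans h2 h3); rewrite -[leRHS]mul1r ler_wpM2r// exprn_ge0//.
  have -> : t 0%N * (2 ^+ a * 2 ^+ n) * (2 / t0) ^+ n = t 0%N * 2 ^+ a * (2 ^+ n * (2 / t0) ^+ n) by ring.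
  by rewrite ler_wpM2r// mulr_ge0 ?exprn_ge0.
Qed.

End Layer.

(** * Piecewise polynomials and weak derivatives *)

Section Pieces.
Context {R : realType}.
Implicit Types (a c t : R) (h : R -> R).

(* Unlike [bc], this is stable under concatenation of intervals. *)
Definition bm a c h : Prop := measurable_fun `]a, c[ h /\
  exists B, forall t, t \in `]a, c[ -> `|h t| <= B.

Lemma bc_bm a c h : bc a c h -> bm a c h.
Proof. by move=> [ch hB]; split => //; apply: bc_measurable. Qed.

Lemma bm_integrable a c h : bm a c h ->
  lebesgue_measure.-integrable `]a, c[ (EFin \o h).
Proof.
move=> [mh [B hB]]; apply: measurable_bounded_integrable => //.
- exact: lebesgue_itvoo_fin.
- exists B; split; first by rewrite num_real.
  move=> M BM t /= tac; apply: le_trans (hB _ tac) (ltW BM).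
Qed.

Lemma bm_cat a b c h : a < b -> b < c -> bm a b h -> bm b c h ->
  bm a c h /\ itg a c h = itg a b h + itg b c h.
Proof.
move=> ab bc' h1 h2; have [m1 [B1 hB1]] := h1; have [m2 [B2 hB2]] := h2.
have E : `]a, c[%classic = `]a, b]%classic `|` `]b, c[%classic :> set R.
  by rewrite -itv_bndbnd_setU// ?bnd_simp// ltW.
have m1' : measurable_fun `]a, b] h by apply/measurable_fun_itv_bndo_bndcP.
have mac : measurable_fun `]a, c[ h.
  by rewrite E; apply/measurable_funU.
have bac : bm a c h.
  split => //; exists (`|B1| + `|B2| + `|h b|) => t; rewrite in_itv /= => /andP[at_ tc].
  have [tb|bt|->] := ltgtP t b.
  - apply: le_trans (hB1 t _) _; first by rewrite in_itv /= at_ tb.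
    by apply: le_trans (ler_norm _) _; rewrite -addrA lerDl addr_ge0.
  - apply: le_trans (hB2 t _) _; first by rewrite in_itv /= bt tc.
    by apply: le_trans (ler_norm _) _; rewrite addrAC lerDr addr_ge0.
  - by rewrite lerDr addr_ge0.
split => //.
have i1 : itg a b h = \int[lebesgue_measure]_(t in `]a, b]) h t.
  by rewrite /itg Rintegral_itv_bndo_bndc//; exact: bm_integrable.
rewrite i1 /itg E Rintegral_setU//.
  by rewrite -E; exact: bm_integrable.
rewrite disj_set2E; apply/eqP; rewrite -subset0 => y [] /=.
by rewrite !in_itv /= => /andP[_ xb] /andP[bx _]; have := le_lt_trans xb bx; rewrite ltxx.
Qed.

Lemma bm_in_L2 a c h : bm a c h -> in_L2 a c h.
Proof.
move=> bmh; have [mh [B hB]] := bmh.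
apply/andP; split.
  rewrite inE /=; apply: (measurable_restrictT h _).1 => //.
rewrite inE /= /finite_norm unlock /=.
apply: poweR_lty.
rewrite [X in (X < _)%E](_ : _ = \int[lebesgue_measure]_(t in `]a, c[) (h t ^+ 2)%:E)%E.
  have : lebesgue_measure.-integrable `]a, c[ (EFin \o (fun t => h t ^+ 2)).
    apply: bm_integrable; split; first exact: measurable_funX.
    exists (B ^+ 2) => t tac; rewrite normrX lerXn2r// ?nnegrE ?hB//.
    exact: le_trans (hB t tac).
  exact: integrable_lty.
rewrite [RHS]integral_mkcond; apply: eq_integral => t _ /=.
rewrite !patchE; case: ifPn => _.
  by rewrite powR_mulrn// real_normK// num_real.
by rewrite normr0 powR0.
Qed.

End Pieces.

(** * Piecewise polynomials on a mesh and existence of weak derivatives *)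

Section Mesh.
Context {R : realType} (N : nat) (x : N.+1.-tuple R) (hx : mesh x).
Implicit Types (t : R) (j : 'I_N) (d : 'I_N -> {poly R}).

Let X (i : nat) : R := nth 0 x i.

Lemma xlE j : xl x j = X j.
Proof. by rewrite /xl (tnth_nth 0). Qed.

Lemma xrE j : xr x j = X j.+1.
Proof. by rewrite /xr (tnth_nth 0) /= /bump. Qed.

Lemma node_mono (i j : nat) : (i < j)%N -> (j <= N)%N -> X i < X j.
Proof.
move=> ij jN; have [_ _ so] := hx.
have tr : transitive (<%R : rel R) by move=> y z w; apply: lt_trans.
apply: (sorted_ltn_nth tr 0 so) => //; rewrite inE size_tuple //.
by rewrite ltnS (leq_trans (ltnW ij)).
Qed.

Lemma node_le (i j : nat) : (i <= j)%N -> (j <= N)%N -> X i <= X j.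
Proof.
by rewrite leq_eqVlt => /predU1P[->//|ij] jN; apply: ltW; apply: node_mono.
Qed.

Lemma node0 : X 0 = 0.
Proof. by have [h _ _] := hx; rewrite -h (tnth_nth 0). Qed.

Lemma nodeN : X N = 1.
Proof. by have [_ h _] := hx; rewrite -h (tnth_nth 0). Qed.

Lemma xl_lt_xr j : xl x j < xr x j.
Proof. by rewrite xlE xrE; exact: (node_mono (ltnSn j) (ltn_ord j)). Qed.

Lemma xl_ge0 j : 0 <= xl x j.
Proof. by rewrite xlE -node0; exact: (node_le (leq0n j) (ltnW (ltn_ord j))). Qed.

Lemma xr_le1 j : xr x j <= 1.
Proof. by rewrite xrE -nodeN; exact: (node_le (ltn_ord j) (leqnn N)). Qed.

Lemma elem_cc j t : xl x j <= t <= xr x j -> cc t.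
Proof.
by move=> /andP[h1 h2]; rewrite /cc (le_trans (xl_ge0 j) h1) (le_trans h2 (xr_le1 j)).
Qed.

Lemma elem_oo j t : t \in `]xl x j, xr x j[ -> oo 0 1 t.
Proof.
rewrite in_itv /= => /andP[h1 h2].
by rewrite /oo (le_lt_trans (xl_ge0 j) h1) (lt_le_trans h2 (xr_le1 j)).
Qed.

Lemma elem_disj i j t : t \in `]xl x i, xr x i[ -> t \in `]xl x j, xr x j[ -> i = j.
Proof.
rewrite !in_itv /= !xlE !xrE => /andP[i1 i2] /andP[j1 j2].
have [ij|ji|/val_inj //] := ltngtP i j.
  have := node_le ij (ltnW (ltn_ord j)) => h.
  by have := lt_trans i2 (le_lt_trans h j1); rewrite ltxx.
have := node_le ji (ltnW (ltn_ord i)) => h.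
by have := lt_trans j2 (le_lt_trans h i1); rewrite ltxx.
Qed.

Lemma itg_mesh (h : R -> R) : (forall j, bc (xl x j) (xr x j) h) ->
  bm 0 1 h /\ itg 0 1 h = \sum_j itg (xl x j) (xr x j) h.
Proof.
move=> bh.
have N0 : (0 < N)%N.
  by rewrite lt0n; apply/eqP => N0; have := nodeN; rewrite N0 node0 => /eqP; rewrite eq_sym oner_eq0.
have key k : (k < N)%N -> bm (X 0) (X k.+1) h /\
    itg (X 0) (X k.+1) h = \sum_(i < k.+1) itg (X i) (X i.+1) h.
  elim: k => [|k IH] kN.
    rewrite big_ord1; split => //; apply: bc_bm.
    by have := bh (Ordinal kN); rewrite xlE xrE.
  have [b1 e1] := IH (ltnW kN).
  have [|| b2 e2] := bm_cat _ _ b1 (bc_bm (ltac:(by have := bh (Ordinal kN); rewrite xlE xrE) :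
     bc (X k.+1) (X k.+2) h)).
  - exact: (node_mono (ltn0Sn k) (ltnW kN)).
  - exact: (node_mono (ltnSn k.+1) kN).
  by rewrite big_ord_recr /= -e1.
have [] := key N.-1 (ltac:(by rewrite prednK)).
rewrite (prednK N0) node0 nodeN => h1 ->; split => //.
by apply: eq_bigr => j _; rewrite xlE xrE.
Qed.

(** Glues element polynomials. The value at the nodes is 0, which neither integrals nor one-sided
    limits see. *)
Definition pwf d t : R := \sum_j (if t \in `]xl x j, xr x j[ then (d j).[t] else 0).

Lemma pwfE d j t : t \in `]xl x j, xr x j[ -> pwf d t = (d j).[t].
Proof.
move=> tj; rewrite /pwf (bigD1 j)//= tj big1 ?addr0// => i ij.
by case: ifP => // ti; move: ij; rewrite (elem_disj ti tj) eqxx.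
Qed.

Definition is_pw (v : R -> R) d : Prop :=
  forall j t, t \in `]xl x j, xr x j[ -> v t = (d j).[t].

Lemma bc_eq a c (f g : R -> R) : (forall t, t \in `]a, c[ -> f t = g t) ->
  bc a c g -> bc a c f.
Proof.
move=> fg [cg [B gB]]; split; last by exists B => t tac; rewrite fg ?gB.
move=> t tac; have nt : \forall s \near t, s \in `]a, c[ by exact: near_in_itvoo.
apply/cvgrPdist_lt => e e0.
have := cg t tac; move/cvgrPdist_lt => /(_ e e0) h.
rewrite fg//; near=> s; rewrite fg; last by near: s.
by near: s.
Unshelve. all: by end_near. Qed.

Lemma is_pw_bc v d j : is_pw v d -> bc (xl x j) (xr x j) v.
Proof.
by move=> hv; apply: (bc_eq (g := horner (d j))); [exact: hv|exact: bc_horner].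
Qed.

Lemma pwf_is_pw d : is_pw (pwf d) d.
Proof. by move=> j t; apply: pwfE. Qed.

Lemma piecewise_polyP (p : nat) (v : R -> R) : piecewise_poly x p v <->
  exists2 d : 'I_N -> {poly R}, (forall j, (size (d j) <= p.+1)%N) & is_pw v d.
Proof.
split; last by move=> [d sd hd] j; exists (d j) => // t; exact: hd.
move=> h; have H j : exists q : {poly R}, (size q <= p.+1)%N /\
    forall t, t \in `]xl x j, xr x j[ -> v t = q.[t].
  by have [q q1 q2] := h j; exists q.
have [d hd] := choice H.
by exists d => [j|j]; have [] := hd j.
Qed.

Lemma is_pw_in_W (p : nat) v d : (forall j, (size (d j) <= p.+1)%N) -> is_pw v d -> in_W x p v.
Proof.
move=> sd hd; split; last by apply/piecewise_polyP; exists d.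
by apply: bm_in_L2; have [] := itg_mesh (fun j => is_pw_bc j hd).
Qed.

Lemma is_pw_in_H1 v d j : is_pw v d -> in_H1 (xl x j) (xr x j) v.
Proof.
move=> hd; split.
- by apply: bm_in_L2; apply: bc_bm; exact: is_pw_bc hd.
- by have [] := is_pw_bc j hd.
exists (horner (d j)^`()).
  by apply: bm_in_L2; apply: bc_bm; exact: bc_horner.
move=> phi [dphi [a' [c' [aa cc' phi0]]]].
have ac := xl_lt_xr j.
have cphi : continuous phi.
  move=> t; apply: differentiable_continuous; apply/derivable1_diffP.
  exact: (dphi 0%N).
have cdphi : continuous (derive1 phi).
  move=> t; apply: differentiable_continuous; apply/derivable1_diffP.
  exact: (dphi 1%N).
have isd t : is_derive t 1 phi (derive1 phi t).
  by apply: DeriveDef; [exact: (dphi 0%N)|rewrite derive1E].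
have phia : phi (xl x j) = 0.
  by apply: phi0; rewrite in_itv /= leNgt aa.
have phic : phi (xr x j) = 0.
  by apply: phi0; rewrite in_itv /= [_ <= c']leNgt cc' andbF.
rewrite /inner -!/(itg _ _ _).
rewrite (@eq_itg _ _ _ _ (fun t => (d j).[t] * derive1 phi t)); last first.
  by move=> t tj; rewrite (hd _ _ tj).
have b1 : bc (xl x j) (xr x j) (fun t => (d j)^`().[t] * phi t).
  by apply: bcM; [exact: bc_horner|exact: bc_cont].
have b2 : bc (xl x j) (xr x j) (fun t => (d j).[t] * derive1 phi t).
  by apply: bcM; [exact: bc_horner|exact: bc_cont].
have := @itg_deriv _ (fun t => (d j).[t] * phi t)
  (fun t => (d j)^`().[t] * phi t + (d j).[t] * derive1 phi t) _ _ ac.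
rewrite phia phic !mulr0 subrr itgD// => h.
apply/eqP; rewrite -addr_eq0 addrC; apply/eqP; apply: h.
- by move=> t _; apply: is_deriveM' => //; exact: is_derive_horner.
- exact: bcD.
- apply: continuous_subspaceT => t; apply: continuousM; first exact: continuous_horner.
  exact: cphi.
Qed.

Lemma pw_in_V0 (p : nat) (v : broken R N) d : (forall j, (size (d j) <= p.+1)%N) -> is_pw v.1 d ->
  v.2 0 ord0 = 0 -> v.2 0 ord_max = 0 -> @in_V0 R N x p v.
Proof.
move=> sd hd v0 vN; split => //; split; last by apply/piecewise_polyP; exists d.
split; last by move=> j; apply: is_pw_in_H1 hd.
by apply: bm_in_L2; have [] := itg_mesh (fun j => is_pw_bc j hd).
Qed.

(** [wderiv] is a choice by [xget], meaningful once a weak derivative exists. Riesz representation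
    on each element, glued by [pwf], provides one; whichever is chosen coincides with polynomials
    inside the elements. *)
Lemma wderiv_spec n (v : broken R N) : (forall j, bc (xl x j) (xr x j) v.1) ->
  exists d, [/\ forall j, (size (d j) <= n.+1)%N, is_pw (wderiv x n v) d &
  forall j (q : {poly R}), (size q <= n.+1)%N ->
    itg (xl x j) (xr x j) (fun t => (d j).[t] * q.[t]) =
    - itg (xl x j) (xr x j) (fun t => v.1 t * q^`().[t])
    + v.2 0 (rnode j) * q.[xr x j] - v.2 0 (lnode j) * q.[xl x j]].
Proof.
move=> bv.
have H j : exists q0 : {poly R}, (size q0 <= n.+1)%N /\
  forall q : {poly R}, (size q <= n.+1)%N ->
    itg (xl x j) (xr x j) (fun t => q0.[t] * q.[t]) =
    - itg (xl x j) (xr x j) (fun t => v.1 t * q^`().[t])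
    + v.2 0 (rnode j) * q.[xr x j] - v.2 0 (lnode j) * q.[xl x j].
  have bq (q : {poly R}) : bc (xl x j) (xr x j) (fun t => v.1 t * q.[t]).
    by apply: bcM => //; exact: bc_horner.
  have [||d sd hd] := @poly_riesz R _ _ n.+1 (fun q =>
    - itg (xl x j) (xr x j) (fun t => v.1 t * q^`().[t])
    + v.2 0 (rnode j) * q.[xr x j] - v.2 0 (lnode j) * q.[xl x j]) (xl_lt_xr j).
  - move=> p q; rewrite derivD !hornerD.
    rewrite (@eq_itg _ _ _ _ (fun t => v.1 t * p^`().[t] + v.1 t * q^`().[t])).
      by rewrite itgD//; ring.
    by move=> t _; rewrite hornerD mulrDr.
  - move=> k p; rewrite derivZ !hornerZ.
    rewrite (@eq_itg _ _ _ _ (fun t => k * (v.1 t * p^`().[t]))).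
      by rewrite itgZ//; ring.
    by move=> t _; rewrite hornerZ mulrCA.
  by exists d.
have [d0 hd0] := choice H.
have ex : exists dd : R -> R, is_wderiv x n v dd.
  exists (pwf d0); split.
    by apply: is_pw_in_W (pwf_is_pw d0) => j; have [] := hd0 j.
  move=> j q qn; have [_ h] := hd0 j; rewrite -(h q qn).
  by apply: eq_itg => t tj; rewrite (pwfE _ tj).
have : is_wderiv x n v (wderiv x n v).
  rewrite /wderiv; case: xgetP => [d _ //|h].
  by case: ex => d hd; have := h d.
move=> [[_ /piecewise_polyP[d sd hd]] h2]; exists d; split => // j q qn.
rewrite -[RHS](h2 j q qn); apply: eq_itg => t tj.
by rewrite (hd _ _ tj).
Qed.

Lemma wderivc_spec (b db : R -> R) n (v : broken R N) :
  (forall t, cc t -> is_derive t 1 b (db t)) ->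
  (forall t, cc t -> {for t, continuous db}) ->
  (forall j, bc (xl x j) (xr x j) v.1) ->
  exists d, [/\ forall j, (size (d j) <= n.+1)%N, is_pw (wderivc x b n v) d &
  forall j (q : {poly R}), (size q <= n.+1)%N ->
    itg (xl x j) (xr x j) (fun t => (d j).[t] * q.[t]) =
    - itg (xl x j) (xr x j) (fun t => v.1 t * (db t * q.[t] + b t * q^`().[t]))
    + v.2 0 (rnode j) * (b (xr x j) * q.[xr x j])
    - v.2 0 (lnode j) * (b (xl x j) * q.[xl x j])].
Proof.
move=> dB cdb bv.
have cb t : cc t -> {for t, continuous b}.
  by move=> ct; exact: is_derive_continuous (dB t ct).
have bccc j (h : R -> R) : (forall t, cc t -> {for t, continuous h}) ->
    bc (xl x j) (xr x j) h.
  move=> ch; apply: bc_within; apply: continuous_in_subspaceT => t.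
  by rewrite inE /= in_itv /= => tj; apply: ch; exact: elem_cc tj.
have d1E (q : {poly R}) t : cc t ->
    derive1 (fun t => b t * q.[t]) t = db t * q.[t] + b t * q^`().[t].
  move=> ct; rewrite derive1E; apply: derive_val.
  by have /= := is_deriveM' (dB t ct) (is_derive_horner q t); rewrite [db t * _]mulrC.
have cco j t : t \in `]xl x j, xr x j[ -> cc t by move=> /elem_oo /oo_cc.
have H j : exists q0 : {poly R}, (size q0 <= n.+1)%N /\
  forall q : {poly R}, (size q <= n.+1)%N ->
    itg (xl x j) (xr x j) (fun t => q0.[t] * q.[t]) =
    - itg (xl x j) (xr x j) (fun t => v.1 t * (db t * q.[t] + b t * q^`().[t]))
    + v.2 0 (rnode j) * (b (xr x j) * q.[xr x j])
    - v.2 0 (lnode j) * (b (xl x j) * q.[xl x j]).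
  have bq (q : {poly R}) : bc (xl x j) (xr x j)
      (fun t => v.1 t * (db t * q.[t] + b t * q^`().[t])).
    apply: bcM => //; apply: bcD; apply: bcM; try exact: bc_horner; exact: bccc.
  have [||d sd hd] := @poly_riesz R _ _ n.+1 (fun q =>
    - itg (xl x j) (xr x j) (fun t => v.1 t * (db t * q.[t] + b t * q^`().[t]))
    + v.2 0 (rnode j) * (b (xr x j) * q.[xr x j])
    - v.2 0 (lnode j) * (b (xl x j) * q.[xl x j])) (xl_lt_xr j).
  - move=> p q; rewrite !hornerD.
    rewrite (@eq_itg _ _ _ _ (fun t => v.1 t * (db t * p.[t] + b t * p^`().[t])
       + v.1 t * (db t * q.[t] + b t * q^`().[t]))).
      by rewrite itgD//; ring.
    by move=> t _; rewrite derivD !hornerD; ring.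
  - move=> k p; rewrite !hornerZ.
    rewrite (@eq_itg _ _ _ _ (fun t => k * (v.1 t * (db t * p.[t] + b t * p^`().[t])))).
      by rewrite itgZ//; ring.
    by move=> t _; rewrite derivZ !hornerZ; ring.
  by exists d.
have [d0 hd0] := choice H.
have inE' j (q : {poly R}) : inner (xl x j) (xr x j) v.1 (derive1 (fun t => b t * q.[t])) =
    itg (xl x j) (xr x j) (fun t => v.1 t * (db t * q.[t] + b t * q^`().[t])).
  by apply: eq_itg => t tj; rewrite d1E//; exact: cco tj.
have ex : exists dd : R -> R, is_wderivc x b n v dd.
  exists (pwf d0); split.
    by apply: is_pw_in_W (pwf_is_pw d0) => j; have [] := hd0 j.
  move=> j q qn /=; have [_ h] := hd0 j; rewrite inE' -(h q qn).
  by apply: eq_itg => t tj; rewrite (pwfE _ tj).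
have : is_wderivc x b n v (wderivc x b n v).
  rewrite /wderivc; case: xgetP => [d _ //|h].
  by case: ex => d hd; have := h d.
move=> [[_ /piecewise_polyP[d sd hd]] h2]; exists d; split => // j q qn.
have := h2 j q qn; rewrite /= inE' => <-; apply: eq_itg => t tj.
by rewrite (hd _ _ tj).
Qed.

Lemma lim_left_within (h : R -> R) j : {within `[xl x j, xr x j], continuous h} ->
  forall v, (forall t, t \in `]xl x j, xr x j[ -> v t = h t) ->
  lim (v t @[t --> (xr x j)^'-]) = h (xr x j).
Proof.
move=> ch v vh; apply/cvg_lim => //.
have /(continuous_within_itvP _ (xl_lt_xr j))[_ _ h1] := ch.
apply: cvg_trans h1; apply: near_eq_cvg; near=> t; apply/esym/vh.
rewrite in_itv /=; apply/andP; split; near: t.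
  by apply: nbhs_left_gt; exact: xl_lt_xr.
exact: nbhs_left_lt.
Unshelve. all: by end_near. Qed.

Lemma lim_right_within (h : R -> R) j : {within `[xl x j, xr x j], continuous h} ->
  forall v, (forall t, t \in `]xl x j, xr x j[ -> v t = h t) ->
  lim (v t @[t --> (xl x j)^'+]) = h (xl x j).
Proof.
move=> ch v vh; apply/cvg_lim => //.
have /(continuous_within_itvP _ (xl_lt_xr j))[_ h1 _] := ch.
apply: cvg_trans h1; apply: near_eq_cvg; near=> t; apply/esym/vh.
rewrite in_itv /=; apply/andP; split; near: t.
  exact: nbhs_right_gt.
by apply: nbhs_right_lt; exact: xl_lt_xr.
Unshelve. all: by end_near. Qed.

Lemma jumpr_pw (v : broken R N) d j : is_pw v.1 d ->
  jumpr x v j = (d j).[xr x j] - v.2 0 (rnode j).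
Proof.
move=> hd; rewrite /jumpr (@lim_left_within (horner (d j)))//; last exact: hd.
exact/continuous_subspaceT/continuous_horner.
Qed.

Lemma jumpl_pw (v : broken R N) d j : is_pw v.1 d ->
  jumpl x v j = (d j).[xl x j] - v.2 0 (lnode j).
Proof.
move=> hd; rewrite /jumpl (@lim_right_within (horner (d j)))//; last exact: hd.
exact/continuous_subspaceT/continuous_horner.
Qed.

End Mesh.

(** * The weak Galerkin form *)

Lemma within_continuousM {R : realType} (A : set R) (f g : R -> R) :
  {within A, continuous f} -> {within A, continuous g} ->
  {within A, continuous (fun t => f t * g t)}.
Proof. by move=> cf cg x; apply: continuousM; [exact: cf|exact: cg]. Qed.

Section Element.
Context {R : realType}.
Variables (a c : R) (ac : a < c) (b db r : R -> R).
Hypothesis dB : forall t, a <= t <= c -> is_derive t 1 b (db t).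
Hypothesis bdb : bc a c db.
Hypothesis br : bc a c r.
Implicit Types (P W V D q : {poly R}) (t : R).

(* The contribution of one element to the bilinear form, with the weak
   derivatives of [P] eliminated by their definition; [D] is the weak derivative
   of [V] on the element. *)
Definition elem_form (e1 e2 pen : R) P (pr pl : R) V (vr vl : R) D : R :=
  e1 * (- itg a c (fun t => P.[t] * D^`().[t]) + pr * D.[c] - pl * D.[a])
  + e2 * (- itg a c (fun t => P.[t] * (db t * V.[t] + b t * V^`().[t]))
          + pr * (b c * V.[c]) - pl * (b a * V.[a]))
  + itg a c (fun t => r t * P.[t] * V.[t])
  + pen * ((P.[c] - pr) * (V.[c] - vr) + (P.[a] - pl) * (V.[a] - vl))
  + e2 * b c * (P.[c] - pr) * (V.[c] - vr).

Lemma elem_cb : {within `[a, c], continuous b}.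
Proof.
apply: continuous_in_subspaceT => t; rewrite inE /= in_itv /= => tj.
exact: is_derive_continuous (dB tj).
Qed.

Lemma elem_bcb : bc a c b.
Proof. exact: bc_within elem_cb. Qed.
Let bb := elem_bcb.

Lemma oo_cc_elem t : t \in `]a, c[ -> a <= t <= c.
Proof. by rewrite in_itv /= => /andP[h1 h2]; rewrite !ltW. Qed.

Lemma elem_formB e1 e2 pen P pr pl W wr wl V vr vl D :
  elem_form e1 e2 pen (P - W) (pr - wr) (pl - wl) V vr vl D =
  elem_form e1 e2 pen P pr pl V vr vl D - elem_form e1 e2 pen W wr wl V vr vl D.
Proof.
rewrite /elem_form.
rewrite (@eq_itg _ _ _ _ (fun t => P.[t] * D^`().[t] - W.[t] * D^`().[t])); last first.
  by move=> t _; rewrite hornerD hornerN mulrBl.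
rewrite itgB; [|by bcs|by bcs].
rewrite (@eq_itg _ _ _ (fun t => (P - W).[t] * (db t * V.[t] + b t * V^`().[t]))
  (fun t => P.[t] * (db t * V.[t] + b t * V^`().[t]) - W.[t] * (db t * V.[t] + b t * V^`().[t]))); last first.
  by move=> t _; rewrite hornerD hornerN mulrBl.
rewrite itgB; [|by bcs|by bcs].
rewrite (@eq_itg _ _ _ (fun t => r t * (P - W).[t] * V.[t])
  (fun t => r t * P.[t] * V.[t] - r t * W.[t] * V.[t])); last first.
  by move=> t _; rewrite hornerD hornerN; ring.
rewrite itgB; [|by bcs|by bcs].
rewrite !hornerD !hornerN; ring.
Qed.

Lemma itg_conv_parts W V :
  itg a c (fun t => W.[t] * (db t * V.[t] + b t * V^`().[t])) =
  W.[c] * (b c * V.[c]) - W.[a] * (b a * V.[a]) - itg a c (fun t => b t * W^`().[t] * V.[t]).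
Proof.
have := @itg_deriv _ (fun t => W.[t] * (b t * V.[t]))
  (fun t => W^`().[t] * (b t * V.[t]) + W.[t] * (db t * V.[t] + b t * V^`().[t])) a c ac.
move=> h; apply: (canRL (addrK _)); rewrite -[RHS]h.
- rewrite addrC -itgD; [|by bcs|by bcs].
  by apply: eq_itg => t _; ring.
- move=> t /oo_cc_elem tac; apply: (is_deriveM' (is_derive_horner W t)).
  exact: (is_deriveM' (dB tac) (is_derive_horner V t)).
- by bcs.
- have cp q : {within `[a, c], continuous (horner q)}.
    exact/continuous_subspaceT/continuous_horner.
  apply: (@within_continuousM _ _ (horner W) (fun t => b t * V.[t])) => //.
  apply: (@within_continuousM _ _ b (horner V)) => //; exact: elem_cb.
Qed.

(** If the node values are the traces of [W], the penalties vanish and integration by parts turns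
    both weak derivatives of [W] into [W']. *)
Lemma elem_form_conforming e1 e2 pen W V vr vl D :
  elem_form e1 e2 pen W W.[c] W.[a] V vr vl D =
  e1 * itg a c (fun t => W^`().[t] * D.[t])
  + e2 * itg a c (fun t => b t * W^`().[t] * V.[t])
  + itg a c (fun t => r t * W.[t] * V.[t]).
Proof.
rewrite /elem_form itg_poly_parts// itg_conv_parts !subrr; ring.
Qed.

(** Convection and its stabilization combine at the right end to
    [e2 b (V - vr)^2 / 2 + e2 b vr^2 / 2], and at the left end to
    [e2 b (V - vl)^2 / 2 - e2 b vl^2 / 2]. The pure node terms telescope over the mesh;
    [- e2 b' / 2] joins the reaction. *)
Lemma elem_form_diag e1 e2 pen V vr vl D :
  itg a c (fun t => D.[t] * D.[t]) =
    - itg a c (fun t => V.[t] * D^`().[t]) + vr * D.[c] - vl * D.[a] ->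
  elem_form e1 e2 pen V vr vl V vr vl D =
  e1 * itg a c (fun t => D.[t] * D.[t])
  + itg a c (fun t => (r t - e2 / 2 * db t) * (V.[t] * V.[t]))
  + pen * ((V.[c] - vr) ^+ 2 + (V.[a] - vl) ^+ 2)
  + e2 / 2 * b c * (V.[c] - vr) ^+ 2 + e2 / 2 * b a * (V.[a] - vl) ^+ 2
  + e2 / 2 * (b c * vr ^+ 2 - b a * vl ^+ 2).
Proof.
move=> hD; rewrite /elem_form hD.
rewrite (@eq_itg _ _ _ (fun t => (r t - e2 / 2 * db t) * (V.[t] * V.[t]))
  (fun t => r t * V.[t] * V.[t] - e2 / 2 * (db t * (V.[t] * V.[t])))); last first.
  by move=> t _; ring.
rewrite itgB; [|by bcs|by bcs]; rewrite itgZ; last by bcs.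
have e : 2 * itg a c (fun t => V.[t] * (db t * V.[t] + b t * V^`().[t])) =
   b c * (V.[c] * V.[c]) - b a * (V.[a] * V.[a]) + itg a c (fun t => db t * (V.[t] * V.[t])).
  have := itg_conv_parts V V.
  set X := itg _ _ _ => hX.
  have : X = itg a c (fun t => db t * (V.[t] * V.[t])) + itg a c (fun t => b t * V^`().[t] * V.[t]).
    rewrite -itgD; [|by bcs|by bcs].
    by apply: eq_itg => t _; ring.
  by move=> h; lra.
have -> : itg a c (fun t => V.[t] * (db t * V.[t] + b t * V^`().[t])) =
   (b c * (V.[c] * V.[c]) - b a * (V.[a] * V.[a]) + itg a c (fun t => db t * (V.[t] * V.[t]))) / 2.
  by rewrite -e; field.
by field.
Qed.

(** One element's share of the squared norm, without [|.|_J], which is dominated by the [S_c]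
    term. *)
Definition elem_norm2 (e1 e2 pen : R) V (vr vl : R) D : R :=
  e1 * itg a c (fun t => D.[t] * D.[t]) + itg a c (fun t => V.[t] * V.[t])
  + pen * ((V.[c] - vr) ^+ 2 + (V.[a] - vl) ^+ 2) + e2 * b c * (V.[c] - vr) ^+ 2.

(** The 1/2 in the minimum is the half of the outflow jump that survives in [elem_form_diag]. *)
Lemma elem_coercive e1 e2 pen gam V vr vl D :
  0 <= e1 -> 0 <= e2 -> 0 <= pen -> 0 < gam -> 0 <= b a -> 0 <= b c ->
  (forall t, a <= t <= c -> gam <= r t - e2 / 2 * db t) ->
  itg a c (fun t => D.[t] * D.[t]) =
    - itg a c (fun t => V.[t] * D^`().[t]) + vr * D.[c] - vl * D.[a] ->
  Num.min gam (1 / 2) * elem_norm2 e1 e2 pen V vr vl D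
    + e2 / 2 * (b c * vr ^+ 2 - b a * vl ^+ 2) <=
  elem_form e1 e2 pen V vr vl V vr vl D.
Proof.
move=> e10 e20 pen0 gam0 ba0 bc0 hg hD; rewrite elem_form_diag// /elem_norm2.
set k := Num.min _ _.
have kg : k <= gam by rewrite ge_min lexx.
have k2 : k <= 1 / 2 by rewrite ge_min lexx orbT.
have k0 : 0 < k by rewrite lt_min gam0; lra.
have D0 : 0 <= itg a c (fun t => D.[t] * D.[t]).
  by apply: itg_ge0 => t _; rewrite -expr2 sqr_ge0.
have V0 : k * itg a c (fun t => V.[t] * V.[t]) <=
    itg a c (fun t => (r t - e2 / 2 * db t) * (V.[t] * V.[t])).
  rewrite -itgZ; last by bcs.
  apply: itg_le; [by bcs|by bcs|] => t /oo_cc_elem tac.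
  apply: ler_wpM2r; first by rewrite -expr2 sqr_ge0.
  exact: le_trans kg (hg t tac).
have s1 := sqr_ge0 (V.[c] - vr); have s2 := sqr_ge0 (V.[a] - vl).
have h1 : k * (e1 * itg a c (fun t => D.[t] * D.[t])) <= 1 * (e1 * itg a c (fun t => D.[t] * D.[t])).
  apply: ler_wpM2r; first exact: mulr_ge0.
  by lra.
have h2 : k * (pen * ((V.[c] - vr) ^+ 2 + (V.[a] - vl) ^+ 2)) <=
   1 * (pen * ((V.[c] - vr) ^+ 2 + (V.[a] - vl) ^+ 2)).
  apply: ler_wpM2r; last by lra.
  by apply: mulr_ge0 => //; apply: addr_ge0.
have h3 : k * (e2 * b c * (V.[c] - vr) ^+ 2) <= 1 / 2 * (e2 * b c * (V.[c] - vr) ^+ 2).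
  by apply: ler_wpM2r => //; apply: mulr_ge0 => //; apply: mulr_ge0.
have h4 : 0 <= e2 / 2 * b a * (V.[a] - vl) ^+ 2.
  by apply: mulr_ge0 => //; apply: mulr_ge0 => //; lra.
rewrite !mulrDr; lra.
Qed.

(* Testing the weak derivative [DE] of [u - P] with itself. *)
Lemma elem_wderiv_le (u du : R -> R) W V (vr vl : R) D DE :
  (forall t, t \in `]a, c[ -> is_derive t 1 u (du t)) -> bc a c du ->
  {within `[a, c], continuous u} ->
  itg a c (fun t => D.[t] * DE.[t]) =
    - itg a c (fun t => V.[t] * DE^`().[t]) + vr * DE.[c] - vl * DE.[a] ->
  itg a c (fun t => DE.[t] * DE.[t]) =
    - itg a c (fun t => (u t - (V + W).[t]) * DE^`().[t])
    + (u c - (vr + W.[c])) * DE.[c] - (u a - (vl + W.[a])) * DE.[a] ->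
  itg a c (fun t => DE.[t] * DE.[t]) <=
  2 * itg a c (fun t => (du t - W^`().[t]) * (du t - W^`().[t]))
  + 2 * itg a c (fun t => D.[t] * D.[t]).
Proof.
move=> hu bdu cu hD hDE.
have bu := bc_within cu.
have cp q : {within `[a, c], continuous (horner q)}.
  exact/continuous_subspaceT/continuous_horner.
have e1 : itg a c (fun t => (du t - W^`().[t]) * DE.[t]) + itg a c (fun t => (u t - W.[t]) * DE^`().[t]) =
    (u c - W.[c]) * DE.[c] - (u a - W.[a]) * DE.[a].
  rewrite -itgD; [|by bcs|by bcs].
  apply: (@itg_deriv _ (fun t => (u t - W.[t]) * DE.[t])) => //.
  - move=> t tac; exact: (is_deriveM' (is_deriveB' (hu t tac) (is_derive_horner W t)) (is_derive_horner DE t)).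
  - by bcs.
  - apply: (@within_continuousM _ _ (fun t => u t - W.[t]) (horner DE)) => //.
    exact: (@within_continuousB _ _ _ _ u (horner W)).
have e2 : itg a c (fun t => (u t - (V + W).[t]) * DE^`().[t]) =
    itg a c (fun t => (u t - W.[t]) * DE^`().[t]) - itg a c (fun t => V.[t] * DE^`().[t]).
  rewrite -itgB; [|by bcs|by bcs].
  by apply: eq_itg => t _; rewrite hornerD; ring.
have e3 : itg a c (fun t => DE.[t] * DE.[t]) =
    itg a c (fun t => (du t - W^`().[t] - D.[t]) * DE.[t]).
  rewrite (@eq_itg _ _ _ (fun t => (du t - W^`().[t] - D.[t]) * DE.[t])
    (fun t => (du t - W^`().[t]) * DE.[t] - D.[t] * DE.[t])); last by move=> t _; ring.
  rewrite itgB; [|by bcs|by bcs].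
  by rewrite hDE e2 hD; lra.
have e4 : itg a c (fun t => (du t - W^`().[t] - D.[t]) * DE.[t]) <=
   itg a c (fun t => (du t - W^`().[t]) * (du t - W^`().[t])) + itg a c (fun t => D.[t] * D.[t])
   + 1 / 2 * itg a c (fun t => DE.[t] * DE.[t]).
  rewrite -itgZ; last by bcs.
  rewrite -itgD; [|by bcs|by bcs]; rewrite -itgD; [|by bcs|by bcs].
  apply: itg_le; [by bcs|by bcs|] => t _.
  move: (du t - _) (D.[t]) (DE.[t]) => X Y Z.
  have := sqr_ge0 (X + Y); have := sqr_ge0 (X - Y - Z); rewrite !expr2; lra.
by lra.
Qed.

End Element.

(** * Error equation on the whole mesh *)

Section Galerkin.
Context {R : realType} (N : nat) (x : N.+1.-tuple R) (hx : mesh x).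

Lemma sum_nodes (g : 'I_N.+1 -> R) :
  \sum_(j < N) (g (rnode j) - g (lnode j)) = g ord_max - g ord0.
Proof.
have H n (h : 'I_n.+1 -> R) :
    \sum_(j < n) (h (rnode j) - h (lnode j)) = h ord_max - h ord0.
  elim: n h => [|n IH] h; first by rewrite big_ord0 (_ : ord_max = ord0) ?subrr//; exact: val_inj.
  rewrite big_ord_recl.
  have := IH (fun i => h (lift ord0 i)).
  rewrite (_ : lift ord0 ord_max = ord_max); last exact: val_inj.
  rewrite (_ : \sum_(j < n) _ = \sum_(i < n) (h (rnode (lift ord0 i)) - h (lnode (lift ord0 i)))).
    move=> ->; rewrite (_ : rnode ord0 = lift ord0 ord0); last exact: val_inj.
    rewrite (_ : lnode ord0 = ord0); last exact: val_inj.
    by ring.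
  apply: eq_bigr => i _; congr (h _ - h _); exact: val_inj.
exact: H.
Qed.

Lemma penalty_ge0 e1 (p : nat) (j : 'I_N) : 0 <= e1 -> 0 <= penalty e1 p x j.
Proof.
move=> e10; apply: divr_ge0; last by rewrite subr_ge0 ltW// xl_lt_xr.
by apply: mulr_ge0 => //; exact: sqr_ge0.
Qed.

Lemma inner_pw (h g : R -> R) d (k : R -> R) (q : 'I_N -> {poly R}) :
  (forall j t, t \in `]xl x j, xr x j[ -> h t = k t * (d j).[t]) ->
  (forall j, bc (xl x j) (xr x j) k) -> is_pw x g q ->
  inner 0 1 h g = \sum_j itg (xl x j) (xr x j) (fun t => k t * (d j).[t] * (q j).[t]).
Proof.
move=> hd bk hq; have e j t : t \in `]xl x j, xr x j[ -> h t * g t = k t * (d j).[t] * (q j).[t].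
  by move=> tj; rewrite (hd _ _ tj) (hq _ _ tj).
have [|_ E] := itg_mesh hx (h := fun t => h t * g t).
  by move=> j; have := bk j => bkj; apply: bc_eq (e j) _; bcs.
by rewrite /inner -/(itg _ _ _) E; apply: eq_bigr => j _; apply: eq_itg; exact: e.
Qed.

Section Error.
Variables (e1 e2 gam : R) (p : nat) (b db r f : R -> R).
Hypothesis p_gt0 : (0 < p)%N.
Hypothesis e1_gt0 : 0 < e1.
Hypothesis e2_ge0 : 0 <= e2.
Hypothesis gam_gt0 : 0 < gam.
Hypothesis dB : forall t, cc t -> is_derive t 1 b (db t).
Hypothesis cdb : forall t, cc t -> {for t, continuous db}.
Hypothesis cr : forall t, cc t -> {for t, continuous r}.
Hypothesis cf : forall t, cc t -> {for t, continuous f}.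
Hypothesis b_ge0 : forall t, cc t -> 0 <= b t.
Hypothesis r_ge : forall t, cc t -> gam <= r t - e2 / 2 * db t.
Implicit Types (j : 'I_N) (P V W D DV : 'I_N -> {poly R}) (vb : 'rV[R]_N.+1).

Definition wg_norm2 V vb D : R := \sum_j elem_norm2 (xl x j) (xr x j) b e1 e2
  (penalty e1 p x j) (V j) (vb 0 (rnode j)) (vb 0 (lnode j)) (D j).

(** The contribution of one element to [(f, V) - A(W, V)] for a continuous [W]. *)
Definition residual V W D j : R :=
  itg (xl x j) (xr x j) (fun t => f t * (V j).[t])
  - e1 * itg (xl x j) (xr x j) (fun t => (W j)^`().[t] * (D j).[t])
  - e2 * itg (xl x j) (xr x j) (fun t => b t * (W j)^`().[t] * (V j).[t])
  - itg (xl x j) (xr x j) (fun t => r t * (W j).[t] * (V j).[t]).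

Definition is_pw_wderiv V vb D := forall j (q : {poly R}), (size q <= p)%N ->
  itg (xl x j) (xr x j) (fun t => (D j).[t] * q.[t]) =
    - itg (xl x j) (xr x j) (fun t => (V j).[t] * q^`().[t])
    + vb 0 (rnode j) * q.[xr x j] - vb 0 (lnode j) * q.[xl x j].

Lemma bc_elem j (h : R -> R) : (forall t, cc t -> {for t, continuous h}) ->
  bc (xl x j) (xr x j) h.
Proof.
move=> ch; apply: bc_within; apply: continuous_in_subspaceT => t.
by rewrite inE /= in_itv /= => tj; apply: ch; exact: (elem_cc hx tj).
Qed.

Lemma bilinear_formE (up v : broken R N) P V DV :
  (forall j, (size (P j) <= p.+1)%N) -> (forall j, (size (V j) <= p.+1)%N) ->
  is_pw x up.1 P -> is_pw x v.1 V ->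
  (forall j, (size (DV j) <= p)%N) -> is_pw x (wderiv x p.-1 v) DV ->
  bilinear_form e1 e2 b r p x up v =
  \sum_j elem_form (xl x j) (xr x j) b db r e1 e2 (penalty e1 p x j)
    (P j) (up.2 0 (rnode j)) (up.2 0 (lnode j)) (V j) (v.2 0 (rnode j)) (v.2 0 (lnode j)) (DV j).
Proof.
move=> sP sV hP hV sD hD; have pE : p.-1.+1 = p by rewrite prednK.
have [DP [_ hDP specD]] := wderiv_spec hx p.-1 (fun j => is_pw_bc j hP).
have [CP [_ hCP specC]] := wderivc_spec hx p dB cdb (fun j => is_pw_bc j hP).
have b1 j : bc (xl x j) (xr x j) (fun=> 1 : R) by exact: bc_cst.
rewrite /bilinear_form.
rewrite (@inner_pw _ _ DP (fun=> 1) DV)//; last by move=> j t tj; rewrite mul1r; exact: hDP.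
rewrite (@inner_pw _ _ CP (fun=> 1) V)//; last by move=> j t tj; rewrite mul1r; exact: hCP.
rewrite (@inner_pw _ _ P r V)//; [|by move=> j t tj; rewrite (hP _ _ tj)|by move=> j; exact: bc_elem].
rewrite /stab /stabc !mulr_sumr -!big_split /=; apply: eq_bigr => j _.
rewrite /elem_form !(jumpr_pw hx _ hP) !(jumpr_pw hx _ hV) !(jumpl_pw hx _ hP) !(jumpl_pw hx _ hV).
have eP s t : t \in `]xl x s, xr x s[ -> up.1 t = (P s).[t] by exact: hP.
congr (_ + _ + _ + _ + _).
- congr (_ * _); rewrite (@eq_itg _ _ _ _ (fun t => (DP j).[t] * (DV j).[t])); last by move=> t _; rewrite mul1r.
  rewrite specD ?pE//; congr (- _ + _ - _); apply: eq_itg => t tj.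
  by rewrite (eP j).
- congr (_ * _); rewrite (@eq_itg _ _ _ _ (fun t => (CP j).[t] * (V j).[t])); last by move=> t _; rewrite mul1r.
  rewrite specC//; congr (- _ + _ - _); apply: eq_itg => t tj.
  by rewrite (eP j).
Qed.

(** [V = u_p - W] is tested with itself; in the sum over the elements the node terms telescope to 0,
    as [vb] vanishes at both ends. Since [u] and [W] are continuous, the jumps of [u - u_p] are
    those of [V] up to sign. *)
Lemma wg_error_equation (u du : R -> R) (up : broken R N) W (wn : 'rV[R]_N.+1) :
  (forall t, oo 0 1 t -> is_derive t 1 u (du t)) -> bc 0 1 du ->
  {within `[0, 1], continuous u} ->
  is_galerkin_solution e1 e2 b r f p x up ->
  (forall j, (size (W j) <= p.+1)%N) ->
  (forall j, (W j).[xr x j] = wn 0 (rnode j)) ->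
  (forall j, (W j).[xl x j] = wn 0 (lnode j)) ->
  wn 0 ord0 = 0 -> wn 0 ord_max = 0 ->
  exists V D vb, [/\ (forall j, (size (V j) <= p.+1)%N) /\ (forall j, (size (D j) <= p)%N),
    vb 0 ord0 = 0 /\ vb 0 ord_max = 0, is_pw_wderiv V vb D,
    Num.min gam (1 / 2) * wg_norm2 V vb D <= \sum_j residual V W D j &
    energy_norm e1 e2 b p x (embed x u - up) <=
    Num.sqrt (2 * \sum_j (e1 * itg (xl x j) (xr x j)
        (fun t => (du t - (W j)^`().[t]) * (du t - (W j)^`().[t]))
      + itg (xl x j) (xr x j) (fun t => (u t - (W j).[t]) * (u t - (W j).[t])))
    + 2 * wg_norm2 V vb D)].
Proof.
move=> hu bdu cu [[[[L2up H1up] /piecewise_polyP[P sP hP]] up0 upN] gal] sW Wr Wl wn0 wnN.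
have pE : p.-1.+1 = p by rewrite prednK.
pose V j := P j - W j; pose vb := up.2 - wn.
have sV j : (size (V j) <= p.+1)%N.
  by apply: leq_trans (size_polyD _ _) _; rewrite geq_max size_polyN sP sW.
pose v : broken R N := (pwf x V, vb).
have hV : is_pw x v.1 V by exact: pwf_is_pw.
have [D [sD hD specD]] := wderiv_spec hx p.-1 (fun j => is_pw_bc j hV).
have vb0 : vb 0 ord0 = 0 by rewrite !mxE up0 wn0 subrr.
have vbN : vb 0 ord_max = 0 by rewrite !mxE upN wnN subrr.
have wD : is_pw_wderiv V vb D.
  move=> j q qp; rewrite specD ?pE//; congr (- _ + _ - _).
  by apply: eq_itg => t tj; rewrite (hV _ _ tj).
have sDp j : (size (D j) <= p)%N by have := sD j; rewrite pE.
exists V, D, vb; split => //.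
- have V0 : in_V0 x p v by exact: (pw_in_V0 hx sV hV).
  have := gal v V0; rewrite (bilinear_formE sP sV hP hV sDp hD).
  have b1 j : bc (xl x j) (xr x j) f by exact: bc_elem.
  have -> : inner 0 1 f v.1 = \sum_j itg (xl x j) (xr x j) (fun t => f t * (V j).[t]).
    rewrite (@inner_pw f v.1 (fun=> 1) f V)//; last by move=> j t _; rewrite hornerC mulr1.
    by apply: eq_bigr => j _; apply: eq_itg => t _; rewrite hornerC mulr1.
  rewrite [v.2]/= => E.
  have S j : Num.min gam (1 / 2) * elem_norm2 (xl x j) (xr x j) b e1 e2
      (penalty e1 p x j) (V j) (vb 0 (rnode j)) (vb 0 (lnode j)) (D j)
      + e2 / 2 * (b (tnth x (rnode j)) * vb 0 (rnode j) ^+ 2 - b (tnth x (lnode j)) * vb 0 (lnode j) ^+ 2) <=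
     elem_form (xl x j) (xr x j) b db r e1 e2 (penalty e1 p x j)
    (P j) (up.2 0 (rnode j)) (up.2 0 (lnode j)) (V j) (vb 0 (rnode j)) (vb 0 (lnode j)) (D j)
    - itg (xl x j) (xr x j) (fun t => f t * (V j).[t]) + residual V W D j.
    have lr := xl_lt_xr hx j.
    have dBj t : xl x j <= t <= xr x j -> is_derive t 1 b (db t) by move=> /(elem_cc hx)/dB.
    have bdbj := bc_elem j cdb; have brj := bc_elem j cr.
    have e10 := ltW e1_gt0.
    have ccl : cc (xl x j) by apply: (elem_cc hx (j := j)); rewrite lexx ltW.
    have ccr : cc (xr x j) by apply: (elem_cc hx (j := j)); rewrite lexx ltW.
    have := @elem_coercive _ _ _ lr b db r dBj bdbj brj e1 e2 (penalty e1 p x j) gam (V j)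
      (vb 0 (rnode j)) (vb 0 (lnode j)) (D j) e10 e2_ge0 (penalty_ge0 p j e10) gam_gt0
      (b_ge0 ccl) (b_ge0 ccr).
    move=> h; apply: le_trans (h _ (wD j (D j) (sDp j))) _.
      by move=> t /(elem_cc hx)/r_ge.
    rewrite {1}/V {1 2}/vb !mxE.
    rewrite (elem_formB dBj bdbj brj) -Wr -Wl (elem_form_conforming lr _ dBj bdbj).
    by rewrite /residual; lra.
  rewrite /wg_norm2 mulr_sumr.
  have : \sum_j (Num.min gam (1 / 2) * elem_norm2 (xl x j) (xr x j) b e1 e2
      (penalty e1 p x j) (V j) (vb 0 (rnode j)) (vb 0 (lnode j)) (D j)
      + e2 / 2 * (b (tnth x (rnode j)) * vb 0 (rnode j) ^+ 2 - b (tnth x (lnode j)) * vb 0 (lnode j) ^+ 2)) <=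
     \sum_j (elem_form (xl x j) (xr x j) b db r e1 e2 (penalty e1 p x j)
    (P j) (up.2 0 (rnode j)) (up.2 0 (lnode j)) (V j) (vb 0 (rnode j)) (vb 0 (lnode j)) (D j)
    - itg (xl x j) (xr x j) (fun t => f t * (V j).[t]) + residual V W D j).
    by apply: ler_sum => j _; exact: S.
  rewrite [leLHS]big_split [leRHS]big_split /= [X in _ <= X + _ -> _]sumrB E subrr add0r.
  rewrite -[X in _ + X <= _]mulr_sumr.
  rewrite (sum_nodes (fun i => b (tnth x i) * vb 0 i ^+ 2)) vb0 vbN expr0n /= !mulr0 subrr mulr0 addr0.
  by [].
rewrite /energy_norm; apply: ler_wsqrtr.
set w : broken R N := embed x u - up.
have w1 t : w.1 t = u t - up.1 t by [].
have w2 i : w.2 0 i = u (tnth x i) - up.2 0 i by rewrite !mxE.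
have cuj j : {within `[xl x j, xr x j], continuous u}.
  apply: continuous_subspaceW cu => t; rewrite /= !in_itv /=; exact: (elem_cc hx).
have cwj j : {within `[xl x j, xr x j], continuous (fun t => u t - (P j).[t])}.
  apply: (@within_continuousB _ _ _ _ u (horner (P j))) => //.
  exact/continuous_subspaceT/continuous_horner.
have wP j t : t \in `]xl x j, xr x j[ -> w.1 t = u t - (P j).[t].
  by move=> tj; rewrite w1 (hP _ _ tj).
have bw j : bc (xl x j) (xr x j) w.1.
  by apply: bc_eq (wP j) _; apply: bc_within.
have jr j : jumpr x w j = - ((V j).[xr x j] - vb 0 (rnode j)).
  rewrite /jumpr (lim_left_within hx (cwj j) (wP j)) w2 /V /vb hornerD hornerN !mxE -Wr -/(xr x j).
  by ring.
have jl j : jumpl x w j = - ((V j).[xl x j] - vb 0 (lnode j)).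
  rewrite /jumpl (lim_right_within hx (cwj j) (wP j)) w2 /V /vb hornerD hornerN !mxE -Wl -/(xl x j).
  by ring.
have [DE [sDE hDE specE]] := wderiv_spec hx p.-1 bw.
have b1 j : bc (xl x j) (xr x j) (fun=> 1 : R) by exact: bc_cst.
have [|_ E2] := itg_mesh hx (h := fun t => w.1 t * w.1 t).
  by move=> j; apply: bcM.
rewrite (@inner_pw _ _ DE (fun=> 1) DE)//; last by move=> j t tj; rewrite mul1r; exact: hDE.
rewrite /inner -/(itg _ _ _) E2.
rewrite /stab /stabc /jump_sqnorm /wg_norm2 !mulr_sumr -!big_split /=.
apply: ler_sum => j _.
have lr := xl_lt_xr hx j.
have ccr : cc (xr x j) by apply: (elem_cc hx (j := j)); rewrite lexx ltW.
have bduj : bc (xl x j) (xr x j) du.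
  by apply: bc_sub bdu; [exact: (xl_ge0 hx)|exact: (xr_le1 hx)].
have duj t : t \in `]xl x j, xr x j[ -> is_derive t 1 u (du t).
  by move=> /(elem_oo hx)/hu.
have buj := bc_within (cuj j).
have sDEp : (size (DE j) <= p)%N by have := sDE j; rewrite pE.
have VW : V j + W j = P j by exact: subrK.
have I1 := @elem_wderiv_le _ _ _ lr u du (W j) (V j) (vb 0 (rnode j)) (vb 0 (lnode j)) (D j) (DE j)
   duj bduj (cuj j) (wD j _ sDEp).
have {}I1 : itg (xl x j) (xr x j) (fun t => (DE j).[t] * (DE j).[t]) <=
    2 * itg (xl x j) (xr x j) (fun t => (du t - (W j)^`().[t]) * (du t - (W j)^`().[t]))
    + 2 * itg (xl x j) (xr x j) (fun t => (D j).[t] * (D j).[t]).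
  apply: I1; rewrite specE ?pE// !w2 Wr Wl VW /vb !mxE !subrK; congr (- _ + _ - _).
  by apply: eq_itg => t tj; rewrite (wP _ _ tj).
have I2 : itg (xl x j) (xr x j) (fun t => w.1 t * w.1 t) <=
   2 * itg (xl x j) (xr x j) (fun t => (u t - (W j).[t]) * (u t - (W j).[t]))
   + 2 * itg (xl x j) (xr x j) (fun t => (V j).[t] * (V j).[t]).
  rewrite (@eq_itg _ _ _ _ (fun t => (u t - (P j).[t]) * (u t - (P j).[t]))); last by move=> t tj; rewrite (wP j).
  rewrite -itgZ; [|by bcs]; rewrite -itgZ; [|by bcs]; rewrite -itgD; [|by bcs|by bcs].
  apply: itg_le; [by bcs|by bcs|] => t _; rewrite /V hornerD hornerN.
  move: (u t) (P j).[t] (W j).[t] => X Y Z.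
  have := sqr_ge0 ((X - Z) + (Y - Z)); rewrite expr2; lra.
rewrite /elem_norm2 jr jl.
rewrite (@eq_itg _ _ _ (fun t => 1 * _ * _) (fun t => (DE j).[t] * (DE j).[t])); last by move=> t _; rewrite mul1r.
have I3 := ler_wpM2l (ltW e1_gt0) I1.
have I4 : 0 <= penalty e1 p x j * (((V j).[xr x j] - vb 0 (rnode j)) ^+ 2 + ((V j).[xl x j] - vb 0 (lnode j)) ^+ 2).
  by apply: mulr_ge0; [exact: penalty_ge0 (ltW e1_gt0)|apply: addr_ge0; exact: sqr_ge0].
have I5 : 0 <= e2 * b (xr x j) * ((V j).[xr x j] - vb 0 (rnode j)) ^+ 2.
  by apply: mulr_ge0; [apply: mulr_ge0 => //; exact: b_ge0|exact: sqr_ge0].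
move: I2 I3 I4 I5; set i1 := itg _ _ _; set i2 := itg _ _ _; set i3 := itg _ _ _.
set i4 := itg _ _ _; set i5 := itg _ _ _; set i6 := itg _ _ _.
move: (penalty _ _ _ _) => pen; move: ((V j).[_] - _) ((V j).[_] - _) => J1 J2.
move: (e2 * _) => ebj.
rewrite [ebj * - J2 * - J2](_ : _ = ebj * J2 ^+ 2); last by ring.
(* The outflow jump occurs in [S_c] and once more in [|.|_J] with weight at most 1, hence at most
   twice. *)
rewrite !mulrNN -!expr2 !sqrrN; case: ifP => _; lra.
Qed.

End Error.
End Galerkin.

(** * Residual on the elements *)

Section Layer.
Context {R : realType}.

Lemma itg_bound_le (a c k m : R) (th g : R -> R) : a <= c -> 0 <= k -> 0 <= m ->
  bc a c th -> bc a c g -> (forall t, t \in `]a, c[ -> `|th t| <= k) ->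
  itg a c (fun t => g t * g t) <= m ^+ 2 ->
  `|itg a c (fun t => th t * g t)| <= k * Num.sqrt (c - a) * m.
Proof.
move=> ac k0 m0 bth bg hth hg; apply: itg_cauchy_le => //.
  by apply: mulr_ge0 => //; exact: sqrtr_ge0.
rewrite exprMn sqr_sqrtr ?subr_ge0// -itg_cst//; apply: itg_le; [by bcs|exact: bc_cst|].
by move=> t /hth h; rewrite -expr2 -real_normK ?num_real// lerXn2r ?nnegrE.
Qed.

Lemma ler_of_sqr (y z : R) : 0 <= z -> y ^+ 2 <= z ^+ 2 -> `|y| <= z.
Proof.
by move=> z0 h; rewrite -(ger0_norm z0) -!sqrtr_sqr ler_sqrt ?sqr_ge0.
Qed.

Variables (a c : R) (ac : a < c) (p : nat) (p0 : (0 < p)%N).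
Variables (e1 M : R) (V D : {poly R}) (vr vl : R).
Hypothesis e10 : 0 < e1.
Hypothesis M0 : 0 <= M.
Hypothesis sV : (size V <= p.+1)%N.
Hypothesis specD : forall q : {poly R}, (size q <= p)%N ->
  itg a c (fun t => D.[t] * q.[t]) =
    - itg a c (fun t => V.[t] * q^`().[t]) + vr * q.[c] - vl * q.[a].
Hypothesis DM : e1 * itg a c (fun t => D.[t] * D.[t]) <= M ^+ 2.
Hypothesis VM : itg a c (fun t => V.[t] * V.[t]) <= M ^+ 2.
Hypothesis JM : e1 * p%:R ^+ 2 / (c - a) * ((V.[c] - vr) ^+ 2 + (V.[a] - vl) ^+ 2) <= M ^+ 2.

Let h : R := c - a.
Let H : R := Num.sqrt (h / e1).

Let h0 : 0 < h. Proof. by rewrite subr_gt0. Qed.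
Let H0 : 0 <= H. Proof. exact: sqrtr_ge0. Qed.
Let H2 : H ^+ 2 = h / e1. Proof. by rewrite sqr_sqrtr// divr_ge0 ?ltW. Qed.
Let pR : 1 <= p%:R :> R. Proof. by rewrite ler1n. Qed.

Let jump_le (y z : R) : e1 * p%:R ^+ 2 / h * (y ^+ 2 + z ^+ 2) <= M ^+ 2 ->
  p%:R * `|y| <= H * M.
Proof.
move=> hyp; have {}hyp : e1 * p%:R ^+ 2 / h * y ^+ 2 <= M ^+ 2.
  apply: le_trans hyp; apply: ler_wpM2l; last by rewrite lerDl sqr_ge0.
  by apply: divr_ge0; [apply: mulr_ge0; [exact: ltW|exact: sqr_ge0]|exact: ltW].
rewrite -[p%:R](@ger0_norm _ (p%:R : R))// -normrM; apply: ler_of_sqr; first exact: mulr_ge0.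
rewrite exprMn [leRHS]exprMn H2.
have -> : p%:R ^+ 2 * y ^+ 2 = h / e1 * (e1 * p%:R ^+ 2 / h * y ^+ 2).
  by field; rewrite !gt_eqF.
by apply: ler_wpM2l => //; rewrite divr_ge0 ?ltW.
Qed.

Lemma jumpr_le : p%:R * `|V.[c] - vr| <= H * M.
Proof. exact: (jump_le JM). Qed.

Lemma jumpl_le : p%:R * `|V.[a] - vl| <= H * M.
Proof. by apply: (@jump_le _ (V.[c] - vr)); rewrite [_ ^+ 2 + _]addrC. Qed.

Let le_p (y z : R) : 0 <= y -> p%:R * y <= z -> y <= z.
Proof. by move=> y0; apply: le_trans; rewrite ler_peMl. Qed.

Let Dn : itg a c (fun t => D.[t] * D.[t]) <= (M / Num.sqrt e1) ^+ 2.
Proof. by rewrite exprMn exprVn sqr_sqrtr ?(ltW e10)// ler_pdivlMr// mulrC. Qed.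

Let HE : Num.sqrt h * (M / Num.sqrt e1) = H * M.
Proof. by rewrite /H sqrtrM ?(ltW h0)// sqrtrV ?(ltW e10)//; ring. Qed.

(** Testing [D] with 1 shows that its integral is [vr - vl]. In this way node values, absent from
    the norm, are reached from an end point where they vanish. *)
Lemma node_jump_le : `|vr - vl| <= H * M.
Proof.
have := specD (q := 1); rewrite size_poly1 => /(_ p0).
rewrite (@eq_itg _ _ _ (fun t => V.[t] * 1^`().[t]) (fun=> 0)); last first.
  by move=> t _; rewrite derivC horner0 mulr0.
rewrite itg_cst ?(ltW ac)// mul0r oppr0 add0r !hornerC !mulr1 => <-.
rewrite -[H * M]HE -[Num.sqrt h]mul1r.
rewrite (@eq_itg _ _ _ _ (fun t => 1 * D.[t])); last by move=> t _; rewrite mulrC hornerC.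
apply: itg_bound_le; rewrite ?(ltW ac)//.
- by apply: divr_ge0 => //; exact: sqrtr_ge0.
- exact: bc_cst.
- exact: bc_horner.
- by move=> t _; rewrite normr1.
Qed.

(** The norm controls [D], not [V']. Testing [D] with [V'] gives the squared norm of [V'] as the
    integral of [D V'] plus jumps times [V'] at the ends. The trace inequality for [V'] costs
    [p / sqrt h], which the penalty gives back: no power of [p] is lost. *)
Lemma deriv_itg_le (th : R -> R) k : 0 <= k -> bc a c th ->
  (forall t, t \in `]a, c[ -> `|th t| <= k) ->
  `|itg a c (fun t => th t * V^`().[t])| <= k * (3 * (H * M)).
Proof.
move=> k0 bth hth; pose m := Num.sqrt (itg a c (fun t => V^`().[t] * V^`().[t])).
have I0 : 0 <= itg a c (fun t => V^`().[t] * V^`().[t]).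
  by apply: itg_ge0 => t _; rewrite -expr2 sqr_ge0.
have m0 : 0 <= m by exact: sqrtr_ge0.
have m2 : m ^+ 2 = itg a c (fun t => V^`().[t] * V^`().[t]) by rewrite sqr_sqrtr.
have sV' : (size V^`() <= p)%N.
  by have := size_derivn_leq V 1; rewrite derivn1 => /leq_trans; apply; rewrite leq_subLR add1n.
have tr t : t \in [:: a; c] -> Num.sqrt h * `|V^`().[t]| <= p%:R * m.
  move=> tac; rewrite -[Num.sqrt h]ger0_norm ?sqrtr_ge0// -normrM.
  apply: ler_of_sqr; first exact: mulr_ge0.
  rewrite !exprMn sqr_sqrtr ?(ltW h0)// m2 mulrC; exact: trace_ineq ac tac sV'.
have key : Num.sqrt h * m <= 3 * (H * M).
  have [->|mn0] := eqVneq m 0; first by rewrite mulr0 !mulr_ge0.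
  have mp : 0 < m by rewrite lt_def mn0.
  have E : m ^+ 2 = itg a c (fun t => D.[t] * V^`().[t])
      + (V.[c] - vr) * V^`().[c] - (V.[a] - vl) * V^`().[a].
    by rewrite specD// (itg_poly_parts V V^`() ac) m2; ring.
  have h1 : `|itg a c (fun t => D.[t] * V^`().[t])| <= M / Num.sqrt e1 * m.
    apply: itg_cauchy_le => //; [|exact: bc_horner|exact: bc_horner|by rewrite m2].
    by apply: divr_ge0 => //; exact: sqrtr_ge0.
  have sh : 0 <= Num.sqrt h by exact: sqrtr_ge0.
  have jump (y v : R) : p%:R * `|y| <= H * M -> Num.sqrt h * `|v| <= p%:R * m ->
      Num.sqrt h * `|y * v| <= H * M * m.
    move=> h2 h3; rewrite normrM mulrCA; apply: le_trans (ler_wpM2l (normr_ge0 y) h3) _.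
    by rewrite mulrA [`|y| * _]mulrC; apply: ler_wpM2r.
  have h2 := jump _ _ jumpr_le (tr c (ltac:(by rewrite !inE eqxx orbT))).
  have h3 := jump _ _ jumpl_le (tr a (ltac:(by rewrite !inE eqxx))).
  have h4 := ler_wpM2l sh h1.
  rewrite -(ler_pM2r mp) -mulrA -expr2 E mulrBr mulrDr.
  rewrite mulrA HE in h4.
  apply: le_trans (ler_norm _) _; apply: le_trans (ler_normB _ _) _.
  have := ler_normD (Num.sqrt h * itg a c (fun t => D.[t] * V^`().[t]))
    (Num.sqrt h * ((V.[c] - vr) * V^`().[c])).
  by rewrite !normrM !(ger0_norm sh) -!normrM in h2 h3 h4 *; lra.
have := @itg_bound_le a c k m th (horner V^`()) (ltW ac) k0 m0 bth (bc_horner _ _ _) hth.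
rewrite m2 => /(_ (lexx _)) h1; apply: le_trans h1 _; rewrite -mulrA.
exact: ler_wpM2l.
Qed.

Lemma value_itg_le (th : R -> R) k : 0 <= k -> bc a c th -> h <= 1 ->
  (forall t, t \in `]a, c[ -> `|th t| <= k) ->
  `|itg a c (fun t => th t * V.[t])| <= k * M.
Proof.
move=> k0 bth h1 hth.
apply: le_trans (itg_bound_le (ltW ac) k0 M0 bth (bc_horner a c V) hth VM) _.
apply: ler_wpM2r => //; rewrite -[leRHS]mulr1; apply: ler_wpM2l => //.
by rewrite -sqrtr1 ler_sqrt// ler01.
Qed.

(* The convection and diffusion terms are integrated by parts, since the
   pointwise bound on [th1] only is of order [e2 / e1]. *)
Lemma layer_residual (e2 B Lam del : R) (b db r th0 th1 th2 : R -> R) :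
  0 < e2 -> e2 <= 1 -> 1 <= Lam -> 1 <= B -> 0 <= del -> h <= 1 ->
  h * e2 <= Lam * p%:R * e1 -> vr = 0 ->
  (forall t, a <= t <= c -> is_derive t 1 b (db t)) -> bc a c db -> bc a c r ->
  (forall t, t \in `]a, c[ -> [/\ `|b t| <= B, `|db t| <= B & `|r t| <= B]) ->
  (forall t, t \in `]a, c[ -> is_derive t 1 th0 (th1 t)) ->
  (forall t, t \in `]a, c[ -> is_derive t 1 th1 (th2 t)) ->
  bc a c th2 ->
  (forall t, t \in `]a, c[ -> `|th0 t| <= del /\ `|th1 t| <= e2 / e1 * del) ->
  `|itg a c (fun t => (- e1 * th2 t + e2 * b t * th1 t + r t * th0 t) * V.[t])|
   <= 14 * B * Lam * p%:R * del * M.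
Proof.
move=> e20 e21 Lam1 B1 del0 h1 hLam vr0 dB bdb br hB d0 d1 bth2 hth.
have eB := elem_bcb dB.
have bth1 : bc a c th1.
  split; first by move=> t tac; exact: is_derive_continuous (d1 t tac).
  by exists (e2 / e1 * del) => t /hth[].
have bth0 : bc a c th0.
  split; first by move=> t tac; exact: is_derive_continuous (d0 t tac).
  by exists del => t /hth[].
have bV q : bc a c (horner q) by exact: bc_horner.
(* [H = sqrt(h / e1)] is the price of passing from the energy norm to point values. Together with
   [e2] it stays below [Lam p], as [h] is at most of order [p e1 / e2]. *)
have HL : e2 * H <= Lam * p%:R.
  rewrite -[leLHS]ger0_norm ?mulr_ge0 ?(ltW e20)//.
  have Lp : 1 <= Lam * p%:R by apply: mulr_ege1.
  apply: ler_of_sqr; first by lra.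
  rewrite exprMn H2 expr2.
  have h2 : e2 * e2 * (h / e1) <= 1 * (h * e2 / e1).
    rewrite [leLHS](_ : _ = e2 * (h * e2 / e1)); last by ring.
    by apply: ler_wpM2r => //; rewrite divr_ge0 ?mulr_ge0// ltW.
  apply: le_trans h2 _; rewrite mul1r ler_pdivrMr//; apply: le_trans hLam _.
  by apply: ler_wpM2r; [exact: ltW|rewrite expr2 ler_peMl//; lra].
have HM0 : 0 <= H * M by exact: mulr_ge0.
(* Both end values of [V] are bounded starting from [vr = 0]: by the jump at [c], and by the
   difference of node values and the jump at [a]. *)
have Vc : `|V.[c]| <= H * M.
  by have := le_p (normr_ge0 _) jumpr_le; rewrite vr0 subr0.
have Va : `|V.[a]| <= 2 * (H * M).
  have h2 := le_p (normr_ge0 _) jumpl_le.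
  have h3 := node_jump_le; rewrite vr0 sub0r normrN in h3.
  rewrite -[V.[a]](subrK vl); apply: le_trans (ler_normD _ _) _; lra.
have I1 : `|itg a c (fun t => th2 t * V.[t] + th1 t * V^`().[t])| <= e2 / e1 * del * (3 * (H * M)).
  have := @itg_deriv_le _ (fun t => th1 t * V.[t]) (fun t => th2 t * V.[t] + th1 t * V^`().[t])
    (fun t => e2 / e1 * del * `|V.[t]|) a c ac.
  move=> h2; apply: le_trans (h2 _ _ _ _) _.
  - by move=> t tac; exact: is_deriveM' (d1 t tac) (is_derive_horner V t).
  - by bcs.
  - by move=> t /hth[_ h3]; rewrite normrM ler_wpM2r.
  - move=> t; apply: cvgM; first exact: cvg_cst.
    by apply: cvg_norm; exact: continuous_horner.
  rewrite -mulrDr; apply: ler_wpM2l; last by lra.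
  by rewrite mulr_ge0// divr_ge0 ?ltW.
have I2 := @deriv_itg_le th1 (e2 / e1 * del) (ltac:(by rewrite mulr_ge0// divr_ge0 ?ltW))
  bth1 (fun t tac => (hth t tac).2).
have I3 : `|itg a c (fun t => th1 t * (b t * V.[t]) + th0 t * (db t * V.[t] + b t * V^`().[t]))|
    <= del * B * (3 * (H * M)).
  have := @itg_deriv_le _ (fun t => th0 t * (b t * V.[t]))
    (fun t => th1 t * (b t * V.[t]) + th0 t * (db t * V.[t] + b t * V^`().[t]))
    (fun t => del * B * `|V.[t]|) a c ac.
  move=> h2; apply: le_trans (h2 _ _ _ _) _.
  - move=> t tac; apply: (is_deriveM' (d0 t tac)).
    exact: (is_deriveM' (dB t (oo_cc_elem tac)) (is_derive_horner V t)).
  - by bcs.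
  - move=> t tac; have [h3 _] := hth t tac; have [h4 _ _] := hB t tac.
    rewrite !normrM mulrA; apply: ler_wpM2r => //.
    by apply: ler_pM.
  - move=> t; apply: cvgM; first exact: cvg_cst.
    by apply: cvg_norm; exact: continuous_horner.
  rewrite -mulrDr; apply: ler_wpM2l; last by lra.
  by rewrite mulr_ge0//; lra.
have dB0 : 0 <= del * B by rewrite mulr_ge0//; lra.
have I4 : `|itg a c (fun t => th0 t * b t * V^`().[t])| <= del * B * (3 * (H * M)).
  apply: deriv_itg_le => //; first by bcs.
  move=> t tac; have [h3 _] := hth t tac; have [h4 _ _] := hB t tac.
  by rewrite normrM; apply: ler_pM.
have I5 : `|itg a c (fun t => th0 t * db t * V.[t])| <= del * B * M.
  apply: value_itg_le => //; first by bcs.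
  move=> t tac; have [h3 _] := hth t tac; have [_ h4 _] := hB t tac.
  by rewrite normrM; apply: ler_pM.
have I6 : `|itg a c (fun t => th0 t * r t * V.[t])| <= del * B * M.
  apply: value_itg_le => //; first by bcs.
  move=> t tac; have [h3 _] := hth t tac; have [_ _ h4] := hB t tac.
  by rewrite normrM; apply: ler_pM.
rewrite itgD in I1; [|by bcs|by bcs].
rewrite (@eq_itg _ _ _ _ (fun t => (th1 t * (b t * V.[t]) + th0 t * db t * V.[t]) +
  th0 t * b t * V^`().[t])) in I3; last by move=> t _; ring.
rewrite itgD in I3; [|by bcs|by bcs]; rewrite itgD in I3; [|by bcs|by bcs].
rewrite (@eq_itg _ _ _ _ (fun t => (- e1 * (th2 t * V.[t]) + e2 * (th1 t * (b t * V.[t]))) +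
  th0 t * r t * V.[t])); last by move=> t _; ring.
rewrite itgD; [|by bcs|by bcs]; rewrite itgD; [|by bcs|by bcs].
rewrite itgZ; [|by bcs]; rewrite itgZ; [|by bcs].
move: I1 I2 I3 I4 I5 I6.
set i1 := itg _ _ _; set i2 := itg _ _ _; set i3 := itg _ _ _.
set i4 := itg _ _ _; set i5 := itg _ _ _; set i6 := itg _ _ _ => I1 I2 I3 I4 I5 I6.
have A1 : e1 * `|i1| <= e2 * H * (6 * del * M).
  have -> : e2 * H * (6 * del * M) = e1 * (e2 / e1 * del * (6 * (H * M))).
    by field; rewrite gt_eqF.
  apply: ler_wpM2l; first exact: ltW.
  by have := ler_normB (i1 + i2) i2; rewrite addrK; lra.
have A2 : e2 * `|i3| <= e2 * H * (6 * B * del * M) + B * del * M.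
  have : `|i3| <= 6 * del * B * (H * M) + del * B * M.
    have h2 : i3 = (i3 + i4 + i5) - (i4 + i5) by ring.
    have := ler_normB (i3 + i4 + i5) (i4 + i5); rewrite -h2.
    by have := ler_normD i4 i5; lra.
  move=> h2; apply: le_trans (ler_wpM2l (ltW e20) h2) _.
  rewrite mulrDr; apply: lerD; first by rewrite le_eqVlt; apply/orP; left; apply/eqP; ring.
  by rewrite [B * del]mulrC ler_piMl// mulr_ge0.
have B0 : 0 <= B := le_trans ler01 B1.
have A3 : e2 * H * (6 * del * M) <= Lam * p%:R * (6 * del * M).
  by apply: ler_wpM2r => //; rewrite !mulr_ge0.
have A4 : e2 * H * (6 * B * del * M) <= Lam * p%:R * (6 * B * del * M).
  by apply: ler_wpM2r => //; rewrite !mulr_ge0.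
have Lp : 1 <= Lam * p%:R by apply: mulr_ege1.
have A5 : 1 * (B * del * M) <= Lam * p%:R * (B * del * M).
  by apply: ler_wpM2r => //; rewrite !mulr_ge0.
have A6 : 1 * (Lam * p%:R * del * M) <= B * (Lam * p%:R * del * M).
  by apply: ler_wpM2r => //; rewrite !mulr_ge0// (le_trans ler01).
have := ler_normD (- e1 * i1 + e2 * i3) i6; have := ler_normD (- e1 * i1) (e2 * i3).
rewrite !normrM normrN (gtr0_norm e10) (gtr0_norm e20).
by lra.
Qed.

End Layer.

(** * From residuals to the error *)

Section Assembly.
Context {R : realType}.

(** The definition of [D], tested with [W'], trades the integral of [W' D] for that of [V W'']. What
    is left is the strong residual of [W] and [e1 W'] times the node values. *)
Lemma residual_strong (a c e1 e2 vr vl : R) (b r f : R -> R) (p : nat) (W V D : {poly R}) :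
  a < c -> bc a c b -> bc a c r -> bc a c f -> (size W <= p.+1)%N ->
  (forall q : {poly R}, (size q <= p)%N ->
  itg a c (fun t => D.[t] * q.[t]) =
    - itg a c (fun t => V.[t] * q^`().[t]) + vr * q.[c] - vl * q.[a]) ->
  itg a c (fun t => f t * V.[t])
  - e1 * itg a c (fun t => W^`().[t] * D.[t])
  - e2 * itg a c (fun t => b t * W^`().[t] * V.[t])
  - itg a c (fun t => r t * W.[t] * V.[t]) =
  itg a c (fun t => (f t - (- e1 * W^`()^`().[t] + e2 * b t * W^`().[t] + r t * W.[t])) * V.[t])
  - e1 * (vr * W^`().[c] - vl * W^`().[a]).
Proof.
move=> ac bb br bf sW spec.
have sW' : (size W^`() <= p)%N.
  by have := size_derivn_leq W 1; rewrite derivn1 => /leq_trans; apply; rewrite leq_subLR add1n.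
rewrite (@eq_itg _ _ _ (fun t => W^`().[t] * D.[t]) (fun t => D.[t] * W^`().[t])); last by move=> t _; exact: mulrC.
rewrite (spec _ sW').
rewrite (@eq_itg _ _ _ (fun t => (f t - _) * V.[t]) (fun t => f t * V.[t] +
  e1 * (V.[t] * W^`()^`().[t]) - e2 * (b t * W^`().[t] * V.[t]) - r t * W.[t] * V.[t])); last by move=> t _; ring.
rewrite itgB; [|by bcs|by bcs]; rewrite itgB; [|by bcs|by bcs]; rewrite itgD; [|by bcs|by bcs].
rewrite itgZ; [|by bcs]; rewrite itgZ; [|by bcs].
by ring.
Qed.

(** For [n = sqrt N2], the inequality [m n^2 <= K del n] gives [n <= (K / m) del]; the linear
    constant in the conclusion dominates the square root. *)
Lemma energy_close (m K L N2 T S del en : R) : 0 < m -> 0 <= K -> 0 <= L -> 0 <= del ->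
  0 <= N2 -> m * N2 <= S -> S <= K * del * Num.sqrt N2 -> T <= L * del ^+ 2 ->
  en <= Num.sqrt (2 * T + 2 * N2) -> en <= (2 + 2 * L + 2 * (K / m)) * del.
Proof.
move=> m0 K0 L0 d0 N0 h1 h2 hT hen; set k := K / m.
have k0 : 0 <= k by rewrite divr_ge0// ltW.
have hs : Num.sqrt N2 <= k * del.
  have [s0|s0] := eqVneq (Num.sqrt N2) 0; first by rewrite s0 mulr_ge0.
  have sp : 0 < Num.sqrt N2 by rewrite lt_def s0 sqrtr_ge0.
  rewrite -(ler_pM2r sp) -expr2 sqr_sqrtr// [leRHS](_ : _ = K * del * Num.sqrt N2 / m); last first.
    by rewrite /k; ring.
  rewrite ler_pdivlMr// mulrC; exact: le_trans h1 h2.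
have hN : N2 <= (k * del) ^+ 2.
  by rewrite -{1}(sqr_sqrtr N0) lerXn2r// ?nnegrE ?sqrtr_ge0// mulr_ge0.
apply: le_trans hen _; rewrite -[leRHS]ger0_norm ?mulr_ge0//; last by lra.
rewrite -sqrtr_sqr; apply: ler_wsqrtr.
rewrite exprMn in hN; rewrite exprMn.
have : 2 * L * del ^+ 2 + 2 * k ^+ 2 * del ^+ 2 <= (2 + 2 * L + 2 * k) ^+ 2 * del ^+ 2.
  rewrite -mulrDl; apply: ler_wpM2r; first exact: sqr_ge0.
  have := mulr_ge0 L0 k0; have := sqr_ge0 k; have := sqr_ge0 L; rewrite !expr2; lra.
by lra.
Qed.

Section Norm.
Variables (N : nat) (x : N.+1.-tuple R) (hx : mesh x).
Variables (e1 e2 : R) (p : nat) (b : R -> R) (V D : 'I_N -> {poly R}) (vb : 'rV[R]_N.+1).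
Hypothesis e10 : 0 <= e1.
Hypothesis e20 : 0 <= e2.
Hypothesis b0 : forall t, cc t -> 0 <= b t.
Let N2 := wg_norm2 x e1 e2 p b V vb D.

Lemma wg_norm2_parts j : [/\ 0 <= N2,
  e1 * itg (xl x j) (xr x j) (fun t => (D j).[t] * (D j).[t]) <= Num.sqrt N2 ^+ 2,
  itg (xl x j) (xr x j) (fun t => (V j).[t] * (V j).[t]) <= Num.sqrt N2 ^+ 2 &
  e1 * p%:R ^+ 2 / (xr x j - xl x j) * (((V j).[xr x j] - vb 0 (rnode j)) ^+ 2
    + ((V j).[xl x j] - vb 0 (lnode j)) ^+ 2) <= Num.sqrt N2 ^+ 2].
Proof.
have sq i (q : {poly R}) : 0 <= itg (xl x i) (xr x i) (fun t => q.[t] * q.[t]).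
  by apply: itg_ge0 => t _; rewrite -expr2 sqr_ge0.
have pos i : [/\ 0 <= e1 * itg (xl x i) (xr x i) (fun t => (D i).[t] * (D i).[t]),
    0 <= itg (xl x i) (xr x i) (fun t => (V i).[t] * (V i).[t]),
    0 <= penalty e1 p x i * (((V i).[xr x i] - vb 0 (rnode i)) ^+ 2
     + ((V i).[xl x i] - vb 0 (lnode i)) ^+ 2) &
    0 <= e2 * b (xr x i) * ((V i).[xr x i] - vb 0 (rnode i)) ^+ 2].
  split; [exact: mulr_ge0|exact: sq| |].
    by apply: mulr_ge0; [exact: penalty_ge0|apply: addr_ge0; exact: sqr_ge0].
  apply: mulr_ge0; last exact: sqr_ge0.
  apply: mulr_ge0 => //; apply: b0; apply: (elem_cc hx (j := i)).
  by rewrite lexx ltW// xl_lt_xr.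
have tpos i : 0 <= elem_norm2 (xl x i) (xr x i) b e1 e2 (penalty e1 p x i) (V i)
    (vb 0 (rnode i)) (vb 0 (lnode i)) (D i).
  by have [h1 h2 h3 h4] := pos i; rewrite /elem_norm2; lra.
have N0 : 0 <= N2 by apply: sumr_ge0 => i _.
have le : elem_norm2 (xl x j) (xr x j) b e1 e2 (penalty e1 p x j) (V j)
    (vb 0 (rnode j)) (vb 0 (lnode j)) (D j) <= N2.
  by rewrite /N2 /wg_norm2 (bigD1 j)//= lerDl sumr_ge0.
have [h1 h2 h3 h4] := pos j.
split => //; rewrite sqr_sqrtr//; apply: le_trans le; rewrite /elem_norm2 /penalty in h3 *; lra.
Qed.

End Norm.

Lemma itg_sqr_sup (a c k : R) (g : R -> R) : a <= c -> c - a <= 1 -> bc a c g ->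
  (forall t, t \in `]a, c[ -> `|g t| <= k) -> itg a c (fun t => g t * g t) <= k ^+ 2.
Proof.
move=> ac h1 bg gk.
have h0 : 0 <= c - a by rewrite subr_ge0.
apply: le_trans (_ : k ^+ 2 * (c - a) <= _); last first.
  by rewrite -[leRHS]mulr1; apply: ler_wpM2l => //; exact: sqr_ge0.
rewrite -itg_cst//; apply: itg_le; [by bcs|exact: bc_cst|] => t tac.
have gt := gk t tac; have k0 := le_trans (normr_ge0 _) gt.
by rewrite -expr2 -real_normK ?num_real// lerXn2r ?nnegrE.
Qed.

End Assembly.

Definition jv {R : realType} (F : R -> nat -> R) (t : R) : R := F t 0%N.

(** * Elements at the outflow end *)

Section Cases.
Context {R : realType}.
Variables (b r f : R -> nat -> R) (C0 g beta gam : R).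
Hypothesis od : ode_data b r f C0 g beta gam.
Implicit Types (t : R).

Lemma jet_deriv D (F : R -> nat -> R) t : jet D F -> D t ->
  is_derive t 1 (jv F) (F t 1%N).
Proof. by move=> jF Dt; have := jF t Dt 0%N; rewrite /sder mul1r. Qed.

Lemma ode_data_sup t : cc t -> [/\ `|b t 0%N| <= C0 * g, `|b t 1%N| <= C0 * g,
  `|r t 0%N| <= C0 * g & `|f t 0%N| <= C0 * g].
Proof.
move=> ct; have C01 := od_C0 od; have g1 := od_g od.
have le : C0 <= C0 * g by rewrite ler_peMr//; lra.
by split; [have := od_bC od 0 ct|have := od_bC od 1 ct|have := od_rC od 0 ct|have := od_fC od 0 ct];
  rewrite ?expr0 ?expr1 ?mulr1 => h //; apply: le_trans h le.
Qed.

Lemma ode_sol_bc e1 e2 u du : 0 < e1 -> 0 < e2 -> e2 <= 1 -> 4 * e1 <= e2 ^+ 2 ->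
  ode_sol b r f e1 e2 u du -> bc 0 1 du.
Proof.
move=> e10 e20 e21 e12 os.
have ooP t : t \in `]0, 1[ -> oo 0 1 t by rewrite in_itv.
split; first by move=> t /ooP ht; exact: is_derive_continuous (os_dd os ht).
exists ((e2 * ((2 + 3 * C0 + C0 * g) * (C0 / gam) + C0)) / e1) => t /ooP ht.
rewrite ler_pdivlMr//; have := ode_dsol_bound od os e10 e20 e21 e12 ht.
by rewrite normrM (gtr0_norm e10) mulrC.
Qed.

Section Solution.
Variables (e1 e2 : R) (u du : R -> R) (p : nat).
Hypothesis p0 : (0 < p)%N.
Hypothesis e10 : 0 < e1.
Hypothesis e20 : 0 < e2.
Hypothesis e21 : e2 <= 1.
Hypothesis e12 : 4 * e1 <= e2 ^+ 2.
Hypothesis os : ode_sol b r f e1 e2 u du.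

(** [W] approximates [u] itself, with a derivative error of layer size [e2 / e1 * del]. The right
    node is the boundary point 1 or has node value 0 like it; the term at the left node is kept, to
    be combined with that of the neighbour. *)
Lemma layer_element a c (W V D : {poly R}) vl del Lam M : a < c -> 0 <= a -> c <= 1 ->
  (size W <= p.+1)%N -> (size V <= p.+1)%N ->
  (forall q : {poly R}, (size q <= p)%N ->
    itg a c (fun t => D.[t] * q.[t]) =
    - itg a c (fun t => V.[t] * q^`().[t]) + 0 * q.[c] - vl * q.[a]) ->
  0 <= M -> e1 * itg a c (fun t => D.[t] * D.[t]) <= M ^+ 2 ->
  itg a c (fun t => V.[t] * V.[t]) <= M ^+ 2 ->
  e1 * p%:R ^+ 2 / (c - a) * ((V.[c] - 0) ^+ 2 + (V.[a] - vl) ^+ 2) <= M ^+ 2 ->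
  0 <= del -> 1 <= Lam -> (c - a) * e2 <= Lam * p%:R * e1 ->
  (forall t, t \in `]a, c[ -> `|u t - W.[t]| <= del /\ `|du t - W^`().[t]| <= e2 / e1 * del) ->
  [/\ itg a c (fun t => jv f t * V.[t])
    - e1 * itg a c (fun t => W^`().[t] * D.[t])
    - e2 * itg a c (fun t => jv b t * W^`().[t] * V.[t])
    - itg a c (fun t => jv r t * W.[t] * V.[t])
    <= 14 * (C0 * g) * Lam * p%:R * del * M + e1 * vl * W^`().[a] &
  e1 * itg a c (fun t => (du t - W^`().[t]) * (du t - W^`().[t]))
    + itg a c (fun t => (u t - W.[t]) * (u t - W.[t])) <= 2 * Lam * p%:R * del ^+ 2].
Proof.
move=> ac a0 c1 sW sV spec M0 DM VM JM d0 Lam1 hL hth.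
have C01 := od_C0 od; have g1 := od_g od.
have Cg : 1 <= C0 * g by apply: mulr_ege1.
have oot t : t \in `]a, c[ -> oo 0 1 t.
  by rewrite in_itv /= => /andP[h1 h2]; rewrite /oo (le_lt_trans a0 h1) (lt_le_trans h2 c1).
have cct t : a <= t <= c -> cc t.
  by move=> /andP[h1 h2]; rewrite /cc (le_trans a0 h1) (le_trans h2 c1).
have h1 : c - a <= 1 by lra.
have cbc F n : jet cc F -> bc a c (fun t => F t n).
  move=> jF; apply: bc_within; apply: continuous_in_subspaceT => t.
  by rewrite inE /= in_itv /= => /cct; exact: jet_continuous.
have bb : bc a c (jv b) := cbc b 0%N (od_b od).
have br : bc a c (jv r) := cbc r 0%N (od_r od).
have bf : bc a c (jv f) := cbc f 0%N (od_f od).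
have bdb : bc a c (fun t => b t 1%N) := cbc b 1%N (od_b od).
have bdu : bc a c du by apply: bc_sub (ode_sol_bc e10 e20 e21 e12 os).
have bu : bc a c u.
  apply: bc_within; apply: continuous_subspaceW (os_cont os) => t /=.
  by rewrite !in_itv /= => /cct.
pose ddu t := e1^-1 * (e2 * (jv b t * du t) + jv r t * u t - jv f t).
have bddu : bc a c ddu.
  apply: bcM; first exact: bc_cst.
  by bcs.
have E := residual_strong e1 e2 ac bb br bf sW spec.
split.
  have h2 (X y z w : R) : X <= y -> X - e1 * (0 * w - vl * z) <= y + e1 * vl * z.
    by move=> Xy; rewrite mul0r sub0r mulrN opprK mulrA lerD2r.
  rewrite E; apply: h2; apply: le_trans (ler_norm _) _.
  rewrite (@eq_itg _ _ _ _ (fun t => (- e1 * (ddu t - W^`()^`().[t]) + e2 * jv b t * (du t - W^`().[t])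
    + jv r t * (u t - W.[t])) * V.[t])); last first.
    by move=> t _; rewrite /ddu; field; rewrite gt_eqF.
  apply: (@layer_residual R a c ac p p0 e1 M V D 0 vl e10 M0 sV spec DM VM JM e2 (C0 * g) Lam del
    (jv b) (fun t => b t 1%N) (jv r) (fun t => u t - W.[t]) (fun t => du t - W^`().[t])) => //.
  - by move=> t /cct ct; apply: jet_deriv (od_b od) ct.
  - by move=> t /oo_cc_elem/cct/ode_data_sup[].
  - by move=> t /oot ht; exact: (is_deriveB' (os_d os ht) (is_derive_horner W t)).
  - by move=> t /oot ht; exact: (is_deriveB' (os_dd os ht) (is_derive_horner W^`() t)).
  - by bcs.
have t1 : itg a c (fun t => (u t - W.[t]) * (u t - W.[t])) <= del ^+ 2.
  by apply: (itg_sqr_sup (g := fun t => u t - W.[t])) => //; [exact: ltW|bcs|move=> t /hth[]].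
have Lp : 1 <= Lam * p%:R by apply: mulr_ege1 => //; rewrite ler1n.
(* The derivative error is large pointwise, but [e1 (e2 / e1)^2] times the length of the element is
   at most [e2 Lam p]. *)
have t2 : e1 * itg a c (fun t => (du t - W^`().[t]) * (du t - W^`().[t])) <= Lam * p%:R * del ^+ 2.
  have h2 : itg a c (fun t => (du t - W^`().[t]) * (du t - W^`().[t])) <=
     (e2 / e1 * del) ^+ 2 * (c - a).
    rewrite -itg_cst ?(ltW ac)//; apply: itg_le; [by bcs|exact: bc_cst|] => t /hth[_ h2].
    rewrite -expr2 -real_normK ?num_real// lerXn2r ?nnegrE//.
    by rewrite mulr_ge0// divr_ge0 ?ltW.
  apply: le_trans (ler_wpM2l (ltW e10) h2) _.
  rewrite [leLHS](_ : _ = e2 * ((c - a) * e2 / e1) * del ^+ 2); last by field; rewrite gt_eqF.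
  apply: ler_wpM2r; first exact: sqr_ge0.
  have h3 : (c - a) * e2 / e1 <= Lam * p%:R by rewrite ler_pdivrMr.
  apply: le_trans h3; rewrite ler_piMl// divr_ge0 ?(ltW e10)// mulr_ge0 ?(ltW e20)//; lra.
have : 1 * del ^+ 2 <= Lam * p%:R * del ^+ 2 by apply: ler_wpM2r => //; exact: sqr_ge0.
lra.
Qed.

End Solution.

Lemma error_one_element gam0 Lam : 0 < gam0 -> 1 <= Lam -> exists2 C : R, 0 < C &
  forall (p : nat) e1 e2 (x : 2.-tuple R) u du up (W : {poly R}) del,
  (0 < p)%N -> 0 < e1 -> 0 < e2 -> e2 <= 1 -> 4 * e1 <= e2 ^+ 2 ->
  (forall t, cc t -> gam0 <= r t 0%N - e2 / 2 * b t 1%N) ->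
  mesh x -> x = [:: 0; 1] :> seq R -> e2 <= Lam * p%:R * e1 ->
  ode_sol b r f e1 e2 u du ->
  is_galerkin_solution e1 e2 (jv b) (jv r) (jv f) p x up ->
  (size W <= p.+1)%N -> W.[0] = 0 -> W.[1] = 0 -> 0 <= del ->
  (forall t, oo 0 1 t -> `|u t - W.[t]| <= del /\ `|du t - W^`().[t]| <= e2 / e1 * del) ->
  energy_norm e1 e2 (jv b) p x (embed x u - up) <= C * p%:R * del.
Proof.
move=> gam00 Lam1; pose m := Num.min gam0 (1 / 2).
have m0 : 0 < m by rewrite lt_min gam00; lra.
have C01 := od_C0 od; have g1 := od_g od; have Cg : 1 <= C0 * g by apply: mulr_ege1.
have Cgm : 0 <= C0 * g / m by rewrite divr_ge0 ?(ltW m0)//; lra.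
exists (2 + 2 * (2 * Lam) + 2 * (14 * (C0 * g) * Lam / m)).
  rewrite [14 * _ * _ / m](_ : _ = 14 * Lam * (C0 * g / m)); last by ring.
  have : 0 <= 14 * Lam * (C0 * g / m) by apply: mulr_ge0 => //; lra.
  by lra.
move=> p e1 e2 x u du up W del p0 e10 e20 e21 e12 hg hx xE hL os gal sW W0 W1 d0 hth.
have XL : xl x ord0 = 0 by rewrite xlE xE.
have XR : xr x ord0 = 1 by rewrite xrE xE.
have dB t : cc t -> is_derive t 1 (jv b) (b t 1%N) by exact: jet_deriv (od_b od).
have cB n t : cc t -> {for t, continuous (fun s => b s n)} by exact: jet_continuous (od_b od).
have cR n t : cc t -> {for t, continuous (fun s => r s n)} by exact: jet_continuous (od_r od).
have cF n t : cc t -> {for t, continuous (fun s => f s n)} by exact: jet_continuous (od_f od).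
have b0 t : cc t -> 0 <= jv b t.
  by move=> ct; apply: le_trans (ltW (od_beta od)) (od_bge od ct).
have [V [D [vb [[sV sD] [vb0 vbN] spec coer en]]]] := @wg_error_equation R 1 x hx e1 e2 gam0 p
  (jv b) (fun t => b t 1%N) (jv r) (jv f) p0 e10 (ltW e20) gam00 dB (cB 1%N) (cR 0%N) (cF 0%N) b0 hg
  u du up (fun=> W) 0 (fun t ht => os_d os ht) (ode_sol_bc e10 e20 e21 e12 os) (os_cont os) gal
  (fun=> sW)
  (ltac:(by move=> j; rewrite (ord1 j) XR mxE))
  (ltac:(by move=> j; rewrite (ord1 j) XL mxE))
  (ltac:(by rewrite mxE)) (ltac:(by rewrite mxE)).
have [N0 DM VM JM] := wg_norm2_parts hx p V D vb (ltW e10) (ltW e20) b0 ord0.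
have r0 : rnode (ord0 : 'I_1) = ord_max by exact: val_inj.
have l0 : lnode (ord0 : 'I_1) = ord0 by exact: val_inj.
have spec0 := spec ord0.
rewrite r0 l0 vb0 vbN XL XR in DM VM JM spec0.
rewrite !big_ord1 /residual XL XR -/(jv f) in en coer.
have [||h1 h2] := layer_element p0 e10 e20 e21 e12 os (a := 0) (c := 1) (M := Num.sqrt (wg_norm2 x e1 e2 p (jv b) V vb D))
   (ltr01) (lexx _) (lexx _) sW (sV ord0) spec0 (sqrtr_ge0 _) DM VM JM d0 Lam1.
- by rewrite subr0 mul1r.
- by move=> t; rewrite in_itv /=; exact: hth.
rewrite -/m in coer.
have p1 : 1 <= p%:R :> R by rewrite ler1n.
have Lam0 : 0 <= Lam := le_trans ler01 Lam1.
rewrite -mulrA; apply: (@energy_close _ m (14 * (C0 * g) * Lam) (2 * Lam) _ _ _ _ _ m0 _ _ _ N0 coer _ _ en).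
- by apply: mulr_ge0 => //; apply: mulr_ge0 => //; exact: le_trans ler01 Cg.
- exact: mulr_ge0.
- exact: mulr_ge0.
- by apply: le_trans h1 _; rewrite mulr0 mul0r addr0 !mulrA.
- apply: le_trans h2 _; rewrite exprMn [leLHS](_ : _ = 2 * Lam * (p%:R * del ^+ 2)); last by ring.
  apply: ler_wpM2l; first exact: mulr_ge0.
  by apply: ler_wpM2r; [exact: sqr_ge0|rewrite expr2 ler_peMl].
Qed.
End Cases.

(** * Error for a given comparison function *)

(** The comparison function is [q + z], [q] and [W3] on the three elements: [q] is the smooth part,
    [z] the left layer, [W3] an approximation of [u]. Its derivative jumps by [- z'] at [x1] and by
    [W3' - q'] at [x2]; the node terms there are the reason for the two hypotheses on these
    quantities. *)
Lemma error_three_elements {R : realType} (b r f : R -> nat -> R) (C0 g beta gam gam0 Lam : R) :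
  ode_data b r f C0 g beta gam -> 0 < gam0 -> 1 <= Lam -> exists2 C : R, 0 < C &
  forall (p : nat) e1 e2 (x : 4.-tuple R) x1 x2 u du up (q z W3 : {poly R}) del,
  (0 < p)%N -> 0 < e1 -> 0 < e2 -> e2 <= 1 -> 4 * e1 <= e2 ^+ 2 ->
  (forall t, cc t -> gam0 <= r t 0%N - e2 / 2 * b t 1%N) ->
  mesh x -> x = [:: 0; x1; x2; 1] :> seq R -> (1 - x2) * e2 <= Lam * p%:R * e1 ->
  ode_sol b r f e1 e2 u du ->
  is_galerkin_solution e1 e2 (jv b) (jv r) (jv f) p x up ->
  (size q <= p.+1)%N -> (size z <= p.+1)%N -> (size W3 <= p.+1)%N ->
  q.[0] + z.[0] = 0 -> z.[x1] = 0 -> W3.[x2] = q.[x2] -> W3.[1] = 0 -> 0 <= del ->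
  (forall t, t \in `]x2, 1[ -> `|u t - W3.[t]| <= del /\ `|du t - W3^`().[t]| <= e2 / e1 * del) ->
  (forall t, oo 0 1 t ->
    `|- e1 * q^`()^`().[t] + e2 * b t 0%N * q^`().[t] + r t 0%N * q.[t] - f t 0%N| <= del) ->
  (forall t, t \in `]0, x1[ ->
    `|- e1 * z^`()^`().[t] + e2 * b t 0%N * z^`().[t] + r t 0%N * z.[t]| <= del) ->
  e1 * `|W3^`().[x2] - q^`().[x2]| <= e2 * del -> Num.sqrt e1 * `|z^`().[x1]| <= del ->
  e1 * itg 0 x1 (fun t => (du t - (q + z)^`().[t]) * (du t - (q + z)^`().[t]))
    + itg 0 x1 (fun t => (u t - (q + z).[t]) * (u t - (q + z).[t])) <= del ^+ 2 ->
  e1 * itg x1 x2 (fun t => (du t - q^`().[t]) * (du t - q^`().[t]))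
    + itg x1 x2 (fun t => (u t - q.[t]) * (u t - q.[t])) <= del ^+ 2 ->
  energy_norm e1 e2 (jv b) p x (embed x u - up) <= C * p%:R * del.
Proof.
move=> od gam00 Lam1; pose m := Num.min gam0 (1 / 2).
have m0 : 0 < m by rewrite lt_min gam00; lra.
have C01 := od_C0 od; have g1 := od_g od; have Cg : 1 <= C0 * g by apply: mulr_ege1.
pose K := 14 * (C0 * g) * Lam + Lam + 4.
have K0 : 0 <= K by have := mulr_ge0 (le_trans ler01 Cg) (le_trans ler01 Lam1); rewrite /K; lra.
have Km : 0 <= K / m by rewrite divr_ge0// ltW.
exists (2 + 2 * (2 * Lam + 2) + 2 * (K / m)); first lra.
move=> p e1 e2 x x1 x2 u du up q z W3 del p0 e10 e20 e21 e12 hg hx xE hL os gal sq sz sW.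
move=> q0 z1 Wx2 W1 d0 hth hq hz hW3 hz1 T1 T2.
pose j1 : 'I_3 := ord0; pose j2 : 'I_3 := lift ord0 ord0; pose j3 : 'I_3 := lift ord0 (lift ord0 ord0).
have [XL1 XR1] : xl x j1 = 0 /\ xr x j1 = x1 by rewrite xlE xrE xE.
have [XL2 XR2] : xl x j2 = x1 /\ xr x j2 = x2 by rewrite xlE xrE xE.
have [XL3 XR3] : xl x j3 = x2 /\ xr x j3 = 1 by rewrite xlE xrE xE.
have sum3 (F : 'I_3 -> R) : \sum_j F j = F j1 + F j2 + F j3.
  by rewrite !big_ord_recl big_ord0 addr0 addrA.
have all3 (P : 'I_3 -> Prop) : P j1 -> P j2 -> P j3 -> forall j, P j.
  move=> P1 P2 P3 [[|[|[|//]]] hj].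
  - by rewrite (_ : Ordinal hj = j1)//; exact: val_inj.
  - by rewrite (_ : Ordinal hj = j2)//; exact: val_inj.
  - by rewrite (_ : Ordinal hj = j3)//; exact: val_inj.
pose W (j : 'I_3) : {poly R} := nth 0 [:: q + z; q; W3] j.
pose wn : 'rV[R]_4 := \row_i nth 0 [:: 0; q.[x1]; q.[x2]; 0] i.
have sW' j : (size (W j) <= p.+1)%N.
  by apply: (all3 (fun j => (size (W j) <= p.+1)%N)) => //; apply: leq_trans (size_polyD _ _) _; rewrite geq_max sq sz.
have Wr j : (W j).[xr x j] = wn 0 (rnode j).
  apply: (all3 (fun j => (W j).[xr x j] = wn 0 (rnode j))); rewrite mxE /W ?XR1 ?XR2 ?XR3 //=.
  by rewrite hornerD z1 addr0.
have Wl j : (W j).[xl x j] = wn 0 (lnode j).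
  apply: (all3 (fun j => (W j).[xl x j] = wn 0 (lnode j))); rewrite mxE /W ?XL1 ?XL2 ?XL3 //=.
  by rewrite hornerD.
have wn0 : wn 0 ord0 = 0 by rewrite mxE.
have wnN : wn 0 ord_max = 0 by rewrite mxE.
have dB t : cc t -> is_derive t 1 (jv b) (b t 1%N) by exact: jet_deriv (od_b od).
have cB n t : cc t -> {for t, continuous (fun s => b s n)} by exact: jet_continuous (od_b od).
have cR n t : cc t -> {for t, continuous (fun s => r s n)} by exact: jet_continuous (od_r od).
have cF n t : cc t -> {for t, continuous (fun s => f s n)} by exact: jet_continuous (od_f od).
have b0 t : cc t -> 0 <= jv b t.
  by move=> ct; apply: le_trans (ltW (od_beta od)) (od_bge od ct).
have [V [D [vb [[sV sD] [vb0 vbN] spec coer en]]]] := @wg_error_equation R 3 x hx e1 e2 gam0 p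
  (jv b) (fun t => b t 1%N) (jv r) (jv f) p0 e10 (ltW e20) gam00 dB (cB 1%N) (cR 0%N) (cF 0%N) b0 hg
  u du up W wn (fun t ht => os_d os ht) (ode_sol_bc od e10 e20 e21 e12 os) (os_cont os) gal
  sW' Wr Wl wn0 wnN.
set N2 := wg_norm2 _ _ _ _ _ _ _ _ in coer en.
pose M := Num.sqrt N2; have M0 : 0 <= M by exact: sqrtr_ge0.
have parts j := wg_norm2_parts hx p V D vb (ltW e10) (ltW e20) b0 j.
have [N0 DM1 VM1 JM1] := parts j1.
have [_ DM2 VM2 JM2] := parts j2.
have [_ DM3 VM3 JM3] := parts j3.
have s1 := spec j1; have s2 := spec j2; have s3 := spec j3.
have l1 : lnode j1 = ord0 by exact: val_inj.
have r3 : rnode j3 = ord_max by exact: val_inj.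
have l2 : lnode j2 = rnode j1 by exact: val_inj.
have l3 : lnode j3 = rnode j2 by exact: val_inj.
rewrite -/N2 -/M XL1 XR1 in DM1 VM1 JM1; rewrite -/N2 -/M XL2 XR2 in DM2 VM2 JM2.
rewrite -/N2 -/M XL3 XR3 r3 vbN in DM3 VM3 JM3.
rewrite XL1 XR1 in s1; rewrite XL2 XR2 in s2; rewrite XL3 XR3 r3 vbN in s3.
rewrite !sum3 /residual XL1 XR1 XL2 XR2 XL3 XR3 -/m in en coer.
have X1 : 0 < x1 by rewrite -XL1 -XR1; exact: xl_lt_xr.
have X2 : x1 < x2 by rewrite -XL2 -XR2; exact: xl_lt_xr.
have X3 : x2 < 1 by rewrite -XL3 -XR3; exact: xl_lt_xr.
have cbc (a c : R) (F : R -> nat -> R) n : 0 <= a -> c <= 1 -> jet cc F -> bc a c (fun t => F t n).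
  move=> a0 c1 jF; apply: bc_within; apply: continuous_in_subspaceT => t.
  rewrite inE /= in_itv /= => /andP[t1 t2]; apply: jet_continuous jF _.
  by rewrite /cc (le_trans a0 t1) (le_trans t2 c1).
have x10 : 0 <= x1 := ltW X1. have x21 : x2 <= 1 := ltW X3.
have x11 : x1 <= 1 by clear -X2 X3; lra.
have x20 : 0 <= x2 by clear -X1 X2; lra.
have [H3 S3] := layer_element od p0 e10 e20 e21 e12 os X3 x20 (lexx 1) sW (sV j3) s3 M0 DM3 VM3 JM3 d0 Lam1 hL hth.
have E1 := residual_strong e1 e2 X1 (cbc 0 x1 b 0%N (lexx 0) x11 (od_b od))
  (cbc 0 x1 r 0%N (lexx 0) x11 (od_r od)) (cbc 0 x1 f 0%N (lexx 0) x11 (od_f od)) (sW' j1) s1.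
have E2 := residual_strong e1 e2 X2 (cbc x1 x2 b 0%N x10 x21 (od_b od))
  (cbc x1 x2 r 0%N x10 x21 (od_r od)) (cbc x1 x2 f 0%N x10 x21 (od_f od)) (sW' j2) s2.
have V1 := node_jump_le X1 p0 e10 M0 s1 DM1.
have V3 := node_jump_le X3 p0 e10 M0 s3 DM3.
rewrite l1 vb0 in E1 V1; rewrite l2 in E2; rewrite l3 in H3 V3.
set v1 := vb 0 (rnode j1) in E1 E2 V1; set v2 := vb 0 (rnode j2) in E2 H3 V3.
rewrite subr0 in V1; rewrite sub0r normrN in V3.
have bL (a c : R) (w : {poly R}) : 0 <= a -> c <= 1 ->
    bc a c (fun t => f t 0%N - (- e1 * w^`()^`().[t] + e2 * b t 0%N * w^`().[t] + r t 0%N * w.[t])).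
  move=> a0 c1; have bb := cbc a c b 0%N a0 c1 (od_b od); have br := cbc a c r 0%N a0 c1 (od_r od).
  by have bf := cbc a c f 0%N a0 c1 (od_f od); bcs.
have I1 : `|itg 0 x1 (fun t => (f t 0%N - (- e1 * (q + z)^`()^`().[t] + e2 * b t 0%N * (q + z)^`().[t]
    + r t 0%N * (q + z).[t])) * (V j1).[t])| <= 2 * del * M.
  apply: (value_itg_le X1 M0 VM1 (th := fun t => f t 0%N - (- e1 * (q + z)^`()^`().[t]
     + e2 * b t 0%N * (q + z)^`().[t] + r t 0%N * (q + z).[t]))).
  - exact: mulr_ge0.
  - exact: bL.
  - by rewrite subr0.
  move=> t tx; have tx' : oo 0 1 t.
    by move: tx; rewrite in_itv /= => /andP[h1 h2]; rewrite /oo h1 (lt_trans h2 (lt_trans X2 X3)).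
  have h1 := hq t tx'; have h2 := hz t tx.
  rewrite !derivD !hornerD.
  move: h1 h2; set A := (X in `|X| <= _ -> _); set B := (X in _ -> `|X| <= _ -> _) => h1 h2.
  rewrite [X in `|X|](_ : _ = - (A + B)); last by rewrite /A /B; ring.
  by rewrite normrN mulrDl mul1r; apply: le_trans (ler_normD _ _) (lerD h1 h2).
have I2 : `|itg x1 x2 (fun t => (f t 0%N - (- e1 * q^`()^`().[t] + e2 * b t 0%N * q^`().[t]
    + r t 0%N * q.[t])) * (V j2).[t])| <= del * M.
  apply: (value_itg_le X2 M0 VM2 (th := fun t => f t 0%N - (- e1 * q^`()^`().[t]
     + e2 * b t 0%N * q^`().[t] + r t 0%N * q.[t]))).
  - by [].
  - exact: bL.
  - by clear -X1 X3; lra.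
  move=> t; rewrite in_itv /= => /andP[h1 h2]; rewrite distrC; apply: hq.
  by rewrite /oo (lt_trans X1 h1) (lt_trans h2 X3).
have p1 : 1 <= p%:R :> R by rewrite ler1n.
have se0 : 0 < Num.sqrt e1 by rewrite sqrtr_gt0.
(* [v1] is reached from the node value 0 at the left end, over a length at most 1, so it is at most
   [M / sqrt e1]. *)
have Z1 : `|e1 * (v1 * z^`().[x1])| <= del * M.
  have h1 : `|v1| <= M / Num.sqrt e1.
    apply: le_trans V1 _; rewrite mulrC; apply: ler_wpM2l => //.
    rewrite -sqrtrV ?(ltW e10)//; apply: ler_wsqrtr.
    by rewrite subr0 ler_piMl ?invr_ge0 ?(ltW e10).
  rewrite !normrM (gtr0_norm e10) -{1}(sqr_sqrtr (ltW e10)).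
  rewrite [leLHS](_ : _ = (Num.sqrt e1 * `|v1|) * (Num.sqrt e1 * `|z^`().[x1]|)); last by ring.
  rewrite mulrC; apply: ler_pM => //; try by apply: mulr_ge0 => //; exact: ltW.
  by rewrite mulrC -ler_pdivlMr.
(* [v2] is reached from the right end over the short last element, so [e2 |v2| <= Lam p M]. *)
have Z2 : `|e1 * (v2 * (W3^`().[x2] - q^`().[x2]))| <= Lam * p%:R * del * M.
  rewrite !normrM (gtr0_norm e10) mulrCA.
  apply: le_trans (ler_wpM2l (normr_ge0 _) hW3) _.
  have Lp : 1 <= Lam * p%:R by apply: mulr_ege1.
  have HL : e2 * Num.sqrt ((1 - x2) / e1) <= Lam * p%:R.
    rewrite -[leLHS]ger0_norm ?mulr_ge0 ?(ltW e20) ?sqrtr_ge0//.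
    apply: ler_of_sqr; first exact: le_trans ler01 Lp.
    rewrite exprMn sqr_sqrtr ?divr_ge0 ?(ltW e10) ?subr_ge0//.
    have h2 : (1 - x2) * e2 / e1 <= Lam * p%:R by rewrite ler_pdivrMr.
    rewrite [leLHS](_ : _ = e2 * ((1 - x2) * e2 / e1)); last by ring.
    have h3 : 0 <= (1 - x2) * e2 / e1 by rewrite divr_ge0 ?(ltW e10)// mulr_ge0 ?(ltW e20)// subr_ge0.
    rewrite expr2; apply: ler_pM => //; first exact: ltW.
    exact: le_trans e21 Lp.
  apply: le_trans (ler_wpM2r _ V3) _; first by apply: mulr_ge0 => //; exact: ltW.
  rewrite [leLHS](_ : _ = e2 * Num.sqrt ((1 - x2) / e1) * (del * M)); last by ring.
  by rewrite -[leRHS]mulrA; apply: ler_wpM2r => //; exact: mulr_ge0.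
rewrite -mulrA; apply: (@energy_close _ m K (2 * Lam + 2) _ _ _ _ _ m0 K0 _ _ N0 coer _ _ en).
- by clear -Lam1; lra.
- exact: mulr_ge0.
- move: E1; rewrite -[W j1]/(q + z) => ->; move: E2; rewrite -[W j2]/q => ->.
  rewrite -[W j3]/W3 -/M.
  apply: le_trans (lerD (lexx _) H3) _.
  have n1 := le_trans (ler_norm _) I1; have n2 := le_trans (ler_norm _) I2.
  have n3 := le_trans (ler_norm _) Z2.
  have n4 : - (e1 * (v1 * z^`().[x1])) <= del * M.
    by apply: le_trans Z1; rewrite -normrN ler_norm.
  have n5 : 1 * (del * M) <= p%:R * (del * M) by apply: ler_wpM2r => //; exact: mulr_ge0.
  rewrite mul0r subr0 derivD hornerD.
  move: n1 n2; rewrite /jv !derivD.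
  set A := itg _ _ _; set B := itg _ _ _ => n1 n2.
  rewrite /K; move: n3 n4 n1 n2 n5; rewrite !mulrBr; clear; lra.
- rewrite -[W j1]/(q + z) -[W j2]/q -[W j3]/W3.
  have h5 : 1 * del ^+ 2 <= p%:R ^+ 2 * del ^+ 2.
    by apply: ler_wpM2r; [exact: sqr_ge0|rewrite exprn_ege1].
  have h6 : 2 * Lam * (p%:R * del ^+ 2) <= 2 * Lam * (p%:R ^+ 2 * del ^+ 2).
    apply: ler_wpM2l; first by clear -Lam1; lra.
    by apply: ler_wpM2r; [exact: sqr_ge0|rewrite expr2 ler_peMl].
  by rewrite exprMn; clear -T1 T2 S3 h5 h6; lra.
Qed.

(** * Remainder of the decomposition *)

(* The barrier function is [exp(- beta e2 (1 - x) / e1)]. *)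
Lemma remainder_bound {R : realType} (b r f : R -> nat -> R) (C0 g beta gam e1 e2 A rho : R)
    (v dv ddv : R -> R) :
  ode_data b r f C0 g beta gam -> 0 < e1 -> 0 < e2 -> 0 <= A -> 0 <= rho ->
  {within `[0, 1], continuous v} ->
  (forall x, oo 0 1 x -> is_derive x 1 v (dv x)) ->
  (forall x, oo 0 1 x -> is_derive x 1 dv (ddv x)) ->
  (forall x, oo 0 1 x ->
    `|- e1 * ddv x + e2 * b x 0%N * dv x + r x 0%N * v x| <= rho) ->
  v 0 = 0 -> `|v 1| <= A ->
  forall x, cc x -> `|v x| <= A * expR (- (beta * e2 / e1) * (1 - x)) + rho / gam.
Proof.
move=> od e10 e20 A0 rho0 cv hv hdv Lv v0 v1.
have gam0 := od_gam od; have beta0 := od_beta od.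
pose k := beta * e2 / e1; have k0 : 0 < k by rewrite divr_gt0// mulr_gt0.
pose w x : R := expR (- k * (1 - x)).
have w0 x : 0 < w x by exact: expR_gt0.
have dw (x : R) : is_derive x 1 w (k * w x).
  have d1 : is_derive x 1 (fun y => - k * (1 - y)) k.
    have := is_deriveZ' (- k) (is_deriveB' (is_derive_cst (1 : R) x 1) (is_derive_id x 1)).
    by rewrite sub0r mulrN1 opprK.
  have := is_derive1_comp (f := expR) (is_derive_expR _) d1.
  by rewrite mulrC.
have w1 : w 1 = 1 by rewrite /w subrr mulr0 expR0.
have wE x : w x = expR (- (beta * e2 / e1) * (1 - x)) by [].
clearbody w.
have kg : 0 <= rho / gam by rewrite divr_ge0// ltW.
have key (s : R) : `|s| = 1 -> forall x, cc x -> 0 <= A * w x + rho / gam + s * v x.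
  move=> s1 x hx.
  apply: (@max_principle _ e1 e2 (fun x => b x 0%N) (fun x => r x 0%N)
    (fun x => A * w x + rho / gam + s * v x) (fun x => A * (k * w x) + s * dv x)
    (fun x => A * (k * (k * w x)) + s * ddv x)).
  - exact: e10.
  - move=> y; apply: cvgD.
      apply: (@within_continuousD _ _ _ _ (fun x => A * w x) (fun=> rho / gam)).
        apply: continuous_subspaceT => t; apply: cvgM; first exact: cvg_cst.
        exact: is_derive_continuous (dw t).
      by apply: continuous_subspaceT => t; exact: cvg_cst.
    by apply: cvgM; [exact: cvg_cst|exact: cv].
  - move=> y hy; have := is_deriveD' (is_deriveD' (is_deriveZ' A (dw y))
      (is_derive_cst (rho / gam) y 1)) (is_deriveZ' s (hv y hy)).
    by rewrite addr0.
  - move=> y hy; exact: is_deriveD' (is_deriveZ' A (is_deriveZ' k (dw y))) (is_deriveZ' s (hdv y hy)).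
  - by move=> y /oo_cc hy; apply: lt_le_trans gam0 (od_rge od hy).
  - move=> y hy; have := Lv y hy; have cy := oo_cc hy.
    have bb := od_bge od cy; have rr := od_rge od cy.
    set L := (X in `|X|) => hL.
    have -> : - e1 * (A * (k * (k * w y)) + s * ddv y) +
       e2 * b y 0%N * (A * (k * w y) + s * dv y) + r y 0%N * (A * w y + rho / gam + s * v y) =
       A * w y * (k * (e2 * b y 0%N - e1 * k) + r y 0%N) + r y 0%N * (rho / gam) + s * L.
      by rewrite /L; ring.
    have ek : e1 * k = beta * e2 by rewrite /k; field; rewrite gt_eqF.
    (* The barrier is a supersolution: [e1 k = beta e2 <= e2 b]. *)
    have h1 : 0 <= A * w y * (k * (e2 * b y 0%N - e1 * k) + r y 0%N).
      apply: mulr_ge0; first by apply: mulr_ge0 => //; exact: ltW.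
      apply: addr_ge0; last by lra.
      apply: mulr_ge0; first exact: ltW.
      by rewrite ek [beta * _]mulrC -mulrBr mulr_ge0 ?(ltW e20)// subr_ge0.
    have h2 : rho <= r y 0%N * (rho / gam).
      rewrite -{1}(divfK (lt0r_neq0 gam0) rho) mulrC; exact: ler_wpM2r.
    have h3 : `|s * L| <= rho by rewrite normrM s1 mul1r.
    by have := ler_norm (- (s * L)); rewrite normrN; lra.
  - rewrite v0 mulr0 addr0; apply: addr_ge0 => //; apply: mulr_ge0 => //; exact: ltW.
  - have h3 : `|s * v 1| <= A by rewrite normrM s1 mul1r.
    by have := ler_norm (- (s * v 1)); rewrite normrN w1; lra.
  - exact: hx.
move=> x hx; rewrite ler_norml.
have := key 1 (normr1 _) x hx; have := key (- 1) (normrN1 _) x hx.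
by rewrite -wE; lra.
Qed.

(** Squaring the pointwise bound on [e1 v'] would lose a factor [e2^2 / e1]. Instead [e1 v'^2] is
    integrated through the identity for [G = - e1 v v' + e2 b v^2 / 2], where [v'] enters the end
    values only as [e1 v']. *)
Lemma remainder_energy {R : realType} (b r f : R -> nat -> R) (C0 g beta gam e1 e2 B rho y : R)
    (v dv ddv k : R -> R) : ode_data b r f C0 g beta gam ->
  0 < e1 -> 0 < e2 -> e2 <= 1 -> e1 <= e2 ^+ 2 -> e1 / e2 < y -> y < 1 ->
  (forall x, oo 0 1 x -> is_derive x 1 v (dv x)) ->
  (forall x, oo 0 1 x -> is_derive x 1 dv (ddv x)) ->
  (forall x, oo 0 1 x -> {for x, continuous k}) ->
  (forall x, oo 0 1 x -> - e1 * ddv x + e2 * b x 0%N * dv x + r x 0%N * v x = k x) ->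
  (forall x, 0 < x <= y -> `|v x| <= B /\ `|k x| <= rho) ->
  let K := 2 * (2 + 3 * C0 + C0 * g) + C0 + 1 + C0 * g in
  (forall x, 0 < x <= y -> `|e1 * dv x| <= e2 * (K * (B + rho))) /\
  (forall a c, 0 <= a -> a < c -> c <= y -> bc a c dv /\
    e1 * itg a c (fun t => dv t * dv t) <= K * (B + rho) ^+ 2).
Proof.
move=> od e10 e20 e21 e12 ey y1 hv hdv ck Lv hB; pose K1 := 2 + 3 * C0 + C0 * g; move=> K.
have C01 := od_C0 od; have g1 := od_g od; have gam0 := od_gam od.
have Cg : 1 <= C0 * g by apply: mulr_ege1.
have e2h : 0 < e2 / 2 by rewrite divr_gt0.
have ep : 0 < e1 / e2 by rewrite divr_gt0.
have y0 : 0 < y by apply: lt_trans ey.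
have [B0 rho0] : 0 <= B /\ 0 <= rho.
  have [|h1 h2] := hB y _; first by rewrite y0 lexx.
  by split; [exact: le_trans h1|exact: le_trans h2].
have ooy x : 0 < x <= y -> oo 0 1 x.
  by move=> /andP[x0 xy]; rewrite /oo x0 (le_lt_trans xy y1).
have oob x : oo 0 1 x -> is_derive x 1 (fun t => b t 0%N) (b x 1%N).
  by move=> /oo_cc hx; exact: jet_deriv (od_b od) hx.
have supC x : oo 0 1 x -> [/\ `|b x 0%N| <= C0, `|b x 1%N| <= C0 * g & `|r x 0%N| <= C0].
  move=> /oo_cc hx; have := od_bC od 0 hx; have := od_bC od 1 hx; have := od_rC od 0 hx.
  by rewrite !expr0 expr1 !mulr1.
have D1 x : 0 < x <= y -> `|e1 * dv x| <= e2 * (K1 * B + rho).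
  (* The window [[s, s + e1 / e2]] contains [x] and stops at [y] at the latest, beyond which no
     bound is assumed. *)
  move=> /andP[x0 xy]; pose s := Num.min x (y - e1 / e2).
  have s0 : 0 < s by rewrite lt_min x0 subr_gt0.
  have sx : s <= x by rewrite ge_min lexx.
  have sy : s <= y - e1 / e2 by rewrite ge_min lexx orbT.
  have xs : x <= s + e1 / e2.
    by rewrite /s minElt; case: ltP => h; clear -ep xy; lra.
  apply: (@derivative_estimate R e1 e2 C0 (C0 * g) B rho s (fun x => b x 0%N) (fun x => b x 1%N)
    (fun x => r x 0%N) v dv ddv k) => //.
  - by lra.
  - by move=> t /andP[t1 t2]; apply: hB; apply/andP; split; clear -s0 t1 t2 sy; lra.
  - by apply/andP.
have K1B : K1 * B + rho <= K1 * (B + rho).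
  have : 1 * rho <= K1 * rho by apply: ler_wpM2r => //; rewrite /K1; lra.
  by lra.
have K1K : K1 * (B + rho) <= K * (B + rho).
  by apply: ler_wpM2r; [lra|rewrite /K -/K1; rewrite /K1; lra].
split.
  move=> x hx; apply: le_trans (D1 x hx) _; apply: ler_wpM2l; [exact: ltW|lra].
move=> a c a0 ac cy.
have oot t : t \in `]a, c[ -> oo 0 1 t.
  by rewrite in_itv /= => /andP[h1 h2]; rewrite /oo (le_lt_trans a0 h1) (lt_trans h2 (le_lt_trans cy y1)).
have yt t : t \in `]a, c[ -> 0 < t <= y.
  by rewrite in_itv /= => /andP[h1 h2]; rewrite (le_lt_trans a0 h1) (ltW (lt_le_trans h2 cy)).
have bdv : bc a c dv.
  split; first by move=> t /oot ht; exact: is_derive_continuous (hdv t ht).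
  exists (e2 * (K1 * B + rho) / e1) => t /yt ht.
  by rewrite ler_pdivlMr// mulrC -{1}(gtr0_norm e10) -normrM; exact: D1.
split => //.
have bv : bc a c v.
  split; first by move=> t /oot ht; exact: is_derive_continuous (hv t ht).
  by exists B => t /yt /hB[].
have bk : bc a c k.
  split; first by move=> t /oot ht; exact: ck.
  by exists rho => t /yt /hB[].
have bb n : bc a c (fun t => b t n).
  split; first by move=> t /oot /oo_cc ht; exact: jet_continuous (od_b od) ht.
  by exists (C0 * g ^+ n) => t /oot /oo_cc ht; exact: (od_bC od n ht).
have br : bc a c (fun t => r t 0%N).
  split; first by move=> t /oot /oo_cc ht; exact: jet_continuous (od_r od) ht.
  by exists (C0 * g ^+ 0) => t /oot /oo_cc ht; exact: (od_rC od 0%N ht).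
have b0 := bb 0%N; have b1 := bb 1%N.
pose G t := - e1 * (v t * dv t) + e2 / 2 * (b t 0%N * (v t * v t)).
pose S t := v t * k t - r t 0%N * (v t * v t) + e2 / 2 * (b t 1%N * (v t * v t)).
pose G' t := S t - e1 * (dv t * dv t).
have bS : bc a c S by rewrite /S; bcs.
have dG t : t \in `]a, c[ -> is_derive t 1 G (G' t).
  move=> /oot ht.
  have -> : G' t = - e1 * (dv t * dv t + v t * ddv t) +
      e2 / 2 * (b t 1%N * (v t * v t) + b t 0%N * (dv t * v t + v t * dv t)).
    by rewrite /G' /S -(Lv t ht); field.
  exact: (is_deriveD' (is_deriveZ' (- e1) (is_deriveM' (hv t ht) (hdv t ht)))
    (is_deriveZ' (e2 / 2) (is_deriveM' (oob t ht) (is_deriveM' (hv t ht) (hv t ht))))).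
have GH t : t \in `]a, c[ -> `|G t| <= (K1 * B + rho) * B + C0 / 2 * B ^+ 2.
  move=> tac; have ht := yt t tac; have [h1 _] := hB t ht.
  have [h2 _ _] := supC t (ooy t ht); have h3 := D1 t ht.
  apply: le_trans (ler_normD _ _) _; apply: lerD.
    rewrite [- e1 * _](_ : _ = - (v t * (e1 * dv t))); last by ring.
    rewrite normrN normrM mulrC; apply: ler_pM => //; apply: le_trans h3 _.
    rewrite ler_piMl//; apply: addr_ge0 => //; apply: mulr_ge0 => //; rewrite /K1; clear -C01 Cg; lra.
  rewrite [`|e2 / 2 * _|]normrM (gtr0_norm e2h) !normrM -expr2.
  rewrite [leRHS](_ : _ = 1 / 2 * (C0 * B ^+ 2)); last by field.
  apply: ler_pM; [exact: ltW|by apply: mulr_ge0 => //; exact: sqr_ge0|clear -e21; lra|].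
  by apply: ler_pM => //; rewrite lerXn2r ?nnegrE.
have bdv2 := bcZ e1 (bcM bdv bdv).
have bG : bc a c G' by exact: bcB bS bdv2.
have cH : continuous (fun _ : R => (K1 * B + rho) * B + C0 / 2 * B ^+ 2).
  by move=> t; exact: cvg_cst.
have I1 := itg_deriv_le ac dG bG GH cH.
have I2 : itg a c S <= (rho * B + C0 * g * B ^+ 2).
  have h0 : 0 <= rho * B + C0 * g * B ^+ 2.
    by apply: addr_ge0; [exact: mulr_ge0|apply: mulr_ge0; [lra|exact: sqr_ge0]].
  apply: le_trans (_ : (rho * B + C0 * g * B ^+ 2) * (c - a) <= _); last first.
    by rewrite ler_piMr//; lra.
  rewrite -itg_cst ?(ltW ac)//; apply: itg_le => //; first exact: bc_cst.
  move=> t tac; have ht := yt t tac; have [h1 h2] := hB t ht.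
  have [_ h3 _] := supC t (ooy t ht); have cct := oo_cc (ooy t ht).
  have h4 : `|v t * k t| <= rho * B by rewrite normrM mulrC; apply: ler_pM.
  have h5 : 0 <= r t 0%N * (v t * v t).
    by apply: mulr_ge0; [exact: le_trans (ltW gam0) (od_rge od cct)|rewrite -expr2 sqr_ge0].
  have h6 : `|e2 / 2 * (b t 1%N * (v t * v t))| <= 1 * (C0 * g * B ^+ 2).
    rewrite [`|e2 / 2 * _|]normrM (gtr0_norm e2h) !normrM -expr2.
    apply: ler_pM; [exact: ltW|by apply: mulr_ge0 => //; exact: sqr_ge0|clear -e21; lra|].
    by apply: ler_pM => //; rewrite lerXn2r ?nnegrE.
  have := ler_norm (v t * k t); have := ler_norm (e2 / 2 * (b t 1%N * (v t * v t))).
  rewrite /S; clear -h4 h5 h6; lra.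
have I3 : itg a c G' = itg a c S - e1 * itg a c (fun t => dv t * dv t).
  by rewrite (itgB bS bdv2) (itgZ e1 (bcM bdv bdv)).
have I4 := ler_norm (- itg a c G'); rewrite normrN in I4.
have I5 : itg a c (fun t => dv t * dv t) * e1 <= 2 * ((K1 * B + rho) * B + C0 / 2 * B ^+ 2) + (rho * B + C0 * g * B ^+ 2).
  by clear -I1 I2 I3 I4; lra.
rewrite mulrC; apply: le_trans I5 _.
have Br0 : 0 <= B * rho by exact: mulr_ge0.
have h1 : (K1 * B + rho) * B <= K1 * (B + rho) ^+ 2.
  apply: le_trans (ler_wpM2r B0 K1B) _; rewrite -mulrA; apply: ler_wpM2l; first by rewrite /K1; clear -C01 Cg; lra.
  by rewrite expr2; apply: ler_wpM2l; clear -B0 rho0; lra.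
have h2 : B ^+ 2 <= (B + rho) ^+ 2 by rewrite lerXn2r ?nnegrE//; clear -B0 rho0; lra.
have h3 : rho * B <= (B + rho) ^+ 2.
  by rewrite expr2 [rho * B]mulrC; apply: ler_pM => //; clear -B0 rho0; lra.
have h4 : C0 * B ^+ 2 <= C0 * (B + rho) ^+ 2 by apply: ler_wpM2l => //; clear -C01; lra.
have h5 : C0 * g * B ^+ 2 <= C0 * g * (B + rho) ^+ 2 by apply: ler_wpM2l => //; clear -Cg; lra.
rewrite /K -/K1; clear -h1 h3 h4 h5; lra.
Qed.

(** * Comparison functions *)

(** Over a length [Lam p e1 / e2] the scaled coefficients of [u] carry the factor [exp(2 C0 Lam p)].
    With [Lam = s2 / (4 C0)] this spends half of the approximation rate [s2]. *)
Lemma solution_poly {R : realType} (b r f : R -> nat -> R) (C0 g beta gam : R) :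
  ode_data b r f C0 g beta gam ->
  exists Lam sigma C : R, [/\ 0 < Lam, 0 < sigma, 0 < C &
  forall (p : nat) e1 e2 u du (a A0 tau : R), (0 < p)%N ->
  ode_sol b r f e1 e2 u du -> 0 < e1 -> 0 < e2 -> e2 <= 1 -> 4 * e1 <= e2 ^+ 2 ->
  0 <= a -> a < 1 -> (1 - a) * (e2 / e1) <= Lam * p%:R -> 0 <= tau -> `|A0 - u a| <= tau ->
  exists P : {poly R}, [/\ (size P <= p.+1)%N, P.[a] = A0, P.[1] = 0 &
    forall x, oo a 1 x -> let e := C * (expR (- sigma * p%:R) + tau) in
    `|u x - P.[x]| <= e /\ `|du x - P^`().[x]| * (1 - a) <= e]].
Proof.
move=> od; have C01 := od_C0 od; have g1 := od_g od.
have K0 : 0 <= 2 * g by lra.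
have [s2 [C2 [s20 C20 HP]]] := poly_approx_C2 K0.
have [CQ CQ0 HR] := ode_sol_regularity od.
have Lam0 : 0 < s2 / (4 * C0) by rewrite divr_gt0//; lra.
exists (s2 / (4 * C0)), (s2 / 2), (C2 * CQ + 3); split => //.
- by rewrite divr_gt0.
- by rewrite addr_gt0// mulr_gt0.
move=> p e1 e2 u du a A0 tau p0 os e10 e20 e21 e12 a0 a1 hL tau0 hA.
have := HR e1 e2 u du os e10 e20 e21 e12; set uj := fun x => odejet _ _ _ _ _ _ _ => -[juj Buj].
set Lp := s2 / (4 * C0) * p%:R in hL.
have Q0 : 0 <= CQ * expR (2 * C0 * Lp) by apply: mulr_ge0; [exact: ltW|exact: expR_ge0].
have ooa x : oo a 1 x -> oo 0 1 x.
  by move=> /andP[h1 h2]; rewrite /oo (le_lt_trans a0 h1).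
have uj0 x : uj x 0%N = u x by exact: odejet0.
have uj1 x : uj x 1%N = du x by exact: odejet1.
have cu : {within `[a, 1], continuous (fun x => uj x 0%N)}.
  rewrite (_ : (fun x => uj x 0%N) = u); last by apply/funext => y; exact: uj0.
  apply: continuous_subspaceW (os_cont os) => t /=.
  by rewrite !in_itv /= => /andP[h1 h2]; rewrite h2 (le_trans a0 h1).
have [||||P [sP Pa P1 HPx]] := HP _ tau uj a 1 A0 0 Q0 tau0 a1 _ cu _ _ _ p p0.
- by move=> x /ooa hx; exact: juj.
- move=> x n /ooa hx; apply: Buj => //; lra.
- by rewrite uj0.
- by rewrite uj0 (os_1 os) subrr normr0.
exists P; split => // x hx e; have [h1 h2 _] := HPx x hx.
have ee : C2 * (CQ * expR (2 * C0 * Lp)) * expR (- s2 * p%:R) + 3 * tau <= e.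
  have -> : C2 * (CQ * expR (2 * C0 * Lp)) * expR (- s2 * p%:R) = C2 * CQ * expR (- (s2 / 2) * p%:R).
    rewrite [LHS](_ : _ = C2 * CQ * (expR (2 * C0 * Lp) * expR (- s2 * p%:R))); last by ring.
    rewrite -expRD; congr (_ * expR _); rewrite /Lp; field; rewrite gt_eqF//; lra.
  have t1 : 0 <= C2 * CQ * tau by apply: mulr_ge0 => //; apply: ltW; exact: mulr_gt0.
  have t2 := expR_ge0 (- (s2 / 2) * p%:R).
  by rewrite /e mulrDl !mulrDr; clear -t1 t2; lra.
rewrite uj0 in h1; rewrite uj1 in h2.
by split; [exact: le_trans h1 ee|exact: le_trans h2 ee].
Qed.

(** [kap0] makes the factor [exp(CE CM kap p)] in the coefficients of [E] on [0, x1] cost at most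
    half of the approximation rate. [P] vanishes at [x1], where [E] is merely exponentially small,
    so that the layer part can end with the first element. *)
Lemma layer_poly {R : realType} (b r f : R -> nat -> R) (C0 g beta gam cm CM : R) :
  ode_data b r f C0 g beta gam -> 0 < cm -> 0 < CM ->
  exists2 kap0 : R, 0 < kap0 & forall kap, 0 < kap -> kap <= kap0 ->
  exists c1 sigma C : R, [/\ 0 < c1, 0 < sigma, 0 < C &
  forall (p : nat) e1 e2 x1, (0 < p)%N -> 0 < e1 -> 0 < e2 -> e2 <= 1 ->
    e1 <= c1 * e2 ^+ 2 -> kap * p%:R * e2 < 1 / 2 -> x1 < 1 ->
    cm * (kap * p%:R * e2) <= x1 -> x1 <= CM * (kap * p%:R * e2) ->
  let del := expR (- sigma * p%:R) in
  exists (E : R -> nat -> R) (P : {poly R}), [/\ jet cc E, E 0 0%N = 1,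
    [/\ (size P <= p.+1)%N, P.[0] = 1, P.[x1] = 0 & e2 * `|P^`().[x1]| <= C * del],
    forall x, cc x ->
      `|- e1 * (2 * E x 2%N) + e2 * b x 0%N * E x 1%N + r x 0%N * E x 0%N| <= C * del /\
      (x1 <= x -> `|E x 0%N| <= del /\ e2 * `|E x 1%N| <= C * del) &
    forall x, oo 0 x1 x ->
      [/\ `|- e1 * P^`()^`().[x] + e2 * b x 0%N * P^`().[x] + r x 0%N * P.[x]| <= C * del,
        `|E x 0%N - P.[x]| <= C * del & e2 * `|E x 1%N - P^`().[x]| <= C * del]]].
Proof.
move=> od cm0 CM0; have C01 := od_C0 od.
have [al [CE [K [al0 CE0 K0 HE]]]] := layer_function od.
have [s1 [C1 [s10 C10 HP]]] := poly_approx_C2 K0.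
exists (s1 / (2 * (CE * CM))); first by rewrite divr_gt0// mulr_gt0// mulr_gt0.
move=> kap kap0 kapE.
have [c1 c10 {}HE] := HE kap kap0.
pose s := cm * kap; have s0 : 0 < s by rewrite mulr_gt0.
have kR : CE * (CM * kap) <= s1 / 2.
  have := ler_wpM2r (ltW (mulr_gt0 CE0 CM0)) kapE.
  rewrite [leRHS](_ : _ = s1 / 2); last by field; rewrite !gt_eqF.
  by clear; lra.
have ln20 : 0 < ln (2 : R) by apply: ln_gt0; lra.
(* Three rates: approximation on [0, x1], decay of [E] up to [x1 >= s p e2], and the factor [2^-p]
   of its residual. *)
pose sigma := Num.min (s1 / 2) (Num.min (al * s) (ln 2)).
have sig0 : 0 < sigma by rewrite !lt_min divr_gt0//= mulr_gt0.
pose CP := C1 * CE + 3; have CP0 : 0 < CP by rewrite addr_gt0// mulr_gt0.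
pose C := CE + CP * (s^-1 ^+ 2 + C0 / s + C0 + s^-1 + 1).
have si0 : 0 < s^-1 by rewrite invr_gt0.
have Cs0 : 0 < C0 / s by rewrite divr_gt0//; lra.
have si2 : 0 < s^-1 ^+ 2 by rewrite exprn_gt0.
have T0 : 0 < s^-1 ^+ 2 + C0 / s + C0 + s^-1 + 1 by lra.
have T1 : 0 < CP * (s^-1 ^+ 2 + C0 / s + C0 + s^-1 + 1) by exact: mulr_gt0.
exists (Num.min c1 1), sigma, C; split => //; first by rewrite lt_min c10 ltr01.
  by rewrite addr_gt0.
move=> p e1 e2 x1 p0 e10 e20 e21 e12 kp x11 xm xM del.
have p1 : 1 <= p%:R :> R by rewrite ler1n.
have e22 : 0 < e2 ^+ 2 by rewrite exprn_gt0.
have e1c : e1 <= c1 * e2 ^+ 2.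
  by apply: le_trans e12 _; apply: ler_wpM2r; [exact: ltW|rewrite ge_min lexx].
have e1e : e1 <= e2 ^+ 2.
  by apply: le_trans e12 _; rewrite -[leRHS]mul1r; apply: ler_wpM2r; [exact: ltW|rewrite ge_min lexx orbT].
have sx : s * p%:R * e2 <= x1 by move: xm; rewrite !mulrA.
have sx' : s * e2 <= x1.
  apply: le_trans sx; apply: ler_wpM2r; first exact: ltW.
  by rewrite ler_peMr// ltW.
have x10 : 0 < x1 by apply: lt_le_trans sx'; exact: mulr_gt0.
have del0 : 0 < del by exact: expR_gt0.
have dle k : sigma <= k -> expR (- k * p%:R) <= del.
  by move=> sk; rewrite ler_expR; apply: ler_wpM2r => //; rewrite lerN2.
have dele : forall x, x1 <= x -> expR (- (al * x / e2)) <= del.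
  move=> x xx; apply: le_trans (dle (al * s) _); last by rewrite /sigma !ge_min lexx orbT.
  rewrite ler_expR mulNr lerN2 ler_pdivlMr//; rewrite -!mulrA; apply: ler_wpM2l; first exact: ltW.
  by rewrite !mulrA in sx *; exact: le_trans sx xx.
have [E [jE E0 EB ER]] := HE p e1 e2 e10 e20 e21 e1c kp.
have oocc x : oo 0 x1 x -> cc x.
  by move=> /andP[h1 h2]; rewrite /cc (ltW h1) (ltW (lt_trans h2 x11)).
have cE n x : cc x -> {for x, continuous (fun t => E t n)} by exact: jet_continuous jE.
have ccx1 : cc x1 by rewrite /cc (ltW x10) (ltW x11).
pose tau := expR (- (al * x1 / e2)).
have tau_del : tau <= del by exact: dele.
pose Q := CE * expR (CE * (CM * (kap * p%:R))).
have Q0 : 0 <= Q by apply: mulr_ge0; [exact: ltW|exact: expR_ge0].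
have [|||||P [sP Pa P1 HPx]] := HP Q tau E 0 x1 1 0 Q0 (expR_ge0 _) x10 _ _ _ _ _ p p0.
- by move=> x /oocc hx; exact: jE.
- apply: continuous_in_subspaceT => x; rewrite inE /= in_itv /= => /andP[h1 h2].
  by apply: cE; rewrite /cc h1 (le_trans h2 (ltW x11)).
- move=> x n /oocc hx; rewrite subr0 /Q; apply: ER => //; [exact: ltW|exact: ltW|].
  by rewrite ler_pdivrMr//; move: xM; rewrite !mulrA.
- by rewrite E0 subrr normr0 expR_ge0.
- by rewrite sub0r normrN; have [] := EB x1 ccx1.
have {}HPx x : oo 0 x1 x -> [/\ `|E x 0%N - P.[x]| <= CP * del,
    `|E x 1%N - P^`().[x]| * x1 <= CP * del & `|2 * E x 2%N - P^`()^`().[x]| * x1 ^+ 2 <= CP * del].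
  move=> hx; have := HPx x hx; rewrite subr0 /=; set e := C1 * Q * _ + _.
  have ee : e <= CP * del.
    rewrite /CP mulrDl; apply: lerD; last by apply: ler_wpM2l.
    rewrite /Q -!mulrA; apply: ler_wpM2l; first exact: ltW.
    apply: ler_wpM2l; first exact: ltW.
    rewrite -expRD; apply: le_trans (dle (s1 / 2) _); last by rewrite /sigma ge_min lexx.
    rewrite ler_expR; have := ler_wpM2r (le_trans ler01 p1) kR; rewrite !mulrA.
    by clear; lra.
  by move=> [h1 h2 h3]; split; [exact: le_trans h1 ee|exact: le_trans h2 ee|exact: le_trans h3 ee].
have CPd : 0 <= CP * del by apply: ltW; exact: mulr_gt0.
have e2x : e2 / x1 <= s^-1 by rewrite ler_pdivrMr// mulrC ler_pdivlMr// mulrC.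
have e2x0 : 0 <= e2 / x1 by rewrite divr_ge0// ltW.
have e1x : e1 / x1 ^+ 2 <= s^-1 ^+ 2.
  apply: le_trans (_ : (e2 / x1) ^+ 2 <= _); last by rewrite lerXn2r ?nnegrE// ltW.
  by rewrite exprMn exprVn; apply: ler_wpM2r => //; rewrite invr_ge0 exprn_ge0// ltW.
have d1 x : oo 0 x1 x -> e2 * `|E x 1%N - P^`().[x]| <= s^-1 * (CP * del).
  move=> /HPx[_ h _]; rewrite -(ler_pdivlMr _ _ x10) in h.
  apply: le_trans (ler_wpM2l (ltW e20) h) _; rewrite mulrCA mulrC; exact: ler_wpM2r.
have d2 x : oo 0 x1 x -> e1 * `|2 * E x 2%N - P^`()^`().[x]| <= s^-1 ^+ 2 * (CP * del).
  move=> /HPx[_ _ h]; rewrite -(ler_pdivlMr _ _ (exprn_gt0 2 x10)) in h.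
  apply: le_trans (ler_wpM2l (ltW e10) h) _; rewrite mulrCA mulrC; exact: ler_wpM2r.
have EBd x : x1 <= x -> cc x -> e2 * `|E x 1%N| <= CE * del.
  move=> xx cx; have [_ h _] := EB x cx.
  apply: le_trans (ler_wpM2l (ltW e20) h) _; rewrite mulrA mulrCA mulfV ?mulr1 ?gt_eqF//.
  by apply: ler_wpM2l; [exact: ltW|exact: dele].
have LE x : cc x -> `|- e1 * (2 * E x 2%N) + e2 * b x 0%N * E x 1%N + r x 0%N * E x 0%N| <= CE * del.
  move=> cx; have [_ _ h] := EB x cx; apply: le_trans h _; apply: ler_wpM2l; first exact: ltW.
  apply: le_trans (dle (ln 2) _); last by rewrite /sigma !ge_min lexx !orbT.
  by rewrite -lnV ?posrE// expRM_natr lnK ?posrE.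
have Cexp : C * del = CE * del + CP * del * (s^-1 ^+ 2) + CP * del * (C0 / s) + CP * del * C0
    + CP * del * s^-1 + CP * del by rewrite /C; ring.
have N1 : 0 <= CP * del * (s^-1 ^+ 2) by apply: mulr_ge0 => //; exact: ltW.
have N2 : 0 <= CP * del * (C0 / s) by apply: mulr_ge0 => //; exact: ltW.
have N3 : 0 <= CP * del * C0 by apply: mulr_ge0 => //; lra.
have N4 : 0 <= CP * del * s^-1 by apply: mulr_ge0 => //; exact: ltW.
have N5 : 0 <= CE * del by apply: ltW; exact: mulr_gt0.
exists E, P; split => //.
- split => //.
  have h : `|E x1 1%N - P^`().[x1]| <= s^-1 * (CP * del) / e2.
    apply: (@bound_right_end _ 0 x1 _ (fun x => E x 1%N - P^`().[x])) => //.
      apply: cvgB; [exact: cE|exact: continuous_horner].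
    by move=> x hx; rewrite ler_pdivlMr// mulrC; exact: d1.
  rewrite ler_pdivlMr// mulrC in h; have h2 := EBd x1 (lexx _) ccx1.
  have h3 : e2 * `|P^`().[x1]| <= e2 * `|E x1 1%N| + e2 * `|E x1 1%N - P^`().[x1]|.
    rewrite -mulrDr; apply: ler_wpM2l; first exact: ltW.
    by rewrite -[X in `|X| <= _](subKr (E x1 1%N)); exact: ler_normB.
  by rewrite Cexp; clear -h h2 h3 N1 N2 N3 N4 CPd; lra.
- move=> x cx; split.
    by apply: le_trans (LE x cx) _; rewrite Cexp; clear -N1 N2 N3 N4 CPd; lra.
  move=> xx; split; last by apply: le_trans (EBd x xx cx) _; rewrite Cexp; clear -N1 N2 N3 N4 CPd; lra.
  by have [h _ _] := EB x cx; apply: le_trans h (dele x xx).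
move=> x hx; have [h1 _ _] := HPx x hx; have h2 := d1 x hx; have h3 := d2 x hx.
have cx := oocc x hx; have h4 := LE x cx.
have hb := od_bC od 0 cx; have hr := od_rC od 0 cx; rewrite expr0 mulr1 in hb hr.
split; [|by apply: le_trans h1 _; rewrite Cexp; clear -N1 N2 N3 N4 N5; lra
        |by apply: le_trans h2 _; rewrite Cexp; clear -N1 N2 N3 N5 CPd; lra].
have -> : - e1 * P^`()^`().[x] + e2 * b x 0%N * P^`().[x] + r x 0%N * P.[x] =
  (- e1 * (2 * E x 2%N) + e2 * b x 0%N * E x 1%N + r x 0%N * E x 0%N)
  + (e1 * (2 * E x 2%N - P^`()^`().[x]) - b x 0%N * (e2 * (E x 1%N - P^`().[x]))
  - r x 0%N * (E x 0%N - P.[x])) by ring.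
have h5 : `|e1 * (2 * E x 2%N - P^`()^`().[x])| <= s^-1 ^+ 2 * (CP * del).
  by rewrite normrM (gtr0_norm e10).
have h6 : `|b x 0%N * (e2 * (E x 1%N - P^`().[x]))| <= C0 * (s^-1 * (CP * del)).
  by rewrite normrM; apply: ler_pM => //; rewrite normrM (gtr0_norm e20).
have h7 : `|r x 0%N * (E x 0%N - P.[x])| <= C0 * (CP * del).
  by rewrite normrM; apply: ler_pM.
apply: le_trans (ler_normD _ _) _.
set Y := e1 * _ in h5 *; set Z := b x 0%N * _ in h6 *; set T := r x 0%N * _ in h7 *.
have h8 := ler_normB (Y - Z) T; have h9 := ler_normB Y Z.
rewrite Cexp; clear -h4 h5 h6 h7 h8 h9 N4 CPd; lra.
Qed.

(** [v = u - q + q(0) E] vanishes at 0, is bounded at 1 and has an exponentially small residual. The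
    hypothesis on [y] says that the barrier is still at most [del] there. *)
Lemma remainder_facts {R : realType} (b r f : R -> nat -> R) (C0 g beta gam e1 e2 y del Cq CE : R)
    (u du : R -> R) (q : {poly R}) (E : R -> nat -> R) :
  ode_data b r f C0 g beta gam -> ode_sol b r f e1 e2 u du ->
  0 < e1 -> 0 < e2 -> e2 <= 1 -> e1 <= e2 ^+ 2 -> e1 / e2 < y -> y < 1 ->
  0 <= del -> 0 <= Cq -> 0 <= CE -> `|q.[0]| <= Cq -> `|q.[1]| <= Cq ->
  (forall x, oo 0 1 x -> `|- e1 * q^`()^`().[x] + e2 * b x 0%N * q^`().[x]
     + r x 0%N * q.[x] - f x 0%N| <= Cq * del) ->
  jet cc E -> E 0 0%N = 1 -> `|E 1 0%N| <= 1 ->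
  (forall x, cc x -> `|- e1 * (2 * E x 2%N) + e2 * b x 0%N * E x 1%N
     + r x 0%N * E x 0%N| <= CE * del) ->
  expR (- (beta * e2 / e1) * (1 - y)) <= del ->
  let v x := u x - q.[x] + q.[0] * E x 0%N in
  let dv x := du x - q^`().[x] + q.[0] * E x 1%N in
  let Cr := Cq + Cq * CE in let CB := 2 * Cq + Cr / gam in
  let K := 2 * (2 + 3 * C0 + C0 * g) + C0 + 1 + C0 * g in
  (forall x, 0 < x <= y -> `|v x| <= CB * del /\ e1 * `|dv x| <= e2 * (K * (CB + Cr) * del)) /\
  (forall a c, 0 <= a -> a < c -> c <= y -> [/\ bc a c v, bc a c dv &
    e1 * itg a c (fun t => dv t * dv t) <= K * (CB + Cr) ^+ 2 * del ^+ 2]).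
Proof.
move=> od os e10 e20 e21 e12 ey y1 del0 Cq0 CE0 q0 q1 Lq jE E0 E1 LE hexp v dv Cr CB K.
have gam0 := od_gam od; have beta0 := od_beta od.
pose ddu x := e1^-1 * (e2 * (b x 0%N * du x) + r x 0%N * u x - f x 0%N).
pose ddv x := ddu x - q^`()^`().[x] + q.[0] * (2 * E x 2%N).
pose k x := - (- e1 * q^`()^`().[x] + e2 * b x 0%N * q^`().[x] + r x 0%N * q.[x] - f x 0%N)
  + q.[0] * (- e1 * (2 * E x 2%N) + e2 * b x 0%N * E x 1%N + r x 0%N * E x 0%N).
have Cr0 : 0 <= Cr by apply: addr_ge0 => //; exact: mulr_ge0.
have hv x : oo 0 1 x -> is_derive x 1 v (dv x).
  move=> hx; have := jE x (oo_cc hx) 0%N; rewrite /sder mul1r => dE.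
  exact: is_deriveD' (is_deriveB' (os_d os hx) (is_derive_horner q x)) (is_deriveZ' q.[0] dE).
have hdv x : oo 0 1 x -> is_derive x 1 dv (ddv x).
  move=> hx; have := jE x (oo_cc hx) 1%N; rewrite /sder => dE.
  exact: is_deriveD' (is_deriveB' (os_dd os hx) (is_derive_horner q^`() x)) (is_deriveZ' q.[0] dE).
have Lv x : oo 0 1 x -> - e1 * ddv x + e2 * b x 0%N * dv x + r x 0%N * v x = k x.
  by move=> hx; rewrite /ddv /dv /v /k /ddu; field; rewrite gt_eqF.
have kB x : oo 0 1 x -> `|k x| <= Cr * del.
  move=> hx; apply: le_trans (ler_normD _ _) _; rewrite normrN /Cr [leRHS]mulrDl; apply: lerD; first exact: Lq.
  by rewrite normrM -[leRHS]mulrA; apply: ler_pM => //; apply: LE; exact: oo_cc.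
have cv : {within `[0, 1], continuous v}.
  apply: (@within_continuousD _ _ _ _ (fun x => u x - q.[x]) (fun x => q.[0] * E x 0%N)).
    apply: (@within_continuousB _ _ _ _ u (horner q)); first exact: os_cont os.
    exact/continuous_subspaceT/continuous_horner.
  apply: continuous_in_subspaceT => x; rewrite inE /= in_itv /= => hx.
  by apply: cvgM; [exact: cvg_cst|exact: jet_continuous jE hx].
have v0 : v 0 = 0 by rewrite /v (os_0 os) E0; ring.
have v1 : `|v 1| <= 2 * Cq.
  rewrite /v (os_1 os) sub0r; apply: le_trans (ler_normD _ _) _; rewrite normrN normrM.
  have : `|q.[0]| * `|E 1 0%N| <= Cq * 1 by apply: ler_pM.
  by clear -q1; lra.
have B1 := remainder_bound od e10 e20 (mulr_ge0 (ler0n _ 2) Cq0) (mulr_ge0 Cr0 del0) cv hv hdv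
  (fun x hx => eq_ind_r (fun z => `|z| <= Cr * del) (kB x hx) (Lv x hx)) v0 v1.
have B2 x : 0 < x <= y -> `|v x| <= CB * del.
  move=> /andP[x0 xy]; apply: le_trans (B1 x _) _.
    by rewrite /cc (ltW x0) (le_trans xy (ltW y1)).
  rewrite /CB [leRHS]mulrDl; apply: lerD; last by rewrite mulrAC.
  apply: ler_wpM2l; first by rewrite mulr_ge0.
  apply: le_trans hexp; rewrite ler_expR !mulNr lerN2; apply: ler_wpM2l; last by rewrite lerB.
  by apply: ltW; rewrite divr_gt0// mulr_gt0.
have ck x : oo 0 1 x -> {for x, continuous k}.
  move=> hx; have cx := oo_cc hx.
  have cb : {for x, continuous (fun t => b t 0%N)} by exact: jet_continuous (od_b od) cx.
  have cr : {for x, continuous (fun t => r t 0%N)} by exact: jet_continuous (od_r od) cx.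
  have cf : {for x, continuous (fun t => f t 0%N)} by exact: jet_continuous (od_f od) cx.
  have cE n : {for x, continuous (fun t => E t n)} by exact: jet_continuous jE cx.
  have ch (w : {poly R}) : {for x, continuous (horner w)} by exact: continuous_horner.
  have cc0 (z : R) : {for x, continuous (fun _ : R => z)} by exact: cvg_cst.
  apply: cvgD.
    apply: cvgN; apply: cvgB => //; apply: cvgD; last by apply: cvgM; [exact: cr|exact: ch].
    apply: cvgD; first by apply: cvgM; [exact: cc0|exact: ch].
    by apply: cvgM; [apply: cvgM; [exact: cc0|exact: cb]|exact: ch].
  apply: cvgM; first exact: cc0.
  apply: cvgD; last by apply: cvgM; [exact: cr|exact: cE].
  apply: cvgD; last by apply: cvgM; [apply: cvgM; [exact: cc0|exact: cb]|exact: cE].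
  by apply: cvgM; [exact: cc0|apply: cvgM; [exact: cc0|exact: cE]].
have [|D1 D2] := @remainder_energy R b r f C0 g beta gam e1 e2 (CB * del) (Cr * del) y v dv ddv k
  od e10 e20 e21 e12 ey y1 hv hdv ck Lv.
  move=> x hx; split; first exact: B2.
  by apply: kB; move: hx => /andP[h1 h2]; rewrite /oo h1 (le_lt_trans h2 y1).
rewrite -/K -!mulrDl in D1 D2.
split.
  move=> x hx; split; first exact: B2.
  by have := D1 x hx; rewrite normrM (gtr0_norm e10) [K * (_ * del)]mulrA.
move=> a c a0 ac cy; have [h1 h2] := D2 a c a0 ac cy; split => //.
  apply: bc_within; apply: continuous_subspaceW cv => t /=; rewrite !in_itv /= => /andP[t1 t2].
  by rewrite (le_trans a0 t1) (le_trans t2 (le_trans cy (ltW y1))).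
by move: h2; rewrite exprMn mulrA.
Qed.

(** The condition [e1 <= e2^2] lets functions that vary on the scale [e2] enter the energy. *)
Lemma energy_sum_le {R : realType} (a c e1 e2 EE k k0 : R) (v dv h dh : R -> R) :
  a < c -> c - a <= 1 -> 0 < e1 -> 0 < e2 -> e1 <= e2 ^+ 2 ->
  bc a c v -> bc a c dv -> bc a c h -> bc a c dh ->
  e1 * itg a c (fun t => dv t * dv t) <= EE ->
  (forall t, t \in `]a, c[ -> e2 * `|dh t| <= k /\ `|v t - h t| <= k0) ->
  e1 * itg a c (fun t => (dv t - dh t) * (dv t - dh t))
    + itg a c (fun t => (v t - h t) * (v t - h t)) <= 2 * EE + 2 * k ^+ 2 + k0 ^+ 2.
Proof.
move=> ac c1 e10 e20 e12 bv bdv bh bdh hE hk.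
have h1 : itg a c (fun t => (v t - h t) * (v t - h t)) <= k0 ^+ 2.
  by apply: (itg_sqr_sup (g := fun t => v t - h t)) => //; [exact: ltW|bcs|move=> t /hk[]].
have h2 : itg a c (fun t => e2 * dh t * (e2 * dh t)) <= k ^+ 2.
  apply: (itg_sqr_sup (g := fun t => e2 * dh t)) => //; [exact: ltW|bcs|move=> t /hk[]].
  by rewrite normrM (gtr0_norm e20).
have h3 : itg a c (fun t => e1 * ((dv t - dh t) * (dv t - dh t))) <=
   itg a c (fun t => 2 * e1 * (dv t * dv t) + 2 * (e2 * dh t * (e2 * dh t))).
  apply: itg_le; [by bcs|by bcs|] => t _.
  have h4 : e1 * (dh t * dh t) <= e2 ^+ 2 * (dh t * dh t).
    by apply: ler_wpM2r => //; rewrite -expr2 sqr_ge0.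
  have := mulr_ge0 (ltW e10) (sqr_ge0 (dv t + dh t)).
  by move: h4; rewrite !expr2; clear; lra.
rewrite itgZ in h3; [|by bcs]; rewrite itgD in h3; [|by bcs|by bcs].
rewrite itgZ in h3; [|by bcs]; rewrite itgZ in h3; [|by bcs].
by rewrite -mulrA in h3; clear -h1 h2 h3 hE; lra.
Qed.

(** * The theorem *)

(** Half of the rate absorbs the factor [p], because [y exp(- y) <= 1]. *)
Lemma nat_expR_decay {R : realType} (s : R) (p : nat) : 0 < s ->
  p%:R * expR (- s * p%:R) <= 2 / s * expR (- (s / 2) * p%:R).
Proof.
move=> s0; have h : s / 2 * p%:R <= expR (s / 2 * p%:R).
  by apply: le_trans (expR_ge1Dx _); rewrite lerDr.
have -> : expR (- s * p%:R) = expR (- (s / 2) * p%:R) * expR (- (s / 2 * p%:R)).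
  by rewrite -expRD; congr expR; field.
rewrite mulrCA mulrC; apply: ler_wpM2r; first exact: expR_ge0.
have := ler_wpM2r (expR_ge0 (- (s / 2 * p%:R))) h; rewrite expRxMexpNx_1 => h2.
rewrite -(ler_pM2l (_ : 0 < s / 2)) ?divr_gt0// mulrA; apply: le_trans h2 _.
by rewrite [leRHS](_ : _ = 1)//; field; rewrite gt_eqF.
Qed.

Lemma three_error {R : realType} (b r f : R -> nat -> R) (C0 g beta gam gam0 cm CM : R) :
  ode_data b r f C0 g beta gam -> 0 < gam0 -> 0 < cm -> 0 < CM ->
  exists2 kap0 : R, 0 < kap0 & forall kap, 0 < kap -> kap <= kap0 ->
  exists c0 sigma C : R, [/\ 0 < c0, 0 < sigma, 0 < C &
  forall (p : nat) e1 e2 (x : 4.-tuple R) x1 x2 u du up,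
    (0 < p)%N -> 0 < e1 -> 0 < e2 -> e2 <= 1 -> e1 <= c0 * e2 ^+ 2 ->
    (forall t, cc t -> gam0 <= r t 0%N - e2 / 2 * b t 1%N) ->
    mesh x -> x = [:: 0; x1; x2; 1] :> seq R -> 0 < x1 -> x1 < x2 -> x2 < 1 ->
    kap * p%:R * e2 < 1 / 2 ->
    cm * (kap * p%:R * e2) <= x1 -> x1 <= CM * (kap * p%:R * e2) ->
    cm * (kap * p%:R * (e1 / e2)) <= 1 - x2 -> 1 - x2 <= CM * (kap * p%:R * (e1 / e2)) ->
    ode_sol b r f e1 e2 u du ->
    is_galerkin_solution e1 e2 (jv b) (jv r) (jv f) p x up ->
    energy_norm e1 e2 (jv b) p x (embed x u - up) <= C * (p%:R * expR (- sigma * p%:R))].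
Proof.
move=> od gam00 cm0 CM0; have C01 := od_C0 od; have beta0 := od_beta od; have gm0 := od_gam od.
have g1 := od_g od.
have [LU [su [Cu [LU0 su0 Cu0 Hu]]]] := solution_poly od.
have [kE kE0 HE] := layer_poly od cm0 CM0.
(* [LU / CM] makes the last element short enough for [solution_poly]. *)
exists (Num.min kE (LU / CM)); first by rewrite lt_min kE0 divr_gt0.
move=> kap kap0; rewrite le_min => /andP[kapE kapU].
have [c1 [sE [CE [c10 sE0 CE0 {}HE]]]] := HE kap kap0 kapE.
have [sq [Cq [sq0 Cq0 Hq]]] := smooth_part od kap0.
pose s := cm * kap; have s0 : 0 < s by exact: mulr_gt0.
(* The last rate, [beta s], is the decay of the barrier across the last element, whose length is at
   least [s p e1 / e2]. *)
pose sigma := Num.min (Num.min su sE) (Num.min sq (beta * s)).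
have sig0 : 0 < sigma by rewrite !lt_min su0 sE0 sq0 mulr_gt0.
pose Cr := Cq + Cq * CE; pose CB := 2 * Cq + Cr / gam.
pose K := 2 * (2 + 3 * C0 + C0 * g) + C0 + 1 + C0 * g.
pose C3 := Cu * (1 + (CB + Cq)); pose CV := K * (CB + Cr).
have Cr0 : 0 < Cr by rewrite addr_gt0// mulr_gt0.
have CB0 : 0 < CB by apply: addr_gt0; [exact: mulr_gt0|exact: divr_gt0].
have C30 : 0 < C3 by apply: mulr_gt0 => //; clear -CB0 Cq0; lra.
have Cg : 1 <= C0 * g by apply: mulr_ege1.
have K0 : 0 < K by rewrite /K; clear -Cg C01; lra.
have CV0 : 0 < CV by apply: mulr_gt0 => //; exact: addr_gt0.
have CqE : 0 < Cq * CE by exact: mulr_gt0.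
have C3s : 0 < C3 / s by exact: divr_gt0.
pose CT := 1 + C3 + C3 / s + Cq + Cq * CE + CV + (2 * (K * (CB + Cr) ^+ 2) + 2 * (Cq * CE) ^+ 2
  + (CB + Cq + Cq * CE) ^+ 2).
have S1 : 0 <= K * (CB + Cr) ^+ 2 by apply: mulr_ge0; [exact: ltW|exact: sqr_ge0].
have S2 := sqr_ge0 (Cq * CE). have S3 := sqr_ge0 (CB + Cq + Cq * CE).
have CT1 : 1 <= CT by rewrite /CT; clear -C30 C3s Cq0 CqE CV0 S1 S2 S3; lra.
have Lam1 : 1 <= Num.max 1 (CM * kap) by rewrite le_max lexx.
have [C C_gt0 HC] := error_three_elements od gam00 Lam1.
(* [1 / 4] is the regime of the bounds on [u]; [s] gives [e1 / e2 <= s e2 <= x1], so that a window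
   of length [e1 / e2] fits to the left of [x2]. *)
have c00 : 0 < Num.min (Num.min c1 (1 / 4)) s by rewrite !lt_min c10 s0 divr_gt0.
exists (Num.min (Num.min c1 (1 / 4)) s), sigma, (C * CT); split => //.
  by apply: mulr_gt0 => //; exact: lt_le_trans ltr01 CT1.
move=> p e1 e2 x x1 x2 u du up p0 e10 e20 e21 e1c hg hx xE x10 x12 x21 kp xm xM ym yM os gal.
have p1 : 1 <= p%:R :> R by rewrite ler1n.
have e22 : 0 < e2 ^+ 2 by rewrite exprn_gt0.
have eC k : Num.min (Num.min c1 (1 / 4)) s <= k -> e1 <= k * e2 ^+ 2.
  by move=> ck; apply: le_trans e1c _; apply: ler_wpM2r => //; exact: ltW.
have e1c1 : e1 <= c1 * e2 ^+ 2 by apply: eC; rewrite !ge_min lexx.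
have e14 : 4 * e1 <= e2 ^+ 2.
  by have := eC (1 / 4) (ltac:(by rewrite !ge_min lexx orbT)); clear; lra.
have e1s : e1 <= s * e2 ^+ 2 by apply: eC; rewrite ge_min lexx orbT.
have e12 : e1 <= e2 ^+ 2 by clear -e14 e10; lra.
pose del := expR (- sigma * p%:R).
have del0 : 0 < del by exact: expR_gt0.
have dle k : sigma <= k -> expR (- k * p%:R) <= del.
  by move=> sk; rewrite ler_expR; apply: ler_wpM2r => //; rewrite lerN2.
have x11 : x1 < 1 by exact: lt_trans x12 x21.
have [E [P [jE E0 [sP P0 P1 P2] EB PB]]] := HE p e1 e2 x1 p0 e10 e20 e21 e1c1 kp x11 xm xM.
have [q [sq_ q0 q1 Lq]] := Hq p e1 e2 p0 e10 e12 e20 e21 kp.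
have dE : expR (- sE * p%:R) <= del by apply: dle; rewrite /sigma !ge_min lexx orbT.
have dq : expR (- sq * p%:R) <= del by apply: dle; rewrite /sigma !ge_min lexx !orbT.
have du_ : expR (- su * p%:R) <= del by apply: dle; rewrite /sigma !ge_min lexx.
have CEd : CE * expR (- sE * p%:R) <= CE * del by apply: ler_wpM2l => //; exact: ltW.
have cx1 : cc (1 : R) by rewrite /cc ler01 lexx.
have cx2 : cc x2 by rewrite /cc (ltW (lt_trans x10 x12)) (ltW x21).
have {}Lq z : oo 0 1 z -> `|- e1 * q^`()^`().[z] + e2 * b z 0%N * q^`().[z]
     + r z 0%N * q.[z] - f z 0%N| <= Cq * del.
  by move=> hz; apply: le_trans (Lq z hz) _; apply: ler_wpM2l => //; exact: ltW.
have E1 : `|E 1 0%N| <= 1.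
  have [_ /(_ (ltW x11))[h _]] := EB 1 cx1; apply: le_trans h _.
  by rewrite -[leRHS]expR0 ler_expR mulNr oppr_le0 mulr_ge0// ltW.
have LE z : cc z -> `|- e1 * (2 * E z 2%N) + e2 * b z 0%N * E z 1%N
     + r z 0%N * E z 0%N| <= CE * del.
  by move=> hz; have [h _] := EB z hz; exact: le_trans h CEd.
have Etail z : cc z -> x1 <= z -> `|E z 0%N| <= del /\ e2 * `|E z 1%N| <= CE * del.
  move=> hz xz; have [_ /(_ xz)[h1 h2]] := EB z hz.
  by split; [exact: le_trans h1 dE|exact: le_trans h2 CEd].
have sx1 : s * e2 <= x1.
  apply: le_trans xm; rewrite /s -mulrA; apply: ler_wpM2l; first exact: ltW.
  by apply: ler_wpM2r; [exact: ltW|rewrite ler_peMr// ltW].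
have ep : 0 < e1 / e2 by exact: divr_gt0.
have sy : s * (e1 / e2) * p%:R <= 1 - x2.
  by apply: le_trans ym; rewrite le_eqVlt /s; apply/orP; left; apply/eqP; ring.
have sy1 : s * (e1 / e2) <= 1 - x2.
  by apply: le_trans sy; rewrite ler_peMr// mulr_ge0 ?ltW.
have ex2 : e1 / e2 < x2.
  apply: le_lt_trans x12; apply: le_trans sx1; rewrite ler_pdivrMr//.
  by apply: le_trans e1s _; rewrite expr2 mulrA.
have hexp : expR (- (beta * e2 / e1) * (1 - x2)) <= del.
  apply: le_trans (dle (beta * s) _); last by rewrite /sigma !ge_min lexx !orbT.
  rewrite ler_expR !mulNr lerN2.
  have h := ler_wpM2l (ltW (divr_gt0 (mulr_gt0 beta0 e20) e10)) sy.
  by apply: le_trans h; rewrite le_eqVlt; apply/orP; left; apply/eqP; field; rewrite !gt_eqF.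
have [V1 V2] := remainder_facts od os e10 e20 e21 e12 ex2 x21 (ltW del0) (ltW Cq0) (ltW CE0)
  q0 q1 Lq jE E0 E1 LE hexp.
rewrite -/Cr -/CB -/K in V1 V2.
have x20 : 0 < x2 by exact: lt_trans x10 x12.
have [Vx2 dVx2] := V1 x2 (ltac:(by rewrite x20 lexx)).
have [Ex2 dEx2] := Etail x2 cx2 (ltW x12).
(* [W3] starts at [q(x2)] instead of [u(x2)]. The difference consists of the remainder and the tail
   of the layer, both exponentially small at [x2]. *)
have tauB : `|q.[x2] - u x2| <= (CB + Cq) * del.
  have -> : q.[x2] - u x2 = q.[0] * E x2 0%N - (u x2 - q.[x2] + q.[0] * E x2 0%N) by ring.
  apply: le_trans (ler_normB _ _) _; rewrite mulrDl addrC; apply: lerD => //.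
  by rewrite normrM; apply: ler_pM.
have tau0 : 0 <= (CB + Cq) * del by apply: mulr_ge0; apply: ltW => //; exact: addr_gt0.
have yU : (1 - x2) * (e2 / e1) <= LU * p%:R.
  have h := ler_wpM2r (ltW (divr_gt0 e20 e10)) yM.
  have h2 : kap * CM <= LU by rewrite -ler_pdivlMr.
  apply: le_trans h _; rewrite [leLHS](_ : _ = kap * CM * p%:R); last by field; rewrite !gt_eqF.
  exact: ler_wpM2r.
have [W3 [sW3 W3l W3r W3B]] := Hu p e1 e2 u du x2 q.[x2] ((CB + Cq) * del) p0 os e10 e20 e21 e14
  (ltW x20) x21 yU tau0 tauB.
have e3le : Cu * (expR (- su * p%:R) + (CB + Cq) * del) <= C3 * del.
  rewrite /C3 -mulrA; apply: ler_wpM2l; first exact: ltW.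
  by rewrite [leRHS]mulrDl mul1r lerD2r.
have y0 : 0 < 1 - x2 by rewrite subr_gt0.
have W3d z : oo x2 1 z -> `|u z - W3.[z]| <= C3 * del /\ `|du z - W3^`().[z]| <= e2 / e1 * (C3 / s * del).
  move=> hz; have [h1 h2] := W3B z hz; split; first exact: le_trans h1 e3le.
  have {h2}h2 := le_trans h2 e3le.
  have h3 : `|du z - W3^`().[z]| * (s * (e1 / e2)) <= C3 * del.
    by apply: le_trans h2; apply: ler_wpM2l.
  rewrite -ler_pdivlMr in h3; last by apply: mulr_gt0.
  by apply: le_trans h3 _; rewrite le_eqVlt; apply/orP; left; apply/eqP; field; rewrite !gt_eqF.
pose z := (- q.[0]) *: P.
have z_ t : z.[t] = - q.[0] * P.[t] by rewrite hornerZ.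
have dz t : z^`().[t] = - q.[0] * P^`().[t] by rewrite derivZ hornerZ.
have ddz t : z^`()^`().[t] = - q.[0] * P^`()^`().[t] by rewrite !derivZ hornerZ.
have Lam_ : (1 - x2) * e2 <= Num.max 1 (CM * kap) * p%:R * e1.
  have h := ler_wpM2r (ltW e20) yM; apply: le_trans h _.
  rewrite [leLHS](_ : _ = CM * kap * p%:R * e1); last by field; rewrite gt_eqF.
  by apply: ler_wpM2r; [exact: ltW|apply: ler_wpM2r => //; rewrite le_max lexx orbT].
have CTd k : k <= CT -> k * del <= CT * del by move=> h; apply: ler_wpM2r => //; exact: ltW.
have CTsq EE : EE <= (2 * (K * (CB + Cr) ^+ 2) + 2 * (Cq * CE) ^+ 2 + (CB + Cq + Cq * CE) ^+ 2) * del ^+ 2 ->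
    EE <= (CT * del) ^+ 2.
  move=> h; apply: le_trans h _; rewrite [leRHS]exprMn; apply: ler_wpM2r; first exact: sqr_ge0.
  rewrite expr2; apply: le_trans (_ : 1 * CT <= _); last by apply: ler_wpM2r => //; exact: le_trans ler01 CT1.
  by rewrite mul1r /CT; clear -C30 C3s Cq0 CqE CV0; lra.
have k1 : C3 <= CT by rewrite /CT; clear -C30 C3s Cq0 CqE CV0 S1 S2 S3; lra.
have k2 : C3 / s <= CT by rewrite /CT; clear -C30 C3s Cq0 CqE CV0 S1 S2 S3; lra.
have k3 : Cq <= CT by rewrite /CT; clear -C30 C3s Cq0 CqE CV0 S1 S2 S3; lra.
have k4 : Cq * CE <= CT by rewrite /CT; clear -C30 C3s Cq0 CqE CV0 S1 S2 S3; lra.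
have k5 : C3 / s + CV + Cq * CE <= CT by rewrite /CT; clear -C30 C3s Cq0 CqE CV0 S1 S2 S3; lra.
have CTdel0 : 0 <= CT * del by apply: mulr_ge0; [exact: le_trans ler01 CT1|exact: ltW].
have cE n (t : R) : cc t -> {for t, continuous (fun t => E t n)} by exact: jet_continuous jE.
have bE (a c : R) n : 0 <= a -> c <= 1 -> bc a c (fun t => E t n).
  move=> a0 c1'; apply: bc_within; apply: continuous_in_subspaceT => t.
  rewrite inE /= in_itv /= => /andP[t1 t2]; apply: cE.
  by rewrite /cc (le_trans a0 t1) (le_trans t2 c1').
rewrite [leRHS](_ : _ = C * p%:R * (CT * del)); last by rewrite /del; ring.
apply: (HC p e1 e2 x x1 x2 u du up q z W3 (CT * del)) => //.
- by apply: leq_trans (size_scale_leq _ _) sP.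
- by rewrite z_ P0 mulr1 subrr.
- by rewrite z_ P1 mulr0.
- move=> t; rewrite in_itv /= => ht; have [h1 h2] := W3d t ht; split.
    exact: le_trans h1 (CTd _ k1).
  apply: le_trans h2 _; apply: ler_wpM2l; first by rewrite divr_ge0 ?ltW.
  exact: CTd.
- by move=> t ht; apply: le_trans (Lq t ht) (CTd _ k3).
- move=> t; rewrite in_itv /= => ht; have [h1 _ _] := PB t ht.
  rewrite ddz dz z_ [X in `|X|](_ : _ = - q.[0] * (- e1 * P^`()^`().[t] + e2 * b t 0%N * P^`().[t] + r t 0%N * P.[t])); last by ring.
  apply: le_trans (CTd _ k4); rewrite normrM normrN -[leRHS]mulrA; apply: ler_pM => //.
  exact: le_trans h1 CEd.
(* [W3' - q'] at [x2] is split into the derivatives of the remainder, of the layer tail and of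
   [u - W3]; the bound on the last one reaches the end point by continuity. *)
- have ox2 : oo 0 1 x2 by rewrite /oo x20.
  have h1 : `|du x2 - W3^`().[x2]| <= e2 / e1 * (C3 / s * del).
    apply: (@bound_left_end _ x2 1 _ (fun t => du t - W3^`().[t])) => //.
      by apply: cvgB; [exact: is_derive_continuous (os_dd os ox2)|exact: continuous_horner].
    by move=> t /W3d[].
  have h2 : e1 * `|du x2 - W3^`().[x2]| <= e2 * (C3 / s * del).
    apply: le_trans (ler_wpM2l (ltW e10) h1) _.
    by rewrite le_eqVlt; apply/orP; left; apply/eqP; field; rewrite !gt_eqF.
  have h3 : e1 * `|q.[0] * E x2 1%N| <= e2 * (Cq * CE * del).
    rewrite normrM mulrCA -[Cq * CE * del]mulrA [leRHS]mulrCA; apply: ler_pM => //.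
      by apply: mulr_ge0 => //; exact: ltW.
    apply: le_trans (_ : e2 ^+ 2 * `|E x2 1%N| <= _); first exact: ler_wpM2r.
    by rewrite expr2 -mulrA; apply: ler_wpM2l => //; exact: ltW.
  have h4 : e1 * `|W3^`().[x2] - q^`().[x2]| <= e1 * (`|du x2 - q^`().[x2] + q.[0] * E x2 1%N|
     + `|q.[0] * E x2 1%N| + `|du x2 - W3^`().[x2]|).
    apply: ler_wpM2l; first exact: ltW.
    rewrite [W3^`().[x2] - q^`().[x2]](_ : _ = (du x2 - q^`().[x2] + q.[0] * E x2 1%N)
      - q.[0] * E x2 1%N - (du x2 - W3^`().[x2])); last by ring.
    apply: le_trans (ler_normB _ _) _; rewrite lerD2r; exact: ler_normB.
  apply: le_trans h4 _; rewrite !mulrDr.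
  apply: le_trans (_ : e2 * ((C3 / s + CV + Cq * CE) * del) <= _); last first.
    by apply: ler_wpM2l; [exact: ltW|exact: CTd].
  by move: dVx2; rewrite -/CV; clear -h2 h3; lra.
- rewrite dz normrM normrN.
  have se : Num.sqrt e1 <= e2.
    by rewrite -(ger0_norm (ltW e20)) -sqrtr_sqr; exact: ler_wsqrtr.
  rewrite mulrCA; apply: le_trans (CTd _ k4); rewrite -[leRHS]mulrA; apply: ler_pM => //.
  apply: le_trans (_ : e2 * `|P^`().[x1]| <= _); first exact: ler_wpM2r.
  exact: le_trans P2 CEd.
- have [bv bdv hE] := V2 0 x1 (lexx 0) x10 (ltW x12).
  apply: CTsq.
  have b0 : bc 0 x1 (fun t => q.[0] * (E t 0%N - P.[t])).
    by have := bE 0 x1 0%N (lexx 0) (ltW x11) => bE0; bcs.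
  have b1 : bc 0 x1 (fun t => q.[0] * (E t 1%N - P^`().[t])).
    by have := bE 0 x1 1%N (lexx 0) (ltW x11) => bE0; bcs.
  have h : forall t, t \in `]0, x1[ -> e2 * `|q.[0] * (E t 1%N - P^`().[t])| <= Cq * CE * del /\
      `|u t - q.[t] + q.[0] * E t 0%N - q.[0] * (E t 0%N - P.[t])| <= (CB + Cq + Cq * CE) * del.
    move=> t; rewrite in_itv /= => ht; have [_ h1 h2] := PB t ht.
    have h1' := le_trans h1 CEd; have h2' := le_trans h2 CEd; split.
      by rewrite normrM mulrCA -[leRHS]mulrA; apply: ler_pM => //; apply: mulr_ge0 => //; exact: ltW.
    have [|h3 _] := V1 t; first by move: ht => /andP[-> h4]; exact: ltW (lt_trans h4 x12).
    apply: le_trans (ler_normB _ _) _.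
    have h5 : `|q.[0] * (E t 0%N - P.[t])| <= Cq * CE * del.
      by rewrite normrM -[leRHS]mulrA; apply: ler_pM.
    have h6 := mulr_ge0 (ltW Cq0) (ltW del0).
    by rewrite [leRHS]mulrDl; apply: lerD => //; rewrite [leRHS]mulrDl; apply: le_trans h3 _; rewrite lerDl.
  have := @energy_sum_le R 0 x1 e1 e2 _ (Cq * CE * del) ((CB + Cq + Cq * CE) * del) _ _
    (fun t => q.[0] * (E t 0%N - P.[t])) (fun t => q.[0] * (E t 1%N - P^`().[t]))
    x10 (ltac:(by rewrite subr0 ltW)) e10 e20 e12 bv bdv b0 b1 hE h.
  rewrite [X in e1 * X + _ <= _ -> _](eq_itg (g := fun t => (du t - (q + z)^`().[t]) * (du t - (q + z)^`().[t]))); last first.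
    by move=> t _; rewrite derivD hornerD dz; ring.
  rewrite [X in _ + X <= _ -> _](eq_itg (g := fun t => (u t - (q + z).[t]) * (u t - (q + z).[t]))); last first.
    by move=> t _; rewrite hornerD z_; ring.
  by move=> h1; apply: le_trans h1 _; rewrite !exprMn; clear; lra.
- have [bv bdv hE] := V2 x1 x2 (ltW x10) x12 (lexx _).
  apply: CTsq.
  have b0 : bc x1 x2 (fun t => q.[0] * E t 0%N).
    by have := bE x1 x2 0%N (ltW x10) (ltW x21) => bE0; bcs.
  have b1 : bc x1 x2 (fun t => q.[0] * E t 1%N).
    by have := bE x1 x2 1%N (ltW x10) (ltW x21) => bE0; bcs.
  have h : forall t, t \in `]x1, x2[ -> e2 * `|q.[0] * E t 1%N| <= Cq * CE * del /\
      `|u t - q.[t] + q.[0] * E t 0%N - q.[0] * E t 0%N| <= (CB + Cq + Cq * CE) * del.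
    move=> t; rewrite in_itv /= => /andP[t1 t2].
    have ct : cc t by rewrite /cc (ltW (lt_trans x10 t1)) (ltW (lt_trans t2 x21)).
    have [h1 h2] := Etail t ct (ltW t1); split.
      by rewrite normrM mulrCA -[leRHS]mulrA; apply: ler_pM => //; apply: mulr_ge0 => //; exact: ltW.
    have [|h3 _] := V1 t; first by rewrite (lt_trans x10 t1) ltW.
    apply: le_trans (ler_normB _ _) _.
    have h5 : `|q.[0] * E t 0%N| <= Cq * del by rewrite normrM; apply: ler_pM.
    have h6 := mulr_ge0 (ltW CqE) (ltW del0).
    by rewrite [leRHS]mulrDl -[leLHS]addr0; apply: lerD => //; rewrite [leRHS]mulrDl; exact: lerD.
  have := @energy_sum_le R x1 x2 e1 e2 _ (Cq * CE * del) ((CB + Cq + Cq * CE) * del) _ _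
    (fun t => q.[0] * E t 0%N) (fun t => q.[0] * E t 1%N)
    x12 (ltac:(by clear -x10 x21; lra)) e10 e20 e12 bv bdv b0 b1 hE h.
  rewrite [X in e1 * X + _ <= _ -> _](eq_itg (g := fun t => (du t - q^`().[t]) * (du t - q^`().[t]))); last first.
    by move=> t _; ring.
  rewrite [X in _ + X <= _ -> _](eq_itg (g := fun t => (u t - q.[t]) * (u t - q.[t]))); last first.
    by move=> t _; ring.
  by move=> h1; apply: le_trans h1 _; rewrite !exprMn; clear; lra.
Qed.

Lemma jv_derjet {R : realType} (h : R -> R) : jv (derjet h) = h.
Proof. by apply/funext => x; exact: derjet0. Qed.

Lemma derjet1 {R : realType} (h : R -> R) x : derjet h x 1%N = derive1 h x.
Proof. by rewrite /derjet (_ : 1`! = 1%N)// divr1. Qed.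

Lemma solution_ode_sol {R : realType} e1 e2 (b r f u : R -> R) : e1 != 0 ->
  is_solution e1 e2 b r f u ->
  ode_sol (derjet b) (derjet r) (derjet f) e1 e2 u (derive1 u).
Proof.
move=> e10 [cu hu u0 u1]; split => //.
  move=> x hx; have [|d1 _ _] := hu x; first by rewrite in_itv.
  by apply: DeriveDef => //; rewrite derive1E.
move=> x hx; have [|_ d2 eq] := hu x; first by rewrite in_itv.
apply: DeriveDef => //; rewrite -derive1E !derjet0.
rewrite [LHS](_ : _ = derive1n 2 u x)//.
have -> : f x = - e1 * derive1n 2 u x + e2 * b x * derive1 u x + r x * u x by rewrite eq.
by field.
Qed.

(** The first rate is rationalized to [2 r / (D + e2 b)], free of cancellation. Hence [1 / mu0] is
    of order [e2] and [1 / mu1] of order [e1 / e2], which are the sizes of the outer elements up to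
    [kap p]. *)
Lemma layer_rate_bounds {R : realType} (e1 e2 beta gam C : R) (b r : R -> R) y :
  0 < e1 -> 0 < e2 -> 4 * e1 <= e2 ^+ 2 -> 0 < beta -> 0 < gam -> 1 <= C ->
  beta <= b y -> b y <= C -> gam <= r y -> r y <= C ->
  [/\ 2 * gam / (3 * C * e2) <= layer_rate0 e1 e2 b r y,
    layer_rate0 e1 e2 b r y <= C / (beta * e2),
    beta * e2 / e1 <= layer_rate1 e1 e2 b r y &
    layer_rate1 e1 e2 b r y <= 3 * C * e2 / (2 * e1)].
Proof.
move=> e10 e20 e12 be0 gam0 C1 bb bC rg rC.
rewrite /layer_rate0 /layer_rate1; set S := e2 ^+ 2 * _ + _; set D := Num.sqrt S.
have b0 : 0 < b y by exact: lt_le_trans bb.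
have r0 : 0 < r y by exact: lt_le_trans rg.
have S0 : 0 < S by apply: addr_gt0; rewrite !mulr_gt0// exprn_gt0.
have D0 : 0 < D by rewrite sqrtr_gt0.
have D2 : D ^+ 2 = S by rewrite sqr_sqrtr// ltW.
have bD : e2 * b y <= D.
  rewrite -(ger0_norm (ltW (mulr_gt0 e20 b0))) -sqrtr_sqr; apply: ler_wsqrtr.
  by rewrite exprMn /S lerDl !mulr_ge0// ltW.
have DC : D <= 2 * C * e2.
  have h0 : 0 <= 2 * C * e2 by rewrite !mulr_ge0 ?(ltW e20)//; lra.
  rewrite -(ger0_norm h0) -sqrtr_sqr; apply: ler_wsqrtr.
  have h1 : e2 ^+ 2 * b y ^+ 2 <= e2 ^+ 2 * C ^+ 2.
    by apply: ler_wpM2l; [exact: sqr_ge0|rewrite lerXn2r ?nnegrE ?(ltW b0)//; lra].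
  have h2 : 4 * e1 * r y <= e2 ^+ 2 * C ^+ 2.
    apply: ler_pM => //; [by rewrite mulr_ge0// ltW|exact: ltW|].
    by apply: le_trans rC _; rewrite expr2 ler_peMl//; lra.
  rewrite /S !exprMn; have := mulr_ge0 (sqr_ge0 e2) (sqr_ge0 C); clear -h1 h2; lra.
have bC2 : e2 * b y <= C * e2 by rewrite mulrC; apply: ler_wpM2r => //; exact: ltW.
have bbe : beta * e2 <= e2 * b y by rewrite mulrC; apply: ler_wpM2l => //; exact: ltW.
have P0 : 0 < D + e2 * b y by apply: addr_gt0 => //; exact: mulr_gt0.
have -> : (- (e2 * b y) + D) / (2 * e1) = 2 * r y / (D + e2 * b y).
  have n1 : 2 * e1 != 0 by rewrite gt_eqF// mulr_gt0.
  have n2 : D + e2 * b y != 0 by rewrite gt_eqF.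
  apply/eqP; rewrite eqr_div//.
  have -> : (- (e2 * b y) + D) * (D + e2 * b y) = D ^+ 2 - (e2 * b y) ^+ 2 by ring.
  by rewrite D2 /S; apply/eqP; ring.
have be : 0 < beta * e2 by exact: mulr_gt0.
split.
- rewrite ler_pdivrMr; last by rewrite !mulr_gt0//; lra.
  rewrite mulrAC ler_pdivlMr//; apply: ler_pM; [lra|exact: ltW|lra|lra].
- rewrite ler_pdivrMr// mulrAC ler_pdivlMr// -mulrA mulrCA; apply: ler_pM; [exact: ltW|lra|exact: rC|lra].
- rewrite [leRHS](_ : _ = (e2 * b y + D) / 2 / e1); last by field; rewrite gt_eqF.
  by apply: ler_wpM2r; [rewrite invr_ge0 ltW|lra].
- by apply: ler_wpM2r; [rewrite invr_ge0 mulr_ge0// ltW|lra].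
Qed.

Theorem proposition1 (R : realType) (b r f : R -> R)
    (C0 gb gr gf gamma : R)
    (hC0 : 0 < C0) (hgb : 0 < gb) (hgr : 0 < gr) (hgf : 0 < gf)
    (hb : analytic_data C0 gb b)
    (hr : analytic_data C0 gr r)
    (hf : analytic_data C0 gf f)
    (b_gt0 : forall y : R, y \in `[0, 1] -> 0 < b y)
    (r_ge0 : forall y : R, y \in `[0, 1] -> 0 <= r y)
    (gamma_gt0 : 0 < gamma) :
  exists c0 kappa sigma C : R,
    [/\ 0 < c0 < 1, 0 < kappa, 0 < sigma, 0 < C &
      forall (p : nat) (e1 e2 : R),
        (1 <= p)%N ->
        0 < e1 <= 1 -> 0 < e2 <= 1 ->
        (forall y : R, y \in `[0, 1] -> gamma <= r y - e2 / 2 * derive1 b y) ->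
        e1 <= c0 * e2 ^+ 2 -> e2 ^+ 2 <= c0 ->
        forall (N : nat) (x : N.+1.-tuple R),
          BL_mesh b r kappa e1 e2 p x ->
          forall (u : R -> R) (up : broken R N),
            is_solution e1 e2 b r f u ->
            is_galerkin_solution e1 e2 b r f p x up ->
            energy_norm e1 e2 b p x (embed x u - up)
              <= C * expR (- sigma * p%:R)].
Proof.
have ccI (y : R) : cc y -> y \in `[0, 1] by rewrite in_itv.
(* The hypothesis bounds [r - e2 b' / 2] for the given [e2] only. For small [c0] one has
   [|e2 b' / 2| <= gamma / 2], which forces [r >= gamma / 2]; if the latter fails, the hypotheses
   contradict each other and the claim is vacuous. *)
have [rg|nrg] := pselect (forall y, cc y -> gamma / 2 <= r y); last first.
  have G0 : 0 < gamma / (C0 * gb) by rewrite divr_gt0// mulr_gt0.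
  exists (Num.min (1 / 2) ((gamma / (C0 * gb)) ^+ 2)), 1, 1, 1; split => //.
    rewrite lt_min exprn_gt0// andbT; apply/andP; split; first lra.
    by rewrite gt_min; apply/orP; left; lra.
  move=> p e1 e2 _ _ /andP[e20 _] hg _; rewrite le_min => /andP[_ h2].
  exfalso; apply: nrg => y cy.
  have h3 : e2 <= gamma / (C0 * gb).
    by rewrite -(@ler_pXn2r _ 2) ?nnegrE ?(ltW e20) ?(ltW G0).
  rewrite ler_pdivlMr ?mulr_gt0// in h3.
  have h4 := derjet_bound 1 hb cy; rewrite derjet1 expr1 in h4.
  have h5 : `|e2 / 2 * derive1 b y| <= e2 / 2 * (C0 * gb).
    rewrite normrM gtr0_norm ?divr_gt0//; apply: ler_wpM2l => //; lra.
  have := hg y (ccI y cy); have := ler_norm (- (e2 / 2 * derive1 b y)); rewrite normrN.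
  clear -h3 h5; lra.
have [y0 y01 hy0] : exists2 c, c \in `[0, 1] & forall t, t \in `[0, 1] -> b c <= b t.
  apply: EVT_min => //; apply: continuous_in_subspaceT => y; rewrite inE /= in_itv /= => cy.
  by have := is_derive_continuous (jet_deriv (jet_analytic hb) cy); rewrite jv_derjet.
pose Cm := Num.max C0 1; have Cm1 : 1 <= Cm by rewrite le_max lexx orbT.
pose g := 1 + gb + gr + gf.
have bd (h : R -> R) (k y : R) n : analytic_data C0 k h -> 0 < k -> k <= g -> cc y -> `|derjet h y n| <= Cm * g ^+ n.
  move=> hh k0 kg cy; apply: le_trans (derjet_bound n hh cy) _.
  apply: ler_pM; [exact: ltW|by rewrite exprn_ge0// ltW|by rewrite le_max lexx|].
  by rewrite lerXn2r ?nnegrE ?(ltW k0)//; exact: le_trans (ltW k0) kg.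
have od : ode_data (derjet b) (derjet r) (derjet f) Cm g (b y0) (gamma / 2).
  split; try exact: jet_analytic; try lra.
  - by move=> y n cy; apply: bd cy => //; rewrite /g; lra.
  - by move=> y n cy; apply: bd cy => //; rewrite /g; lra.
  - by move=> y n cy; apply: bd cy => //; rewrite /g; lra.
  - exact: b_gt0.
  - by move=> y cy; rewrite derjet0; exact: hy0 (ccI y cy).
  - by move=> y cy; rewrite derjet0; exact: rg.
  - by rewrite /g; lra.
set beta := b y0 in od; have beta0 := od_beta od.
have gm0 := od_gam od; set gam := gamma / 2 in od gm0 rg.
pose cm := Num.min (2 / (3 * Cm)) (beta / Cm).
pose CM := 1 / beta + 3 * Cm / (2 * gam).
have Cm0 : 0 < Cm by lra.
have cm0 : 0 < cm by rewrite lt_min !divr_gt0// mulr_gt0.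
have CM0 : 0 < CM by rewrite addr_gt0// divr_gt0// mulr_gt0.
have [ks ks0 H3] := three_error od gamma_gt0 cm0 CM0.
have [LU [su [Cu [LU0 su0 Cu0 Hu]]]] := solution_poly od.
(* [LU / 2] serves the mesh {0, 1}: there [kap p e1 >= 1 / 2], hence
   [e2 / e1 <= 2 kap p <= LU p]. *)
pose kap := Num.min ks (LU / 2).
have kap0 : 0 < kap by rewrite lt_min ks0 divr_gt0.
have [|c3 [s3 [C3 [c30 s30 C30 {}H3]]]] := H3 kap kap0; first by rewrite ge_min lexx.
have Lam1 : 1 <= Num.max 1 (2 * kap) by rewrite le_max lexx.
have [C1 C10 H1] := error_one_element od gamma_gt0 Lam1.
pose s := Num.min s3 su; have s0 : 0 < s by rewrite lt_min s30.
exists (Num.min c3 (1 / 4)), kap, (s / 2), ((C3 + C1 * Cu) * (2 / s)); split => //.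
- by rewrite lt_min c30 gt_min; apply/andP; split; [lra|apply/orP; right; lra].
- by rewrite divr_gt0.
- by apply: mulr_gt0; [apply: addr_gt0 => //; exact: mulr_gt0|exact: divr_gt0].
move=> p e1 e2 p0 /andP[e10 e11] /andP[e20 e21] hg e1c e2c N x [hx hmesh] u up hsol hgal.
have e1c3 : e1 <= c3 * e2 ^+ 2.
  by apply: le_trans e1c _; apply: ler_wpM2r; [exact: sqr_ge0|rewrite ge_min lexx].
have e14 : 4 * e1 <= e2 ^+ 2.
  have : e1 <= 1 / 4 * e2 ^+ 2.
    by apply: le_trans e1c _; apply: ler_wpM2r; [exact: sqr_ge0|rewrite ge_min lexx orbT].
  by clear; lra.
have os := solution_ode_sol (lt0r_neq0 e10) hsol.
have hgc t : cc t -> gamma <= derjet r t 0%N - e2 / 2 * derjet b t 1%N.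
  by move=> ct; rewrite derjet0 derjet1; exact: hg (ccI t ct).
have fin k A : s <= k -> 0 < A -> A <= C3 + C1 * Cu ->
    A * (p%:R * expR (- k * p%:R)) <= (C3 + C1 * Cu) * (2 / s) * expR (- (s / 2) * p%:R).
  move=> sk A0 AC; rewrite -[leRHS]mulrA; apply: ler_pM => //; first exact: ltW.
  apply: le_trans (nat_expR_decay p s0); apply: ler_wpM2l => //.
  by rewrite ler_expR; apply: ler_wpM2r => //; rewrite lerN2.
have C1u : 0 < C1 * Cu by exact: mulr_gt0.
case: hmesh => [[ke1 xE]|[ke2 [mu0 [mu1 [min0 min1 xE]]]]].
  have N1 : N = 1%N by have := size_tuple x; rewrite xE /= => -[].
  subst N.
  have kpe : 1 <= 2 * kap * p%:R * e1 by clear -ke1; lra.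
  have hLU : (1 - 0) * (e2 / e1) <= LU * p%:R.
    rewrite subr0 mul1r ler_pdivrMr//; apply: le_trans e21 _; apply: le_trans kpe _.
    apply: ler_wpM2r; first exact: ltW.
    by apply: ler_wpM2r => //; rewrite mulrC -ler_pdivlMr// ge_min lexx orbT.
  have [|W [sW W0 W1 HW]] := Hu p e1 e2 u (derive1 u) 0 0 0 p0 os e10 e20 e21 e14 (lexx 0) ltr01 hLU (lexx 0).
    by rewrite (os_0 os) subrr normr0.
  have := H1 p e1 e2 x u (derive1 u) up W (Cu * expR (- su * p%:R)) p0 e10 e20 e21 e14 hgc hx xE.
  rewrite !jv_derjet => h; apply: le_trans (h _ os hgal sW W0 W1 _ _) _.
  - apply: le_trans e21 _; apply: le_trans kpe _; apply: ler_wpM2r; first exact: ltW.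
    by apply: ler_wpM2r => //; rewrite le_max lexx orbT.
  - by rewrite mulr_ge0 ?expR_ge0// ltW.
  - move=> t ht; have [h1 h2] := HW t ht; rewrite addr0 in h1 h2; split => //.
    rewrite subr0 mulr1 in h2; apply: le_trans h2 _; rewrite ler_peMl ?mulr_ge0 ?expR_ge0 ?(ltW Cu0)//.
    rewrite ler_pdivlMr// mul1r; have : e2 ^+ 2 <= e2 by rewrite expr2 ler_piMr// ltW.
    by clear -e14 e10; lra.
  rewrite [leLHS](_ : _ = C1 * Cu * (p%:R * expR (- su * p%:R))); last by ring.
  by apply: fin => //; [rewrite ge_min lexx orbT|clear -C30; lra].
have N3 : N = 3%N by have := size_tuple x; rewrite xE /= => -[].
subst N.
have rates y : y \in `[0, 1] -> [/\ 2 * gam / (3 * Cm * e2) <= layer_rate0 e1 e2 b r y,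
    layer_rate0 e1 e2 b r y <= Cm / (beta * e2),
    beta * e2 / e1 <= layer_rate1 e1 e2 b r y &
    layer_rate1 e1 e2 b r y <= 3 * Cm * e2 / (2 * e1)].
  move=> hy; have cy : cc y by move: hy; rewrite in_itv.
  have hby := od_bC od 0 cy; have hry := od_rC od 0 cy.
  rewrite !derjet0 expr0 mulr1 in hby hry.
  apply: layer_rate_bounds => //; [exact: hy0|exact: le_trans (ler_norm _) hby|exact: rg|].
  exact: le_trans (ler_norm _) hry.
have [m0l m0u] : 2 * gam / (3 * Cm * e2) <= mu0 /\ mu0 <= Cm / (beta * e2).
  by have [[y hy <-] _] := min0; have [] := rates y hy.
have [m1l m1u] : beta * e2 / e1 <= mu1 /\ mu1 <= 3 * Cm * e2 / (2 * e1).
  by have [[y hy <-] _] := min1; have [] := rates y hy.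
have q0 : 0 < 2 * gam / (3 * Cm * e2) by rewrite divr_gt0 ?mulr_gt0.
have q1 : 0 < beta * e2 / e1 by rewrite divr_gt0 ?mulr_gt0.
have mu00 : 0 < mu0 by exact: lt_le_trans q0 m0l.
have mu10 : 0 < mu1 by exact: lt_le_trans q1 m1l.
have i0u : mu0^-1 <= CM * e2.
  apply: le_trans (_ : (2 * gam / (3 * Cm * e2))^-1 <= _); first by rewrite lef_pV2 ?posrE.
  rewrite [leLHS](_ : _ = 3 * Cm / (2 * gam) * e2); last by field; rewrite !gt_eqF.
  by apply: ler_wpM2r; [exact: ltW|rewrite /CM lerDr divr_ge0// ltW].
have i0l : cm * e2 <= mu0^-1.
  apply: le_trans (_ : (Cm / (beta * e2))^-1 <= _); last by rewrite lef_pV2 ?posrE ?divr_gt0 ?mulr_gt0.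
  rewrite [leRHS](_ : _ = beta / Cm * e2); last by field; rewrite !gt_eqF.
  by apply: ler_wpM2r; [exact: ltW|rewrite ge_min lexx orbT].
have i1u : mu1^-1 <= CM * (e1 / e2).
  apply: le_trans (_ : (beta * e2 / e1)^-1 <= _); first by rewrite lef_pV2 ?posrE.
  rewrite [leLHS](_ : _ = 1 / beta * (e1 / e2)); last by field; rewrite !gt_eqF.
  by apply: ler_wpM2r; [rewrite divr_ge0// ltW|rewrite /CM lerDl divr_ge0// ltW// mulr_gt0].
have i1l : cm * (e1 / e2) <= mu1^-1.
  apply: le_trans (_ : (3 * Cm * e2 / (2 * e1))^-1 <= _).
    rewrite [leRHS](_ : _ = 2 / (3 * Cm) * (e1 / e2)); last by field; rewrite !gt_eqF.
    by apply: ler_wpM2r; [rewrite divr_ge0// ltW|rewrite ge_min lexx].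
  by rewrite lef_pV2 ?posrE ?divr_gt0 ?mulr_gt0.
set x1 := kap * p%:R * mu0^-1 in xE; set x2 := 1 - kap * p%:R * mu1^-1 in xE.
have kp : 0 <= kap * p%:R by rewrite mulr_ge0// ltW.
have XL1 : xl x (@Ordinal 3 0 isT) = 0 by rewrite xlE xE.
have XR1 : xr x (@Ordinal 3 0 isT) = x1 by rewrite xrE xE.
have XL2 : xl x (@Ordinal 3 1 isT) = x1 by rewrite xlE xE.
have XR2 : xr x (@Ordinal 3 1 isT) = x2 by rewrite xrE xE.
have XL3 : xl x (@Ordinal 3 2 isT) = x2 by rewrite xlE xE.
have XR3 : xr x (@Ordinal 3 2 isT) = 1 by rewrite xrE xE.
have := H3 p e1 e2 x x1 x2 u (derive1 u) up p0 e10 e20 e21 e1c3 hgc hx xE.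
rewrite !jv_derjet => h; apply: le_trans (h _ _ _ ke2 _ _ _ _ os hgal) _.
- by rewrite -XL1 -XR1; exact: xl_lt_xr.
- by rewrite -XL2 -XR2; exact: xl_lt_xr.
- by rewrite -XL3 -XR3; exact: xl_lt_xr.
- by rewrite mulrCA; apply: ler_wpM2l.
- by rewrite mulrCA; apply: ler_wpM2l.
- by rewrite /x2 subKr mulrCA; apply: ler_wpM2l.
- by rewrite /x2 subKr mulrCA; apply: ler_wpM2l.
by apply: fin => //; [rewrite ge_min lexx|rewrite lerDl ltW].
Qed.
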